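(* Let $H_{\mathbb R}$ be a real Hilbert space equipped with a strongly continuous group of orthogonal transformations $(U_t)_{t\in\mathbb R}$. Then for all $q\in(-1,1)$ the $q$-Araki-Woods von Neumann algebra $\Gamma_q(H_{\mathbb R},(U_t)_{t\in\mathbb R})$ is QWEP.
   Context: QWEP: a $C^*$-algebra $B$ has the weak expectation property (WEP) if the canonical inclusion $B\to B^{**}$ factorizes completely contractively through some $B(K)$, $K$ a Hilbert space (i.e. it is a composition of complete contractions $B\to B(K)\to B^{**}$). A $C^*$-algebra is QWEP if it is a quotient, by a closed (two-sided) ideal, of a $C^*$-algebra with the WEP. $q$-Araki-Woods algebra: inner products are linear in the second variable. Let $H_{\mathbb C}$ be the complexification of $H_{\mathbb R}$ and still write $(U_t)$ for the extension to a unitary group on $H_{\mathbb C}$. Let $A$ be the (possibly unbounded) non-degenerate (injective) positive self-adjoint operator on $H_{\mathbb C}$ with $U_t=A^{it}$ for all $t\in\mathbb R$. Define $\langle\xi,\eta\rangle_U=\langle 2A(1+A)^{-1}\xi,\eta\rangle$ on $H_{\mathbb C}$ and let $H$ be the completion of $H_{\mathbb C}$ for this inner product. For $q\in(-1,1)$, the $q$-Fock space $\mathcal F_q(H)=\mathbb C\Omega\oplus\bigoplus_{n\ge1}H^{\otimes n}$ is the Hilbert space completion of the algebraic direct sum of algebraic tensor powers for the inner product $\langle h_1\otimes\dots\otimes h_n,g_1\otimes\dots\otimes g_m\rangle_q=\delta_{n,m}\sum_{\pi\in S_n}q^{\mathrm{inv}(\pi)}\prod_{i=1}^n\langle h_i,g_{\pi(i)}\rangle_U$,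 where $\mathrm{inv}(\pi)$ is the number of inversions of $\pi$. For $h\in H$, $a^*(h)$ is the bounded operator with $a^*(h)\Omega=h$, $a^*(h)(h_1\otimes\dots\otimes h_n)=h\otimes h_1\otimes\dots\otimes h_n$, and $a(h)$ is its adjoint. For $f\in H_{\mathbb R}$, $G(f)=a^*(f)+a(f)$. Then $\Gamma_q(H_{\mathbb R},(U_t)_{t\in\mathbb R})$ is the von Neumann algebra generated by $\{G(f): f\in H_{\mathbb R}\}$ in $B(\mathcal F_q(H))$. *)

(* Defs.v *)
From HB Require Import structures.
From mathcomp Require Import all_boot all_order all_algebra perm.
From mathcomp Require Import complex.
From mathcomp Require Import all_classical all_reals all_analysis.

Set Implicit Arguments.
Unset Strict Implicit.
Unset Printing Implicit Defensive.

Import Order.TTheory GRing.Theory Num.Theory.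
Import numFieldNormedType.Exports.

Local Open Scope classical_set_scope.
Local Open Scope complex_scope.
Local Open Scope ring_scope.

(* Positivity and definiteness of the inner products below follow from the    *)
(* compatibility with the norm.                                               *)
HB.mixin Record isRealHilbert (R : realType) V
    of CompleteNormedModule R V := {
  rdot : V -> V -> R ;
  rdotC : forall x y, rdot x y = rdot y x ;
  rdot_linear : forall x a y z, rdot x (a *: y + z) = a * rdot x y + rdot x z ;
  rdot_norm : forall x, rdot x x = `|x| ^+ 2 }.

#[short(type="realHilbertType")]
HB.structure Definition RealHilbert (R : realType) :=
  {V of isRealHilbert R V & CompleteNormedModule R V}.

(* Complex inner products are linear in the second variable. *)
HB.mixin Record isHilbert (R : realType) V
    of CompleteNormedModule R[i] V := {
  dot : V -> V -> R[i] ;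
  dot_conj : forall x y, dot x y = (dot y x)^* ;
  dot_linear : forall x a y z, dot x (a *: y + z) = a * dot x y + dot x z ;
  dot_norm : forall x, dot x x = `|x| ^+ 2 }.

#[short(type="hilbertType")]
HB.structure Definition Hilbert (R : realType) :=
  {V of isHilbert R V & CompleteNormedModule R[i] V}.

Section BoundedOperators.
Context {R : realType}.
Implicit Types H K : hilbertType R.

Definition bounded_op H K (T : H -> K) : Prop := linear T /\ continuous T.

(* || T || <= c; norms are elements of R[i], whose order only relates numbers *)
(* with the same imaginary part, so that 0 <= c means c real nonnegative.     *)
Definition opnorm_le H K (T : H -> K) (c : R[i]) : Prop :=
  0 <= c /\ forall x, `|T x| <= c * `|x|.

Definition adjoint H (T T' : H -> H) : Prop :=
  forall x y, dot (T x) y = dot x (T' y).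

(* || X || <= c for the matrix X as an operator on the Hilbert sum H^I, i.e.  *)
(* in the C*-algebra M_I(B(H)) = B(H^I).                                      *)
Definition mxopnorm_le H (I : finType) (X : I -> I -> H -> H) (c : R[i]) : Prop :=
  0 <= c /\ forall v : I -> H,
    \sum_i `|\sum_j X i j (v j)| ^+ 2 <= c ^+ 2 * \sum_j `|v j| ^+ 2.

Definition mxnorm_le (I : finType) (M : I -> I -> R[i]) (c : R[i]) : Prop :=
  0 <= c /\ forall v : I -> R[i],
    \sum_i `|\sum_j M i j * v j| ^+ 2 <= c ^+ 2 * \sum_j `|v j| ^+ 2.

End BoundedOperators.

Section CstarAlgebras.
Context {R : realType}.
Implicit Types H K : hilbertType R.

Definition norm_closed H (S : set (H -> H)) : Prop :=
  forall T, bounded_op T ->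
    (forall e : R[i], 0 < e -> exists2 X, S X & opnorm_le (X - T) e) -> S T.

Definition op_subspace H (S : set (H -> H)) : Prop :=
  S 0 /\ forall (a : R[i]) X Y, S X -> S Y -> S (a *: X + Y).

(* A C*-algebra is given as a norm-closed *-subalgebra of some B(H); it need  *)
(* not contain the identity.                                                  *)
Record cstar_algebra H (S : set (H -> H)) : Prop := {
  cstar_bounded : forall X, S X -> bounded_op X ;
  cstar_subspace : op_subspace S ;
  cstar_mul : forall X Y, S X -> S Y -> S (X \o Y) ;
  cstar_adj : forall X X', S X -> bounded_op X' -> adjoint X X' -> S X' ;
  cstar_closed : norm_closed S }.

Record closed_ideal H (S J : set (H -> H)) : Prop := {
  ideal_sub : J `<=` S ;
  ideal_subspace : op_subspace J ;
  ideal_mull : forall X Y, S X -> J Y -> J (X \o Y) ;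
  ideal_mulr : forall X Y, S X -> J Y -> J (Y \o X) ;
  ideal_closed : norm_closed J }.

Definition linear_on H K (S : set (H -> H)) (pi : (H -> H) -> (K -> K)) : Prop :=
  forall (a : R[i]) X Y, S X -> S Y -> pi (a *: X + Y) = a *: pi X + pi Y.

Record star_morphism H K (S : set (H -> H)) (S' : set (K -> K))
    (pi : (H -> H) -> (K -> K)) : Prop := {
  smor_fun : forall X, S X -> S' (pi X) ;
  smor_linear : linear_on S pi ;
  smor_mul : forall X Y, S X -> S Y -> pi (X \o Y) = pi X \o pi Y ;
  smor_adj : forall X X', S X -> S X' -> adjoint X X' ->
    adjoint (pi X) (pi X') }.

(* The *-algebra S' is *-isomorphic to the quotient S / J. *)
Definition is_quotient H K (S J : set (H -> H)) (S' : set (K -> K)) : Prop :=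
  exists pi : (H -> H) -> (K -> K),
    [/\ star_morphism S S' pi,
        pi @` S = S' &
        forall X, S X -> (pi X = 0 <-> J X)].

Definition commutant H (S : set (H -> H)) : set (H -> H) :=
  [set T | bounded_op T /\ forall X, S X -> T \o X = X \o T].

Definition von_neumann H (M : set (H -> H)) : Prop :=
  (forall X X', M X -> bounded_op X' -> adjoint X X' -> M X') /\
  commutant (commutant M) = M.

Definition vN_generated H (S : set (H -> H)) : set (H -> H) :=
  smallest (@von_neumann H) S.

End CstarAlgebras.

(* The dual S^* and the bidual S^** of a C*-algebra S in B(H), with their     *)
(* standard operator space structures: M_n(V^* ) = CB(V, M_n) isometrically.  *)
(* A functional on S is a function on all of H -> H whose values outside S    *)
(* are irrelevant: two functionals that agree on S differ by an element of    *)
(* norm 0, so that bounded linear forms on S^* do not distinguish them.       *)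
Section WeakExpectationProperty.
Context {R : realType}.
Implicit Types H K : hilbertType R.

Definition functional H := (H -> H) -> R[i].
Definition bifunctional H := functional H -> R[i].

Definition fnorm_le H (S : set (H -> H)) (f : functional H) (c : R[i]) : Prop :=
  0 <= c /\ forall X d, S X -> opnorm_le X d -> `|f X| <= c * d.

Definition dual H (S : set (H -> H)) (f : functional H) : Prop :=
  (forall (a : R[i]) X Y, S X -> S Y -> f (a *: X + Y) = a * f X + f Y) /\
  exists c, fnorm_le S f c.

Definition bidual H (S : set (H -> H)) (phi : bifunctional H) : Prop :=
  (forall (a : R[i]) f g, dual S f -> dual S g ->
     phi (fun X => a * f X + g X) = a * phi f + phi g) /\
  exists c, 0 <= c /\
    forall f d, dual S f -> fnorm_le S f d -> `|phi f| <= c * d.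

Definition dual_mxnorm_le H (S : set (H -> H)) (I : finType)
    (f : I -> I -> functional H) (c : R[i]) : Prop :=
  0 <= c /\
  forall m (X : 'I_m -> 'I_m -> H -> H) d,
    (forall k l, S (X k l)) -> mxopnorm_le X d ->
    mxnorm_le (fun p r : I * 'I_m => f p.1 r.1 (X p.2 r.2)) (c * d).

Definition bidual_mxnorm_le H (S : set (H -> H)) (I : finType)
    (phi : I -> I -> bifunctional H) (c : R[i]) : Prop :=
  0 <= c /\
  forall m (f : 'I_m -> 'I_m -> functional H) d,
    (forall k l, dual S (f k l)) -> dual_mxnorm_le S f d ->
    mxnorm_le (fun p r : I * 'I_m => phi p.1 r.1 (f p.2 r.2)) (c * d).

(* alpha : S -> B(K) *)
Record complete_contraction_to_BK H K (S : set (H -> H))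
    (alpha : (H -> H) -> (K -> K)) : Prop := {
  ccB_fun : forall X, S X -> bounded_op (alpha X) ;
  ccB_linear : linear_on S alpha ;
  ccB_norm : forall n (X : 'I_n -> 'I_n -> H -> H) c,
    (forall i j, S (X i j)) -> mxopnorm_le X c ->
    mxopnorm_le (fun i j => alpha (X i j)) c }.

(* beta : B(K) -> S^** *)
Record complete_contraction_to_bidual H K (S : set (H -> H))
    (beta : (K -> K) -> bifunctional H) : Prop := {
  ccS_fun : forall T, bounded_op T -> bidual S (beta T) ;
  ccS_linear : forall (a : R[i]) T T', bounded_op T -> bounded_op T' ->
    forall f, dual S f ->
    beta (a *: T + T') f = a * beta T f + beta T' f ;
  ccS_norm : forall n (T : 'I_n -> 'I_n -> K -> K) c,
    (forall i j, bounded_op (T i j)) -> mxopnorm_le T c ->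
    bidual_mxnorm_le S (fun i j => beta (T i j)) c }.

Definition WEP H (S : set (H -> H)) : Prop :=
  exists (K : hilbertType R) (alpha : (H -> H) -> (K -> K))
         (beta : (K -> K) -> bifunctional H),
    [/\ complete_contraction_to_BK S alpha,
        complete_contraction_to_bidual S beta &
        forall X f, S X -> dual S f -> beta (alpha X) f = f X].

Definition QWEP K (S' : set (K -> K)) : Prop :=
  cstar_algebra S' /\
  exists (H : hilbertType R) (S J : set (H -> H)),
    [/\ cstar_algebra S, WEP S, closed_ideal S J & is_quotient S J S'].

End WeakExpectationProperty.

Section UnboundedOperators.
Context {R : realType}.
Implicit Types H : hilbertType R.

(* Only the values of uop_fun on the domain are meaningful. *)
Record unbounded_op H := UnboundedOp {
  uop_dom : set H ;
  uop_fun :> H -> H }.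

Definition densely_defined H (A : unbounded_op H) : Prop :=
  [/\ uop_dom A 0,
      forall (a : R[i]) x y, uop_dom A x -> uop_dom A y ->
        uop_dom A (a *: x + y) /\ A (a *: x + y) = a *: A x + A y &
      dense (uop_dom A)].

(* The right-hand side says that x is in the domain of the adjoint of A,      *)
(* with image y.                                                              *)
Definition self_adjoint H (A : unbounded_op H) : Prop :=
  densely_defined A /\
  forall x y, (uop_dom A x /\ A x = y) <->
              (forall z, uop_dom A z -> dot x (A z) = dot y z).

Definition positive_op H (A : unbounded_op H) : Prop :=
  forall x, uop_dom A x -> 0 <= dot x (A x).

Definition injective_op H (A : unbounded_op H) : Prop :=
  forall x, uop_dom A x -> A x = 0 -> x = 0.

(* (1 + A)^-1 y, everywhere defined for A positive self-adjoint *)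
Definition resolvent H (A : unbounded_op H) (y : H) : H :=
  xget 0 [set x | uop_dom A x /\ x + A x = y].

(* 2 A (1 + A)^-1 *)
Definition deformation H (A : unbounded_op H) (y : H) : H :=
  2%:R *: A (resolvent A y).

(* Projection-valued Borel measures on the real line; pvm_dist x is the       *)
(* scalar measure B |-> < x, E(B) x >, whose existence is the countable       *)
(* additivity of E.                                                           *)
Record pvm H := Pvm {
  pvm_proj : set (measurableTypeR R) -> H -> H ;
  pvm_dist : H -> {measure set (measurableTypeR R) -> \bar R} ;
  pvm_bounded : forall B, measurable B -> bounded_op (pvm_proj B) ;
  pvm_adjoint : forall B, measurable B -> adjoint (pvm_proj B) (pvm_proj B) ;
  pvm_setI : forall B C, measurable B -> measurable C ->
    pvm_proj (B `&` C) = pvm_proj B \o pvm_proj C ;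
  pvm_setT : pvm_proj setT = id ;
  pvm_distE : forall x B, measurable B ->
    pvm_dist x B = (complex.Re (dot x (pvm_proj B x)))%:E }.

(* A = \int l dE(l), as quadratic forms and with the exact domain *)
Definition spectral_resolution H (A : unbounded_op H) (E : pvm H) : Prop :=
  (forall x, uop_dom A x <->
     (\int[pvm_dist E x]_(l in setT) (l ^+ 2)%:E < +oo)%E) /\
  (forall x, uop_dom A x ->
     dot x (A x) = (\int[pvm_dist E x]_(l in setT) l)%:C).

(* V = A^(it) for A positive, self-adjoint and injective, through the Borel   *)
(* functional calculus: l^(it) = exp (i t ln l) is integrated against E.      *)
Definition imaginary_power H (A : unbounded_op H) (t : R) (V : H -> H) : Prop :=
  exists E : pvm H, spectral_resolution A E /\
    forall x, dot x (V x) =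
      (\int[pvm_dist E x]_(l in `]0, +oo[) cos (t * ln l)) +i*
      (\int[pvm_dist E x]_(l in `]0, +oo[) sin (t * ln l)).

End UnboundedOperators.

Section ArakiWoods.
Context {R : realType}.

Record orthogonal_group (HR : realHilbertType R) (U : R -> HR -> HR) : Prop := {
  og_linear : forall t, linear (U t) ;
  og_isometry : forall t x y, rdot (U t x) (U t y) = rdot x y ;
  og_zero : U 0 = id ;
  og_add : forall s t, U (s + t) = U s \o U t ;
  og_continuous : forall x, continuous (fun t => U t x) }.

Record complexification (HR : realHilbertType R) (HC : hilbertType R)
    (iota : HR -> HC) : Prop := {
  cplx_linear : forall (a : R) x y, iota (a *: x + y) = a%:C *: iota x + iota y ;
  cplx_dot : forall x y, dot (iota x) (iota y) = (rdot x y)%:C ;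
  cplx_decomp : forall z, exists x y, z = iota x + 'i%C *: iota y }.

Definition complex_extension (HR : realHilbertType R) (HC : hilbertType R)
    (iota : HR -> HC) (T : HR -> HR) (TC : HC -> HC) : Prop :=
  forall x y, TC (iota x + 'i%C *: iota y) = iota (T x) + 'i%C *: iota (T y).

(* j exhibits H as the completion of V for the inner product b. *)
Record completion (V : lmodType R[i]) (b : V -> V -> R[i]) (H : hilbertType R)
    (j : V -> H) : Prop := {
  cpl_linear : linear j ;
  cpl_dot : forall x y, dot (j x) (j y) = b x y ;
  cpl_dense : dense (range j) }.

Definition dot_U (HC : hilbertType R) (A : unbounded_op HC) (x y : HC) : R[i] :=
  dot (deformation A x) y.

Definition inversions n (s : 'S_n) : nat :=
  #|[set p : 'I_n * 'I_n | (p.1 < p.2)%N && (s p.2 < s p.1)%N]%SET|.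

(* tens [:: h_1; ...; h_n] stands for h_1 (x) ... (x) h_n and tens [::] for   *)
(* the vacuum vector: F is the completion, for the q-inner product, of the    *)
(* algebraic direct sum of the tensor powers of H.                            *)
Record q_fock (q : R) (H F : hilbertType R) (tens : seq H -> F) : Prop := {
  fock_multilinear : forall s1 s2 (a : R[i]) h h',
    tens (s1 ++ (a *: h + h') :: s2) =
    a *: tens (s1 ++ h :: s2) + tens (s1 ++ h' :: s2) ;
  fock_dot : forall s t,
    dot (tens s) (tens t) =
    if size s == size t then
      \sum_(p : 'S_(size s)) (q ^+ inversions p)%:C *
        \prod_(i < size s) dot (nth 0 s i) (nth 0 t (p i))
    else 0 ;
  fock_dense : dense [set x | exists n (c : 'I_n -> R[i]) (s : 'I_n -> seq H),
    x = \sum_i c i *: tens (s i)] }.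

Definition creation (H F : hilbertType R) (tens : seq H -> F) (h : H)
    (c : F -> F) : Prop :=
  bounded_op c /\ forall s, c (tens s) = tens (h :: s).

(* The operators G(f) = a^*(f) + a(f), for f in H_R seen in H through emb.    *)
(* For |q| < 1, creation and annihilation operators exist and are unique.     *)
Definition q_gaussians (HR : realHilbertType R) (H F : hilbertType R)
    (tens : seq H -> F) (emb : HR -> H) : set (F -> F) :=
  [set G | exists f c a, [/\ creation tens (emb f) c,
                             bounded_op a, adjoint c a & G = c + a]].

Definition q_araki_woods (HR : realHilbertType R) (H F : hilbertType R)
    (tens : seq H -> F) (emb : HR -> H) : set (F -> F) :=
  vN_generated (q_gaussians tens emb).

End ArakiWoods.

(* Main.v *)
(* The algebra M generated by the left field operators x(f) of the real subspace
   E (the image of H_R) is the commutant of the right field operators y(g), g in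
   the real-orthogonal of iE: by Rieffel's commutation argument it suffices that a
   vector real-orthogonal to the self-adjoint x-polynomials and to i times the
   self-adjoint y-polynomials applied to the vacuum is zero, which comes down to
   the positivity of a second quantized operator on the q-Fock space.
   Following Speicher, x(f) and y(g) are limits in moments of normalized sums of N
   fermionic fields with independent random signs of mean q; the right fields are
   built from the reversed Jordan-Wigner order, and commute with the left ones
   before the limit. Averaging over finitely many unitary symmetries maps B(K)
   onto the commutant of the right fermions, which is therefore injective. Along
   an ultrafilter the product of these commutants maps onto M by a completely
   positive map phi: self-adjoint elements of M are reached through resolvents of
   polynomials in the fields. Restricted to its multiplicative domain S, phi is a
   surjective morphism, and S has the WEP: for E the expectation onto the commutant
   of the right fermions, k an approximate unit of J = ker phi, c = 1 - k and
   sigma a section of phi, the maps T |-> k E(T) k + c sigma(phi (E T)) c tend to a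
   complete contraction B(K) -> S** that is the identity on S. *)

From HB Require Import structures.
From mathcomp Require Import all_boot all_order all_algebra perm.
From mathcomp Require Import complex ring lra zify.
From mathcomp Require Import all_classical all_reals all_analysis.
Require Import Defs.
Set Implicit Arguments.
Unset Strict Implicit.
Unset Printing Implicit Defensive.
Import Order.TTheory GRing.Theory Num.Theory.
Import numFieldNormedType.Exports.
Local Open Scope classical_set_scope.
Local Open Scope complex_scope.
Local Open Scope ring_scope.

(** * Hilbert spaces and bounded operators *)

(** The models converge in moments only: their fields are bounded uniformly just on states with a
    bounded number of particles, so polynomials in them are not elements of the product and no
    homomorphism is at hand. Resolvents of self-adjoint polynomials are contractions and survive;
    the resolvent identity makes r*r and rr* linear in r and r*, which puts them in the
    multiplicative domain of phi, itself a mere compression to the span of the words on the vacuum.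
    Neither a trace nor the modular group occurs: operators in the image of phi are only seen to
    commute with the right fields, and the commutation theorem says that this places them in M. For
    the WEP, sigma is a bare set-theoretic section. Changing it adds elements of J, which
    compression by c annihilates in the limit; this restores linearity and leaves room for matrix
    lifts of nearly optimal norm. The splitting of S** along J** is replaced by a splitting of each
    functional f, whose part carried by J is the limit of f(ksk). *)

Section RealNorm.
Context {R : realType}.
Local Notation C := R[i].

(** Norms are elements of the partially ordered R[i]; their real parts live in a totally ordered
    field, where the arithmetic tactics apply. *)
Definition nrm {V : normedZmodType C} (x : V) : R := complex.Re `|x|.

Lemma nrmE {V : normedZmodType C} (x : V) : `|x| = (nrm x)%:C.
Proof. by rewrite [LHS]complexE (ger0_Im (normr_ge0 x)) mulr0 addr0. Qed.

Lemma nrm_ge0 {V : normedZmodType C} (x : V) : 0 <= nrm x.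
Proof. by rewrite -ler0c -nrmE. Qed.

Lemma nrmD {V : normedZmodType C} (x y : V) : nrm (x + y) <= nrm x + nrm y.
Proof. by rewrite -lecR rmorphD /= -!nrmE ler_normD. Qed.

Lemma nrmN {V : normedZmodType C} (x : V) : nrm (- x) = nrm x.
Proof. by rewrite /nrm normrN. Qed.

Lemma nrm0 {V : normedZmodType C} : nrm (0 : V) = 0.
Proof. by rewrite /nrm normr0. Qed.

Lemma nrm_eq0 {V : normedZmodType C} (x : V) : nrm x = 0 -> x = 0.
Proof. by move=> h; apply/eqP; rewrite -normr_eq0 nrmE h. Qed.

Lemma nrmBC {V : normedZmodType C} (x y : V) : nrm (x - y) = nrm (y - x).
Proof. by rewrite /nrm distrC. Qed.

Lemma nrmB {V : normedZmodType C} (x y : V) : nrm (x - y) <= nrm x + nrm y.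
Proof. by rewrite (le_trans (nrmD _ _))// nrmN. Qed.

Lemma nrm_tri {V : normedZmodType C} (x y z : V) :
  nrm (x - z) <= nrm (x - y) + nrm (y - z).
Proof. by rewrite -[x - z](subrKA y) nrmD. Qed.

Lemma nrmZ {V : normedModType C} (a : C) (x : V) : nrm (a *: x) = nrm a * nrm x.
Proof. by apply: complexI; rewrite rmorphM /= -!nrmE normrZ. Qed.

Lemma nrmM (a b : C) : nrm (a * b) = nrm a * nrm b.
Proof. by apply: complexI; rewrite rmorphM /= -!nrmE normrM. Qed.

Lemma nrmR (r : R) : nrm (r%:C : C) = `|r|.
Proof. by rewrite /nrm normc_def /= expr0n /= addr0 sqrtr_sqr. Qed.

Lemma nrmJ (a : C) : nrm (a^*) = nrm a.
Proof. by rewrite /nrm normcJ. Qed.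

Lemma nrm1 : nrm (1 : C) = 1.
Proof. by rewrite /nrm normr1. Qed.

Lemma nrm_i : nrm ('i%C : C) = 1.
Proof. by rewrite /nrm normc_def /= expr0n /= add0r expr1n sqrtr1. Qed.

Lemma nrm_sqr (a : C) : nrm a ^+ 2 = complex.Re a ^+ 2 + complex.Im a ^+ 2.
Proof. by apply: complexI; rewrite rmorphXn /= -nrmE add_Re2_Im2. Qed.

Lemma Re_le_nrm (a : C) : `|complex.Re a| <= nrm a.
Proof. by rewrite -lecR -nrmE normc_ge_Re. Qed.

Lemma Re_le (a : C) : complex.Re a <= nrm a.
Proof. exact: le_trans (ler_norm _) (Re_le_nrm _). Qed.

Lemma Im_le_nrm (a : C) : `|complex.Im a| <= nrm a.
Proof.
by rewrite -(ler_pXn2r (ltn0Sn 1))// ?nnegrE ?nrm_ge0// real_normK ?num_real// nrm_sqr lerDr ?sqr_ge0.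
Qed.

Lemma nrm_le_ReIm (a : C) : nrm a <= `|complex.Re a| + `|complex.Im a|.
Proof.
rewrite -(ler_pXn2r (ltn0Sn 1))// ?nnegrE ?nrm_ge0 ?addr_ge0// nrm_sqr.
have h1 := normr_ge0 (complex.Re a); have h2 := normr_ge0 (complex.Im a).
have := real_normK (num_real (complex.Re a)); have := real_normK (num_real (complex.Im a)).
by nra.
Qed.

Lemma mulcJ (a : C) : a * a^* = (nrm a ^+ 2)%:C.
Proof. by rewrite -sqr_normc nrmE rmorphXn. Qed.

Lemma phase (a : C) : exists t : C, nrm t = 1 /\ t * a = (nrm a)%:C.
Proof.
have [->|a0] := eqVneq a 0; first by exists 1; rewrite nrm1 mul1r nrm0.
have na0 : nrm a != 0 by apply: contra a0 => /eqP/nrm_eq0 ->.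
exists (a^* / (nrm a)%:C); split.
  by rewrite nrmM nrmJ -(rmorphV (real_complex R)) ?unitfE//= nrmR ger0_norm ?invr_ge0 ?nrm_ge0// divff.
rewrite mulrAC [a^* * a]mulrC mulcJ -(rmorphV (real_complex R)) ?unitfE//= -rmorphM /=.
by rewrite expr2 mulfK.
Qed.

Lemma ReD (a b : C) : complex.Re (a + b) = complex.Re a + complex.Re b.
Proof. by case: a b => ? ? []. Qed.
Lemma ReN (a : C) : complex.Re (- a) = - complex.Re a.
Proof. by case: a. Qed.
Lemma ReB (a b : C) : complex.Re (a - b) = complex.Re a - complex.Re b.
Proof. by rewrite ReD ReN. Qed.
Lemma ImD (a b : C) : complex.Im (a + b) = complex.Im a + complex.Im b.
Proof. by case: a b => ? ? []. Qed.
Lemma ImN (a : C) : complex.Im (- a) = - complex.Im a.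
Proof. by case: a. Qed.
Lemma ReJ (a : C) : complex.Re (a^*) = complex.Re a.
Proof. by case: a. Qed.
Lemma ImJ (a : C) : complex.Im (a^*) = - complex.Im a.
Proof. by case: a. Qed.
Lemma ReZ (r : R) (a : C) : complex.Re (r%:C * a) = r * complex.Re a.
Proof. by case: a => x y /=; rewrite mul0r subr0. Qed.
Lemma ImZ (r : R) (a : C) : complex.Im (r%:C * a) = r * complex.Im a.
Proof. by case: a => x y /=; rewrite mul0r addr0. Qed.
Lemma ReiM (a : C) : complex.Re ('i%C * a) = - complex.Im a.
Proof. by case: a => x y /=; rewrite mul0r mul1r sub0r. Qed.
Lemma conjR (r : R) : (r%:C : C)^* = r%:C.
Proof. exact: conjc_real. Qed.
Lemma cplx_eq (a b : C) : complex.Re a = complex.Re b -> complex.Im a = complex.Im b -> a = b.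
Proof. by case: a b => ? ? [] ? ? /= -> ->. Qed.
Lemma conj_i : ('i%C : C)^* = - 'i%C.
Proof. by apply: cplx_eq; rewrite /= ?oppr0. Qed.
Lemma mulii : ('i%C : C) * 'i%C = -1.
Proof. by rewrite -expr2 sqr_i. Qed.

End RealNorm.

Section Hilbert.
Context {R : realType}.
Local Notation C := R[i].
Implicit Types H : hilbertType R.

Lemma dotDr H (x y z : H) : dot x (y + z) = dot x y + dot x z.
Proof. by have := dot_linear x 1 y z; rewrite scale1r mul1r. Qed.
Lemma dot0r H (x : H) : dot x 0 = 0.
Proof. by apply: (addrI (dot x 0)); rewrite -dotDr !addr0. Qed.
Lemma dotZr H a (x y : H) : dot x (a *: y) = a * dot x y.
Proof. by rewrite -[a *: y]addr0 dot_linear dot0r addr0. Qed.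
Lemma dotNr H (x y : H) : dot x (- y) = - dot x y.
Proof. by rewrite -scaleN1r dotZr mulN1r. Qed.
Lemma dotBr H (x y z : H) : dot x (y - z) = dot x y - dot x z.
Proof. by rewrite dotDr dotNr. Qed.
Lemma dotDl H (x y z : H) : dot (x + y) z = dot x z + dot y z.
Proof. by rewrite dot_conj dotDr rmorphD /= -!dot_conj. Qed.
Lemma dotZl H a (x y : H) : dot (a *: x) y = a^* * dot x y.
Proof. by rewrite dot_conj dotZr rmorphM /= -!dot_conj. Qed.
Lemma dotNl H (x y : H) : dot (- x) y = - dot x y.
Proof. by rewrite dot_conj dotNr rmorphN /= -!dot_conj. Qed.
Lemma dotBl H (x y z : H) : dot (x - y) z = dot x z - dot y z.
Proof. by rewrite dotDl dotNl. Qed.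
Lemma dot0l H (x : H) : dot 0 x = 0.
Proof. by rewrite dot_conj dot0r rmorph0. Qed.
Lemma dot_sumr H I (r : seq I) (P : pred I) (x : H) (F : I -> H) :
  dot x (\sum_(i <- r | P i) F i) = \sum_(i <- r | P i) dot x (F i).
Proof. by apply: (big_morph (dot x)); [exact: dotDr | exact: dot0r]. Qed.
Lemma dot_suml H I (r : seq I) (P : pred I) (x : H) (F : I -> H) :
  dot (\sum_(i <- r | P i) F i) x = \sum_(i <- r | P i) dot (F i) x.
Proof. by apply: (big_morph (fun y => dot y x)) => [y z|]; rewrite ?dotDl ?dot0l. Qed.

Lemma dot_nrm H (x : H) : dot x x = (nrm x ^+ 2)%:C.
Proof. by rewrite dot_norm nrmE rmorphXn. Qed.
Lemma nrm_dot H (x : H) : nrm x ^+ 2 = complex.Re (dot x x).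
Proof. by rewrite dot_nrm. Qed.

Lemma nrmD_sq H (x y : H) :
  nrm (x + y) ^+ 2 = nrm x ^+ 2 + nrm y ^+ 2 + 2 * complex.Re (dot x y).
Proof.
rewrite !nrm_dot dotDl !dotDr !ReD [dot y x]dot_conj ReJ; ring.
Qed.
Lemma nrmB_sq H (x y : H) :
  nrm (x - y) ^+ 2 = nrm x ^+ 2 + nrm y ^+ 2 - 2 * complex.Re (dot x y).
Proof. by rewrite nrmD_sq nrmN dotNr ReN mulrN. Qed.

Lemma parallelogram H (x y : H) :
  nrm (x + y) ^+ 2 + nrm (x - y) ^+ 2 = 2 * (nrm x ^+ 2 + nrm y ^+ 2).
Proof. by rewrite nrmD_sq nrmB_sq; ring. Qed.

Lemma CS_Re H (x y : H) : complex.Re (dot x y) <= nrm x * nrm y.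
Proof.
have [y0|y0] := eqVneq (nrm y) 0.
  by rewrite (nrm_eq0 y0) dot0r nrm0 mulr0.
have yp : 0 < nrm y by rewrite lt_neqAle eq_sym y0 nrm_ge0.
have := sqr_ge0 (nrm ((nrm y)%:C *: x - (nrm x)%:C *: y)).
rewrite nrmB_sq !nrmZ dotZl dotZr conjR !ReZ !nrmR !ger0_norm ?nrm_ge0// => h.
have [x0|x0] := eqVneq (nrm x) 0.
  by rewrite (nrm_eq0 x0) dot0l nrm0 mul0r.
have xp : 0 < nrm x by rewrite lt_neqAle eq_sym x0 nrm_ge0.
have h2 : nrm y * (nrm x * complex.Re (dot x y)) <= nrm y * (nrm x * (nrm x * nrm y)) by nra.
by move: h2; rewrite !ler_pM2l.
Qed.

Lemma CS H (x y : H) : nrm (dot x y) <= nrm x * nrm y.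
Proof.
have [t [t1 te]] := phase (dot x y).
have := CS_Re x (t *: y).
by rewrite dotZr te /= nrmZ t1 mul1r.
Qed.

Lemma dot_eq0 H (x : H) : dot x x = 0 -> x = 0.
Proof.
rewrite dot_nrm => /complexI /eqP; rewrite sqrf_eq0 => /eqP; exact: nrm_eq0.
Qed.

Lemma dot_ext H (x y : H) : (forall z, dot z x = dot z y) -> x = y.
Proof.
move=> h; apply/eqP; rewrite -subr_eq0; apply/eqP/dot_eq0.
by rewrite dotBr h subrr.
Qed.

Lemma le_nrm_dot H (x : H) c : 0 <= c ->
  (forall y, complex.Re (dot y x) <= c * nrm y) -> nrm x <= c.
Proof.
move=> c0 h; have := h x; rewrite -nrm_dot expr2.
have [->//|x0] := eqVneq (nrm x) 0.
by rewrite ler_pM2r// lt_neqAle eq_sym x0 nrm_ge0.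
Qed.

End Hilbert.

Section Topology.
Context {R : realType}.
Local Notation C := R[i].

Lemma nbhs_nrm (V : normedModType C) (x : V) (A : set V) :
  nbhs x A <-> exists2 e : R, 0 < e & forall y, nrm (x - y) < e -> A y.
Proof.
split.
  move=> /nbhs_ballP[e /= e0 h]; exists (complex.Re e).
    by move: e0; rewrite ltcE => /andP[].
  move=> y hy; apply: h; rewrite -ball_normE /= nrmE.
  by move: e0; rewrite !ltcE /= => /andP[/eqP-> _]; rewrite hy eqxx.
move=> [e e0 h]; apply/nbhs_ballP; exists e%:C; first by rewrite /= ltcR.
by move=> y; rewrite -ball_normE /= nrmE ltcR; exact: h.
Qed.

Lemma dense_nrm (V : normedModType C) (D : set V) :
  dense D <-> forall x (e : R), 0 < e -> exists2 d, D d & nrm (x - d) < e.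
Proof.
split=> [h x e e0|h O [x Ox] oO].
  have [||y [Oy Dy]] := h (ball x e%:C).
  - by exists x; apply: ballxx; rewrite ltcR.
  - by apply: ball_open; rewrite ltcR.
  by exists y => //; move: Oy; rewrite -ball_normE /= nrmE ltcR.
have /nbhs_nrm[e e0 he] : nbhs x O by exact: open_nbhs_nbhs.
by have [d Dd xd] := h x e e0; exists d; split => //; exact: he.
Qed.

Lemma complete_nrm (V : completeNormedModType C) (u : nat -> V) :
  (forall e : R, 0 < e -> exists N, forall m n, (N <= m)%N -> (N <= n)%N ->
     nrm (u m - u n) < e) ->
  exists l, forall e : R, 0 < e -> exists N, forall n, (N <= n)%N -> nrm (u n - l) < e.
Proof.
move=> h.
have cu : cvg (u @ \oo).
  apply: cauchy_cvg; apply/cauchy_ballP => e e0.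
  have [N hN] := h (complex.Re e) ltac:(by move: e0; rewrite ltcE => /andP[]).
  exists (u @` [set n | (N <= n)%N], u @` [set n | (N <= n)%N]) => /=.
    by split; exists N => // n /= Nn; exists n.
  move=> [_ _] /= [[m Nm <-] [n Nn <-]]; rewrite -ball_normE /= nrmE.
  by move: e0; rewrite !ltcE /= => /andP[/eqP-> _]; rewrite eqxx hN.
exists (lim (u @ \oo)) => e e0.
have : nbhs (lim (u @ \oo)) [set y | nrm (lim (u @ \oo) - y) < e].
  by apply/nbhs_nrm; exists e.
by move/cu => [N _ hN]; exists N => n Nn; rewrite nrmBC; exact: hN.
Qed.

Lemma bounded_opP (H K : hilbertType R) (T : H -> K) :
  bounded_op T <->
  linear T /\ exists2 c : R, 0 <= c & forall x, nrm (T x) <= c * nrm x.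
Proof.
split=> -[lT h]; split=> //.
  have T0 : T 0 = 0.
    by have := lT 1 0 0; rewrite !scale1r addr0 => /eqP; rewrite -subr_eq0 opprD addNKr oppr_eq0 => /eqP.
  have /nbhs_nrm[e e0 he] : nbhs (0 : H) (T @^-1` [set y | nrm (0 - y) < 1]).
    by apply: h; rewrite T0; apply/nbhs_nrm; exists 1.
  exists (2 / e); first by rewrite divr_ge0// ltW.
  move=> x; have [x0|x0] := eqVneq (nrm x) 0.
    by rewrite (nrm_eq0 x0) T0 !nrm0 mulr0.
  have xp : 0 < nrm x by rewrite lt_neqAle eq_sym x0 nrm_ge0.
  set a := e / (2 * nrm x).
  have a0 : 0 < a by rewrite divr_gt0// mulr_gt0.
  have TZ : T (a%:C *: x) = a%:C *: T x.
    by have := lT a%:C x 0; rewrite !addr0 T0 addr0.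
  have : nrm (0 - a%:C *: x) < e.
    rewrite sub0r nrmN nrmZ nrmR gtr0_norm// /a invfM mulrA -mulrA mulVf// mulr1.
    by rewrite ltr_pdivrMr//; lra.
  move/he => /=; rewrite sub0r nrmN TZ nrmZ nrmR gtr0_norm// => h1.
  rewrite -(ler_pM2l a0) (le_trans (ltW h1))//.
  rewrite /a le_eqVlt; apply/orP; left; apply/eqP; field.
  by rewrite x0 gt_eqF.
case: h => c c0 hc x A /nbhs_nrm[e e0 he].
apply/nbhs_nrm; exists (e / (c + 1)); first by rewrite divr_gt0// ltr_wpDl.
move=> y hy; apply: he.
have -> : T x - T y = T (x - y).
  by rewrite -scaleN1r addrC -lT scaleN1r addrC.
apply: le_lt_trans (hc _) _.
move: hy; rewrite ltr_pdivlMr ?ltr_wpDl// => hy.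
apply: le_lt_trans hy.
by rewrite mulrC ler_wpM2l ?nrm_ge0// lerDl.
Qed.

Lemma opnorm_leP (H K : hilbertType R) (T : H -> K) (c : C) :
  opnorm_le T c <-> exists r : R, [/\ c = r%:C, 0 <= r & forall x, nrm (T x) <= r * nrm x].
Proof.
split=> [[c0 h]|[r [-> r0 h]]].
  exists (complex.Re c); have ce : c = (complex.Re c)%:C.
    by rewrite [LHS]complexE (ger0_Im c0) mulr0 addr0.
  split=> //; first by rewrite -ler0c -ce.
  by move=> x; rewrite -lecR rmorphM /= -ce -!nrmE.
split; first by rewrite ler0c.
by move=> x; rewrite !nrmE -rmorphM lecR.
Qed.

End Topology.

(** * Hilbert sums of families of Hilbert spaces *)

Section HilbertSum.
Context {R : realType} (I : choiceType) (K : I -> hilbertType R).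
Local Notation C := R[i].

Definition nsum (v : forall i, K i) (s : seq I) : R := \sum_(i <- s) nrm (v i) ^+ 2.

Definition square_summable (v : forall i, K i) : Prop :=
  exists c : R, forall s, uniq s -> nsum v s <= c.

Record hsum := HSum { hval :> forall i, K i ; hvalP : square_summable hval }.

Lemma hsum_eq (v w : hsum) : (forall i, v i = w i) -> v = w.
Proof.
case: v w => v hv [w hw] /= h.
have e : v = w by exact: functional_extensionality_dep.
by case: _ / e hw {h} => hw; congr HSum; exact: Prop_irrelevance.
Qed.

Lemma nsum_ge0 v s : 0 <= nsum v s.
Proof. by apply: sumr_ge0 => i _; rewrite sqr_ge0. Qed.

Lemma sqrD_le (a b : R) : (a + b) ^+ 2 <= 2 * a ^+ 2 + 2 * b ^+ 2.
Proof. by have := sqr_ge0 (a - b); nra. Qed.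

Lemma square_summable_lin (a : C) v w :
  square_summable v -> square_summable w ->
  square_summable (fun i => a *: v i + w i).
Proof.
move=> [c hc] [d hd]; exists (2 * (nrm a ^+ 2 * c) + 2 * d) => s us.
rewrite /nsum (le_trans (y := \sum_(i <- s) (2 * (nrm a ^+ 2 * nrm (v i) ^+ 2) + 2 * nrm (w i) ^+ 2)))//.
  apply: ler_sum => i _; apply: le_trans (_ : (nrm (a *: v i) + nrm (w i)) ^+ 2 <= _).
    by rewrite ler_pXn2r ?nnegrE ?addr_ge0 ?nrm_ge0// nrmD.
  by rewrite (le_trans (sqrD_le _ _))// nrmZ exprMn.
rewrite big_split /= -!mulr_sumr lerD// ler_pM2l//; last exact: hd.
by rewrite ler_wpM2l ?sqr_ge0//; exact: hc.
Qed.

Lemma square_summable0 : square_summable (fun i => 0).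
Proof. by exists 0 => s _; rewrite /nsum big1// => i _; rewrite nrm0 expr0n. Qed.

Lemma square_summableD v w : square_summable v -> square_summable w ->
  square_summable (fun i => v i + w i).
Proof.
move=> hv hw; have := square_summable_lin 1 hv hw.
by congr square_summable; apply: functional_extensionality_dep => i; rewrite scale1r.
Qed.

Lemma square_summableZ a v : square_summable v -> square_summable (fun i => a *: v i).
Proof.
move=> hv; have := square_summable_lin a hv square_summable0.
by congr square_summable; apply: functional_extensionality_dep => i; rewrite addr0.
Qed.

Lemma square_summableN v : square_summable v -> square_summable (fun i => - v i).
Proof.
move=> hv; have := square_summableZ (-1) hv.
by congr square_summable; apply: functional_extensionality_dep => i; rewrite scaleN1r.
Qed.

HB.instance Definition _ := gen_eqMixin hsum.
HB.instance Definition _ := gen_choiceMixin hsum.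

Definition hsum_zero := HSum square_summable0.
Definition hsum_add (v w : hsum) := HSum (square_summableD (hvalP v) (hvalP w)).
Definition hsum_opp (v : hsum) := HSum (square_summableN (hvalP v)).
Definition hsum_scale (a : C) (v : hsum) := HSum (square_summableZ a (hvalP v)).

Lemma hsum_addA : associative hsum_add.
Proof. by move=> u v w; apply: hsum_eq => i /=; rewrite addrA. Qed.
Lemma hsum_addC : commutative hsum_add.
Proof. by move=> u v; apply: hsum_eq => i /=; rewrite addrC. Qed.
Lemma hsum_add0 : left_id hsum_zero hsum_add.
Proof. by move=> u; apply: hsum_eq => i /=; rewrite add0r. Qed.
Lemma hsum_addN : left_inverse hsum_zero hsum_opp hsum_add.
Proof. by move=> u; apply: hsum_eq => i /=; rewrite addNr. Qed.

HB.instance Definition _ := GRing.isZmodule.Build hsum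
  hsum_addA hsum_addC hsum_add0 hsum_addN.

Lemma hsum_scaleA a b v : hsum_scale a (hsum_scale b v) = hsum_scale (a * b) v.
Proof. by apply: hsum_eq => i /=; rewrite scalerA. Qed.
Lemma hsum_scale1 : left_id 1 hsum_scale.
Proof. by move=> v; apply: hsum_eq => i /=; rewrite scale1r. Qed.
Lemma hsum_scaleDr : right_distributive hsum_scale +%R.
Proof. by move=> a v w; apply: hsum_eq => i /=; rewrite scalerDr. Qed.
Lemma hsum_scaleDl v : {morph hsum_scale^~ v : a b / a + b}.
Proof. by move=> a b; apply: hsum_eq => i /=; rewrite scalerDl. Qed.

HB.instance Definition _ := GRing.Zmodule_isLmodule.Build C hsum
  hsum_scaleA hsum_scale1 hsum_scaleDr hsum_scaleDl.

Lemma hvalD (v w : hsum) i : (v + w) i = v i + w i. Proof. by []. Qed.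
Lemma hvalN (v : hsum) i : (- v) i = - v i. Proof. by []. Qed.
Lemma hvalZ a (v : hsum) i : (a *: v) i = a *: v i. Proof. by []. Qed.

Definition hsq (v : hsum) : R := sup [set x | exists2 s, uniq s & x = nsum v s].

Lemma hsq_has_sup (v : hsum) : has_sup [set x | exists2 s, uniq s & x = nsum v s].
Proof.
split; first by exists (nsum v [::]), [::].
by case: (hvalP v) => c hc; exists c => _ [s us ->]; exact: hc.
Qed.

Lemma nsum_le (v : hsum) s : uniq s -> nsum v s <= hsq v.
Proof. by move=> us; apply: ub_le_sup; [exact: (hsq_has_sup v).2|exists s]. Qed.

Lemma hsq_le (v : hsum) c : (forall s, uniq s -> nsum v s <= c) -> hsq v <= c.
Proof.
by move=> h; apply: ge_sup; [exact: (hsq_has_sup v).1|move=> _ [s us ->]; exact: h].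
Qed.

Lemma hsq_ge0 v : 0 <= hsq v.
Proof. exact: le_trans (nsum_ge0 v [::]) (nsum_le v _). Qed.

Lemma nrm_le_hsq (v : hsum) i : nrm (v i) ^+ 2 <= hsq v.
Proof. by have := @nsum_le v [:: i] isT; rewrite /nsum big_seq1. Qed.

Lemma nsum_sub (v : forall i, K i) s t : uniq s -> uniq t -> {subset s <= t} -> nsum v s <= nsum v t.
Proof.
move=> us ut st.
have e : perm_eq t (s ++ [seq i <- t | i \notin s]).
  apply: uniq_perm => //.
    rewrite cat_uniq us filter_uniq// andbT; apply/hasPn => i.
    by rewrite mem_filter => /andP[].
  move=> i; rewrite mem_cat mem_filter; have [si|] := boolP (i \in s) => //=.
  exact: st.
by rewrite /nsum (perm_big _ e) big_cat /= lerDl; exact: nsum_ge0.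
Qed.

(* Convergence along the finite subsets of I, directed by inclusion. *)
Definition fin_lim (f : seq I -> R) (l : R) : Prop :=
  forall e : R, 0 < e -> exists s0 : seq I, forall s : seq I, uniq s -> {subset s0 <= s} -> `|f s - l| < e.

Lemma fin_lim_uniq f l m : fin_lim f l -> fin_lim f m -> l = m.
Proof.
move=> hl hm; apply/eqP/contraT => lm.
have e0 : 0 < `|l - m| / 2 by rewrite divr_gt0// normr_gt0 subr_eq0.
have [s hs] := hl _ e0; have [t ht] := hm _ e0.
have h1 := hs (undup (s ++ t)) (undup_uniq _).
have h2 := ht (undup (s ++ t)) (undup_uniq _).
have /h1 {}h1 : {subset s <= undup (s ++ t)} by move=> i; rewrite mem_undup mem_cat => ->.
have /h2 {}h2 : {subset t <= undup (s ++ t)} by move=> i; rewrite mem_undup mem_cat => ->; rewrite orbT.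
have := ler_distD (f (undup (s ++ t))) l m; rewrite [`|l - f _|]distrC => h3; lra.
Qed.

Lemma fin_lim_lin f g l m a b : fin_lim f l -> fin_lim g m ->
  fin_lim (fun s => a * f s + b * g s) (a * l + b * m).
Proof.
move=> hf hg e e0.
have d0 : 0 < e / (`|a| + `|b| + 1) by rewrite divr_gt0// ltr_wpDl// addr_ge0.
have [s hs] := hf _ d0; have [t ht] := hg _ d0.
exists (s ++ t) => r ur sr.
have /(hs r ur) h1 : {subset s <= r} by move=> i si; apply: sr; rewrite mem_cat si.
have /(ht r ur) h2 : {subset t <= r} by move=> i si; apply: sr; rewrite mem_cat si orbT.
rewrite opprD addrACA -!mulrBr (le_lt_trans (ler_normD _ _))// !normrM.
set d := e / _ in d0 h1 h2.
have -> : e = d * (`|a| + `|b| + 1) by rewrite /d divfK// gt_eqF// ltr_wpDl// addr_ge0.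
have a0 := normr_ge0 a; have b0 := normr_ge0 b.
have : `|a| * `|f r - l| <= `|a| * d by rewrite ler_wpM2l// ltW.
have : `|b| * `|g r - m| <= `|b| * d by rewrite ler_wpM2l// ltW.
by nra.
Qed.

Lemma fin_lim_eq f g l : (forall s, f s = g s) -> fin_lim f l -> fin_lim g l.
Proof. by move=> /funext ->. Qed.

Lemma fin_lim_hsq (v : hsum) : fin_lim (nsum v) (hsq v).
Proof.
move=> e e0; have [_ [s us ->] hs] := sup_adherent e0 (hsq_has_sup v).
exists s => t ut st; rewrite distrC ger0_norm ?subr_ge0 ?nsum_le//.
by have := nsum_sub v us ut st; rewrite -/(hsq v) in hs; lra.
Qed.

(** Polarization of the supremum [hsq], so that no complex series has to be summed. The nested
    coefficients have the shape of [fin_lim_lin], which identifies this number with the limit of the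
    finite sums of real parts. *)
Definition hdotR (v w : hsum) : R := 2^-1 * (hsq (v + w) + (- 1) * hsq v) + (- 2^-1) * hsq w.
Definition hdot (v w : hsum) : C := hdotR v w +i* hdotR v ((- 'i%C) *: w).

Implicit Types v w : hsum.

Lemma fin_lim_hdotR v w :
  fin_lim (fun s => \sum_(i <- s) complex.Re (dot (v i) (w i))) (hdotR v w).
Proof.
have := fin_lim_lin 2^-1 (- 2^-1) (fin_lim_lin 1 (-1) (fin_lim_hsq (v + w)) (fin_lim_hsq v)) (fin_lim_hsq w).
rewrite [1 * hsq _]mul1r; apply: fin_lim_eq.
move=> s; rewrite /nsum mul1r mulN1r -sumrN -big_split /= !mulr_sumr -big_split /=.
by apply: eq_bigr => i _; rewrite nrmD_sq; field.
Qed.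

Lemma fin_lim_Re v w :
  fin_lim (fun s => \sum_(i <- s) complex.Re (dot (v i) (w i))) (complex.Re (hdot v w)).
Proof. exact: fin_lim_hdotR. Qed.

Lemma fin_lim_Im v w :
  fin_lim (fun s => \sum_(i <- s) complex.Im (dot (v i) (w i))) (complex.Im (hdot v w)).
Proof.
apply: fin_lim_eq (fin_lim_hdotR v (- 'i%C *: w)) => s.
by apply: eq_bigr => i _; rewrite /= dotZr mulNr ReN ReiM opprK.
Qed.

Lemma hdot_conj v w : hdot v w = (hdot w v)^*.
Proof.
apply: cplx_eq; rewrite ?ReJ ?ImJ.
  apply: fin_lim_uniq (fin_lim_Re v w) _.
  by apply: fin_lim_eq (fin_lim_Re w v) => s; apply: eq_bigr => i _; rewrite [in LHS]dot_conj ReJ.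
apply: fin_lim_uniq (fin_lim_Im v w) _.
have := fin_lim_lin (-1) 0 (fin_lim_Im w v) (fin_lim_Im w v).
rewrite mul0r addr0 mulN1r; apply: fin_lim_eq => s.
rewrite mul0r addr0 mulN1r -sumrN.
by apply: eq_bigr => i _; rewrite [in RHS]dot_conj ImJ.
Qed.

Lemma hdot_linear x a y z : hdot x (a *: y + z) = a * hdot x y + hdot x z.
Proof.
apply: cplx_eq.
  apply: fin_lim_uniq (fin_lim_Re x (a *: y + z)) _.
  have := fin_lim_lin 1 1 (fin_lim_lin (complex.Re a) (- complex.Im a) (fin_lim_Re x y) (fin_lim_Im x y)) (fin_lim_Re x z).
  rewrite !mul1r ReD; have -> : complex.Re (a * hdot x y) = complex.Re a * complex.Re (hdot x y) + - complex.Im a * complex.Im (hdot x y).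
    by case: (a) (hdot x y) => ? ? [] ? ? /=; rewrite mulNr.
  apply: fin_lim_eq => s; rewrite !mul1r !mulr_sumr -!big_split /=; apply: eq_bigr => i _.
  by rewrite dot_linear ReD; case: (a) (dot (x i) (y i)) => ? ? [] ? ? /=; rewrite mulNr.
apply: fin_lim_uniq (fin_lim_Im x (a *: y + z)) _.
have := fin_lim_lin 1 1 (fin_lim_lin (complex.Re a) (complex.Im a) (fin_lim_Im x y) (fin_lim_Re x y)) (fin_lim_Im x z).
rewrite !mul1r ImD; have -> : complex.Im (a * hdot x y) = complex.Re a * complex.Im (hdot x y) + complex.Im a * complex.Re (hdot x y).
  by case: (a) (hdot x y) => ? ? [] ? ? /=.
apply: fin_lim_eq => s; rewrite !mul1r !mulr_sumr -!big_split /=; apply: eq_bigr => i _.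
by rewrite dot_linear ImD; case: (a) (dot (x i) (y i)) => ? ? [] ? ? /=.
Qed.

Lemma hdot_hsq v : hdot v v = (hsq v)%:C.
Proof.
apply: cplx_eq => /=.
  apply: fin_lim_uniq (fin_lim_Re v v) _.
  by apply: fin_lim_eq (fin_lim_hsq v) => s; apply: eq_bigr => i _; rewrite nrm_dot.
apply: fin_lim_uniq (fin_lim_Im v v) _ => e e0; exists [::] => s us _.
by rewrite big1 ?subrr ?normr0// => i _; rewrite dot_nrm.
Qed.

Definition hnorm (v : hsum) : C := (Num.sqrt (hsq v))%:C.

Lemma hsq_eq0 v : hsq v = 0 -> v = 0.
Proof.
move=> h; apply: hsum_eq => i; apply: nrm_eq0; apply/eqP.
by rewrite -sqrf_eq0 eq_le sqr_ge0 andbT -h nrm_le_hsq.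
Qed.

Lemma hnormD v w : hnorm (v + w) <= hnorm v + hnorm w.
Proof.
rewrite /hnorm -rmorphD lecR /=.
set a := Num.sqrt (hsq v); set b := Num.sqrt (hsq w).
have a2 : a ^+ 2 = hsq v by rewrite sqr_sqrtr ?hsq_ge0.
have b2 : b ^+ 2 = hsq w by rewrite sqr_sqrtr ?hsq_ge0.
have a0 : 0 <= a by exact: sqrtr_ge0.
have b0 : 0 <= b by exact: sqrtr_ge0.
have [/eqP az|az] := eqVneq a 0.
  by move: az; rewrite -sqrf_eq0 a2 => /eqP/hsq_eq0 ->; rewrite add0r ler_wpDl.
have [/eqP bz|bz] := eqVneq b 0.
  by move: bz; rewrite -sqrf_eq0 b2 => /eqP/hsq_eq0 ->; rewrite addr0 ler_wpDr.
have ap : 0 < a by rewrite lt_neqAle eq_sym az.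
have bp : 0 < b by rewrite lt_neqAle eq_sym bz.
rewrite -(@ler_pXn2r _ 2)// ?nnegrE ?addr_ge0 ?sqrtr_ge0// sqr_sqrtr ?hsq_ge0//.
apply: hsq_le => s us.
(* Weighted form of the square of a sum, from (bx - ay)^2 >= 0. The weights are chosen so that the
   two sides add up to (a + b)^2 once the partial sums are replaced by a^2 and b^2. *)
apply: (@le_trans _ _ ((1 + b / a) * nsum v s + (1 + a / b) * nsum w s)).
  rewrite /nsum !mulr_sumr -big_split /=; apply: ler_sum => i _.
  apply: le_trans (_ : (nrm (v i) + nrm (w i)) ^+ 2 <= _).
    by rewrite ler_pXn2r ?nnegrE ?addr_ge0 ?nrm_ge0// nrmD.
  set x := nrm (v i); set y := nrm (w i).
  have : 0 <= (b * x - a * y) ^+ 2 / (a * b) by rewrite divr_ge0 ?sqr_ge0// mulr_ge0.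
  have -> : (b * x - a * y) ^+ 2 / (a * b) = b / a * x ^+ 2 - 2 * x * y + a / b * y ^+ 2.
    by field; rewrite az bz.
  by nra.
have ba0 : 0 <= b / a by rewrite divr_ge0.
have ab0 : 0 <= a / b by rewrite divr_ge0.
have h1 : (1 + b / a) * nsum v s <= (1 + b / a) * a ^+ 2.
  by rewrite a2 ler_wpM2l ?nsum_le// addr_ge0.
have h2 : (1 + a / b) * nsum w s <= (1 + a / b) * b ^+ 2.
  by rewrite b2 ler_wpM2l ?nsum_le// addr_ge0.
apply: le_trans (lerD h1 h2) _; rewrite le_eqVlt; apply/orP; left; apply/eqP.
by field; rewrite az bz.
Qed.

Lemma hnormZ (a : C) v : hnorm (a *: v) = `|a| * hnorm v.
Proof.
rewrite /hnorm nrmE -rmorphM /=; congr (_%:C).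
have -> : hsq (a *: v) = nrm a ^+ 2 * hsq v.
  apply: fin_lim_uniq (fin_lim_hsq _) _.
  have := fin_lim_lin (nrm a ^+ 2) 0 (fin_lim_hsq v) (fin_lim_hsq v).
  rewrite mul0r addr0; apply: fin_lim_eq => s; rewrite mul0r addr0 mulr_sumr.
  by apply: eq_bigr => i _; rewrite hvalZ nrmZ exprMn.
by rewrite sqrtrM ?sqr_ge0// sqrtr_sqr ger0_norm ?nrm_ge0.
Qed.

Lemma hnorm_eq0 v : hnorm v = 0 -> v = 0.
Proof.
move=> /complexI /eqP; rewrite sqrtr_eq0 => h; apply: hsq_eq0.
by apply/eqP; rewrite eq_le h hsq_ge0.
Qed.

HB.instance Definition _ := Lmodule_isNormed.Build C hsum hnormD hnormZ hnorm_eq0.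

Lemma nrm_hsum (v : hsum) : nrm v ^+ 2 = hsq v.
Proof. by rewrite /nrm /= sqr_sqrtr ?hsq_ge0. Qed.

Lemma nrm_hval (v : hsum) i : nrm (v i) <= nrm v.
Proof.
by rewrite -(@ler_pXn2r _ 2)// ?nnegrE ?nrm_ge0// nrm_hsum nrm_le_hsq.
Qed.

Lemma hsum_complete (F : set_system hsum) : ProperFilter F -> cauchy F -> cvg F.
Proof.
move=> FF cF.
have hF (e : R) : 0 < e -> exists v, F [set w : hsum | nrm (v - w) < e].
  move=> e0; have [|v hv] := (cauchyP F).1 cF e%:C; first by rewrite ltcR.
  exists v; apply: filterS hv => w; rewrite -ball_normE /= nrmE ltcR //.
have cF_ i : exists l : K i, forall e : R, 0 < e -> F [set w : hsum | nrm (l - w i) < e].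
  have cFi : cvg ((fun w : hsum => w i) @ F).
    apply: cauchy_cvg; apply: cauchy_exP => e e0.
    have [v hv] := hF (complex.Re e) ltac:(by move: e0; rewrite ltcE => /andP[]).
    exists (v i); suff : F ((fun w : hsum => w i) @^-1` ball (v i) e) by [].
    apply: filterS hv => w /= vw; rewrite -ball_normE /= nrmE.
    move: e0; rewrite !ltcE /= => /andP[/eqP-> _]; rewrite eqxx /=.
    exact: le_lt_trans (nrm_hval (v - w) i) vw.
  exists (lim ((fun w : hsum => w i) @ F)) => e e0.
  have : nbhs (lim ((fun w : hsum => w i) @ F)) [set y | nrm (lim ((fun w : hsum => w i) @ F) - y) < e].
    by apply/nbhs_nrm; exists e.
  by move/cFi.
pose l i := projT1 (cid (cF_ i)); have hl i := projT2 (cid (cF_ i)); rewrite -/(l _) in hl.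
(* On a finite set s, the pointwise limit l is compared with v through a w of the filter that is
   close to v in norm and within e / n of l at each index of s; there are fewer than n such
   indices. *)
have key v (e : R) : 0 < e -> F [set w : hsum | nrm (v - w) < e] ->
    forall s, uniq s -> nsum (fun i => v i - l i) s <= 2 * e ^+ 2 + 2 * e ^+ 2.
  move=> e0 hv s us.
  have [w [vw ws]] : exists w : hsum, nrm (v - w) < e /\ nsum (fun i => w i - l i) s <= e ^+ 2.
    pose n := (size s)%:R + 1 : R.
    have n0 : 0 < n by rewrite ltr_wpDl.
    have : F [set w : hsum | forall i, i \in s -> nrm (l i - w i) < e / n].
      elim: (s) => [|i t IH]; first by apply: filterE.
      apply: filterS2 IH (hl i (e / n) (divr_gt0 e0 n0)) => w h1 h2 k.
      by rewrite inE => /predU1P[->//|/h1].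
    move=> /(filterI hv) /filter_ex[w /= [h1 h2]]; exists w; split=> //.
    apply: (@le_trans _ _ (\sum_(i <- s) (e / n) ^+ 2)).
      rewrite /nsum !big_seq; apply: ler_sum => i si.
      rewrite ler_pXn2r ?nnegrE ?nrm_ge0// ?divr_ge0 ?ltW//.
      by rewrite nrmBC h2.
    rewrite big_const_seq count_predT iter_addr_0 -mulr_natr exprMn -mulrA.
    rewrite ler_piMr ?sqr_ge0// exprVn mulrC ler_pdivrMr ?exprn_gt0// mul1r expr2.
    have n1 : 1 <= n by rewrite lerDr.
    have : (size s)%:R <= n by rewrite lerDl.
    by nra.
  apply: (@le_trans _ _ (2 * nsum (v - w) s + 2 * nsum (fun i => w i - l i) s)).
    rewrite /nsum !mulr_sumr -big_split /=; apply: ler_sum => i _.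
    apply: le_trans (sqrD_le _ _).
    by rewrite ler_pXn2r ?nnegrE ?addr_ge0 ?nrm_ge0// nrm_tri.
  apply: lerD; rewrite ler_pM2l//.
  by rewrite (le_trans (nsum_le _ us))// -nrm_hsum ler_pXn2r ?nnegrE ?nrm_ge0 ?(ltW e0)// ltW.
have sl : square_summable l.
  have [v hv] := hF 1 ltr01.
  have h1 := key v 1 ltr01 hv.
  have h2 : square_summable (fun i => v i - l i) by exists (2 * 1 ^+ 2 + 2 * 1 ^+ 2).
  have := square_summable_lin (-1) h2 (hvalP v).
  congr square_summable; apply: functional_extensionality_dep => i.
  by rewrite scaleN1r opprB subrK.
apply/cvg_ex; exists (HSum sl) => A /nbhs_nrm[e e0 hA].
have e4 : 0 < e / 4 by rewrite divr_gt0.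
have [v hv] := hF _ e4.
have h1 : hsq (v - HSum sl) <= 2 * (e / 4) ^+ 2 + 2 * (e / 4) ^+ 2.
  by apply: hsq_le => s us; exact: key hv s us.
apply: filterS hv => w /= vw; apply: hA.
have h2 : nrm (v - HSum sl) <= e / 2.
  rewrite -(@ler_pXn2r _ 2)// ?nnegrE ?nrm_ge0//; last by rewrite divr_ge0// ltW.
  by rewrite nrm_hsum (le_trans h1)//; nra.
have := nrm_tri (HSum sl) v w; rewrite [nrm (HSum sl - v)]nrmBC => h3; lra.
Qed.

HB.instance Definition _ := Uniform_isComplete.Build hsum hsum_complete.

Lemma hdot_norm x : hdot x x = `|x| ^+ 2.
Proof. by rewrite hdot_hsq nrmE -rmorphXn /= nrm_hsum. Qed.

HB.instance Definition _ := isHilbert.Build R hsum hdot_conj hdot_linear hdot_norm.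

End HilbertSum.

Arguments hsum {R} I K.
Arguments hval {R I K} _ _.

Section HilbertSumTheory.
Context {R : realType} (I : choiceType) (K : I -> hilbertType R).
Local Notation C := R[i].
Local Notation hs := (hsum I K).

Lemma fin_lim_le (f : seq I -> R) (l c : R) :
  fin_lim f l -> (forall s, uniq s -> f s <= c) -> l <= c.
Proof.
move=> hf h; rewrite leNgt; apply/negP => cl.
have [s0 hs0] := hf (l - c) ltac:(by rewrite subr_gt0).
have us : uniq (undup s0) by exact: undup_uniq.
have := hs0 _ us; have := h _ us => h1 h2.
have : `|f (undup s0) - l| < l - c by apply: h2 => i; rewrite mem_undup.
by rewrite ltr_norml => /andP[]; lra.
Qed.

Lemma fin_lim_sum (J : Type) (r : seq J) (f : J -> seq I -> R) (l : J -> R) :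
  (forall k, fin_lim (f k) (l k)) ->
  fin_lim (fun s => \sum_(k <- r) f k s) (\sum_(k <- r) l k).
Proof.
move=> h; elim: r => [|k r IH].
  by rewrite big_nil => e e0; exists [::] => s _ _; rewrite big_nil subrr normr0.
rewrite big_cons; have := fin_lim_lin 1 1 (h k) IH; rewrite !mul1r.
by apply: fin_lim_eq => s; rewrite !mul1r big_cons.
Qed.

Lemma fin_lim_nrm (v : hs) : fin_lim (nsum v) (nrm v ^+ 2).
Proof. by rewrite nrm_hsum; exact: fin_lim_hsq. Qed.

Definition hinj_fun i (x : K i) : forall j, K j :=
  fun j => match pselect (i = j) with left e => ecast k (K k) e x | right _ => 0 end.

Lemma hinj_funE i (x : K i) : hinj_fun x i = x.
Proof.
rewrite /hinj_fun; case: pselect => // e.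
by rewrite (Prop_irrelevance e erefl).
Qed.

Lemma hinj_fun_ne i j (x : K i) : i <> j -> hinj_fun x j = 0.
Proof. by rewrite /hinj_fun; case: pselect. Qed.

Lemma sum_single (V : zmodType) (i : I) (F : I -> V) (s : seq I) :
  uniq s -> (forall j, i <> j -> F j = 0) ->
  \sum_(j <- s) F j = if i \in s then F i else 0.
Proof.
move=> us h; case: ifPn => si.
  by rewrite (bigD1_seq i)//= big1 ?addr0// => j ji; apply: h => e; rewrite e eqxx in ji.
rewrite big_seq big1// => j sj; apply: h => e; by rewrite e sj in si.
Qed.

Lemma hinj_summable i (x : K i) : square_summable (hinj_fun x).
Proof.
exists (nrm x ^+ 2) => s us; rewrite /nsum (@sum_single _ i)//.
  by case: ifP => _; rewrite ?hinj_funE// sqr_ge0.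
by move=> j ij; rewrite hinj_fun_ne// nrm0 expr0n.
Qed.

Definition hinj i (x : K i) : hs := HSum (hinj_summable x).

Lemma hinjE i (x : K i) : hinj x i = x. Proof. exact: hinj_funE. Qed.
Lemma hinj_ne i j (x : K i) : i <> j -> hinj x j = 0. Proof. exact: hinj_fun_ne. Qed.

Lemma hinj_linear i a (x y : K i) : hinj (a *: x + y) = a *: hinj x + hinj y.
Proof.
apply: hsum_eq => j; rewrite hvalD hvalZ.
have [e|ij] := pselect (i = j); first by case: j / e; rewrite !hinjE.
by rewrite !hinj_ne// scaler0 addr0.
Qed.

Lemma fin_lim_single (F : I -> R) i : (forall j, i <> j -> F j = 0) ->
  fin_lim (fun s => \sum_(j <- s) F j) (F i).
Proof.
move=> h e e0; exists [:: i] => s us sub.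
by rewrite (sum_single us h) (sub i) ?inE// subrr normr0.
Qed.

Lemma dot_hinjl i (x : K i) (v : hs) : dot (hinj x) v = dot x (v i).
Proof.
apply: cplx_eq.
  apply: fin_lim_uniq (fin_lim_Re _ _) _.
  rewrite -[in X in fin_lim _ X](hinjE x); apply: (fin_lim_single (F := fun j => complex.Re (dot (hinj x j) (v j)))) => j ij.
  by rewrite hinj_ne// dot0l.
apply: fin_lim_uniq (fin_lim_Im _ _) _.
rewrite -[in X in fin_lim _ X](hinjE x); apply: (fin_lim_single (F := fun j => complex.Im (dot (hinj x j) (v j)))) => j ij.
by rewrite hinj_ne// dot0l.
Qed.

Lemma nrm_hinj i (x : K i) : nrm (hinj x) = nrm x.
Proof.
apply/eqP; rewrite -(@eqrXn2 _ 2)// ?nrm_ge0//; apply/eqP.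
by rewrite !nrm_dot dot_hinjl hinjE.
Qed.

(* The junk value 0 is never met for uniformly bounded families. *)
Definition hdiag (T : forall i, K i -> K i) (v : hs) : hs :=
  match pselect (square_summable (fun i => T i (v i))) with
  | left h => HSum h | right _ => 0 end.

Lemma hdiagE (T : forall i, K i -> K i) c (v : hs) i :
  (forall i x, nrm (T i x) <= c * nrm x) -> hdiag T v i = T i (v i).
Proof.
move=> h; rewrite /hdiag; case: pselect => //= -[].
have [d hd] := hvalP v; exists (c ^+ 2 * d) => s us.
apply: le_trans (ler_wpM2l (sqr_ge0 c) (hd s us)).
rewrite /nsum mulr_sumr; apply: ler_sum => k _; rewrite -exprMn.
rewrite ler_pXn2r ?nnegrE ?nrm_ge0//; exact: le_trans (nrm_ge0 _) (h k (v k)).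
Qed.

Lemma mx_hdiag_bound (J : finType) (T : J -> J -> hs -> hs)
    (S : J -> J -> forall i, K i -> K i) c :
  (forall k l v i, T k l v i = S k l i (v i)) ->
  (forall i (v : J -> K i), \sum_k nrm (\sum_l S k l i (v l)) ^+ 2 <= c ^+ 2 * \sum_l nrm (v l) ^+ 2) ->
  forall v : J -> hs, \sum_k nrm (\sum_l T k l (v l)) ^+ 2 <= c ^+ 2 * \sum_l nrm (v l) ^+ 2.
Proof.
move=> hT hS v.
have hv (r : seq J) (F : J -> hs) i : (\sum_(l <- r) F l) i = \sum_(l <- r) F l i.
  by elim: r => [|k r IH]; rewrite ?big_nil// !big_cons hvalD IH.
apply: (fin_lim_le (fin_lim_sum _ (fun k => fin_lim_nrm (\sum_l T k l (v l))))) => s us.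
rewrite /nsum exchange_big /=.
apply: (@le_trans _ _ (\sum_(i <- s) (c ^+ 2 * \sum_l nrm (v l i) ^+ 2))).
  apply: ler_sum => i _; apply: le_trans (hS i (fun l => v l i)).
  rewrite le_eqVlt; apply/orP; left; apply/eqP; apply: eq_bigr => k _.
  by rewrite hv; under eq_bigr do rewrite hT.
rewrite -mulr_sumr ler_wpM2l ?sqr_ge0// exchange_big /=.
by apply: ler_sum => l _; rewrite nrm_hsum; exact: nsum_le.
Qed.

End HilbertSumTheory.

Section FiniteHilbertSum.
Context {R : realType} (I : finType) (K : I -> hilbertType R).
Local Notation C := R[i].

Lemma fin_summable (v : forall i, K i) : square_summable v.
Proof.
exists (\sum_i nrm (v i) ^+ 2) => s us.
have -> : \sum_i nrm (v i) ^+ 2 = nsum v (enum I) by rewrite /nsum big_enum.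
apply: (nsum_sub v us (enum_uniq I)) => i _; by rewrite mem_enum.
Qed.

Definition hfin (v : forall i, K i) : hsum I K := HSum (fin_summable v).

Lemma fin_lim_fin (F : I -> R) : fin_lim (fun s => \sum_(j <- s) F j) (\sum_j F j).
Proof.
move=> e e0; exists (enum I) => s us sub.
have pe : perm_eq s (enum I).
  by apply: uniq_perm; rewrite ?enum_uniq// => i; rewrite mem_enum; apply: sub; rewrite mem_enum.
by rewrite (perm_big _ pe) /= big_enum_cond /= subrr normr0.
Qed.

Lemma dot_fin (v w : hsum I K) : dot v w = \sum_i dot (v i) (w i).
Proof.
apply: cplx_eq.
  rewrite (fin_lim_uniq (fin_lim_Re v w) (fin_lim_fin _)).
  by rewrite (big_morph (@complex.Re R) (@ReD R) erefl).
rewrite (fin_lim_uniq (fin_lim_Im v w) (fin_lim_fin _)).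
by rewrite (big_morph (@complex.Im R) (@ImD R) erefl).
Qed.

Lemma nrm_fin (v : hsum I K) : nrm v ^+ 2 = \sum_i nrm (v i) ^+ 2.
Proof. exact: fin_lim_uniq (fin_lim_nrm v) (fin_lim_fin _). Qed.

End FiniteHilbertSum.

Section Linear.
Context {K : pzRingType} {V W : lmodType K}.
Implicit Types T : V -> W.

Lemma linD T x y : linear T -> T (x + y) = T x + T y.
Proof. by move=> h; have := h 1 x y; rewrite !scale1r. Qed.
Lemma lin0 T : linear T -> T 0 = 0.
Proof. by move=> h; apply: (addrI (T 0)); rewrite -linD// !addr0. Qed.
Lemma linZ T a x : linear T -> T (a *: x) = a *: T x.
Proof. by move=> h; have := h a x 0; rewrite lin0// !addr0. Qed.
Lemma linN T x : linear T -> T (- x) = - T x.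
Proof. by move=> h; rewrite -scaleN1r linZ// scaleN1r. Qed.
Lemma linB T x y : linear T -> T (x - y) = T x - T y.
Proof. by move=> h; rewrite linD// linN. Qed.
Lemma lin_sum T I (r : seq I) (P : pred I) F : linear T ->
  T (\sum_(i <- r | P i) F i) = \sum_(i <- r | P i) T (F i).
Proof. by move=> h; apply: (big_morph T) => [x y|]; rewrite ?linD ?lin0. Qed.
End Linear.

Lemma choice_ex (T U : Type) (P : T -> U -> Prop) :
  (forall x, exists y, P x y) -> exists f, forall x, P x (f x).
Proof. by move=> h; exists (fun x => projT1 (cid (h x))) => x; exact: projT2 (cid (h x)). Qed.

(** * Minimization, real projections and the Riesz theorem *)

Section Riesz.
Context {R : realType}.
Local Notation C := R[i].

Lemma le_eps (a b : R) : (forall e, 0 < e -> a <= b + e) -> a <= b.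
Proof.
move=> h; rewrite leNgt; apply/negP => ba.
by have := h ((a - b) / 2) ltac:(by rewrite divr_gt0// subr_gt0); lra.
Qed.

Lemma invS_small (e : R) : 0 < e -> exists N, forall n, (N <= n)%N -> n.+1%:R^-1 < e.
Proof.
move=> e0; have [N hN] := ltr_add_invr (e0 : 0 < e); rewrite add0r in hN.
exists N => n Nn; apply: le_lt_trans hN.
by rewrite lef_pV2 ?posrE ?ltr0n// ler_nat.
Qed.

(** G is the graph of a bounded real linear form on a subspace that need not be closed. Minimizing
    |x|^2 - 2 l over G produces at once the vector that represents the form and its approximation by
    the subspace; the projection theorem and the Riesz theorem are both instances. *)
Lemma min_real (H : hilbertType R) (G : set (H * R)) (c : R) :
  0 <= c -> G (0, 0) ->
  (forall r x l y m, G (x, l) -> G (y, m) -> G (r%:C *: x + y, r * l + m)) ->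
  (forall x l, G (x, l) -> `|l| <= c * nrm x) ->
  exists z, (forall e, 0 < e -> exists p, G p /\ nrm (z - p.1) < e) /\
    forall x l, G (x, l) -> complex.Re (dot z x) = l.
Proof.
move=> c0 G0 Glin Gb.
pose phi (p : H * R) := nrm p.1 ^+ 2 - 2 * p.2.
pose V := [set phi p | p in G].
have Vinf : has_inf V.
  split; first by exists (phi (0, 0)), (0, 0).
  exists (- c ^+ 2) => _ [[x l] Gx <-]; rewrite /phi /=.
  have := Gb _ _ Gx; rewrite ler_norml => /andP[_ h].
  by have := sqr_ge0 (nrm x - c); nra.
pose d := inf V.
have dle p : G p -> d <= phi p by move=> Gp; apply: ge_inf; [exact: Vinf.2|exists p].
have [p hp] : exists p : nat -> H * R, forall n, G (p n) /\ phi (p n) < d + n.+1%:R^-1.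
  apply: (@choice_ex _ _ (fun n q => G q /\ phi q < d + n.+1%:R^-1)) => n.
  have e0 : 0 < (n.+1%:R^-1 : R) by rewrite invr_gt0 ltr0n.
  have [_ [q Gq <-] hq] := inf_adherent e0 Vinf.
  by exists q.
(* Parallelogram law, with the value at the midpoint bounded below by the infimum d. *)
have cauchy_p m n : nrm ((p m).1 - (p n).1) ^+ 2 <= 2 * (m.+1%:R^-1 + n.+1%:R^-1).
  have [Gm hm] := hp m; have [Gn hn] := hp n.
  case: (p m) (p n) Gm Gn hm hn => x l [y k] /= Gm Gn hm hn.
  have h0 := Glin 2^-1 _ _ _ _ Gn G0; rewrite !addr0 in h0.
  have := dle _ (Glin 2^-1 _ _ _ _ Gm h0).
  rewrite /phi /= -scalerDr nrmZ nrmR ger0_norm ?invr_ge0// exprMn.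
  have := parallelogram x y; rewrite /phi /= in hm hn.
  have -> : (2^-1 : R) ^+ 2 = 4^-1 by field.
  move: hm hn; move: (m.+1%:R^-1) (n.+1%:R^-1) => E1 E2 hm hn.
  by set A := nrm (x + y) ^+ 2; set B := nrm (x - y) ^+ 2; lra.
have [z hz] : exists l, forall e : R, 0 < e -> exists N, forall n, (N <= n)%N -> nrm ((p n).1 - l) < e.
  apply: (@complete_nrm R H) => e e0.
  have [N hN] := invS_small (e := e ^+ 2 / 4) ltac:(by rewrite divr_gt0// exprn_gt0).
  exists N => m n Nm Nn; rewrite -(@ltr_pXn2r _ 2)// ?nnegrE ?nrm_ge0 ?(ltW e0)//.
  apply: le_lt_trans (cauchy_p m n) _; move: (hN _ Nm) (hN _ Nn).
  by move: (m.+1%:R^-1) (n.+1%:R^-1) => E1 E2 ? ?; lra.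
exists z; split.
  by move=> e e0; have [N hN] := hz e e0; exists (p N); split; [exact: (hp N).1|rewrite nrmBC hN].
move=> y k Gy; set del := complex.Re (dot z y) - k.
(* The variation of the minimized function in the direction t y; a nonnegative quadratic polynomial
   in t without constant term has no linear term. *)
have key t : 0 <= 2 * t * del + t ^+ 2 * nrm y ^+ 2.
  apply: le_eps => e e0; set u := 2 * `|t| * nrm y + 1.
  have u0 : 0 < u by rewrite ltr_wpDl// !mulr_ge0 ?nrm_ge0.
  have [N1 hN1] := invS_small (e := e / 2) ltac:(by rewrite divr_gt0).
  have [N2 hN2] := hz (e / 2 / u) ltac:(by rewrite !divr_gt0).
  pose n := maxn N1 N2.
  have := hN1 n (leq_maxl _ _); have := hN2 n (leq_maxr _ _).
  have [Gn hn] := hp n; case: (p n) Gn hn => x l /= Gn hn.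
  rewrite ltr_pdivlMr// => zx n1.
  have := dle _ (Glin t _ _ _ _ Gy Gn); rewrite /phi /= nrmD_sq nrmZ nrmR dotZl conjR ReZ exprMn real_normK ?num_real//.
  rewrite /phi /= in hn; rewrite [dot y x]dot_conj ReJ => h1.
  have := le_trans (Re_le_nrm (dot (x - z) y)) (CS _ _).
  rewrite dotBl ReB => h2.
  have h3 : `|t * (complex.Re (dot x y) - complex.Re (dot z y))| <= `|t| * (nrm (x - z) * nrm y).
    by rewrite normrM ler_wpM2l.
  move: h3; rewrite ler_norml => /andP[_ h3].
  have h4 : nrm (x - z) * (2 * `|t| * nrm y) <= nrm (x - z) * u.
    by rewrite ler_wpM2l ?nrm_ge0// /u lerDl.
  rewrite /del; move: h1 h3 h4 zx hn n1.
  set X := complex.Re (dot x y); set Z := complex.Re (dot z y); set T := `|t|; set W := nrm (x - z).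
  set Ny := nrm y; set Nx := nrm x ^+ 2; set E := n.+1%:R^-1.
  move=> h1 h3 h4 zx hn n1.
  have : 0 <= E + 2 * t * (X - k) + t ^+ 2 * Ny ^+ 2 by lra.
  by nra.
apply/eqP; rewrite -subr_eq0 -/del; apply/contraT => d0.
have n0 : 0 < nrm y ^+ 2 + 1 by rewrite ltr_wpDl// sqr_ge0.
  have := key (- del / (nrm y ^+ 2 + 1)).
  have -> : 2 * (- del / (nrm y ^+ 2 + 1)) * del + (- del / (nrm y ^+ 2 + 1)) ^+ 2 * nrm y ^+ 2 =
    - (del ^+ 2 * (nrm y ^+ 2 + 2) / (nrm y ^+ 2 + 1) ^+ 2).
    by field; rewrite gt_eqF.
  rewrite oppr_ge0 leNgt divr_gt0// ?exprn_gt0// mulr_gt0// ?ltr_wpDl ?sqr_ge0//.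
by rewrite lt_neqAle eq_sym sqrf_eq0 d0 sqr_ge0.
Qed.

(** The case of the form Re<z0, .>. Only real combinations are allowed in W, and z lies in its
    closure: self-adjoint polynomials applied to the vacuum form such a W. *)
Lemma real_projection (H : hilbertType R) (W : set H) (z0 : H) :
  W 0 -> (forall (r : R) x y, W x -> W y -> W (r%:C *: x + y)) ->
  exists z, (forall e, 0 < e -> exists2 w, W w & nrm (z - w) < e) /\
    forall w, W w -> complex.Re (dot (z0 - z) w) = 0.
Proof.
move=> W0 Wl.
have [||||z [h1 h2]] := @min_real H [set p | W p.1 /\ p.2 = complex.Re (dot z0 p.1)] (nrm z0).
- exact: nrm_ge0.
- by rewrite /= dot0r.
- move=> r x l y m /= [Wx ->] [Wy ->]; split; first exact: Wl.
  by rewrite dotDr ReD dotZr ReZ.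
- by move=> x l /= [_ ->]; exact: le_trans (Re_le_nrm _) (CS _ _).
exists z; split.
  by move=> e /h1[[w l] [[/= Ww _] hw]]; exists w.
by move=> w Ww; rewrite dotBl ReB (h2 w (complex.Re (dot z0 w)))// subrr.
Qed.

Lemma approx_bound (H : hilbertType R) (z : H) (c : R) (P : set H) : 0 <= c ->
  (forall e, 0 < e -> exists2 x, P x & nrm (z - x) < e) ->
  (forall x, P x -> complex.Re (dot z x) <= c * nrm x) -> nrm z <= c.
Proof.
move=> c0 h hb.
have : nrm z ^+ 2 <= c * nrm z.
  apply: le_eps => e e0.
  have u0 : 0 < c + nrm z + 1 by rewrite ltr_wpDl// addr_ge0 ?nrm_ge0.
  have [x Px] := h (e / (c + nrm z + 1)) ltac:(by rewrite divr_gt0).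
  rewrite ltr_pdivlMr// => zx.
  have h1 := hb x Px; have h2 := CS_Re z (z - x).
  rewrite dotBr ReB -nrm_dot in h2.
  have h3 : nrm x <= nrm z + nrm (z - x).
    by have := nrmB z (z - x); rewrite opprB addrC subrK.
  have h4 : c * nrm x <= c * nrm z + c * nrm (z - x) by rewrite -mulrDr ler_wpM2l.
  by have := nrm_ge0 (z - x); nra.
have [->//|z0] := eqVneq (nrm z) 0.
by rewrite expr2 ler_pM2r// lt_neqAle eq_sym z0 nrm_ge0.
Qed.

Lemma riesz (H : hilbertType R) (G : set (H * C)) (c : R) :
  0 <= c -> G (0, 0) ->
  (forall a x l y m, G (x, l) -> G (y, m) -> G (a *: x + y, a * l + m)) ->
  (forall x l, G (x, l) -> nrm l <= c * nrm x) ->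
  exists z, nrm z <= c /\ forall x l, G (x, l) -> dot z x = l.
Proof.
move=> c0 G0 Gl Gb.
have [||||z [h1 h2]] := @min_real H [set p | exists2 l, G (p.1, l) & complex.Re l = p.2] c.
- by [].
- by exists 0.
- move=> r x l y m /= [l' Gx <-] [m' Gy <-]; exists (r%:C * l' + m'); first exact: Gl.
  by rewrite ReD ReZ.
- by move=> x l /= [l' Gx <-]; exact: le_trans (Re_le_nrm _) (Gb _ _ Gx).
exists z; split.
  apply: (@approx_bound _ _ _ [set x | exists l, G (x, l)]) => //.
    by move=> e /h1[[x l] [[l' /= Gx _] zx]]; exists x => //; exists l'.
  move=> x [l Gx]; rewrite (h2 x (complex.Re l)); last by exists l.
  exact: le_trans (Re_le _) (Gb _ _ Gx).
move=> x l Gx; apply: cplx_eq; first by apply: h2; exists l.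
have Gi := Gl 'i%C _ _ _ _ Gx G0; rewrite !addr0 in Gi.
have := h2 ('i%C *: x) (complex.Re ('i%C * l)); rewrite dotZr !ReiM => /(_ _)/oppr_inj; apply.
by exists ('i%C * l) => //; rewrite ReiM.
Qed.

Lemma dense_dot_ext (F : hilbertType R) (D : set F) :
  (forall x e, 0 < e -> exists2 d, D d & nrm (x - d) < e) ->
  forall y z, (forall d, D d -> dot d y = dot d z) -> y = z.
Proof.
move=> hD y z h; apply/eqP; rewrite -subr_eq0; apply/eqP; apply: nrm_eq0.
apply/eqP; rewrite eq_le nrm_ge0 andbT.
apply: (@approx_bound _ _ _ D) => //; first exact: hD.
by move=> x Dx; rewrite dot_conj ReJ dotBr h// subrr mul0r.
Qed.

(* X is a type of formal vectors, with formal linear combinations lc. *)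
Lemma form_op (F : hilbertType R) (X : Type) (lc : C -> X -> X -> X) (x0 : X)
    (io : X -> F) (B : X -> X -> C) (c : R) :
  0 <= c ->
  (forall a x y, io (lc a x y) = a *: io x + io y) ->
  (forall a x y z, B x (lc a y z) = a * B x y + B x z) ->
  (forall a x y z, B (lc a x y) z = a^* * B x z + B y z) ->
  (forall x y, nrm (B x y) <= c * nrm (io x) * nrm (io y)) ->
  (forall z e, 0 < e -> exists x, nrm (z - io x) < e) ->
  exists T : F -> F, [/\ linear T, (forall z, nrm (T z) <= c * nrm z) &
    forall x y, B x y = dot (io x) (T (io y))].
Proof.
move=> c0 iol Bl Bal Bb iod.
have iod' : forall z e, 0 < e -> exists2 d, range io d & nrm (z - d) < e.
  by move=> z e /(iod z)[x hx]; exists (io x) => //; exists x.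
have io0 : io (lc (-1) x0 x0) = 0 by rewrite iol scaleN1r addNr.
have [s hs] : exists s : X -> F, forall x, nrm (s x) <= c * nrm (io x) /\ forall y, dot (s x) (io y) = B x y.
  apply: (@choice_ex _ _ (fun x s => nrm s <= c * nrm (io x) /\ forall y, dot s (io y) = B x y)) => x.
  have [||||z [z1 z2]] := @riesz F [set p | exists y, io y = p.1 /\ B x y = p.2] (c * nrm (io x)).
  - by rewrite mulr_ge0 ?nrm_ge0.
  - by exists (lc (-1) x0 x0) => /=; split=> //; rewrite Bl mulN1r addNr.
  - move=> a _ _ _ _ [y [/= <- <-]] [z [/= <- <-]]; exists (lc a y z) => /=.
    by rewrite iol Bl.
  - by move=> _ _ [y [/= <- <-]]; exact: Bb.
  by exists z; split=> // y; apply: z2; exists y.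
have sl a x y : s (lc a x y) = a *: s x + s y.
  apply: (dense_dot_ext iod') => _ [z _ <-].
  rewrite dotDr dotZr [LHS]dot_conj [X in _ = _ * X + _]dot_conj [X in _ = _ + X]dot_conj.
  by rewrite !(hs _).2 Bal rmorphD rmorphM /= conjCK.
have [T hT] : exists T : F -> F, forall z, nrm (T z) <= c * nrm z /\ forall x, dot (T z) (io x) = dot z (s x).
  apply: (@choice_ex _ _ (fun z t => nrm t <= c * nrm z /\ forall x, dot t (io x) = dot z (s x))) => z.
  have [||||t [t1 t2]] := @riesz F [set p | exists x, io x = p.1 /\ dot z (s x) = p.2] (c * nrm z).
  - by rewrite mulr_ge0 ?nrm_ge0.
  - by exists (lc (-1) x0 x0) => /=; split=> //; rewrite sl scaleN1r addNr dot0r.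
  - move=> a _ _ _ _ [x [/= <- <-]] [y [/= <- <-]]; exists (lc a x y) => /=.
    by rewrite iol sl dotDr dotZr.
  - move=> _ _ [x [/= <- <-]]; apply: le_trans (CS _ _) _.
    by rewrite [c * nrm z]mulrC -mulrA ler_wpM2l ?nrm_ge0//; exact: (hs x).1.
  by exists t; split=> // x; apply: t2; exists x.
exists T; split; last 2 first.
- by move=> z; exact: (hT z).1.
- by move=> x y; rewrite dot_conj (hT _).2 dot_conj conjCK -(hs x).2 dot_conj.
move=> a y z; apply: (dense_dot_ext iod') => _ [x _ <-].
by rewrite dotDr dotZr dot_conj (hT _).2 -dot_conj dotDr dotZr
  [X in _ = _ * X + _]dot_conj [X in _ = _ + X]dot_conj !(hT _).2 -!dot_conj.
Qed.

End Riesz.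

(** * Adjoints, inverses and a fixed point equation *)

Section Operators.
Context {R : realType}.
Local Notation C := R[i].
Implicit Types H : hilbertType R.

Definition bounded_by H (T : H -> H) (c : R) : Prop :=
  linear T /\ forall x, nrm (T x) <= c * nrm x.

Lemma bounded_byP H (T : H -> H) : bounded_op T <-> exists2 c, 0 <= c & bounded_by T c.
Proof.
rewrite bounded_opP; split=> [[lT [c c0 h]]|[c c0 [lT h]]]; first by exists c.
by split=> //; exists c.
Qed.

Lemma bounded_opI H (T : H -> H) c : 0 <= c -> bounded_by T c -> bounded_op T.
Proof. by move=> c0 h; apply/bounded_byP; exists c. Qed.

Lemma bounded_lin H (T : H -> H) : bounded_op T -> linear T.
Proof. by case. Qed.

Lemma bounded_by_comp H (S T : H -> H) c d : 0 <= c ->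
  bounded_by S c -> bounded_by T d -> bounded_by (S \o T) (c * d).
Proof.
move=> c0 [lS hS] [lT hT]; split=> [a x y|x] /=; first by rewrite lT lS.
by rewrite (le_trans (hS _))// -mulrA ler_wpM2l.
Qed.

Lemma bounded_by_lin H (S T : H -> H) a c d :
  bounded_by S c -> bounded_by T d -> bounded_by (a *: S + T) (nrm a * c + d).
Proof.
move=> [lS hS] [lT hT]; split=> [b x y|x].
  by rewrite /= !fctE lS lT !scalerDr !scalerA [a * b]mulrC !addrA; congr (_ + _);
     rewrite -!addrA; congr (_ + _); rewrite addrC.
rewrite !fctE mulrDl (le_trans (nrmD _ _))// lerD// nrmZ -mulrA ler_wpM2l ?nrm_ge0//.
Qed.

Lemma bounded_comp H (S T : H -> H) : bounded_op S -> bounded_op T -> bounded_op (S \o T).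
Proof.
move=> /bounded_byP[c c0 hS] /bounded_byP[d d0 hT].
by apply: bounded_opI (bounded_by_comp c0 hS hT); rewrite mulr_ge0.
Qed.

Lemma bounded_linc H (S T : H -> H) (a : C) : bounded_op S -> bounded_op T -> bounded_op (a *: S + T).
Proof.
move=> /bounded_byP[c c0 hS] /bounded_byP[d d0 hT].
by apply: bounded_opI (bounded_by_lin a hS hT); rewrite addr_ge0// mulr_ge0 ?nrm_ge0.
Qed.

Lemma bounded0 H : bounded_op (0 : H -> H).
Proof.
by apply: (@bounded_opI _ _ 0) => //; split=> [a x y|x]; rewrite ?scaler0 ?addr0// mul0r nrm0.
Qed.

Lemma bounded_id H : bounded_op (id : H -> H).
Proof. by apply: (@bounded_opI _ _ 1) => //; split=> // x; rewrite mul1r. Qed.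

Lemma boundedD H (S T : H -> H) : bounded_op S -> bounded_op T -> bounded_op (S + T).
Proof. by move=> hS hT; have := bounded_linc 1 hS hT; rewrite scale1r. Qed.
Lemma boundedZ H (S : H -> H) (a : C) : bounded_op S -> bounded_op (a *: S).
Proof. by move=> hS; have := bounded_linc a hS (bounded0 H); rewrite addr0. Qed.
Lemma boundedN H (S : H -> H) : bounded_op S -> bounded_op (- S).
Proof. by move=> hS; have := boundedZ (-1) hS; rewrite scaleN1r. Qed.
Lemma boundedB H (S T : H -> H) : bounded_op S -> bounded_op T -> bounded_op (S - T).
Proof. by move=> hS hT; apply: boundedD => //; exact: boundedN. Qed.

Lemma adjoint_sym H (T T' : H -> H) : adjoint T T' -> adjoint T' T.
Proof. by move=> h x y; rewrite dot_conj -h -dot_conj. Qed.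

Lemma adjoint_uniq H (T T1 T2 : H -> H) : adjoint T T1 -> adjoint T T2 -> T1 = T2.
Proof. by move=> h1 h2; apply/funext => y; apply: dot_ext => z; rewrite -h1 -h2. Qed.

Lemma adjoint_bound H (T T' : H -> H) c : 0 <= c ->
  (forall x, nrm (T x) <= c * nrm x) -> adjoint T T' -> forall x, nrm (T' x) <= c * nrm x.
Proof.
move=> c0 hT h x; apply: le_nrm_dot => [|y]; first by rewrite mulr_ge0 ?nrm_ge0.
rewrite -h (le_trans (CS_Re _ _))// mulrAC ler_wpM2r ?nrm_ge0//.
Qed.

Lemma adjoint_linear H (T T' : H -> H) : adjoint T T' -> linear T'.
Proof. by move=> h a x y; apply: dot_ext => z; rewrite -h !dotDr !dotZr -!h. Qed.

Lemma adjoint_ex H (T : H -> H) : bounded_op T -> exists T', bounded_op T' /\ adjoint T T'.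
Proof.
move=> /bounded_byP[c c0 [lT hT]].
have [|||||T' [lT' hT' h]] := @form_op R H H (fun a x y => a *: x + y) 0 id (fun x y => dot (T x) y) c c0.
- by [].
- by move=> a x y z; rewrite dotDr dotZr.
- by move=> a x y z; rewrite lT dotDl dotZl.
- by move=> x y; rewrite (le_trans (CS _ _))// ler_wpM2r ?nrm_ge0.
- by move=> z e e0; exists z; rewrite subrr nrm0.
by exists T'; split=> //; apply: bounded_opI c0 _.
Qed.

(* The junk value of pick_op on an empty predicate is 0. *)
Definition pick_op H (P : set (H -> H)) : H -> H :=
  match pselect (exists T, P T) with left h => projT1 (cid h) | right _ => 0 end.

Lemma pick_opP H (P : set (H -> H)) : (exists T, P T) -> P (pick_op P).
Proof. by rewrite /pick_op; case: pselect => // h _; exact: projT2 (cid h). Qed.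

Definition adj H (T : H -> H) : H -> H := pick_op [set T' | bounded_op T' /\ adjoint T T'].

Lemma adjP H (T : H -> H) : bounded_op T -> bounded_op (adj T) /\ adjoint T (adj T).
Proof. by move=> /adjoint_ex/pick_opP. Qed.

Lemma adj_bounded H (T : H -> H) : bounded_op T -> bounded_op (adj T).
Proof. by move/adjP=> []. Qed.
Lemma adj_adjoint H (T : H -> H) : bounded_op T -> adjoint T (adj T).
Proof. by move/adjP=> []. Qed.
Lemma adjE H (T T' : H -> H) : bounded_op T -> adjoint T T' -> adj T = T'.
Proof. by move=> bT h; exact: adjoint_uniq (adj_adjoint bT) h. Qed.

Lemma dot_adjl H (T : H -> H) x y : bounded_op T -> dot (adj T x) y = dot x (T y).
Proof. by move=> bT; exact: (adjoint_sym (adj_adjoint bT)). Qed.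
Lemma dot_adjr H (T : H -> H) x y : bounded_op T -> dot x (adj T y) = dot (T x) y.
Proof. by move=> bT; rewrite -adj_adjoint. Qed.

Lemma adj_bound H (T : H -> H) c : bounded_op T -> 0 <= c ->
  (forall x, nrm (T x) <= c * nrm x) -> forall x, nrm (adj T x) <= c * nrm x.
Proof. by move=> bT c0 hT; exact: adjoint_bound c0 hT (adj_adjoint bT). Qed.

Lemma adjK H (T : H -> H) : bounded_op T -> adj (adj T) = T.
Proof. by move=> bT; apply: adjE; [exact: adj_bounded|exact/adjoint_sym/adj_adjoint]. Qed.

Lemma adj_comp H (S T : H -> H) : bounded_op S -> bounded_op T -> adj (S \o T) = adj T \o adj S.
Proof.
move=> bS bT; apply: adjE; first exact: bounded_comp.
by move=> x y /=; rewrite dot_adjr// dot_adjr.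
Qed.

Lemma adj_linc H (S T : H -> H) a : bounded_op S -> bounded_op T ->
  adj (a *: S + T) = a^* *: adj S + adj T.
Proof.
move=> bS bT; apply: adjE; first exact: bounded_linc.
by move=> x y; rewrite !fctE dotDl dotZl dotDr dotZr !dot_adjr.
Qed.

Lemma adjD H (S T : H -> H) : bounded_op S -> bounded_op T -> adj (S + T) = adj S + adj T.
Proof. by move=> bS bT; have := adj_linc 1 bS bT; rewrite rmorph1 !scale1r. Qed.
Lemma adj0 H : adj (0 : H -> H) = 0.
Proof. by apply: adjE; [exact: bounded0|move=> x y; rewrite dot0l dot0r]. Qed.
Lemma adjZ H (S : H -> H) a : bounded_op S -> adj (a *: S) = a^* *: adj S.
Proof. by move=> bS; have := adj_linc a bS (bounded0 H); rewrite adj0 !addr0. Qed.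
Lemma adjN H (S : H -> H) : bounded_op S -> adj (- S) = - adj S.
Proof. by move=> bS; have := adjZ (-1) bS; rewrite rmorphN rmorph1 !scaleN1r. Qed.
Lemma adjB H (S T : H -> H) : bounded_op S -> bounded_op T -> adj (S - T) = adj S - adj T.
Proof. by move=> bS bT; rewrite adjD ?adjN//; exact: boundedN. Qed.
Lemma adj_id H : adj (id : H -> H) = id.
Proof. by apply: adjE; [exact: bounded_id|move=> x y]. Qed.

(* The Lax-Milgram lemma, for the constant 1. *)
Lemma coercive_inverse H (B : H -> H) : bounded_op B ->
  (forall x, nrm x ^+ 2 <= complex.Re (dot x (B x))) ->
  exists V, [/\ bounded_by V 1, B \o V = id & V \o B = id].
Proof.
move=> /bounded_byP[c c0 [lB hB]] hc.
have low x : nrm x <= nrm (B x).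
  have [->|x0] := eqVneq (nrm x) 0; first exact: nrm_ge0.
  have xp : 0 < nrm x by rewrite lt_neqAle eq_sym x0 nrm_ge0.
  by rewrite -(ler_pM2l xp) -expr2 (le_trans (hc x))// CS_Re.
(* With z the projection of y on the closed range, y - z is orthogonal to B (y - z), so coercivity
   gives y = z. The lower bound [low] then makes preimages of a sequence tending to y converge. *)
have surj y : exists x, B x = y.
  have [||z [z1 z2]] := @real_projection R H (range B) y.
  - by exists 0 => //; rewrite lin0.
  - by move=> r _ _ [x _ <-] [x' _ <-]; exists (r%:C *: x + x'); rewrite ?lB.
  have ey : y = z.
    apply/eqP; rewrite -subr_eq0; apply/eqP/nrm_eq0/eqP; rewrite -sqrf_eq0 eq_le sqr_ge0 andbT.
    by rewrite (le_trans (hc _))// z2//; exists (y - z).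
  have [u hu] : exists u : nat -> H, forall n, nrm (y - B (u n)) < n.+1%:R^-1.
    apply: (@choice_ex _ _ (fun n u => nrm (y - B u) < n.+1%:R^-1)) => n.
    have [_ [x _ <-] hx] := z1 n.+1%:R^-1 ltac:(by rewrite invr_gt0).
    by exists x; rewrite ey.
  have [l hl] : exists l, forall e : R, 0 < e -> exists N, forall n, (N <= n)%N -> nrm (u n - l) < e.
    apply: (@complete_nrm R H) => e e0.
    have [N hN] := invS_small (e := e / 2) ltac:(by rewrite divr_gt0).
    exists N => m n Nm Nn; apply: le_lt_trans (low _) _.
    rewrite linB// (le_lt_trans (nrm_tri _ y _))// nrmBC.
    move: (hu m) (hu n) (hN _ Nm) (hN _ Nn).
    by move: (m.+1%:R^-1) (n.+1%:R^-1) => E1 E2 ? ? ? ?; lra.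
  exists l; apply/eqP; rewrite -subr_eq0; apply/eqP/nrm_eq0/eqP; rewrite eq_le nrm_ge0 andbT.
  apply: le_eps => e e0; rewrite add0r.
  have [N hN] := invS_small (e := e / 2) ltac:(by rewrite divr_gt0).
  have u0 : 0 < c + 1 by rewrite ltr_wpDl.
  have [N' hN'] := hl (e / 2 / (c + 1)) ltac:(by rewrite !divr_gt0).
  pose n := maxn N N'.
  have := hN' n (leq_maxr _ _); rewrite ltr_pdivlMr// => h2.
  rewrite (le_trans (nrm_tri _ (B (u n)) _))// -linB//.
  have h3 := hB (l - u n); rewrite nrmBC in h2.
  have h4 := hu n; have h5 := hN n (leq_maxl _ _); rewrite nrmBC in h4.
  have h6 := lt_trans h4 h5; have := nrm_ge0 (l - u n).
  have h7 : nrm (l - u n) * (c + 1) = c * nrm (l - u n) + nrm (l - u n) by ring.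
  by lra.
have [V hV] := choice_ex surj.
have inj x y : B x = B y -> x = y.
  move=> e; apply/eqP; rewrite -subr_eq0; apply/eqP/nrm_eq0/eqP; rewrite eq_le nrm_ge0 andbT.
  by rewrite (le_trans (low _))// linB// e subrr nrm0.
exists V; split.
- split=> [a x y|x]; first by apply: inj; rewrite lB !hV.
  by rewrite mul1r (le_trans (low _))// hV.
- exact/funext.
- by apply/funext => x /=; apply: inj; rewrite hV.
Qed.

Definition op_inv H (B : H -> H) : H -> H :=
  pick_op [set V | [/\ bounded_by V 1, B \o V = id & V \o B = id]].

Lemma op_invP H (B : H -> H) : bounded_op B ->
  (forall x, nrm x ^+ 2 <= complex.Re (dot x (B x))) ->
  [/\ bounded_by (op_inv B) 1, B \o op_inv B = id & op_inv B \o B = id].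
Proof.
move=> bB hB; exact: pick_opP (coercive_inverse bB hB).
Qed.

Lemma comm_inv H (B V T : H -> H) : B \o V = id -> V \o B = id ->
  T \o B = B \o T -> T \o V = V \o T.
Proof.
move=> h1 h2 h; rewrite -[LHS]/(id \o (T \o V)) -h2 -[LHS]/(V \o (B \o T) \o V) -h.
by rewrite -[LHS]/((V \o T) \o (B \o V)) h1.
Qed.

(* Every strict contraction m is 2x(1+x*x)^-1 for some x in the C*-algebra it generates. *)
Lemma contraction_fixpoint_op H (m : H -> H) c : 0 <= c -> c < 1 -> bounded_by m c ->
  exists x, [/\ bounded_op x, (forall z, x z = 2^-1 *: m (z + adj x (x z))) &
    forall T, bounded_op T -> T \o m = m \o T -> T \o adj m = adj m \o T -> T \o x = x \o T].
Proof.
move=> c0 c1 [lm hm].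
have bm : bounded_op m by exact: bounded_opI c0 _.
(* Iteration of u |-> m (1 + u*u) / 2, each iterate carried together with its adjoint. On the unit
   ball the map has Lipschitz constant at most |m| <= c, so the iterates converge in norm at rate
   c^n. *)
pose stp (p : (H -> H) * (H -> H)) : (H -> H) * (H -> H) :=
  (fun z => 2^-1 *: m (z + p.2 (p.1 z)), fun z => 2^-1 *: (adj m z + p.2 (p.1 (adj m z)))).
pose p n := iter n stp (0, 0).
have conj2 : (2^-1 : C)^* = 2^-1 by rewrite fmorphV rmorph_nat.
have n2 : nrm (2^-1 : C) = 2^-1 by rewrite -(rmorph_nat (real_complex R)) -fmorphV nrmR ger0_norm ?invr_ge0.
have pP n : [/\ bounded_by (p n).1 1, bounded_by (p n).2 1 & adjoint (p n).1 (p n).2].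
  elim: n => [|n [[l1 h1] [l2 h2] h]].
    by split; [split=> [a x y|x]|split=> [a x y|x]|move=> x y];
       rewrite /= ?fctE ?scaler0 ?addr0 ?dot0l ?dot0r ?nrm0 ?mul1r ?nrm_ge0.
  have H1 : bounded_by (p n.+1).1 1.
    rewrite /p iterS -/(p n); split=> [a x y|x] /=.
      by rewrite l1 l2 addrACA -scalerDr lm scalerDr !scalerA mulrC.
    rewrite nrmZ n2 mul1r (le_trans (ler_wpM2l _ (hm _)))//.
    have := nrmD x ((p n).2 ((p n).1 x)); have := h1 x; have := h2 ((p n).1 x).
    have := nrm_ge0 (x + (p n).2 ((p n).1 x)); have := nrm_ge0 x.
    by move=> ? ? ? ? ?; nra.
  have H2 : adjoint (p n.+1).1 (p n.+1).2.
    move=> x y; rewrite /p iterS -/(p n) /= dotZl conj2 dotZr; congr (_ * _).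
    by rewrite adj_adjoint// dotDl dotDr (adjoint_sym h) h.
  by split=> //; split; [exact: adjoint_linear H2|exact: adjoint_bound ler01 H1.2 H2].
have dP n : forall z, nrm ((p n.+1).1 z - (p n).1 z) <= c ^+ n * nrm z.
  elim: n => [|n IH] z.
    rewrite /p /= !addr0 subr0 nrmZ n2 expr0 mul1r.
    by have := hm z; have := nrm_ge0 z => ? ?; nra.
  have [[l1 h1] [l2 h2] h] := pP n; have [[l1' h1'] [l2' h2'] h'] := pP n.+1.
  have IH' : forall z, nrm ((p n.+1).2 z - (p n).2 z) <= c ^+ n * nrm z.
    apply: (adjoint_bound _ IH); first exact: exprn_ge0.
    by move=> x y; rewrite dotBl dotBr h h'.
  rewrite {1}/p iterS -/(p n.+1) [X in _ - X.1 z]/p iterS -/(p n) /=.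
  rewrite -scalerBr -linB// opprD addrACA subrr add0r nrmZ n2.
  have -> : (p n.+1).2 ((p n.+1).1 z) - (p n).2 ((p n).1 z) =
    (p n.+1).2 ((p n.+1).1 z - (p n).1 z) + ((p n.+1).2 ((p n).1 z) - (p n).2 ((p n).1 z)).
    by rewrite (linB _ _ l2') subrKA.
  set X := _ - _; set Y := _ - _.
  have hX : nrm ((p n.+1).2 X) <= c ^+ n * nrm z by rewrite (le_trans (h2' _))// mul1r IH.
  have hY : nrm Y <= c ^+ n * nrm z.
    by rewrite (le_trans (IH' _))// ler_wpM2l ?exprn_ge0// (le_trans (h1 _))// mul1r.
  have := hm ((p n.+1).2 X + Y); have := nrmD ((p n.+1).2 X) Y => h3 h4.
  have h5 : c * nrm ((p n.+1).2 X + Y) <= c * (c ^+ n * nrm z + c ^+ n * nrm z).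
    by rewrite ler_wpM2l// (le_trans h3)// lerD.
  by rewrite exprS; nra.
have dP2 n k z : nrm ((p (n + k)%N).1 z - (p n).1 z) * (1 - c) <= c ^+ n * (1 - c ^+ k) * nrm z.
  elim: k => [|k IH]; first by rewrite addn0 subrr nrm0 mul0r expr0 subrr mulr0 mul0r.
  have := nrm_tri ((p (n + k.+1)%N).1 z) ((p (n + k)%N).1 z) ((p n).1 z).
  have := dP (n + k)%N z; rewrite addnS exprD exprS => h1 h2.
  have h3 : c ^+ n * c ^+ k * nrm z * (1 - c) = c ^+ n * c ^+ k * nrm z - c ^+ n * (c * c ^+ k) * nrm z by ring.
  have h4 : nrm ((p (n + k).+1).1 z - (p (n + k)).1 z) * (1 - c) <= c ^+ n * c ^+ k * nrm z * (1 - c).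
    by rewrite ler_wpM2r// subr_ge0 ltW.
  have h5 : nrm ((p (n + k).+1).1 z - (p n).1 z) * (1 - c) <=
    (nrm ((p (n + k).+1).1 z - (p (n + k)).1 z) + nrm ((p (n + k)).1 z - (p n).1 z)) * (1 - c).
    by rewrite ler_wpM2r// subr_ge0 ltW.
  by lra.
have c1' : 0 < 1 - c by rewrite subr_gt0.
have dP3 n k z : (n <= k)%N -> nrm ((p k).1 z - (p n).1 z) <= c ^+ n * (nrm z / (1 - c)).
  move=> nk; rewrite -(subnKC nk) mulrA ler_pdivlMr// (le_trans (dP2 _ _ _))//.
  rewrite ler_wpM2r ?nrm_ge0// ler_piMr ?exprn_ge0// lerBlDr lerDl exprn_ge0//.
have small (d e : R) : 0 <= d -> 0 < e -> exists N, forall n, (N <= n)%N -> c ^+ n * d < e.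
  move=> d0 e0; have d1 : 0 < d + 1 by rewrite ltr_wpDl.
  have : (fun n => c ^+ n) @ \oo --> (0 : R) by apply: cvg_expr; rewrite ger0_norm.
  move=> /cvgrPdist_lt /(_ (e / (d + 1)) ltac:(by rewrite divr_gt0)) [N _ hN].
  exists N => n /hN /=; rewrite sub0r normrN ger0_norm ?exprn_ge0// ltr_pdivlMr// => h.
  by apply: le_lt_trans h; rewrite ler_wpM2l ?exprn_ge0// lerDl.
have [x hx] : exists x : H -> H, forall z n, nrm ((p n).1 z - x z) <= c ^+ n * (nrm z / (1 - c)).
  apply: (@choice_ex _ _ (fun z y => forall n, nrm ((p n).1 z - y) <= c ^+ n * (nrm z / (1 - c)))) => z.
  have d0 : 0 <= nrm z / (1 - c) by rewrite divr_ge0 ?nrm_ge0// ltW.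
  have [l hl] : exists l, forall e : R, 0 < e -> exists N, forall n, (N <= n)%N -> nrm ((p n).1 z - l) < e.
    apply: (@complete_nrm R H) => e e0.
    have [N hN] := small _ _ d0 (ltac:(by rewrite divr_gt0) : 0 < e / 2).
    exists N => k n Nk Nn.
    rewrite (le_lt_trans (nrm_tri _ ((p N).1 z) _))// [X in _ + X]nrmBC.
    by have := dP3 N k z Nk; have := dP3 N n z Nn; have := hN N (leqnn _); lra.
  exists l => n; apply: le_eps => e e0; have [N hN] := hl e e0.
  have := hN (maxn N n) (leq_maxl _ _); have := dP3 n (maxn N n) z (leq_maxr _ _) => h1 h2.
  rewrite (le_trans (nrm_tri _ ((p (maxn N n)).1 z) _))// nrmBC; lra.
have lim_eq y1 y2 d : 0 <= d -> (forall n, nrm (y1 - y2) <= c ^+ n * d) -> y1 = y2 :> H.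
  move=> d0 h; apply/eqP; rewrite -subr_eq0; apply/eqP/nrm_eq0/eqP; rewrite eq_le nrm_ge0 andbT.
  apply: le_eps => e e0; rewrite add0r; have [N hN] := small _ _ d0 e0.
  exact: le_trans (h N) (ltW (hN N (leqnn _))).
have n0 (z : H) : 0 <= nrm z / (1 - c) by rewrite divr_ge0 ?nrm_ge0// ltW.
have bx : bounded_by x 1.
  split=> [a y z|z].
    apply: (lim_eq _ _ (nrm (a *: y + z) / (1 - c) + nrm a * (nrm y / (1 - c)) + nrm z / (1 - c))).
      by rewrite !addr_ge0 ?mulr_ge0 ?n0 ?nrm_ge0 ?invr_ge0 ?(ltW c1').
    move=> n; have := hx (a *: y + z) n; have := hx y n; have := hx z n.
    have [[-> _] _ _] := pP n => h1 h2 h3.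
    rewrite (le_trans (nrm_tri _ (a *: (p n).1 y + (p n).1 z) _))// nrmBC -[X in _ <= c ^+ n * X]addrA mulrDr lerD//.
    rewrite mulrDr opprD addrACA -scalerBr (le_trans (nrmD _ _))// lerD// nrmZ mulrCA ler_wpM2l ?nrm_ge0//.
  apply: le_eps => e e0; have [N hN] := small _ _ (n0 z) e0.
  have := hN N (leqnn _); have := hx z N; have [[_ h] _ _] := pP N; have := h z => h1 h2 h3.
  have := nrmD (x z - (p N).1 z) ((p N).1 z); rewrite subrK nrmBC; lra.
have bx' : bounded_op x by exact: bounded_opI ler01 bx.
have hx' z n : nrm ((p n).2 z - adj x z) <= c ^+ n * (nrm z / (1 - c)).
  have h y : nrm ((p n).1 y - x y) <= c ^+ n / (1 - c) * nrm y.
    by rewrite mulrAC -mulrA; exact: hx.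
  rewrite mulrA mulrAC; apply: (@adjoint_bound _ (fun y => (p n).1 y - x y) (fun y => (p n).2 y - adj x y)).
  - by rewrite divr_ge0 ?exprn_ge0// ltW.
  - exact: h.
  - by move=> y w; have [_ _ a] := pP n; rewrite dotBl dotBr a adj_adjoint.
exists x; split=> //.
  move=> z; set w := RHS.
  have [lx' hx1'] : bounded_by (adj x) 1.
    by split; [exact: bounded_lin (adj_bounded bx')|exact: adj_bound bx' ler01 bx.2].
  apply: (lim_eq _ _ (nrm z / (1 - c) + (nrm z / (1 - c) + nrm z / (1 - c)))).
    by rewrite !addr_ge0 ?n0.
  move=> n; have [[l1 h1] [l2 h2] h] := pP n.
  rewrite (le_trans (nrm_tri _ ((p n.+1).1 z) _))// mulrDr lerD//.
    rewrite nrmBC (le_trans (hx z n.+1))// ler_wpM2r ?n0// exprS ler_piMl ?exprn_ge0//; exact: ltW.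
  rewrite /p iterS -/(p n) /= /w -scalerBr -linB// opprD addrACA subrr add0r nrmZ n2.
  have -> : (p n).2 ((p n).1 z) - adj x (x z) = ((p n).2 ((p n).1 z) - adj x ((p n).1 z)) + adj x ((p n).1 z - x z).
    by rewrite (linB _ _ lx') subrKA.
  set X := _ - _; set Y := adj x _.
  have hX : nrm X <= c ^+ n * (nrm z / (1 - c)).
    rewrite (le_trans (hx' _ _))// ler_wpM2l ?exprn_ge0// ler_wpM2r ?invr_ge0 ?(ltW c1')//.
    by rewrite (le_trans (h1 _))// mul1r.
  have hY : nrm Y <= c ^+ n * (nrm z / (1 - c)) by rewrite (le_trans (hx1' _))// mul1r hx.
  have := hm (X + Y); have := nrmD X Y => h3 h4.
  have := nrm_ge0 (X + Y); rewrite mulrDr => h5.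
  have h6 : c * nrm (X + Y) <= 1 * nrm (X + Y) by rewrite ler_wpM2r// ltW.
  have h7 := nrm_ge0 X; lra.
move=> T bT Tm Tm'.
have lT := bounded_lin bT.
have comm n : (forall z, T ((p n).1 z) = (p n).1 (T z)) /\ (forall z, T ((p n).2 z) = (p n).2 (T z)).
  have cm z : T (m z) = m (T z) by have := congr1 (@^~ z) Tm.
  have cm' z : T (adj m z) = adj m (T z) by have := congr1 (@^~ z) Tm'.
  elim: n => [|n [IH1 IH2]]; first by split=> z; rewrite /= lin0.
  rewrite /p iterS -/(p n); split=> z /=.
    by rewrite (linZ _ _ lT) cm (linD _ _ lT) IH2 IH1.
  by rewrite (linZ _ _ lT) (linD _ _ lT) cm' IH2 IH1 cm'.
apply/funext => z /=.
move: bT => /bounded_byP[d d0 [_ hT]].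
apply: (lim_eq _ _ (d * (nrm z / (1 - c)) + nrm (T z) / (1 - c))).
  by rewrite addr_ge0 ?n0// mulr_ge0// n0.
move=> n; rewrite (le_trans (nrm_tri _ (T ((p n).1 z)) _))// mulrDr lerD//.
  by rewrite -linB// (le_trans (hT _))// mulrCA ler_wpM2l// nrmBC.
by rewrite (comm n).1.
Qed.

End Operators.

(** * Limits and matrices of operators *)

Section Tends.
Context {R : realType}.
Local Notation C := R[i].

Definition tends {T : Type} {V : normedZmodType C} (F : set_system T) (u : T -> V) (l : V) : Prop :=
  forall e : R, 0 < e -> F [set x | nrm (u x - l) < e].

Section Filter.
Context {T : Type} (F : set_system T) {FF : ProperFilter F}.
Implicit Types V W : normedZmodType C.

Lemma tends_cst V (l : V) : tends F (fun _ => l) l.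
Proof. by move=> e e0; apply: filterE => x /=; rewrite subrr nrm0. Qed.

Lemma tends_eq V (u v : T -> V) l : F [set x | u x = v x] -> tends F u l -> tends F v l.
Proof. by move=> h hu e e0; apply: filterS2 h (hu e e0) => x /= ->. Qed.

Lemma tends_uniq V (u : T -> V) l m : tends F u l -> tends F u m -> l = m.
Proof.
move=> hl hm; apply/eqP; rewrite -subr_eq0; apply/eqP/nrm_eq0/eqP; rewrite eq_le nrm_ge0 andbT.
apply: le_eps => e e0; rewrite add0r.
have e2 : 0 < e / 2 by rewrite divr_gt0.
have [x [h1 h2]] := filter_ex (filterI (hl _ e2) (hm _ e2)).
rewrite (le_trans (nrm_tri _ (u x) _))// nrmBC; move: h1 h2 => /= h1 h2; lra.
Qed.

Lemma tendsD V (u v : T -> V) l m : tends F u l -> tends F v m -> tends F (fun x => u x + v x) (l + m).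
Proof.
move=> hl hm e e0; have e2 : 0 < e / 2 by rewrite divr_gt0.
apply: filterS2 (hl _ e2) (hm _ e2) => x /= h1 h2.
by rewrite opprD addrACA (le_lt_trans (nrmD _ _))//; lra.
Qed.

Lemma tendsM (u : T -> C) l (a : C) : tends F u l -> tends F (fun x => a * u x) (a * l).
Proof.
move=> hl e e0; have a0 : 0 < nrm a + 1 by rewrite ltr_wpDl ?nrm_ge0.
apply: filterS (hl _ (divr_gt0 e0 a0)) => x /=; rewrite ltr_pdivlMr// -mulrBr nrmM.
by have := nrm_ge0 (u x - l); nra.
Qed.

Lemma tendsN V (u : T -> V) l : tends F u l -> tends F (fun x => - u x) (- l).
Proof. by move=> hl e e0; apply: filterS (hl e e0) => x /=; rewrite -opprD nrmN. Qed.

Lemma tendsB V (u v : T -> V) l m : tends F u l -> tends F v m -> tends F (fun x => u x - v x) (l - m).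
Proof. by move=> hl hm; apply: tendsD => //; exact: tendsN. Qed.

Lemma tends_conj (u : T -> C) l : tends F u l -> tends F (fun x => (u x)^*) (l^*).
Proof. by move=> hl e e0; apply: filterS (hl e e0) => x /=; rewrite -rmorphB nrmJ. Qed.

Lemma tends_le V (u : T -> V) l c : tends F u l -> F [set x | nrm (u x) <= c] -> nrm l <= c.
Proof.
move=> hl hc; apply: le_eps => e e0; have [x [/= h1 h2]] := filter_ex (filterI (hl _ e0) hc).
by have := nrm_tri l (u x) 0; rewrite !subr0 nrmBC; lra.
Qed.

Lemma tends_sum V (J : Type) (r : seq J) (P : pred J) (u : J -> T -> V) l :
  (forall k, tends F (u k) (l k)) ->
  tends F (fun x => \sum_(k <- r | P k) u k x) (\sum_(k <- r | P k) l k).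
Proof.
move=> h; elim: r => [|k r IH].
  by apply: tends_eq (tends_cst _); apply: filterE => x /=; rewrite !big_nil.
rewrite big_cons; case: ifP => Pk.
  by apply: tends_eq (tendsD (h k) IH); apply: filterE => x /=; rewrite big_cons Pk.
by apply: tends_eq IH; apply: filterE => x /=; rewrite big_cons Pk.
Qed.

Lemma tends0_le V W (u : T -> V) (v : T -> W) :
  F [set x | nrm (u x) <= nrm (v x)] -> tends F v 0 -> tends F u 0.
Proof.
by move=> h hv e e0; apply: filterS2 h (hv e e0) => x /=; rewrite !subr0; exact: le_lt_trans.
Qed.

Lemma tends_sub0 V (u v : T -> V) l : tends F (fun x => u x - v x) 0 -> tends F v l -> tends F u l.
Proof.
move=> h hv; have := tendsD h hv; rewrite add0r; apply: tends_eq.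
by apply: filterE => x /=; rewrite subrK.
Qed.

Lemma tends_Re_le (u v : T -> C) l m : tends F u l -> tends F v m ->
  F [set x | complex.Re (u x) <= complex.Re (v x)] -> complex.Re l <= complex.Re m.
Proof.
move=> hu hv h; apply: le_eps => e e0; have e2 : 0 < e / 2 by rewrite divr_gt0.
have [x [[/= h1 h2] h3]] := filter_ex (filterI (filterI (hu _ e2) (hv _ e2)) h).
have := Re_le_nrm (u x - l); have := Re_le_nrm (v x - m).
rewrite !ReB !ler_norml => /andP[h4 h5] /andP[h6 h7]; lra.
Qed.

Lemma tends_sqr_le (J : finType) (u : J -> T -> C) (l : J -> C) (b : R) : (forall j, tends F (u j) (l j)) ->
  F [set x | \sum_j nrm (u j x) ^+ 2 <= b] -> \sum_j nrm (l j) ^+ 2 <= b.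
Proof.
move=> hu h; set L := \sum_j _.
have h1 : tends F (fun x => \sum_j (l j)^* * u j x) L%:C.
  have -> : L%:C = \sum_j (l j)^* * l j.
    by rewrite /L rmorph_sum /=; apply: eq_bigr => j _; rewrite -mulcJ mulrC.
  by apply: tends_sum => j; exact: tendsM.
suff : L <= (L + b) / 2 by lra.
apply: (tends_Re_le h1 (tends_cst ((L + b) / 2)%:C)); apply: filterS h => x /= {}h.
have -> : complex.Re (\sum_j (l j)^* * u j x) = \sum_j complex.Re ((l j)^* * u j x).
  exact: (big_morph _ ReD erefl).
have : \sum_j complex.Re ((l j)^* * u j x) <= \sum_j (2^-1 * nrm (l j) ^+ 2 + 2^-1 * nrm (u j x) ^+ 2).
  apply: ler_sum => j _; rewrite (le_trans (Re_le _))// nrmM nrmJ.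
  by have := sqr_ge0 (nrm (l j) - nrm (u j x)); nra.
by rewrite big_split /= -!mulr_sumr -/L; lra.
Qed.

End Filter.

Section UltraLimit.
Context {T : Type} (F : set_system T) {FF : UltraFilter F}.

Lemma ultra_real (u : T -> R) (c : R) : F [set x | `|u x| <= c] ->
  exists l, forall e, 0 < e -> F [set x | `|u x - l| < e].
Proof.
move=> hc; pose S := [set r | F [set x | r <= u x]].
have hS : has_sup S.
  split; first by exists (- c); apply: filterS hc => x /=; rewrite ler_norml => /andP[].
  exists c => r /= hr; have [x [/= h1]] := filter_ex (filterI hc hr).
  by rewrite ler_norml in h1; case/andP: h1 => _ h1 h2; exact: le_trans h2 h1.
exists (sup S) => e e0.
have [r /= Sr hr] := sup_adherent (ltac:(by rewrite divr_gt0) : 0 < e / 2) hS.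
have h : F (~` [set x | sup S + e / 2 <= u x]).
  have [h|//] := in_ultra_setVsetC [set x | sup S + e / 2 <= u x] FF.
  by have := ub_le_sup hS.2 (h : S (sup S + e / 2)); lra.
apply: filterS2 Sr h => x /= h1 /negP; rewrite -ltNge => h2.
by rewrite ltr_norml; apply/andP; split; lra.
Qed.

Lemma ultra_tends (u : T -> C) (c : R) : F [set x | nrm (u x) <= c] ->
  exists l, tends F u l.
Proof.
move=> hc.
have [|a ha] := @ultra_real (fun x => complex.Re (u x)) c.
  by apply: filterS hc => x /=; exact: le_trans (Re_le_nrm _).
have [|b hb] := @ultra_real (fun x => complex.Im (u x)) c.
  by apply: filterS hc => x /=; exact: le_trans (Im_le_nrm _).
exists (a +i* b) => e e0; have e2 : 0 < e / 2 by rewrite divr_gt0.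
apply: filterS2 (ha _ e2) (hb _ e2) => x /= h1 h2.
rewrite (le_lt_trans (nrm_le_ReIm _))// ReB ImD ImN /=; lra.
Qed.

(* Junk value 0 for functions without a limit. *)
Definition ulim (u : T -> C) : C :=
  match pselect (exists l, tends F u l) with left h => projT1 (cid h) | right _ => 0 end.

Lemma ulimP (u : T -> C) (c : R) : F [set x | nrm (u x) <= c] -> tends F u (ulim u).
Proof. by move=> /ultra_tends h; rewrite /ulim; case: pselect => // {}h; exact: projT2 (cid h). Qed.

End UltraLimit.
End Tends.

(** * Operator matrices as operators on finite Hilbert sums *)

Section MatrixOperators.
Context {R : realType} {I : finType}.
Local Notation C := R[i].
Implicit Types H : hilbertType R.

Definition mx_bound H (X : I -> I -> H -> H) (c : R) : Prop :=
  forall v : I -> H, \sum_i nrm (\sum_j X i j (v j)) ^+ 2 <= c ^+ 2 * \sum_j nrm (v j) ^+ 2.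

Lemma sum_normE (V : normedZmodType C) (w : I -> V) :
  \sum_i `|w i| ^+ 2 = (\sum_i nrm (w i) ^+ 2)%:C.
Proof. by rewrite rmorph_sum /=; apply: eq_bigr => i _; rewrite nrmE rmorphXn. Qed.

Lemma mxopnorm_leP H (X : I -> I -> H -> H) (c : C) :
  mxopnorm_le X c <-> exists r : R, [/\ c = r%:C, 0 <= r & mx_bound X r].
Proof.
split=> [[c0 h]|[r [-> r0 h]]].
  have ce : c = (complex.Re c)%:C by rewrite [LHS]complexE (ger0_Im c0) mulr0 addr0.
  exists (complex.Re c); split=> //; first by rewrite -ler0c -ce.
  move=> v; rewrite -lecR rmorphM rmorphXn /= -ce -!sum_normE; exact: h.
split; first by rewrite ler0c.
by move=> v; rewrite !sum_normE -rmorphXn -rmorphM lecR; exact: h.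
Qed.

Lemma mxnorm_leP (X : I -> I -> C) (c : C) :
  mxnorm_le X c <-> exists r : R, [/\ c = r%:C, 0 <= r & forall v : I -> C,
    \sum_i nrm (\sum_j X i j * v j) ^+ 2 <= r ^+ 2 * \sum_j nrm (v j) ^+ 2].
Proof.
split=> [[c0 h]|[r [-> r0 h]]].
  have ce : c = (complex.Re c)%:C by rewrite [LHS]complexE (ger0_Im c0) mulr0 addr0.
  exists (complex.Re c); split=> //; first by rewrite -ler0c -ce.
  move=> v; rewrite -lecR rmorphM rmorphXn /= -ce -!sum_normE; exact: h.
split; first by rewrite ler0c.
by move=> v; rewrite !sum_normE -rmorphXn -rmorphM lecR; exact: h.
Qed.

Definition mxop H (X : I -> I -> H -> H) (v : hsum I (fun _ => H)) : hsum I (fun _ => H) :=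
  hfin (fun i => \sum_j X i j (v j)).

Definition hinjc H (j : I) (x : H) : hsum I (fun _ => H) := locked (@hinj R I (fun _ => H) j x).

Lemma hinjcE H (j i : I) (x : H) : hinjc j x i = if i == j then x else 0.
Proof.
rewrite /hinjc -lock; have [->|ij] := eqVneq i j; first exact: (@hinjE R I (fun _ => H)).
by apply: (@hinj_ne R I (fun _ => H)) => e; rewrite e eqxx in ij.
Qed.

Definition entry H (T : hsum I (fun _ => H) -> hsum I (fun _ => H)) (i j : I) (x : H) : H :=
  T (hinjc j x) i.

Lemma mx_bounded_by H (X : I -> I -> H -> H) c : 0 <= c -> (forall i j, linear (X i j)) ->
  mx_bound X c <-> bounded_by (mxop X) c.
Proof.
move=> c0 lX; split=> [h|[_ h] v].
  split=> [a u v|v].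
    apply: hsum_eq => i; rewrite hvalD hvalZ /= scaler_sumr -big_split /=.
    by apply: eq_bigr => j _; rewrite lX.
  rewrite -(@ler_pXn2r _ 2)// ?nnegrE ?mulr_ge0 ?nrm_ge0// exprMn.
  by rewrite !nrm_fin; exact: h.
have := h (hfin (K := fun _ => H) v).
by rewrite -(@ler_pXn2r _ 2)// ?nnegrE ?mulr_ge0 ?nrm_ge0// exprMn !nrm_fin.
Qed.

Lemma hval_sum H J (r : seq J) (F : J -> hsum I (fun _ => H)) i :
  (\sum_(j <- r) F j) i = \sum_(j <- r) F j i.
Proof. by elim: r => [|j r IH]; rewrite ?big_nil// !big_cons hvalD IH. Qed.

Lemma hsum_decomp H (v : hsum I (fun _ => H)) : v = \sum_j hinjc j (v j).
Proof.
apply: hsum_eq => i; rewrite hval_sum (bigD1 i)//= hinjcE eqxx big1 ?addr0// => j ji.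
by rewrite hinjcE eq_sym (negPf ji).
Qed.

Lemma mxop_entry H (T : hsum I (fun _ => H) -> hsum I (fun _ => H)) : linear T -> mxop (entry T) = T.
Proof.
move=> lT; apply/funext => v; rewrite [in RHS](hsum_decomp v) (lin_sum _ _ _ lT).
by apply: hsum_eq => i /=; rewrite hval_sum.
Qed.

Lemma entry_mxop H (X : I -> I -> H -> H) i j : (forall i j, linear (X i j)) -> entry (mxop X) i j = X i j.
Proof.
move=> lX; apply/funext => x; rewrite /entry /= (bigD1 j)//= hinjcE eqxx big1 ?addr0// => k kj.
by rewrite hinjcE (negPf kj) lin0.
Qed.

Lemma hinjc_linear H j : linear (@hinjc H j).
Proof. by move=> a x y; rewrite /hinjc -!lock; exact: hinj_linear. Qed.

Lemma nrm_hinjc H j (x : H) : nrm (hinjc j x) = nrm x.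
Proof. rewrite /hinjc -lock; exact: nrm_hinj. Qed.

Lemma dot_hinjcl H j (x : H) v : dot (hinjc j x) v = dot x (v j).
Proof. rewrite /hinjc -lock; exact: dot_hinjl. Qed.

Lemma entry_bounded H (T : hsum I (fun _ => H) -> hsum I (fun _ => H)) i j :
  bounded_op T -> bounded_op (entry T i j).
Proof.
move=> /bounded_byP[c c0 [lT hT]]; apply: (bounded_opI c0); split=> [a x y|x].
  by rewrite /entry hinjc_linear lT.
by rewrite (le_trans (nrm_hval _ _))// (le_trans (hT _))// nrm_hinjc.
Qed.

Lemma entry_adj H (T : hsum I (fun _ => H) -> hsum I (fun _ => H)) i j :
  bounded_op T -> entry (adj T) i j = adj (entry T j i).
Proof.
move=> bT; apply/esym/adjE; first exact: entry_bounded.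
move=> x y; rewrite /entry -dot_hinjcl (dot_adjr _ _ bT).
by rewrite [LHS]dot_conj -dot_hinjcl -dot_conj.
Qed.

Lemma entry_comp H (S T : hsum I (fun _ => H) -> hsum I (fun _ => H)) i k :
  linear S -> entry (S \o T) i k = \sum_j (entry S i j \o entry T j k).
Proof.
move=> lS; apply/funext => x; rewrite fct_sumE /entry /= {1}(hsum_decomp (T _)) (lin_sum _ _ _ lS).
by rewrite hval_sum.
Qed.

Lemma entry_id H i j : entry (id : hsum I (fun _ => H) -> _) i j = if i == j then id else 0.
Proof. by apply/funext => x; rewrite /entry /= hinjcE; case: eqP. Qed.

Lemma bounded_sum (H K : hilbertType R) J (r : seq J) (F : J -> H -> H) :
  (forall j, bounded_op (F j)) -> bounded_op (\sum_(j <- r) F j).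
Proof.
move=> bF; elim: r => [|j r IH]; first by rewrite big_nil; exact: bounded0.
by rewrite big_cons; exact: boundedD.
Qed.

Lemma mxop_bounded H (X : I -> I -> H -> H) : (forall i j, bounded_op (X i j)) -> bounded_op (mxop X).
Proof.
move=> bX.
have -> : mxop X = \sum_i \sum_j (fun v : hsum I (fun _ => H) => hinjc i (X i j (v j))).
  apply/funext => v; rewrite fct_sumE [LHS](hsum_decomp (mxop X v)).
  apply: eq_bigr => i _; rewrite fct_sumE /= (lin_sum _ _ _ (@hinjc_linear H i)) //.
apply: bounded_sum => // i; apply: bounded_sum => // j.
have /bounded_byP[c c0 [lX hX]] := bX i j.
apply: (bounded_opI c0); split=> [a x y|x]; first by rewrite hvalD hvalZ lX hinjc_linear.
by rewrite nrm_hinjc (le_trans (hX _))// ler_wpM2l// nrm_hval.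
Qed.

Lemma mxop_comp H (X Y : I -> I -> H -> H) : (forall i j, linear (X i j)) ->
  mxop X \o mxop Y = mxop (fun i k => \sum_j (X i j \o Y j k)).
Proof.
move=> lX; apply/funext => v; apply: hsum_eq => i /=.
under eq_bigr => j _ do rewrite (lin_sum _ _ _ (lX i j)).
by rewrite exchange_big /=; apply: eq_bigr => k _; rewrite fct_sumE.
Qed.

Definition ampl H (y : H -> H) : hsum I (fun _ => H) -> hsum I (fun _ => H) :=
  mxop (fun i j => if i == j then y else 0).

Lemma amplE H (y : H -> H) v k : ampl y v k = y (v k).
Proof.
rewrite [LHS](bigD1 k)//= eqxx big1 ?addr0// => l lk.
by rewrite eq_sym (negPf lk).
Qed.

Lemma ampl_bounded H (y : H -> H) : bounded_op y -> bounded_op (ampl y).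
Proof. by move=> b; apply: mxop_bounded => k l; case: eqP => // _; exact: bounded0. Qed.

Lemma ampl_hinjc H (y : H -> H) k w : linear y -> ampl y (hinjc k w) = hinjc k (y w).
Proof. by move=> ly; apply: hsum_eq => l; rewrite amplE !hinjcE; case: eqP => // _; rewrite lin0. Qed.

Lemma ampl_adj H (y y' : H -> H) u v : (forall x z, dot (y x) z = dot x (y' z)) ->
  dot (ampl y u) v = dot u (ampl y' v).
Proof. by move=> h; rewrite !dot_fin; apply: eq_bigr => i _; rewrite !amplE. Qed.

Lemma ampl_comm H (X : I -> I -> H -> H) (y : H -> H) : linear y ->
  (forall i j z, X i j (y z) = y (X i j z)) -> ampl y \o mxop X = mxop X \o ampl y.
Proof.
move=> ly h; apply/funext => v; apply: hsum_eq => k; rewrite [LHS]amplE (lin_sum _ _ _ ly).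
by apply: eq_bigr => l _; rewrite -h amplE.
Qed.

Lemma entry_ampl_comm H T (y : H -> H) i j z : linear y -> ampl y \o T = T \o ampl y ->
  entry T i j (y z) = y (entry T i j z).
Proof.
move=> ly h; rewrite /entry -(ampl_hinjc j z ly) -[T (ampl y _)]/((T \o ampl y) _) -h.
exact: amplE.
Qed.

Lemma adj_mxop H (X : I -> I -> H -> H) : (forall i j, bounded_op (X i j)) ->
  adj (mxop X) = mxop (fun i j => adj (X j i)).
Proof.
move=> bX; have bm := mxop_bounded bX.
rewrite -[LHS]mxop_entry; last exact: bounded_lin (adj_bounded bm).
congr mxop; apply/funext => i; apply/funext => j; rewrite entry_adj// entry_mxop// => i' j'.
exact: bounded_lin.
Qed.

End MatrixOperators.

Lemma mx_bound1 {R : realType} (H : hilbertType R) (X : H -> H) (c : R) : 0 <= c ->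
  (forall x, nrm (X x) <= c * nrm x) -> mx_bound (fun _ _ : 'I_1 => X) c.
Proof. by move=> c0 h v; rewrite !big_ord1 -exprMn ler_pXn2r ?nnegrE ?mulr_ge0 ?nrm_ge0. Qed.

(** * Commutants of self-adjoint sets *)

Section Commutant.
Context {R : realType}.
Local Notation C := R[i].
Implicit Types H : hilbertType R.

Definition star_closed H (Y : set (H -> H)) : Prop :=
  forall y, Y y -> bounded_op y /\ Y (adj y).

Lemma comm_bounded H (Y : set (H -> H)) T : commutant Y T -> bounded_op T.
Proof. by case. Qed.

Lemma comm_commute H (Y : set (H -> H)) T y z : commutant Y T -> Y y -> T (y z) = y (T z).
Proof. by move=> [_ h] /h /(congr1 (@^~ z)). Qed.

Lemma commI H (Y : set (H -> H)) T : bounded_op T ->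
  (forall y z, Y y -> T (y z) = y (T z)) -> commutant Y T.
Proof. by move=> bT h; split=> // y Yy; apply/funext => z /=; exact: h. Qed.

Section Fix.
Context {H : hilbertType R} (Y : set (H -> H)) (Ys : star_closed Y).

Lemma comm_id : commutant Y id.
Proof. by apply: commI; first exact: bounded_id. Qed.

Lemma comm0 : commutant Y 0.
Proof.
apply: commI; first exact: bounded0.
by move=> y z /Ys[by_ _]; exact/esym/(lin0 (bounded_lin by_)).
Qed.

Lemma comm_lin a S T : commutant Y S -> commutant Y T -> commutant Y (a *: S + T).
Proof.
move=> hS hT; apply: commI; first exact: bounded_linc (comm_bounded hS) (comm_bounded hT).
move=> y z Yy; rewrite !fctE (comm_commute _ hS Yy) (comm_commute _ hT Yy).
have [by_ _] := Ys Yy.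
by rewrite (linD _ _ (bounded_lin by_)) (linZ _ _ (bounded_lin by_)).
Qed.

Lemma commD S T : commutant Y S -> commutant Y T -> commutant Y (S + T).
Proof. by move=> hS hT; have := comm_lin 1 hS hT; rewrite scale1r. Qed.
Lemma commZ a S : commutant Y S -> commutant Y (a *: S).
Proof. by move=> hS; have := comm_lin a hS comm0; rewrite addr0. Qed.
Lemma commN S : commutant Y S -> commutant Y (- S).
Proof. by move=> /(commZ (-1)); rewrite scaleN1r. Qed.
Lemma commB S T : commutant Y S -> commutant Y T -> commutant Y (S - T).
Proof. by move=> hS hT; apply: commD => //; exact: commN. Qed.

Lemma comm_comp S T : commutant Y S -> commutant Y T -> commutant Y (S \o T).
Proof.
move=> hS hT; apply: commI; first exact: bounded_comp (comm_bounded hS) (comm_bounded hT).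
by move=> y z Yy /=; rewrite (comm_commute _ hT Yy) (comm_commute _ hS Yy).
Qed.

Lemma comm_adj S : commutant Y S -> commutant Y (adj S).
Proof.
move=> hS; have bS := comm_bounded hS; apply: commI; first exact: adj_bounded.
move=> y z Yy; have [by_ Ya] := Ys Yy; apply: dot_ext => w.
rewrite dot_adjr// -[in RHS](adjK by_) (dot_adjr _ _ (adj_bounded by_)) dot_adjr//.
by rewrite (comm_commute _ hS Ya) dot_adjl.
Qed.

Lemma comm_inverse S V : commutant Y S -> bounded_op V -> S \o V = id -> V \o S = id -> commutant Y V.
Proof.
move=> hS bV h1 h2; split=> // y Yy; apply/esym; apply: comm_inv h1 h2 _.
by apply/funext => z /=; rewrite (comm_commute _ hS Yy).
Qed.

Lemma comm_limit T : bounded_op T ->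
  (forall e : R, 0 < e -> exists2 X, commutant Y X & forall x, nrm (X x - T x) <= e * nrm x) ->
  commutant Y T.
Proof.
move=> bT h; apply: commI => // y z Yy; have [by_ _] := Ys Yy.
move: (by_) => /bounded_byP[c c0 [ly hy]].
apply/eqP; rewrite -subr_eq0; apply/eqP/nrm_eq0/eqP; rewrite eq_le nrm_ge0 andbT.
apply: le_eps => e e0; rewrite add0r.
have d0 : 0 < nrm (y z) + c * nrm z + 1 by rewrite ltr_wpDl// addr_ge0 ?mulr_ge0 ?nrm_ge0.
have [X hX hXT] := h _ (divr_gt0 e0 d0).
rewrite (le_trans (nrm_tri _ (X (y z)) _))// nrmBC.
have h1 := hXT (y z); have h2 := hXT z; have h3 := hy (X z - T z).
rewrite (comm_commute _ hX Yy) -linB//; rewrite (comm_commute _ hX Yy) in h1.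
set d := e / _ in h1 h2.
have h4 : d * (nrm (y z) + c * nrm z + 1) = e by rewrite divfK// gt_eqF.
have d1 : 0 < d by rewrite divr_gt0.
have h5 : c * nrm (X z - T z) <= c * (d * nrm z) by rewrite ler_wpM2l.
by nra.
Qed.

End Fix.

Lemma closure_real H (S : set (H -> H)) T :
  (forall e : C, 0 < e -> exists2 X, S X & opnorm_le (X - T) e) ->
  forall e : R, 0 < e -> exists2 X, S X & forall x, nrm (X x - T x) <= e * nrm x.
Proof.
move=> h e e0; have [|X SX /opnorm_leP[r [er _ hr]]] := h e%:C; first by rewrite ltcR.
by exists X => // x; rewrite (complexI er); exact: hr.
Qed.

Lemma adjoint_adj H (X X' : H -> H) : bounded_op X -> bounded_op X' -> adjoint X X' -> X' = adj X.
Proof. by move=> bX _ h; rewrite (adjE bX h). Qed.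

Lemma commutant_cstar H (Y : set (H -> H)) : star_closed Y -> cstar_algebra (commutant Y).
Proof.
move=> Ys; split.
- by move=> X; exact: comm_bounded.
- by split; [exact: comm0|move=> a X X'; exact: comm_lin].
- by move=> X X'; exact: comm_comp.
- by move=> X X' hX bX' a; rewrite (adjoint_adj (comm_bounded hX) bX' a); exact: comm_adj.
- by move=> T bT h; apply: comm_limit => //; exact: closure_real.
Qed.

Lemma polarization H (T : H -> H) : linear T -> (forall z, dot z (T z) = 0) -> T = 0.
Proof.
move=> lT h; apply/funext => z; apply: dot_ext => w; rewrite dot0r.
have h1 := h (z + w); have h2 := h ('i%C *: z + w).
move: h1 h2; rewrite lT (linD _ _ lT) !dotDl !dotDr !dotZl !dotZr !h conj_i.
set a := dot z (T w); set b := dot w (T z) => h1 h2.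
have h3 : a = - b by apply/eqP; rewrite -addr_eq0; move/eqP: h1; rewrite add0r addr0.
move: h2; rewrite !mulr0 add0r addr0 h3 mulrN mulNr opprK -mulr2n => /eqP.
rewrite mulrn_eq0 /= mulf_eq0 => /orP[|/eqP//].
by rewrite eq_complex /= oner_eq0 andbF.
Qed.

End Commutant.

(** * A criterion for QWEP *)

Section Criterion.
Context {R : realType} (K F : hilbertType R).
Local Notation C := R[i].
Context (Y : set (K -> K)) (N : set (F -> F)).
Context (E : (K -> K) -> (K -> K)) (phi : (K -> K) -> (F -> F)).
Local Notation A := (commutant Y).
Local Notation M := (commutant N).
Hypotheses (Ys : star_closed Y) (Ns : star_closed N).
Hypothesis E_A : forall T, bounded_op T -> A (E T).
Hypothesis E_lin : forall a S T, bounded_op S -> bounded_op T -> E (a *: S + T) = a *: E S + E T.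
Hypothesis E_id : forall a, A a -> E a = a.
Hypothesis E_cc : forall n (T : 'I_n -> 'I_n -> K -> K) c, 0 <= c ->
  (forall i j, bounded_op (T i j)) -> mx_bound T c -> mx_bound (fun i j => E (T i j)) c.
Hypothesis phi_M : forall a, A a -> M (phi a).
Hypothesis phi_lin : forall c a b, A a -> A b -> phi (c *: a + b) = c *: phi a + phi b.
Hypothesis phi_adj : forall a, A a -> phi (adj a) = adj (phi a).
Hypothesis phi_id : phi id = id.
Hypothesis phi_cc : forall n (T : 'I_n -> 'I_n -> K -> K) c, 0 <= c ->
  (forall i j, A (T i j)) -> mx_bound T c -> mx_bound (fun i j => phi (T i j)) c.
Hypothesis phi_schwarz : forall a z, A a -> nrm (phi a z) ^+ 2 <= complex.Re (dot z (phi (adj a \o a) z)).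
Hypothesis phi_res : forall x, M x -> adj x = x -> exists a, [/\ A a,
  phi (adj a \o a) = adj (phi a) \o phi a,
  phi (a \o adj a) = phi a \o adj (phi a),
  (forall z, phi a (x z - 'i%C *: z) = z) & (forall z, phi (adj a) (x z + 'i%C *: z) = z)].

Let Ab a : A a -> bounded_op a. Proof. exact: comm_bounded. Qed.
Let Mb a : A a -> bounded_op (phi a). Proof. by move=> /phi_M; exact: comm_bounded. Qed.
Let Aadj a : A a -> A (adj a). Proof. exact: comm_adj. Qed.
Let Acomp a b : A a -> A b -> A (a \o b). Proof. exact: comm_comp. Qed.
Let Alin c a b : A a -> A b -> A (c *: a + b). Proof. exact: comm_lin. Qed.

Lemma phi0 : phi 0 = 0.
Proof.
have h := phi_lin (-1) (comm0 Ys) (comm0 Ys).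
by rewrite scaler0 addr0 scaleN1r addNr in h.
Qed.
Lemma phiD a b : A a -> A b -> phi (a + b) = phi a + phi b.
Proof. by move=> ha hb; have := phi_lin 1 ha hb; rewrite !scale1r. Qed.
Lemma phiZ c a : A a -> phi (c *: a) = c *: phi a.
Proof. by move=> ha; have := phi_lin c ha (comm0 Ys); rewrite phi0 !addr0. Qed.
Lemma phiN a : A a -> phi (- a) = - phi a.
Proof. by move=> ha; rewrite -scaleN1r phiZ// scaleN1r. Qed.
Lemma phiB a b : A a -> A b -> phi (a - b) = phi a - phi b.
Proof. by move=> ha hb; rewrite phiD ?phiN//; exact: commN. Qed.
Lemma phi_sum J (r : seq J) (f : J -> K -> K) : (forall j, A (f j)) ->
  phi (\sum_(j <- r) f j) = \sum_(j <- r) phi (f j).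
Proof.
move=> h; suff : A (\sum_(j <- r) f j) /\ phi (\sum_(j <- r) f j) = \sum_(j <- r) phi (f j) by case.
elim: r => [|j r [IH1 IH2]]; first by rewrite !big_nil phi0; split=> //; exact: comm0.
by rewrite !big_cons phiD// IH2; split=> //; exact: commD.
Qed.

Lemma phi_bound a c : 0 <= c -> A a -> (forall x, nrm (a x) <= c * nrm x) ->
  forall z, nrm (phi a z) <= c * nrm z.
Proof.
move=> c0 Aa h z.
have := @phi_cc 1 (fun _ _ => a) c c0 (fun _ _ => Aa) _ (fun _ => z).
rewrite !big_ord1 -exprMn ler_pXn2r ?nnegrE ?mulr_ge0 ?nrm_ge0//; apply.
by move=> v; rewrite !big_ord1 -exprMn ler_pXn2r ?nnegrE ?mulr_ge0 ?nrm_ge0.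
Qed.

(** Defect of multiplicativity as a sesquilinear form in (b, a), for a fixed vector z; the Schwarz
    inequality says that it is positive. *)
Let defect (b a : K -> K) (z : F) : C := dot z (phi (adj b \o a) z) - dot (phi b z) (phi a z).

Let defect_ge0 a z : A a -> 0 <= complex.Re (defect a a z).
Proof. by move=> Aa; rewrite /defect ReB -nrm_dot subr_ge0; exact: phi_schwarz. Qed.

(** [dom] follows the syntax of an operator down to its atoms; [leaf] is redefined each time a
    smaller algebra inside [commutant Y] becomes available. *)
Ltac leaf := assumption.
Ltac dom := lazymatch goal with
  | |- bounded_op (adj _) => apply: adj_bounded; dom
  | |- bounded_op (_ \o _) => apply: bounded_comp; dom
  | |- bounded_op (phi _) => apply: Mb; dom
  | |- bounded_op _ => first [assumption | apply: Ab; dom]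
  | |- commutant Y (adj _) => apply: Aadj; dom
  | |- commutant Y (_ \o _) => apply: Acomp; dom
  | |- commutant Y (_ *: _ + _) => apply: Alin; dom
  | |- commutant Y _ => leaf
  end.

(** Cauchy-Schwarz for the positive form [defect]: if it vanishes at (a, a), it vanishes at (a, b)
    for all b. Polarization then passes from quadratic forms to operators. *)
Lemma phi_mulr a b : A a -> A b -> phi (adj a \o a) = adj (phi a) \o phi a ->
  phi (adj a \o b) = adj (phi a) \o phi b.
Proof.
move=> ha hb haa.
have Dl c z : defect (c *: a + b) (c *: a + b) z =
  c^* * c * defect a a z + c^* * defect a b z + c * defect b a z + defect b b z.
  rewrite /defect adj_linc; try dom.
  rewrite (phi_lin c ha hb).
  have -> : (c^* *: adj a + adj b) \o (c *: a + b) =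
     c^* *: (c *: (adj a \o a) + (adj a \o b)) + (c *: (adj b \o a) + (adj b \o b)).
    apply/funext => x; rewrite /= !fctE.
    by rewrite (bounded_lin (adj_bounded (Ab ha))) (bounded_lin (adj_bounded (Ab hb))).
  rewrite !phi_lin; try dom.
  rewrite !fctE !dotDr !dotZr !dotDr !dotZr !dotDl !dotZl; ring.
have Daa z : defect a a z = 0 by rewrite /defect haa /= (dot_adjr _ _ (Mb ha)) subrr.
have Dba z : defect b a z = (defect a b z)^*.
  rewrite /defect rmorphB /= -!dot_conj; congr (_ - _).
  rewrite -(dot_adjr z z (Mb (Acomp (Aadj ha) hb))).
  rewrite -phi_adj; last by dom.
  by rewrite (adj_comp (adj_bounded (Ab ha)) (Ab hb)) (adjK (Ab ha)).
have D0 z : defect a b z = 0.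
  apply: nrm_eq0; apply/eqP/contraT => d0.
  have dp : 0 < nrm (defect a b z) by rewrite lt_neqAle eq_sym d0 nrm_ge0.
  set d := defect a b z in d0 dp *.
  set s := complex.Re (defect b b z).
  (* With d the mixed defect and s the defect of b, this c makes the defect of c a + b equal to s -
     2 (s + 1), which is negative. *)
  pose c : C := - (((s + 1) / nrm d ^+ 2)%:C * d).
  have := defect_ge0 z (Alin c ha hb); rewrite Dl Daa mulr0 add0r Dba -/d /c.
  rewrite ReD -/s rmorphN rmorphM /= !mulNr -opprD ReN conjR -mulrA [d^* * d]mulrC mulcJ -mulrA mulcJ.
  rewrite -!rmorphM /= divfK ?sqrf_eq0//.
  have := defect_ge0 z hb; rewrite -/s => s0.
  rewrite /=; lra.
apply/eqP; rewrite -subr_eq0; apply/eqP/polarization.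
  move=> c x y; rewrite !fctE /=.
  have l1 := bounded_lin (Mb (Acomp (Aadj ha) hb)).
  have l2 := bounded_lin (Mb hb); have l3 := bounded_lin (adj_bounded (Mb ha)).
  by rewrite l1 l2 l3 scalerBr opprD addrACA.
by move=> z; rewrite !fctE dotBr /= (dot_adjr _ _ (Mb ha)); exact: D0.
Qed.

(** Multiplicativity is required against all of A, on both sides: the algebraic stability properties
    follow at once, and [mult_domI] recovers membership from the two equalities in the Schwarz
    inequality. *)
Definition mult_dom : set (K -> K) :=
  [set a | A a /\ forall b, A b -> phi (b \o a) = phi b \o phi a /\ phi (a \o b) = phi a \o phi b].
Local Notation S := mult_dom.

Lemma mult_domI a : A a -> phi (adj a \o a) = adj (phi a) \o phi a ->
  phi (a \o adj a) = phi a \o adj (phi a) -> S a.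
Proof.
move=> ha h1 h2; split=> // b hb; split.
  have hb' := Aadj hb; have := phi_mulr ha hb' h1.
  move=> /(congr1 (@adj R F)); rewrite -phi_adj; last by dom.
  rewrite (adj_comp (adj_bounded (Ab ha)) (Ab hb')) (adjK (Ab hb)) (adjK (Ab ha)) => ->.
  by rewrite (adj_comp (adj_bounded (Mb ha)) (Mb hb')) (phi_adj hb) (adjK (Mb hb)) (adjK (Mb ha)).
have ha' := Aadj ha.
by have := phi_mulr ha' hb; rewrite (adjK (Ab ha)) (phi_adj ha) (adjK (Mb ha)); exact.
Qed.

Lemma SA a : S a -> A a. Proof. by case. Qed.
Lemma Sb a : S a -> bounded_op a. Proof. by move=> /SA/Ab. Qed.
Lemma Sr a b : S a -> A b -> phi (b \o a) = phi b \o phi a.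
Proof. by case=> _ h /h[]. Qed.
Lemma Sl a b : S a -> A b -> phi (a \o b) = phi a \o phi b.
Proof. by case=> _ h /h[]. Qed.

Ltac leaf ::= first [assumption | apply: SA; assumption].

Lemma S_id : S id.
Proof. by split; [exact: comm_id|move=> b _; rewrite phi_id]. Qed.

Lemma S0 : S 0.
Proof.
split; first exact: comm0.
move=> b hb; have l1 := lin0 (bounded_lin (Ab hb)); have l2 := lin0 (bounded_lin (Mb hb)).
have -> : b \o (0 : K -> K) = 0 by apply/funext => x /=; rewrite l1.
have -> : (0 : K -> K) \o b = 0 by apply/funext.
by rewrite phi0; split; apply/funext => x //=; rewrite [(0 : F -> F) x]/(0 : F) l2.
Qed.

Lemma S_lin c a b : S a -> S b -> S (c *: a + b).
Proof.
move=> ha hb; have [Aa Abb] := (SA ha, SA hb); split; first exact: Alin.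
move=> x hx; have lx := bounded_lin (Ab hx).
have -> : x \o (c *: a + b) = c *: (x \o a) + (x \o b) by apply/funext => y; rewrite /= !fctE lx.
have -> : (c *: a + b) \o x = c *: (a \o x) + (b \o x) by [].
rewrite !phi_lin; try dom; rewrite (Sr ha)// (Sr hb)// (Sl ha)// (Sl hb)//; split=> //.
by apply/funext => y; rewrite /= !fctE (bounded_lin (Mb hx)).
Qed.

Lemma S_comp a b : S a -> S b -> S (a \o b).
Proof.
move=> ha hb; have [Aa Abb] := (SA ha, SA hb); split; first exact: Acomp.
move=> x hx; split.
  have -> : x \o (a \o b) = (x \o a) \o b by [].
  by rewrite (Sr hb (Acomp hx Aa)) (Sr ha hx) (Sl ha Abb).
have -> : (a \o b) \o x = a \o (b \o x) by [].
by rewrite (Sl ha (Acomp Abb hx)) (Sl hb hx) (Sl ha Abb).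
Qed.

Lemma S_adj a : S a -> S (adj a).
Proof.
move=> ha; have Aa := SA ha; split; first exact: Aadj.
move=> x hx; have hx' := Aadj hx.
have e1 : x \o adj a = adj (a \o adj x) by rewrite (adj_comp (Ab Aa) (Ab hx')) (adjK (Ab hx)).
have e2 : adj a \o x = adj (adj x \o a) by rewrite (adj_comp (Ab hx') (Ab Aa)) (adjK (Ab hx)).
rewrite e1 e2 (phi_adj (Acomp Aa hx')) (phi_adj (Acomp hx' Aa)) (phi_adj Aa).
rewrite (Sl ha hx') (Sr ha hx') (adj_comp (Mb Aa) (Mb hx')) (adj_comp (Mb hx') (Mb Aa)).
by rewrite (phi_adj hx) (adjK (Mb hx)).
Qed.

Lemma S_inv a v : S a -> A v -> a \o v = id -> v \o a = id -> S v.
Proof.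
move=> ha hv h1 h2.
have e1 : phi a \o phi v = id by rewrite -(Sl ha)// h1 phi_id.
split=> // b hb; split.
  have h : phi (b \o v) \o phi a = phi b.
    by rewrite -(Sr ha (Acomp hb hv)) -[(b \o v) \o a]/(b \o (v \o a)) h2.
  by rewrite -[in RHS]h -[RHS]/(phi (b \o v) \o (phi a \o phi v)) e1.
have e2 : phi v \o phi a = id by rewrite -(Sr ha)// h2 phi_id.
have h : phi a \o phi (v \o b) = phi b.
  by rewrite -(Sl ha (Acomp hv hb)) -[a \o (v \o b)]/((a \o v) \o b) h1.
by rewrite -[in RHS]h -[RHS]/((phi v \o phi a) \o phi (v \o b)) e2.
Qed.

Lemma S_limit T : bounded_op T ->
  (forall e : R, 0 < e -> exists2 X, S X & forall x, nrm (X x - T x) <= e * nrm x) -> S T.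
Proof.
move=> bT h.
have AT : A T.
  apply: comm_limit => // e e0; have [X [hX _] hh] := h e e0; by exists X.
split=> // b hb; have [bb bpb] := (Ab hb, Mb hb).
move: (bb) => /bounded_byP[c c0 [lb hcb]].
have hcp := phi_bound c0 hb hcb.
have key (G1 G2 : F -> F) : (forall e : R, 0 < e -> forall z, nrm (G1 z - G2 z) <= 2 * (c * e) * nrm z) -> G1 = G2.
  move=> hG; apply/funext => z; apply/eqP; rewrite -subr_eq0; apply/eqP/nrm_eq0/eqP; rewrite eq_le nrm_ge0 andbT.
  apply: le_eps => e e0; rewrite add0r.
  have d0 : 0 < 2 * c * nrm z + 1 by rewrite ltr_wpDl// !mulr_ge0 ?nrm_ge0.
  apply: le_trans (hG (e / (2 * c * nrm z + 1)) _ z) _; first by rewrite divr_gt0.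
  rewrite mulrA mulrAC [_ * (e / _)]mulrA ler_pdivrMr// mulrC ler_wpM2l ?(ltW e0)//.
  by rewrite lerDl.
split; apply: key => e e0 z; have [X hX hXT] := h e e0.
- have AX := SA hX; have AD := commB Ys AT AX.
  have hD x : nrm ((T - X) x) <= e * nrm x by rewrite !fctE nrmBC.
  have h1 := phi_bound (ltW e0) AD hD z.
  have h2 : forall x, nrm ((b \o (T - X)) x) <= c * e * nrm x.
    by move=> x; rewrite /= (le_trans (hcb _))// -mulrA ler_wpM2l.
  have h3 := phi_bound (mulr_ge0 c0 (ltW e0)) (Acomp hb AD) h2 z.
  have h4 := hcp (phi (T - X) z).
  have e1 : phi (b \o T) z = phi (b \o (T - X)) z + phi (b \o X) z.
    rewrite -[RHS]/((phi (b \o (T - X)) + phi (b \o X)) z) -phiD; try dom.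
    by congr phi; apply/funext => x; rewrite /= !fctE (linB _ _ lb) subrK.
  have e2 : phi b (phi T z) = phi b (phi (T - X) z) + phi b (phi X z).
    rewrite phiB// !fctE (linB _ _ (bounded_lin bpb)) subrK //.
  rewrite /= e1 e2 (Sr hX)// opprD addrACA subrr addr0.
  have := nrmB (phi (b \o (T - X)) z) (phi b (phi (T - X) z)).
  have : c * nrm (phi (T - X) z) <= c * (e * nrm z) by rewrite ler_wpM2l.
  lra.
- have AX := SA hX; have AD := commB Ys AT AX.
  have hD x : nrm ((T - X) x) <= e * nrm x by rewrite !fctE nrmBC.
  have h1 := phi_bound (ltW e0) AD hD (phi b z).
  have h2 : forall x, nrm (((T - X) \o b) x) <= c * e * nrm x.
    by move=> x; rewrite /= (le_trans (hD _))// [c * e]mulrC -mulrA ler_wpM2l ?(ltW e0).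
  have h3 := phi_bound (mulr_ge0 c0 (ltW e0)) (Acomp AD hb) h2 z.
  have e1 : phi (T \o b) z = phi ((T - X) \o b) z + phi (X \o b) z.
    rewrite -[RHS]/((phi ((T - X) \o b) + phi (X \o b)) z) -phiD; try dom.
    by congr phi; apply/funext => x; rewrite /= !fctE subrK.
  have e2 : phi T (phi b z) = phi (T - X) (phi b z) + phi X (phi b z).
    by rewrite phiB// !fctE subrK.
  rewrite /= e1 e2 (Sl hX)// opprD addrACA subrr addr0.
  have := nrmB (phi ((T - X) \o b) z) (phi (T - X) (phi b z)).
  have : e * nrm (phi b z) <= e * (c * nrm z) by rewrite ler_wpM2l ?(ltW e0)// hcp.
  lra.
Qed.

Lemma S_cstar : cstar_algebra S.
Proof.
split.
- exact: Sb.
- by split; [exact: S0|exact: S_lin].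
- exact: S_comp.
- by move=> X X' hX bX' a; rewrite (adjoint_adj (Sb hX) bX' a); exact: S_adj.
- by move=> T bT h; apply: S_limit => //; exact: closure_real.
Qed.

Definition mult_ker : set (K -> K) := [set a | S a /\ phi a = 0].
Local Notation J := mult_ker.

Lemma JS a : J a -> S a. Proof. by case. Qed.
Lemma JA a : J a -> A a. Proof. by move=> /JS/SA. Qed.
Lemma Jb a : J a -> bounded_op a. Proof. by move=> /JS/Sb. Qed.

Ltac leaf ::= first [assumption | apply: SA; assumption | apply: JA; assumption].

Lemma J0 : J 0.
Proof. by split; [exact: S0|exact: phi0]. Qed.

Lemma J_lin c a b : J a -> J b -> J (c *: a + b).
Proof.
move=> [ha ea] [hb eb]; split; first exact: S_lin.
by rewrite phi_lin; try dom; rewrite ea eb scaler0 addr0.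
Qed.

Lemma J_left a x : J a -> A x -> phi (x \o a) = 0.
Proof.
move=> [ha ea] hx; rewrite (Sr ha)// ea; apply/funext => z /=.
exact: lin0 (bounded_lin (Mb hx)).
Qed.

Lemma J_right a x : J a -> A x -> phi (a \o x) = 0.
Proof. by move=> [ha ea] hx; rewrite (Sl ha)// ea. Qed.

Lemma J_mull a x : J a -> S x -> J (x \o a).
Proof. by move=> ha hx; split; [exact: S_comp hx (JS ha)|rewrite J_left//; dom]. Qed.

Lemma J_mulr a x : J a -> S x -> J (a \o x).
Proof. by move=> ha hx; split; [exact: S_comp (JS ha) hx|rewrite J_right//; dom]. Qed.

Lemma J_adj a : J a -> J (adj a).
Proof.
by move=> [ha ea]; split; [exact: S_adj|rewrite phi_adj ?ea ?adj0//; dom].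
Qed.

(** The middle factor x is only in A. This is what places the compression k E(T) k in J, hence in S,
    although E(T) need not be in S. *)
Lemma J_hered a b x : J a -> J b -> A x -> J (a \o (x \o b)).
Proof.
move=> ha hb hx; have [Aa Abb] := (JA ha, JA hb).
have e0 : phi (a \o (x \o b)) = 0 by rewrite J_right//; dom.
split=> //; split; first by dom.
move=> y hy; rewrite e0; split.
  have -> : y \o (a \o (x \o b)) = (y \o (a \o x)) \o b by [].
  rewrite J_left//; last by dom.
  apply/funext => z /=; exact/esym/(lin0 (bounded_lin (Mb hy))).
have -> : (a \o (x \o b)) \o y = a \o ((x \o b) \o y) by [].
by rewrite J_right//; dom.
Qed.

Lemma J_limit T : bounded_op T ->
  (forall e : R, 0 < e -> exists2 X, J X & forall x, nrm (X x - T x) <= e * nrm x) -> J T.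
Proof.
move=> bT h.
have ST : S T by apply: S_limit => // e /h[X [hX _] hh]; exists X.
split=> //; apply/funext => z; apply/nrm_eq0/eqP; rewrite eq_le nrm_ge0 andbT.
apply: le_eps => e e0; rewrite add0r.
have d0 : 0 < nrm z + 1 by rewrite ltr_wpDl// nrm_ge0.
have [X hX hXT] := h _ (divr_gt0 e0 d0).
have := phi_bound (ltW (divr_gt0 e0 d0)) (commB Ys (JA hX) (SA ST)) hXT z.
rewrite phiB; try dom; rewrite hX.2 !fctE sub0r nrmN => h1; apply: le_trans h1 _.
by rewrite mulrAC ler_pdivrMr// ler_wpM2l ?(ltW e0)// lerDl.
Qed.

Lemma J_ideal : closed_ideal S J.
Proof.
split.
- exact: JS.
- by split; [exact: J0|exact: J_lin].
- by move=> X Z hX hZ; exact: J_mull.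
- by move=> X Z hX hZ; exact: J_mulr.
- by move=> T bT h; apply: J_limit => //; exact: closure_real.
Qed.

(* m = 2x(1+x*x)^-1 = (x-i)^-1 + (x+i)^-1 for a self-adjoint x in M. *)
Let phi_onto_sa m : M m -> adj m = m -> exists2 a, S a & phi a = m.
Proof.
move=> Mm am; have bm := comm_bounded Mm; have /bounded_byP[c c0 [lm hc]] := bm.
(* Scaling to norm at most 1/2, so that the fixed point equation applies; c + 1 instead of c because
   c may vanish. *)
pose t := (2 * (c + 1))^-1; have c1 : 0 < 2 * (c + 1) by rewrite mulr_gt0// ltr_wpDl.
have t0 : 0 < t by rewrite invr_gt0.
pose n := (t%:C : C) *: m; have Mn : M n by exact: commZ.
have bn := comm_bounded Mn; have an : adj n = n by rewrite /n adjZ// conjR am.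
have hn : bounded_by n 2^-1.
  split=> [|z]; first exact: bounded_lin.
  rewrite [n z]/(t%:C *: m z) nrmZ nrmR gtr0_norm//.
  have -> : 2^-1 = t * (c + 1) by rewrite /t invfM -mulrA mulVf ?mulr1// gt_eqF// ltr_wpDl.
  rewrite -mulrA ler_wpM2l ?(ltW t0)// (le_trans (hc z))// ler_wpM2r ?nrm_ge0// lerDl //.
have h2 : (0 : R) <= 2^-1 by rewrite invr_ge0.
have h3 : (2^-1 : R) < 1 by rewrite invf_lt1 ?ltr1n// ltr0n.
have [x [bx xE xc]] := contraction_fixpoint_op h2 h3 hn.
have lx := bounded_lin bx.
have Mx : M x.
  apply: commI => // y z Ny; have [by_ _] := Ns Ny.
  have e : y \o n = n \o y by apply/funext => w; rewrite /= (comm_commute _ Mn Ny).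
  by have := xc y by_ e; rewrite an => /(_ e) /(congr1 (@^~ z)) /= ->.
have nx z : n (x z) = x (n z).
  by have := xc n bn erefl; rewrite an => /(_ erefl) /(congr1 (@^~ z)).
have n_sym u w : dot (n u) w = dot u (n w) by rewrite -{2}an dot_adjr.
have nxa z : n (adj x z) = adj x (n z).
  apply: dot_ext => w; rewrite -n_sym !dot_adjr// -nx n_sym //.
have n2 z : n (z + adj x (x z)) = 2 *: x z.
  by rewrite [in RHS]xE scalerA divff ?scale1r// pnatr_eq0.
have ln := bounded_lin bn.
have c2 : (2^-1 : C)^* = 2^-1 by rewrite fmorphV rmorph_nat.
have xa : adj x = x.
  apply: adjE => // z w; rewrite [in LHS]xE [in RHS]xE dotZl dotZr c2; congr (_ * _).
  by rewrite n_sym (linD _ _ ln) dotDl dotDr dot_adjl// nxa nx dot_adjr.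
have [a [Aa e1 e2 e3 e4]] := phi_res Mx xa.
have Sa : S a by exact: mult_domI.
have cB z : nrm z ^+ 2 <= complex.Re (dot z ((id + (adj x \o x)) z)).
  by rewrite [(id + _) z]/(z + adj x (x z)) dotDr ReD nrm_dot lerDl dot_adjr// -nrm_dot sqr_ge0.
have bB : bounded_op (id + (adj x \o x)).
  by apply: boundedD; [exact: bounded_id|exact: bounded_comp (adj_bounded bx) bx].
have [_ hB _] := op_invP bB cB.
have Saa : S (a + adj a) by have := S_lin 1 Sa (S_adj Sa); rewrite scale1r.
(* With w = (1 + x^2)^-1 z one has z = (x - i)(x + i) w, so [phi a] sends z to (x + i) w and
   [phi (adj a)] sends it to (x - i) w; the sum is 2 x w = n z. *)
have en : phi (a + adj a) = n.
  apply/funext => z; pose w := op_inv (id + (adj x \o x)) z.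
  have zE : z = w + x (x w) by have := congr1 (@^~ z) hB; rewrite xa => /= <-; rewrite /w xa.
  have p1 : phi a z = x w + 'i%C *: w.
    rewrite zE -[RHS]e3; congr (phi a _).
    rewrite (linD _ _ lx) (linZ _ _ lx) scalerDr scalerA mulii scaleN1r opprD opprK.
    by rewrite addrA addrK addrC.
  have p2 : phi (adj a) z = x w - 'i%C *: w.
    rewrite zE -[RHS]e4; congr (phi _ _).
    rewrite (linB _ _ lx) (linZ _ _ lx) scalerBr scalerA mulii scaleN1r opprK.
    by rewrite addrA subrK addrC.
  rewrite phiD; [|exact: SA|exact: SA (S_adj Sa)].
  have nz : n z = 2 *: x w by rewrite zE -{1}xa n2.
  rewrite nz -[LHS]/(phi a z + phi (adj a) z) p1 p2.
  by rewrite addrACA addrN addr0 scaler_nat mulr2n.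
exists (t^-1%:C *: (a + adj a)); first by have := S_lin t^-1%:C Saa S0; rewrite addr0.
rewrite phiZ ?en; last exact: SA.
by rewrite /n scalerA -rmorphM mulVf ?scale1r// gt_eqF.
Qed.

Lemma phi_onto m : M m -> exists2 a, S a & phi a = m.
Proof.
move=> Mm; have bm := comm_bounded Mm; have Ma : M (adj m) by exact: comm_adj.
have ba := comm_bounded Ma.
have [|a Sa ea] := phi_onto_sa (commD Ns Mm Ma).
  by rewrite adjD// adjK// addrC.
have [|b Sb eb] := phi_onto_sa (commZ Ns 'i%C (commB Ns Mm Ma)).
  rewrite adjZ//; last exact: boundedB.
  by rewrite adjB// adjK// conj_i scaleNr -scalerN opprB.
exists (2^-1 *: a + ((- 'i%C / 2) *: b + 0)); first by apply: S_lin => //; apply: S_lin => //; exact: S0.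
have Ab0 : A ((- 'i%C / 2) *: b + 0) by apply: Alin; [exact: SA|exact: comm0].
rewrite phi_lin//; last exact: SA.
rewrite phi_lin ?phi0 ?addr0 ?ea ?eb; [|exact: SA|exact: comm0].
rewrite scalerA -[(- 'i / 2) * 'i]mulrA [2^-1 * 'i]mulrC mulrA mulNr mulii opprK mul1r -scalerDr.
have -> : m + adj m + (m - adj m) = 2 *: m by rewrite addrACA subrr addr0 scaler_nat mulr2n.
by rewrite scalerA mulVf ?scale1r// pnatr_eq0.
Qed.

Lemma S_quotient : is_quotient S J M.
Proof.
exists phi; split.
- split.
  + by move=> X /SA; exact: phi_M.
  + by move=> a X Z /SA hX /SA hZ; exact: phi_lin.
  + by move=> X Z hX /SA hZ; exact: Sl.
  + move=> X X' hX hX' a; rewrite (adjoint_adj (Sb hX) (Sb hX') a) phi_adj; last by dom.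
    exact: adj_adjoint (Mb (SA hX)).
- apply/seteqP; split=> [_ [a ha <-]|m /phi_onto[a ha <-]]; last by exists a.
  exact/phi_M/SA.
- by move=> X hX; split=> [e|[_ ->//]]; split.
Qed.

(** * The approximate unit of the kernel *)

Local Notation Lam := (seq (K -> K) * nat)%type.

Definition valid (l : seq (K -> K)) : Prop := forall a, List.In a l -> J a.

Definition sq_sum (l : seq (K -> K)) : K -> K :=
  foldr (fun a T => ((adj a \o a) + (a \o adj a)) + T) 0 l.

(* The approximate unit ku of J and its complement cu, with values in S. *)
Definition cu (p : Lam) : K -> K := op_inv (p.2%:R *: sq_sum p.1 + id).
Definition ku (p : Lam) : K -> K := id - cu p.

Lemma sq_sum_cons a l x : sq_sum (a :: l) x = adj a (a x) + a (adj a x) + sq_sum l x.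
Proof. by []. Qed.

Lemma sq_sum_J l : valid l -> J (sq_sum l).
Proof.
elim: l => [|a l IH] v; first exact: J0.
have Ja : J a by apply: v; left.
have Jl : J (sq_sum l) by apply: IH => b hb; apply: v; right.
have h1 := J_mull Ja (S_adj (JS Ja)); have h2 := J_mull (J_adj Ja) (JS Ja).
by have := J_lin 1 (J_lin 1 h1 h2) Jl; rewrite !scale1r.
Qed.

Lemma sq_sum_dot l x : valid l ->
  dot x (sq_sum l x) = (\sum_(a <- l) (nrm (a x) ^+ 2 + nrm (adj a x) ^+ 2))%:C.
Proof.
elim: l => [|a l IH] v; first by rewrite big_nil dot0r.
have Ja : J a by apply: v; left.
rewrite sq_sum_cons !dotDr big_cons rmorphD /= -IH; last by move=> b hb; apply: v; right.
congr (_ + _).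
by rewrite (dot_adjr _ _ (Jb Ja)) dot_nrm -(dot_adjl _ _ (Jb Ja)) dot_nrm rmorphD.
Qed.

Lemma sq_sum_sym l x y : valid l -> dot (sq_sum l x) y = dot x (sq_sum l y).
Proof.
elim: l => [|a l IH] v; first by rewrite dot0l dot0r.
have Ja : J a by apply: v; left.
rewrite !sq_sum_cons !dotDr !dotDl IH; last by move=> b hb; apply: v; right.
congr (_ + _ + _); first by rewrite (dot_adjl _ _ (Jb Ja)) (dot_adjr _ _ (Jb Ja)).
by rewrite -(dot_adjr _ _ (Jb Ja)) (dot_adjl _ _ (Jb Ja)).
Qed.

Lemma sq_sum_mem l a x : valid l -> List.In a l ->
  nrm (a x) ^+ 2 <= complex.Re (dot x (sq_sum l x)) /\
  nrm (adj a x) ^+ 2 <= complex.Re (dot x (sq_sum l x)).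
Proof.
move=> v; rewrite sq_sum_dot//= => {v}.
elim: l => [//|b l IH] /= [->|/IH[h1 h2]]; rewrite big_cons.
  have : 0 <= \sum_(a0 <- l) (nrm (a0 x) ^+ 2 + nrm (adj a0 x) ^+ 2) :> R.
    by apply: sumr_ge0 => c _; rewrite addr_ge0// sqr_ge0.
  by have := sqr_ge0 (nrm (a x)); have := sqr_ge0 (nrm (adj a x)); split; lra.
by have := sqr_ge0 (nrm (b x)); have := sqr_ge0 (nrm (adj b x)); split; lra.
Qed.

Section ApproximateUnit.
Context (p : Lam) (vp : valid p.1).
Local Notation B := (p.2%:R *: sq_sum p.1 + id).

Lemma sq_sum_ge0 x : 0 <= complex.Re (dot x (sq_sum p.1 x)).
Proof. by rewrite sq_sum_dot//=; apply: sumr_ge0 => c _; rewrite addr_ge0// sqr_ge0. Qed.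

Lemma B_S : S B.
Proof. exact: S_lin (JS (sq_sum_J vp)) S_id. Qed.

Lemma natC (n : nat) : (n%:R : C) = (n%:R : R)%:C.
Proof. by rewrite rmorph_nat. Qed.

Lemma B_coercive x : nrm x ^+ 2 <= complex.Re (dot x (B x)).
Proof.
rewrite [B x]/(p.2%:R *: sq_sum p.1 x + x) dotDr dotZr ReD nrm_dot lerDr natC ReZ.
by rewrite mulr_ge0// sq_sum_ge0.
Qed.

Lemma cuP : [/\ bounded_by (cu p) 1, B \o cu p = id & cu p \o B = id].
Proof. exact: op_invP (Sb B_S) B_coercive. Qed.

Lemma cu_bounded : bounded_op (cu p).
Proof. by have [h _ _] := cuP; exact: bounded_opI ler01 h. Qed.

Lemma cu_S : S (cu p).
Proof.
have [_ h1 h2] := cuP; apply: (S_inv B_S _ h1 h2).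
exact: comm_inverse (SA B_S) cu_bounded h1 h2.
Qed.

Lemma ku_S : S (ku p).
Proof. by have := S_lin (-1) cu_S S_id; rewrite scaleN1r addrC. Qed.

Lemma B_cu x : p.2%:R *: sq_sum p.1 (cu p x) + cu p x = x.
Proof. by have [_ /(congr1 (@^~ x)) ? _] := cuP. Qed.

Lemma kuE x : ku p x = p.2%:R *: sq_sum p.1 (cu p x).
Proof. by apply/eqP; rewrite [ku p x]/(x - cu p x) subr_eq B_cu. Qed.

Lemma cuDku x : cu p x + ku p x = x.
Proof. by rewrite [ku p x]/(x - cu p x) addrC subrK. Qed.

Lemma ku_J : J (ku p).
Proof.
have -> : ku p = p.2%:R *: (sq_sum p.1 \o cu p) + 0.
  by apply/funext => x; rewrite addr0 kuE.
by apply: J_lin J0; apply: J_mulr cu_S; exact: sq_sum_J.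
Qed.

Lemma cu_sym x y : dot (cu p x) y = dot x (cu p y).
Proof.
rewrite -{1}(B_cu y) -{2}(B_cu x) !dotDr !dotDl !dotZr !dotZl sq_sum_sym// natC conjR.
by [].
Qed.

Lemma ku_sym x y : dot (ku p x) y = dot x (ku p y).
Proof. by rewrite [ku p x]/(x - cu p x) [ku p y]/(y - cu p y) dotBl dotBr cu_sym. Qed.

Lemma cu_ku_dot x : complex.Re (dot (cu p x) (ku p x)) = p.2%:R * complex.Re (dot (cu p x) (sq_sum p.1 (cu p x))).
Proof. by rewrite kuE dotZr natC ReZ. Qed.

(** Since k + c = 1 and k = n s c with s = [sq_sum p.1] >= 0, the cross term Re<cx, kx> is
    nonnegative, whence k^2 + c^2 <= 1: the column with entries k and c is a contraction.
    [cu_ku_row] is the dual statement. *)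
Lemma cu_ku_col x : nrm (ku p x) ^+ 2 + nrm (cu p x) ^+ 2 <= nrm x ^+ 2.
Proof.
rewrite -{3}(cuDku x) nrmD_sq cu_ku_dot.
have : 0 <= p.2%:R * complex.Re (dot (cu p x) (sq_sum p.1 (cu p x))) by rewrite mulr_ge0// sq_sum_ge0.
by set t := _ * _; lra.
Qed.

Lemma cu_le x : nrm (cu p x) <= nrm x.
Proof.
rewrite -(@ler_pXn2r _ 2)// ?nnegrE ?nrm_ge0//.
by have := cu_ku_col x; have := sqr_ge0 (nrm (ku p x)); lra.
Qed.

Lemma ku_le x : nrm (ku p x) <= nrm x.
Proof.
rewrite -(@ler_pXn2r _ 2)// ?nnegrE ?nrm_ge0//.
by have := cu_ku_col x; have := sqr_ge0 (nrm (cu p x)); lra.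
Qed.

Lemma cu_ku_row x y : nrm (ku p x + cu p y) ^+ 2 <= nrm x ^+ 2 + nrm y ^+ 2.
Proof.
set z := _ + _; have h : nrm z ^+ 2 <= nrm x * nrm (ku p z) + nrm y * nrm (cu p z).
  by rewrite nrm_dot {1}/z dotDl ReD ku_sym cu_sym lerD// CS_Re.
have := cu_ku_col z; have := sqr_ge0 (nrm x - nrm (ku p z)); have := sqr_ge0 (nrm y - nrm (cu p z)).
by nra.
Qed.

(** For a in the list, a*a and aa* are dominated by the sum s, and n <cx, s c x> = <cx, kx> <=
    |x|^2. *)
Lemma cu_small a x : List.In a p.1 ->
  p.2%:R * nrm (a (cu p x)) ^+ 2 <= nrm x ^+ 2 /\ p.2%:R * nrm (adj a (cu p x)) ^+ 2 <= nrm x ^+ 2.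
Proof.
move=> al; have [h1 h2] := sq_sum_mem (cu p x) vp al.
have h3 : p.2%:R * complex.Re (dot (cu p x) (sq_sum p.1 (cu p x))) <= nrm x ^+ 2.
  rewrite -cu_ku_dot (le_trans (CS_Re _ _))// expr2 ler_pM ?nrm_ge0 ?cu_le ?ku_le//.
by split; apply: le_trans h3; rewrite ler_wpM2l.
Qed.

Definition mix (T s : K -> K) : K -> K := (ku p \o (T \o ku p)) + (cu p \o (s \o cu p)).

Lemma compress_J T : A T -> J (ku p \o (T \o ku p)).
Proof. by move=> hT; apply: J_hered => //; exact: ku_J. Qed.

Lemma compress_S s : S s -> S (cu p \o (s \o cu p)).
Proof. by move=> hs; apply: S_comp cu_S _; apply: S_comp hs cu_S. Qed.

Lemma mix_S T s : A T -> S s -> S (mix T s).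
Proof.
by move=> hT hs; have := S_lin 1 (JS (compress_J hT)) (compress_S hs); rewrite scale1r.
Qed.

(** [mix T s] is the product of the row (k, c), the diagonal operator (T, s) and the column with
    entries k and c; both outer factors are contractions and act entrywise on matrices. *)
Lemma mix_bound (I : finType) (T s : I -> I -> K -> K) c : 0 <= c ->
  mx_bound T c -> mx_bound s c -> mx_bound (fun i j => mix (T i j) (s i j)) c.
Proof.
move=> c0 hT hs v.
have lk := bounded_lin (Sb ku_S); have lc := bounded_lin (Sb cu_S).
apply: (@le_trans _ _ (\sum_i (nrm (\sum_j T i j (ku p (v j))) ^+ 2 + nrm (\sum_j s i j (cu p (v j))) ^+ 2))).
  apply: ler_sum => i _; apply: le_trans (cu_ku_row _ _).
  rewrite (lin_sum _ _ _ lk) (lin_sum _ _ _ lc) -big_split /= le_eqVlt eqxx //.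
rewrite big_split /=; apply: le_trans (lerD (hT _) (hs _)) _.
rewrite -mulrDr ler_wpM2l ?sqr_ge0// -big_split /=.
by apply: ler_sum => j _; exact: cu_ku_col.
Qed.

End ApproximateUnit.

(** Finite lists of elements of J grow by inclusion, and the integer grows along with them; the
    latter forces c to be small against each listed element. *)
Definition unit_filter : set_system Lam :=
  [set W | exists l0 n0, valid l0 /\
    forall l n, valid l -> (forall a, List.In a l0 -> List.In a l) -> (n0 <= n)%N -> W (l, n)].

Lemma unit_filter_proper : ProperFilter unit_filter.
Proof.
split.
  by move=> [l0 [n0 [v h]]]; exact: (h l0 n0).
split.
- by exists [::], 0%N; split=> // a.
- move=> P Q [l1 [n1 [v1 h1]]] [l2 [n2 [v2 h2]]]; exists (l1 ++ l2), (maxn n1 n2); split.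
    by move=> a; rewrite List.in_app_iff => -[/v1|/v2].
  move=> l n vl hl; rewrite geq_max => /andP[hn1 hn2]; split.
    by apply: h1 => // a ha; apply: hl; rewrite List.in_app_iff; left.
  by apply: h2 => // a ha; apply: hl; rewrite List.in_app_iff; right.
- by move=> P Q PQ [l [n [v h]]]; exists l, n; split=> // *; apply: PQ; exact: h.
Qed.

Existing Instance unit_filter_proper.

Lemma unit_filter_valid : unit_filter [set p | valid p.1].
Proof. by exists [::], 0%N; split=> // a. Qed.

Lemma unit_filter_small a (e : R) : J a -> 0 < e ->
  unit_filter [set p | (forall x, nrm (a (cu p x)) <= e * nrm x) /\ (forall x, nrm (cu p (a x)) <= e * nrm x)].
Proof.
move=> Ja e0; have [N0 hN] := invS_small (exprn_gt0 2 e0).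
exists [:: a], N0.+1; split; first by move=> b /= [<-|].
move=> l n vl hl hn.
have al : List.In a l by apply: hl; left.
have n0 : (0 : R) < n%:R by rewrite ltr0n (leq_trans _ hn).
have hn' : (n%:R^-1 : R) <= e ^+ 2.
  case: n hn n0 => // n hn _; exact: ltW (hN n hn).
have key (b : K -> K) : (forall x, n%:R * nrm (b (cu (l, n) x)) ^+ 2 <= nrm x ^+ 2) ->
   forall x, nrm (b (cu (l, n) x)) <= e * nrm x.
  move=> h x; rewrite -(@ler_pXn2r _ 2)// ?nnegrE ?mulr_ge0 ?nrm_ge0 ?(ltW e0)// exprMn.
  rewrite (le_trans _ (ler_wpM2r (sqr_ge0 _) hn'))// ler_pdivlMl//.
have h1 := key a (fun x => (@cu_small (l, n) vl a x al).1).
have h2 := key (adj a) (fun x => (@cu_small (l, n) vl a x al).2).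
split=> //; apply: (adjoint_bound (ltW e0) h2) => x y.
by rewrite (dot_adjl _ _ (Jb Ja)) (@cu_sym (l, n) vl).
Qed.

(** * Splitting a functional along the kernel *)

Section Functional.
Context (U : set_system Lam) {UU : UltraFilter U} (GU : unit_filter `<=` U).
Context (f : functional K) (cf : R) (cf0 : 0 <= cf).
Hypothesis f_lin : forall a X Z, S X -> S Z -> f (a *: X + Z) = a * f X + f Z.
Hypothesis f_bound : forall X d, S X -> 0 <= d -> (forall x, nrm (X x) <= d * nrm x) -> nrm (f X) <= cf * d.

Let f0 : f 0 = 0.
Proof.
have := f_lin (-1) S0 S0; rewrite scaler0 addr0 mulN1r => ->; exact: addNr.
Qed.

Let fB X Z : S X -> S Z -> f X - f Z = f (X - Z).
Proof. by move=> hX hZ; have := f_lin (-1) hZ hX; rewrite scaleN1r addrC mulN1r [- f Z + _]addrC => ->. Qed.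

Let fZ a X : S X -> f (a *: X) = a * f X.
Proof. by move=> hX; have := f_lin a hX S0; rewrite f0 !addr0. Qed.

Let fD X Z : S X -> S Z -> f (X + Z) = f X + f Z.
Proof. by move=> hX hZ; have := f_lin 1 hX hZ; rewrite scale1r mul1r. Qed.

Lemma corner_J_tends j : J j -> tends U (fun p => f (cu p \o (j \o cu p))) 0.
Proof.
move=> Jj e e0; have c1 : 0 < cf + 1 by rewrite ltr_wpDl.
apply: GU; apply: filterS2 (unit_filter_small Jj (divr_gt0 e0 c1)) unit_filter_valid => p /= [h1 h2] v; rewrite subr0.
apply: le_lt_trans (f_bound _ (ltW (divr_gt0 e0 c1)) _) _.
- by apply: compress_S => //; exact: JS.
- by move=> x /=; rewrite (le_trans (cu_le v _)).
- by rewrite mulrA ltr_pdivrMr// mulrC ltr_pM2l// ltrDl.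
Qed.

Lemma corner_tends s s' : S s -> S s' -> phi s = phi s' ->
  tends U (fun p => f (cu p \o (s \o cu p)) - f (cu p \o (s' \o cu p))) 0.
Proof.
move=> hs hs' e.
have Jj : J (s - s').
  split; first by have := S_lin (-1) hs' hs; rewrite scaleN1r addrC.
  by rewrite phiB ?e ?subrr//; dom.
apply: tends_eq (corner_J_tends Jj); apply: filterS (GU unit_filter_valid) => p /= v.
rewrite fB; [|exact: compress_S|exact: compress_S].
congr f; apply/funext => x; rewrite !fctE /=.
by rewrite (linB _ _ (bounded_lin (cu_bounded v))).
Qed.

(** The norm of the restriction of f to J. *)
Definition gamma : R := sup [set r | exists2 j, J j /\ (forall x, nrm (j x) <= nrm x) & r = nrm (f j)].

Let gamma_sup : has_sup [set r | exists2 j, J j /\ (forall x, nrm (j x) <= nrm x) & r = nrm (f j)].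
Proof.
split; first by exists (nrm (f 0)), 0 => //; split; [exact: J0|move=> x; rewrite nrm0 nrm_ge0].
exists cf => _ [j [Jj hj] ->]; have := @f_bound j 1 (JS Jj) ler01; rewrite mulr1; apply.
by move=> x; rewrite mul1r.
Qed.

Let gamma_le j d : J j -> 0 <= d -> (forall x, nrm (j x) <= d * nrm x) -> nrm (f j) <= gamma * d.
Proof.
move=> Jj d0 hj; have [d1|d1] := eqVneq d 0.
  have -> : j = 0.
    by apply/funext => x; apply/nrm_eq0/eqP; rewrite eq_le nrm_ge0 andbT (le_trans (hj x))// d1 mul0r.
  by rewrite f0 nrm0 d1 mulr0.
have dp : 0 < d by rewrite lt_neqAle eq_sym d1.
have Jd : J (d^-1%:C *: j) by have := J_lin d^-1%:C Jj J0; rewrite addr0.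
have : nrm (f (d^-1%:C *: j)) <= gamma.
  apply: (ub_le_sup gamma_sup.2); exists (d^-1%:C *: j) => //; split=> // x.
  rewrite [(_ *: j) x]/(d^-1%:C *: j x) nrmZ nrmR ger0_norm ?invr_ge0//.
  by rewrite ler_pdivrMl.
rewrite fZ; last exact: JS.
by rewrite nrmM nrmR ger0_norm ?invr_ge0// ler_pdivrMl// mulrC.
Qed.

(** The extension of f from J that does not increase the norm. It makes sense on all of A because k
    s k lies in J for every s in A, by [J_hered]. *)
Definition normal_part (s : K -> K) : C := ulim U (fun p => f (ku p \o (s \o ku p))).

Let ku_comp_bound p (T : K -> K) d : valid p.1 -> 0 <= d -> (forall x, nrm (T x) <= d * nrm x) ->
  forall x, nrm ((ku p \o (T \o ku p)) x) <= d * nrm x.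
Proof.
by move=> v d0 h x /=; rewrite (le_trans (ku_le v _))// (le_trans (h _))// ler_wpM2l// ku_le.
Qed.

Lemma normal_tends T : A T -> tends U (fun p => f (ku p \o (T \o ku p))) (normal_part T).
Proof.
move=> hT; have /bounded_byP[d d0 [_ hd]] := comm_bounded hT.
apply: (@ulimP _ _ U UU _ (cf * d)).
apply: filterS (GU unit_filter_valid) => p /= v; apply: f_bound => //.
  exact/JS/compress_J.
exact: ku_comp_bound.
Qed.

Lemma normal_lin a s t : A s -> A t -> normal_part (a *: s + t) = a * normal_part s + normal_part t.
Proof.
move=> hs ht; apply: (tends_uniq (normal_tends (comm_lin Ys a hs ht))).
apply: tends_eq (tendsD (tendsM a (normal_tends hs)) (normal_tends ht)).
apply: filterS (GU unit_filter_valid) => p /= v.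
rewrite -f_lin; [|exact/JS/compress_J|exact/JS/compress_J].
congr f; apply/funext => x.
by rewrite -[RHS]/(ku p (a *: s (ku p x) + t (ku p x))) (bounded_lin (Sb (ku_S v))).
Qed.

Lemma normal_J j : J j -> normal_part j = f j.
Proof.
move=> Jj; apply: (tends_uniq (normal_tends (JA Jj))) => e e0.
have c1 : 0 < 3 * cf + 1 by rewrite ltr_wpDl// mulr_ge0.
have d0 := divr_gt0 e0 c1.
apply: GU; apply: filterS2 (unit_filter_small Jj d0) unit_filter_valid => p /= [h1 h2] v.
rewrite fB; [|exact/JS/compress_J/JA|exact: JS].
set d := e / _ in d0 h1 h2.
apply: le_lt_trans (@f_bound _ (3 * d) _ _ _) _.
- by have := S_lin (-1) (JS Jj) (JS (compress_J v (JA Jj))); rewrite scaleN1r addrC.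
- by rewrite mulr_ge0// ltW.
- move=> x; have lj := bounded_lin (Jb Jj); have lc := bounded_lin (cu_bounded v).
  (* With k = 1 - c: kjk - j = cjc - cj - jc. Each of the three terms has norm at most d, hence the
     constant 3. *)
  have -> : (ku p \o (j \o ku p) - j) x = cu p (j (cu p x)) - cu p (j x) - j (cu p x).
    rewrite !fctE /= [ku p (j _)]/(j (ku p x) - cu p (j (ku p x))) [ku p x]/(x - cu p x).
    rewrite !(linB _ _ lj) !(linB _ _ lc); apply/eqP; rewrite subr_eq; apply/eqP.
    have gen (a b u w : K) : a - b - (u - w) = w - u - b + a by rewrite opprB addrC [a - b]addrC addrA.
    exact: gen.
  rewrite (le_trans (nrmB _ _))// (le_trans (lerD (nrmB _ _) (lexx _)))//.
  have := h1 x; have := h2 x; have := h2 (cu p x); have := cu_le v x.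
  have := nrm_ge0 x; move=> *; nra.
- have -> : e = d * (3 * cf + 1) by rewrite divfK// gt_eqF.
  have -> : d * (3 * cf + 1) = cf * (3 * d) + d by ring.
  by rewrite ltrDl.
Qed.

Lemma normal_bound s d : A s -> 0 <= d -> (forall x, nrm (s x) <= d * nrm x) ->
  nrm (normal_part s) <= gamma * d.
Proof.
move=> hs d0 hd; apply: (tends_le (normal_tends hs)).
apply: filterS (GU unit_filter_valid) => p /= v; apply: gamma_le => //; first exact: compress_J.
exact: ku_comp_bound.
Qed.

(* The norm-preserving extension of f from the ideal J (an M-ideal) vanishes on the corner of cu:
   otherwise k j k + t c s c, of norm at most one, would exceed the norm of f on J. *)
Lemma normal_corner s : S s -> tends U (fun p => normal_part (cu p \o (s \o cu p))) 0.
Proof.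
move=> hs e e0; have /bounded_byP[d' d'0 [_ hd']] := Sb hs.
pose d := d' + 1; have d0 : 0 < d by rewrite ltr_wpDl.
have hd x : nrm (s x) <= d * nrm x.
  by rewrite (le_trans (hd' x))// ler_wpM2r ?nrm_ge0// lerDl.
have e3 : 0 < e / (3 * d) by rewrite divr_gt0// mulr_gt0.
(* j0 nearly attains the norm of f on J; scaled by d and a phase into j, it costs d times e / (3 d)
   = e / 3, and the convergence of f(kjk) to f(j) costs another e / 3. *)
have [_ [j0 [Jj0 hj0] ->] hg] := sup_adherent e3 gamma_sup.
have [t0 [t01 t0f]] := phase (f j0).
pose j := (t0 * d%:C) *: j0.
have Jj : J j by have := J_lin (t0 * d%:C) Jj0 J0; rewrite addr0.
have hj x : nrm (j x) <= d * nrm x.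
  by rewrite [j x]/((t0 * d%:C) *: j0 x) nrmZ nrmM t01 mul1r nrmR gtr0_norm// ler_wpM2l// ltW.
have fj : f j = (d * nrm (f j0))%:C.
  have -> : f j = (t0 * d%:C) * f j0 by exact: fZ (JS Jj0).
  by rewrite mulrAC t0f -rmorphM /= mulrC.
have e2 : 0 < e / 3 by rewrite divr_gt0.
have hk := normal_tends (JA Jj) e2; rewrite normal_J// in hk.
apply: filterS2 hk (GU unit_filter_valid) => p /= h1 v; rewrite subr0.
set z := normal_part _; have [t [t1 tz]] := phase z.
have Akk := JA (compress_J v (JA Jj)).
have Acc := SA (compress_S v hs).
have h2 : nrm (normal_part (t *: (cu p \o (s \o cu p)) + (ku p \o (j \o ku p)))) <= gamma * d.
  apply: normal_bound; [exact: comm_lin| exact: ltW|move=> x].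
  have := @mix_bound p v 'I_1 (fun _ _ => j) (fun _ _ => t *: s) d (ltW d0) _ _ (fun _ => x).
  rewrite !big_ord1 -exprMn ler_pXn2r ?nnegrE ?mulr_ge0 ?nrm_ge0 ?(ltW d0)//.
  have -> : mix p j (t *: s) x = (t *: (cu p \o (s \o cu p)) + (ku p \o (j \o ku p))) x.
    rewrite -[LHS]/(ku p (j (ku p x)) + cu p (t *: s (cu p x))) addrC.
    by rewrite (linZ _ _ (bounded_lin (cu_bounded v))).
  apply=> w; rewrite !big_ord1 -exprMn ler_pXn2r ?nnegrE ?mulr_ge0 ?nrm_ge0 ?(ltW d0)//.
  by rewrite [(t *: s) _]/(t *: s (w ord0)) nrmZ t1 mul1r.
rewrite normal_lin// -/z tz (normal_J (compress_J v (JA Jj))) in h2.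
have h3 := le_trans (Re_le _) h2; rewrite ReD /= in h3.
have h4 := le_lt_trans (Re_le_nrm _) h1; rewrite ReB fj /= ltr_norml in h4.
case/andP: h4 => h4 _.
have h5 : d * gamma < d * nrm (f j0) + e / 3.
  have : d * (gamma - e / (3 * d)) < d * nrm (f j0) by rewrite ltr_pM2l.
  have -> : d * (gamma - e / (3 * d)) = d * gamma - e / 3 by field; rewrite gt_eqF.
  by lra.
rewrite mulrC in h3; lra.
Qed.

(** [phi (cu p)] is the identity, so s - csc lies in J, where f agrees with its normal part. Hence
    f(csc) = f(s) - normal(s) + normal(csc); the last term tends to 0, and f(ksk) tends to
    normal(s). *)
Lemma mix_tends s : S s -> tends U (fun p => f (mix p s s)) (f s).
Proof.
move=> hs.
have h1 := normal_tends (SA hs).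
have h2 := normal_corner hs.
have -> : f s = normal_part s + (0 + (f s - normal_part s)) by rewrite add0r addrC subrK.
have h3 : tends U (fun p => f (ku p \o (s \o ku p)) +
    (normal_part (cu p \o (s \o cu p)) + (f s - normal_part s))) (normal_part s + (0 + (f s - normal_part s))).
  by apply: tendsD h1 (tendsD h2 _); exact: tends_cst.
apply: tends_eq h3; apply: filterS (GU unit_filter_valid) => p /= v.
have Skk := JS (compress_J v (SA hs)); have Scc := compress_S v hs.
rewrite [RHS](fD Skk Scc); congr (_ + _).
have Jd : J (s - (cu p \o (s \o cu p))).
  have Sd : S (s - (cu p \o (s \o cu p))).
    by have := S_lin (-1) Scc hs; rewrite scaleN1r addrC.
  split=> //; rewrite phiB; [|exact: SA|exact: SA].
  have pc : phi (cu p) = id.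
    have -> : cu p = id - ku p by apply/funext => x; rewrite !fctE -{2}(cuDku p x) addrK.
    rewrite phiB; [|exact: comm_id|exact: JA (ku_J v)].
    by rewrite phi_id (ku_J v).2 subr0.
  rewrite (Sl (cu_S v)); last by apply: Acomp; [exact: SA|exact/SA/cu_S].
  by rewrite (Sl hs) ?pc ?subrr//; exact/SA/cu_S.
have := normal_J Jd; rewrite -fB// => h4.
have := normal_lin (-1) (SA Scc) (SA hs); rewrite scaleN1r addrC mulN1r => h5.
rewrite h5 in h4.
have -> : f (cu p \o (s \o cu p)) = f s - (- normal_part (cu p \o (s \o cu p)) + normal_part s).
  by rewrite h4 opprB addrC subrK.
by rewrite opprD opprK addrCA.
Qed.

End Functional.

(* A matrix over M is lifted to a matrix over S of nearly the same norm:
   write it as 2x(1+x*x)^-1 and lift the entries of x. *)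
Lemma lift_mx n (T : 'I_n -> 'I_n -> F -> F) (r e : R) : 0 <= r -> 0 < e ->
  (forall i j, M (T i j)) -> mx_bound T r ->
  exists s : 'I_n -> 'I_n -> K -> K, [/\ forall i j, S (s i j),
    forall i j, phi (s i j) = T i j & mx_bound s (r + e)].
Proof.
move=> r0 e0 MT hT; have re0 : 0 < r + e by rewrite ltr_wpDl.
have bT i j : bounded_op (T i j) by exact: comm_bounded (MT i j).
have lT i j : linear (T i j) by exact: bounded_lin.
pose a : C := (r + e)^-1%:C.
have na : nrm a = (r + e)^-1 by rewrite nrmR gtr0_norm// invr_gt0.
pose m := mxop (fun i j => a *: T i j).
have MaT i j : M (a *: T i j) by exact: commZ.
have baT i j : bounded_op (a *: T i j) by exact: comm_bounded (MaT i j).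
have laT i j : linear (a *: T i j) by exact: bounded_lin.
have bm : bounded_by m (r / (r + e)).
  apply/mx_bounded_by => //; first by rewrite divr_ge0// ltW.
  move=> v; have := hT v.
  have -> : \sum_i nrm (\sum_j (a *: T i j) (v j)) ^+ 2 = (r + e)^-1 ^+ 2 * \sum_i nrm (\sum_j T i j (v j)) ^+ 2.
    rewrite mulr_sumr; apply: eq_bigr => i _; rewrite -exprMn -na -nrmZ scaler_sumr //.
  move=> h; have -> : (r / (r + e)) ^+ 2 = (r + e)^-1 ^+ 2 * r ^+ 2 by rewrite exprMn mulrC.
  by rewrite -[leRHS]mulrA ler_wpM2l ?sqr_ge0.
have re_lt1 : r / (r + e) < 1 by rewrite ltr_pdivrMr// mul1r ltrDl.
have [x [bx xE xc]] := contraction_fixpoint_op (divr_ge0 r0 (ltW re0)) re_lt1 bm.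
have Mx i j : M (entry x i j).
  apply: commI => [|y z Ny]; first exact: entry_bounded.
  have [by_ Nya] := Ns Ny; have ly := bounded_lin by_.
  apply: entry_ampl_comm => //; apply: xc; first exact: ampl_bounded.
    by apply: ampl_comm => // k l u; exact: comm_commute (MaT k l) Ny.
  rewrite /m adj_mxop//; apply: ampl_comm => // k l u.
  exact: comm_commute (comm_adj Ns (MaT l k)) Ny.
(* Arbitrary lifts of the entries, without any norm control: the function 2 X (1 + X*X)^-1 is
   contractive for every X. *)
have [X hX] : exists X : 'I_n * 'I_n -> K -> K, forall p, S (X p) /\ phi (X p) = entry x p.1 p.2.
  by apply: (choice_ex (P := fun p X => S X /\ phi X = entry x p.1 p.2)) => p; have [b Sb eb] := phi_onto (Mx p.1 p.2); exists b.
have SX i j : S (X (i, j)) by case: (hX (i, j)).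
have phX i j : phi (X (i, j)) = entry x i j by case: (hX (i, j)).
pose Xo := mxop (fun i j => X (i, j)).
have bX i j : bounded_op (X (i, j)) by exact: Sb.
have lX i j : linear (X (i, j)) by exact: bounded_lin.
have bXo : bounded_op Xo by exact: mxop_bounded.
pose B := id + (adj Xo \o Xo).
have bB : bounded_op B by apply: boundedD; [exact: bounded_id|exact: bounded_comp (adj_bounded bXo) bXo].
have cB v : nrm v ^+ 2 <= complex.Re (dot v (B v)).
  rewrite [B v]/(v + adj Xo (Xo v)) dotDr ReD nrm_dot lerDl dot_adjr// -nrm_dot sqr_ge0 //.
have [bV BV VB] := op_invP bB cB; set V := op_inv B in bV BV VB.
have bV' : bounded_op V by exact: bounded_opI ler01 bV.
have entB i j : entry B i j = (if i == j then id else 0) + \sum_k (adj (X (k, i)) \o X (k, j)).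
  rewrite -[entry B i j]/(entry id i j + entry (adj Xo \o Xo) i j) entry_id; congr (_ + _).
  rewrite entry_comp; last exact: bounded_lin (adj_bounded bXo).
  by apply: eq_bigr => k _; rewrite entry_adj// !entry_mxop.
have Ssum (J0 : Type) (q : seq J0) (g : J0 -> K -> K) : (forall k, S (g k)) -> S (\sum_(k <- q) g k).
  move=> hg; elim: q => [|k q IH]; first by rewrite big_nil; exact: S0.
  by rewrite big_cons; have := S_lin 1 (hg k) IH; rewrite scale1r.
have SB i j : S (entry B i j).
  have h1 : S (if i == j then id else 0) by case: eqP => _; [exact: S_id|exact: S0].
  rewrite entB -[X in X + _]scale1r; apply: S_lin => //.
  by apply: Ssum => k; apply: S_comp => //; exact: S_adj.
have AV i j : A (entry V i j).
  apply: commI => [|y z Yy]; first exact: entry_bounded.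
  have [by_ Yya] := Ys Yy; have ly := bounded_lin by_.
  apply: entry_ampl_comm => //; apply: (comm_inv BV VB).
  rewrite -(mxop_entry (bounded_lin bB)); apply: ampl_comm => // k l u.
  exact: comm_commute (SA (SB k l)) Yy.
have phBV i k : \sum_j (phi (entry B i j) \o phi (entry V j k)) = if i == k then id else 0.
  have := congr1 (fun g => phi (entry g i k)) BV.
  rewrite entry_id entry_comp; last exact: bounded_lin.
  rewrite phi_sum => [h|j]; last by apply: Acomp; [exact: SA|].
  transitivity (phi (if i == k then id else 0)); last by case: eqP => _; [exact: phi_id|exact: phi0].
  by rewrite -h; apply: eq_bigr => j _; rewrite (Sl (SB i j)).
have phVB i k : \sum_j (phi (entry V i j) \o phi (entry B j k)) = if i == k then id else 0.
  have := congr1 (fun g => phi (entry g i k)) VB.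
  rewrite entry_id entry_comp; last exact: bounded_lin.
  rewrite phi_sum => [h|j]; last by apply: Acomp; [|exact: SA].
  transitivity (phi (if i == k then id else 0)); last by case: eqP => _; [exact: phi_id|exact: phi0].
  by rewrite -h; apply: eq_bigr => j _; rewrite (Sr (SB j k)).
pose W := mxop (fun i j => phi (entry V i j)).
pose Bp := mxop (fun i j => phi (entry B i j)).
have bW : bounded_op W by apply: mxop_bounded => i j; exact: Mb.
have bBp : bounded_op Bp by apply: mxop_bounded => i j; exact/Mb/SA.
have lphV i j : linear (phi (entry V i j)) by exact: bounded_lin (Mb (AV i j)).
have lphB i j : linear (phi (entry B i j)) by exact: bounded_lin (Mb (SA (SB i j))).
have mxid (g : 'I_n -> 'I_n -> F -> F) : (forall i k, g i k = if i == k then id else 0) -> mxop g = id.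
  move=> hg; apply/funext => v; apply: hsum_eq => i /=; rewrite (bigD1 i)//= hg eqxx big1 ?addr0// => l li.
  by rewrite hg eq_sym (negPf li).
have BW : Bp \o W = id by rewrite mxop_comp//; exact: mxid.
have WB : W \o Bp = id by rewrite mxop_comp//; exact: mxid.
(* Matrix analogue of [S_inv]: the entries of B are in S, so multiplying the matrix of the
   [phi (b \o entry V k l)] by the one of the [phi (entry B k l)] gives [phi b] times the identity;
   the latter matrix has the inverse W. Symmetrically on the other side. *)
have SV i j : S (entry V i j).
  split=> // b hb.
  have lb := bounded_lin (Mb hb).
  have key1 k l : \sum_j (phi (b \o entry V k j) \o phi (entry B j l)) = if k == l then phi b else 0.
    have := congr1 (fun g => phi (b \o entry g k l)) VB.
    rewrite entry_id entry_comp; last exact: bounded_lin.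
    have -> : b \o \sum_j0 (entry V k j0 \o entry B j0 l) = \sum_j0 ((b \o entry V k j0) \o entry B j0 l).
      apply/funext => u; rewrite /= !fct_sumE (lin_sum _ _ _ (bounded_lin (Ab hb))) //.
    rewrite phi_sum => [h|j0]; last by apply: Acomp; [exact: Acomp|exact: SA].
    have -> : (if k == l then phi b else 0) = phi (b \o (if k == l then id else 0)).
      case: eqP => _ //; rewrite -phi0; congr phi; apply/funext => u.
      by rewrite /= (lin0 (bounded_lin (Ab hb))).
    by rewrite -h; apply: eq_bigr => j0 _; rewrite (Sr (SB j0 l))//; exact: Acomp.
  have key2 k l : \sum_j (phi (entry B k j) \o phi (entry V j l \o b)) = if k == l then phi b else 0.
    have := congr1 (fun g => phi (entry g k l \o b)) BV.
    rewrite entry_id entry_comp; last exact: bounded_lin.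
    have -> : (\sum_j0 (entry B k j0 \o entry V j0 l)) \o b = \sum_j0 (entry B k j0 \o (entry V j0 l \o b)).
      by apply/funext => u; rewrite /= !fct_sumE.
    rewrite phi_sum => [h|j0]; last by apply: Acomp; [exact: SA|exact: Acomp].
    have -> : (if k == l then phi b else 0) = phi ((if k == l then id else 0) \o b).
      by case: eqP => _ //; rewrite -phi0.
    by rewrite -h; apply: eq_bigr => j0 _; rewrite (Sl (SB k j0))//; exact: Acomp.
  split; apply/funext => z.
    pose G := mxop (fun k l => phi (b \o entry V k l)).
    have lG k l : linear (phi (b \o entry V k l)) by exact: bounded_lin (Mb (Acomp hb (AV k l))).
    have GB : G \o Bp = ampl (phi b).
      by rewrite mxop_comp//; congr mxop; apply/funext => k; apply/funext => l; exact: key1.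
    have : (G \o Bp) (W (hinjc j z)) i = G (hinjc j z) i.
      by rewrite -[(G \o Bp) _]/(G ((Bp \o W) _)) BW.
    rewrite GB -[G _ _]/(entry G i j z) entry_mxop// amplE => <-.
    by congr (phi b _); rewrite -[LHS]/(entry W i j z) entry_mxop.
  pose G := mxop (fun k l => phi (entry V k l \o b)).
  have lG k l : linear (phi (entry V k l \o b)) by exact: bounded_lin (Mb (Acomp (AV k l) hb)).
  have BG : Bp \o G = ampl (phi b).
    by rewrite mxop_comp//; congr mxop; apply/funext => k; apply/funext => l; exact: key2.
  have : W ((Bp \o G) (hinjc j z)) i = G (hinjc j z) i.
    by rewrite -[W ((Bp \o G) _)]/((W \o Bp) (G _)) WB.
  rewrite BG -[G _ _]/(entry G i j z) entry_mxop// ampl_hinjc// => <-.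
  by rewrite -[W _ _]/(entry W i j _) entry_mxop.
(* The factor r + e undoes the normalization of m. *)
pose s i j := (2 * (r + e))%:C *: \sum_k (X (i, k) \o entry V k j).
exists s; split.
- move=> i j; have := S_lin (2 * (r + e))%:C (Ssum _ (index_enum _) _ (fun k => S_comp (SX i k) (SV k j))) S0.
  by rewrite addr0.
- move=> i j; rewrite /s phiZ; last first.
    by have := S_lin 1 (Ssum _ (index_enum _) _ (fun k => S_comp (SX i k) (SV k j))) S0; rewrite addr0 scale1r => /SA.
  rewrite phi_sum => [|k]; last by apply: Acomp; [exact: SA|exact: AV].
  have -> : \sum_k phi (X (i, k) \o entry V k j) = entry (x \o W) i j.
    rewrite entry_comp; last exact: bounded_lin.
    by apply: eq_bigr => k _; rewrite (Sl (SX i k))// phX entry_mxop.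
  have mB : m \o Bp = 2 *: x.
    have Bpx : Bp = id + (adj x \o x).
      rewrite -[RHS]mxop_entry; last first.
        by apply: bounded_lin; apply: boundedD; [exact: bounded_id|exact: bounded_comp (adj_bounded bx) bx].
      congr mxop; apply/funext => k; apply/funext => l.
      rewrite -[RHS]/(entry id k l + entry (adj x \o x) k l) entry_id entB phiD.
      + congr (_ + _); first by case: eqP => _; [exact: phi_id|exact: phi0].
        rewrite phi_sum => [|o]; last by apply: Acomp; [exact/Aadj/SA|exact: SA].
        rewrite entry_comp; last exact: bounded_lin (adj_bounded bx).
        apply: eq_bigr => o _; rewrite (Sl (S_adj (SX o k))); last exact: SA.
        by rewrite phi_adj ?phX; [rewrite entry_adj|exact: SA].
      + by case: eqP => _; [exact: comm_id|exact: comm0].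
      + by apply/SA/Ssum => o; apply: S_comp => //; exact: S_adj.
    by apply/funext => v; rewrite Bpx /= -[RHS]/(2 *: x v) xE scalerA divff ?scale1r//.
  have xW : 2 *: (x \o W) = m.
    by rewrite -[LHS]/((2 *: x) \o W) -mB -[LHS]/(m \o (Bp \o W)) BW.
  rewrite rmorphM mulrC -scalerA /= -[_ *: entry _ _ _]/(entry ((2%:C : C) *: (x \o W)) i j).
  have -> : ((2 : R)%:C : C) = 2 by rewrite rmorph_nat.
  rewrite xW entry_mxop// scalerA -rmorphM /= divff ?scale1r// gt_eqF//.
- have lV := bounded_lin bV'.
  (* With w = V v: |v|^2 = |w + X*Xw|^2 >= 4 |Xw|^2, because |Xw|^2 <= |w| |X*Xw|. *)
  have hb v : nrm ((2%:R : C) *: Xo (V v)) <= nrm v.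
    have n2 : nrm (2%:R : C) = 2 by rewrite natC nrmR ger0_norm.
    rewrite nrmZ n2 -(@ler_pXn2r _ 2)// ?nnegrE ?mulr_ge0 ?nrm_ge0//.
    have := congr1 (@^~ v) BV; rewrite /= [B _]/(V v + adj Xo (Xo (V v))) => {2}<-.
    have h1 : complex.Re (dot (V v) (adj Xo (Xo (V v)))) = nrm (Xo (V v)) ^+ 2.
      by rewrite dot_adjr// -nrm_dot.
    rewrite nrmD_sq h1; have := CS_Re (V v) (adj Xo (Xo (V v))); rewrite h1.
    have := sqr_ge0 (nrm (V v) - nrm (adj Xo (Xo (V v)))); nra.
  have e2 : bounded_by (((2 * (r + e))%:C : C) *: (Xo \o V)) (r + e).
    split; first exact/bounded_lin/boundedZ/bounded_comp.
    move=> v; rewrite -[(_ *: _) v]/((2 * (r + e))%:C *: Xo (V v)) rmorphM mulrC -scalerA nrmZ.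
    rewrite nrmR gtr0_norm// ler_wpM2l ?(ltW re0)//.
    by have := hb v; rewrite rmorph_nat.
  have bs i j : bounded_op (s i j).
    by apply: boundedZ; apply: bounded_sum => // k; apply: bounded_comp => //; exact: entry_bounded.
  apply/(mx_bounded_by (ltW re0) (fun i j => bounded_lin (bs i j))).
  suff -> : mxop s = ((2 * (r + e))%:C : C) *: (Xo \o V) by [].
  rewrite -[RHS](mxop_entry e2.1); congr mxop; apply/funext => i; apply/funext => j; apply/esym.
  rewrite -[LHS]/(_ *: entry (Xo \o V) i j) entry_comp; last exact: bounded_lin.
  by rewrite /s; congr (_ *: _); apply: eq_bigr => k _; rewrite entry_mxop.
Qed.

Lemma dualP f : dual S f -> exists cf : R, [/\ 0 <= cf,
  forall a X Z, S X -> S Z -> f (a *: X + Z) = a * f X + f Z &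
  forall X d, S X -> 0 <= d -> (forall x, nrm (X x) <= d * nrm x) -> nrm (f X) <= cf * d].
Proof.
move=> [fl [c [c0 hc]]]; have ce : c = (complex.Re c)%:C by rewrite [LHS]complexE (ger0_Im c0) mulr0 addr0.
exists (complex.Re c); split=> //; first by rewrite -ler0c -ce.
move=> X d SX d0 h; rewrite -lecR rmorphM /= -ce -nrmE; apply: hc => //.
by apply/opnorm_leP; exists d.
Qed.

(** A choice of lifts, with neither linearity nor norm bound. *)
Let sec (m : F -> F) : K -> K := pick_op [set a | S a /\ phi a = m].
Let sec_S m : M m -> S (sec m).
Proof. by move=> /phi_onto[a Sa e]; have [] := pick_opP (ex_intro (fun a => S a /\ phi a = m) a (conj Sa e)). Qed.
Let sec_phi m : M m -> phi (sec m) = m.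
Proof. by move=> /phi_onto[a Sa e]; have [] := pick_opP (ex_intro (fun a => S a /\ phi a = m) a (conj Sa e)). Qed.

(** * The weak expectation *)

Section WeakExpectation.
Context (U : set_system Lam) {UU : UltraFilter U} (GU : unit_filter `<=` U).

Definition weak_exp (T : K -> K) (f : functional K) : C :=
  ulim U (fun p => f (mix p (E T) (sec (phi (E T))))).

Lemma mix_op_bound p (T s : K -> K) (c : R) : valid p.1 -> 0 <= c ->
  (forall x, nrm (T x) <= c * nrm x) -> (forall x, nrm (s x) <= c * nrm x) ->
  forall x, nrm (mix p T s x) <= c * nrm x.
Proof.
move=> v c0 hT hs x; have := mix_bound v c0 (mx_bound1 c0 hT) (mx_bound1 c0 hs) (fun=> x).
by rewrite !big_ord1 -exprMn ler_pXn2r// nnegrE ?mulr_ge0 ?nrm_ge0.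
Qed.

Lemma common_bound (s t : K -> K) : bounded_op s -> bounded_op t ->
  exists c : R, [/\ 0 <= c, forall x, nrm (s x) <= c * nrm x & forall x, nrm (t x) <= c * nrm x].
Proof.
move=> /bounded_byP[c c0 [_ hc]] /bounded_byP[d d0 [_ hd]]; exists (c + d); split.
- exact: addr_ge0.
- by move=> x; rewrite (le_trans (hc x))// ler_wpM2r ?nrm_ge0// lerDl.
- by move=> x; rewrite (le_trans (hd x))// ler_wpM2r ?nrm_ge0// lerDr.
Qed.

(** The limit does not depend on the lift: two lifts of phi(E T) differ by an element of J, whose
    corner tends to 0. One may therefore use sums of lifts for linearity, the lifts of [lift_mx] for
    matrix norms, and an element of S itself for the identity on S. *)
Lemma weak_exp_tends T s f : bounded_op T -> S s -> phi s = phi (E T) -> dual S f ->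
  tends U (fun p => f (mix p (E T) s)) (weak_exp T f).
Proof.
move=> bT Ss es df; have [cf [cf0 fl fb]] := dualP df.
have AT := E_A bT; have MT := phi_M AT; have St := sec_S MT.
have [c [c0 h1 h2]] := common_bound (Ab AT) (Sb St).
have h : tends U (fun p => f (mix p (E T) (sec (phi (E T))))) (weak_exp T f).
  apply: (@ulimP _ _ U UU _ (cf * c)); apply: filterS (GU unit_filter_valid) => p /= v.
  by apply: fb => //; [exact: mix_S|exact: mix_op_bound].
apply: (tends_sub0 _ h).
have := @corner_tends U UU GU f cf cf0 fl fb s _ Ss St; rewrite sec_phi// => /(_ es).
apply: tends_eq; apply: filterS (GU unit_filter_valid) => p /= v.
have hJ := JS (compress_J v AT).
have h3 := compress_S v Ss; have h4 := compress_S v St.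
have e1 := fl 1 _ _ hJ h3; have e2 := fl 1 _ _ hJ h4.
rewrite !scale1r !mul1r in e1, e2; rewrite /mix e1 e2.
by rewrite opprD addrACA subrr add0r.
Qed.

Lemma mix_lin p a (T T' s s' : K -> K) : valid p.1 -> mix p (a *: T + T') (a *: s + s') = a *: mix p T s + mix p T' s'.
Proof.
move=> v; have lc := bounded_lin (cu_bounded v); have lk := bounded_lin (Jb (ku_J v)).
apply/funext => x; rewrite [RHS]/(a *: (ku p (T (ku p x)) + cu p (s (cu p x))) + (ku p (T' (ku p x)) + cu p (s' (cu p x)))).
rewrite [LHS]/(ku p (a *: T (ku p x) + T' (ku p x)) + cu p (a *: s (cu p x) + s' (cu p x))).
have gen (x1 x2 x3 x4 : K) : a *: x1 + x2 + (a *: x3 + x4) = a *: (x1 + x3) + (x2 + x4).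
  by rewrite scalerDr addrACA.
rewrite (lk a (T _) (T' _)) (lc a (s _) (s' _)); exact: gen.
Qed.

Lemma weak_exp_bidual T : bounded_op T -> bidual S (weak_exp T).
Proof.
move=> bT; have AT := E_A bT; have MT := phi_M AT; have St := sec_S MT.
have et := sec_phi MT; split.
  move=> a f g df dg.
  have dfg : dual S (fun X => a * f X + g X).
    have [cf [cf0 fl fb]] := dualP df; have [cg [cg0 gl gb]] := dualP dg; split.
      by move=> b X Z SX SZ; rewrite fl// gl//; ring.
    exists (nrm a * cf + cg)%:C; split; first by rewrite ler0c addr_ge0// mulr_ge0// nrm_ge0.
    move=> X d SX /opnorm_leP[r [-> r0 hr]]; rewrite nrmE -rmorphM lecR.
    rewrite (le_trans (nrmD _ _))// nrmM mulrDl -mulrA lerD ?ler_wpM2l ?nrm_ge0//.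
      exact: fb.
    exact: gb.
  apply: (tends_uniq (weak_exp_tends bT St et dfg)).
  by apply: tendsD; [apply: tendsM|]; exact: weak_exp_tends.
have [c [c0 h1 h2]] := common_bound (Ab AT) (Sb St).
exists c%:C; split; first by rewrite ler0c.
move=> f d df [d0 hd]; have de : d = (complex.Re d)%:C by rewrite [LHS]complexE (ger0_Im d0) mulr0 addr0.
rewrite nrmE de -rmorphM lecR; apply: (tends_le (weak_exp_tends bT St et df)).
apply: filterS (GU unit_filter_valid) => p /= v.
rewrite mulrC -lecR rmorphM /= -de -nrmE; apply: hd; first exact: mix_S.
by apply/opnorm_leP; exists c; split=> //; exact: mix_op_bound.
Qed.

Lemma weak_exp_linear a T T' f : bounded_op T -> bounded_op T' -> dual S f ->
  weak_exp (a *: T + T') f = a * weak_exp T f + weak_exp T' f.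
Proof.
move=> bT bT' df; have [cf [cf0 fl fb]] := dualP df.
have AT := E_A bT; have MT := phi_M AT; have St := sec_S MT.
have AT' := E_A bT'; have MT' := phi_M AT'; have St' := sec_S MT'.
have h1 := weak_exp_tends bT St (sec_phi MT) df.
have h2 := weak_exp_tends bT' St' (sec_phi MT') df.
have h3 := weak_exp_tends (bounded_linc a bT bT') (S_lin a St St').
rewrite E_lin// !phi_lin ?sec_phi// in h3; try exact: SA.
apply: (tends_uniq (h3 _ erefl df)).
apply: tends_eq (tendsD (tendsM a h1) h2).
apply: filterS (GU unit_filter_valid) => p /= v.
by rewrite mix_lin// fl//; exact: mix_S.
Qed.

Lemma weak_exp_id X f : S X -> dual S f -> weak_exp X f = f X.
Proof.
move=> SX df; have [cf [cf0 fl fb]] := dualP df.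
have EX := E_id (SA SX); have h := weak_exp_tends (Sb SX) SX _ df.
rewrite EX in h; apply: (tends_uniq (h erefl)).
exact: (mix_tends GU cf0 fl fb SX).
Qed.

Lemma weak_exp_cc n (T : 'I_n -> 'I_n -> K -> K) (c : C) :
  (forall i j, bounded_op (T i j)) -> mxopnorm_le T c ->
  bidual_mxnorm_le S (fun i j => weak_exp (T i j)) c.
Proof.
move=> bT /mxopnorm_leP[r [-> r0 hr]]; split; first by rewrite ler0c.
move=> m f d df [d0 hd].
have de : d = (complex.Re d)%:C by rewrite [LHS]complexE (ger0_Im d0) mulr0 addr0.
set dr := complex.Re d in de; have dr0 : 0 <= dr by rewrite -ler0c -de.
apply/mxnorm_leP; exists (r * dr); split; rewrite ?mulr_ge0// ?de -?rmorphM// => v.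
have hE := E_cc r0 bT hr; have AE i j : A (E (T i j)) by exact: E_A.
have hP := phi_cc r0 AE hE; have MP i j : M (phi (E (T i j))) by exact: phi_M.
set V := \sum_j nrm (v j) ^+ 2; have V0 : 0 <= V by apply: sumr_ge0 => j _; exact: sqr_ge0.
(* Lifts have norm at most r + e only, so the bound is proved for r + e and e tends to 0. *)
suff key e : 0 < e -> \sum_i nrm (\sum_j weak_exp (T i.1 j.1) (f i.2 j.2) * v j) ^+ 2 <= ((r + e) * dr) ^+ 2 * V.
  set a := \sum_i _ in key *; apply: le_eps => e e0.
  (* For 0 < t <= 1, (r + t)^2 - r^2 <= t (2 r + 1); the final 1 keeps k positive. *)
  pose k := (2 * r + 1) * dr ^+ 2 * V + 1; have k0 : 0 < k by rewrite ltr_wpDl// !mulr_ge0// ?sqr_ge0// addr_ge0// mulr_ge0.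
  have [h|h] := leP 1 (e / k).
    have := key 1 ltr01; have : k <= e by rewrite -[k]mul1r -ler_pdivlMr.
    rewrite /k => h1 h2; rewrite (le_trans h2)//; move: h1; rewrite !exprMn; move: (dr ^+ 2) => q; nra.
  have h0 : 0 < e / k by rewrite divr_gt0.
  have h1 := key _ h0; have h2 : e / k * k = e by rewrite divfK// gt_eqF.
  move: h h0 h1 h2; set t := e / k => h h0 h1 h2; rewrite (le_trans h1)// -h2 /k !exprMn.
  have q0 : 0 <= dr ^+ 2 * V by rewrite mulr_ge0// sqr_ge0.
  rewrite -subr_ge0 (_ : _ - _ = t * ((1 - t) * (dr ^+ 2 * V) + 1)); last by ring.
  by rewrite mulr_ge0 ?(ltW h0)// addr_ge0// mulr_ge0// subr_ge0 ltW.
move=> e0; have [s [Ss es hs]] := lift_mx r0 e0 MP hP.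
have re0 : 0 <= r + e by rewrite addr_ge0// ltW.
have hE' : mx_bound (fun i j => E (T i j)) (r + e).
  move=> w; rewrite (le_trans (hE w))// ler_wpM2r//; last by rewrite ler_pXn2r// lerDl ltW.
  by apply: sumr_ge0 => j _; exact: sqr_ge0.
apply: (@tends_sqr_le _ _ U _ _ (fun i p => \sum_j f i.2 j.2 (mix p (E (T i.1 j.1)) (s i.1 j.1)) * v j)).
  move=> i; apply: tends_sum => j.
  rewrite mulrC; apply: tends_eq (tendsM (v j) (weak_exp_tends (bT i.1 j.1) (Ss i.1 j.1) (es i.1 j.1) (df i.2 j.2))).
  by apply: filterE => p /=; rewrite mulrC.
apply: filterS (GU unit_filter_valid) => p /= vp.
have SX i j : S (mix p (E (T i j)) (s i j)) by exact: mix_S.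
have hX : mxopnorm_le (fun i j => mix p (E (T i j)) (s i j)) (r + e)%:C.
  by apply/mxopnorm_leP; exists (r + e); split=> //; exact: mix_bound.
have /mxnorm_leP[b [be b0 hb]] := hd _ _ _ SX hX.
have {}be : b = (r + e) * dr.
  have : (b%:C : C) = ((r + e) * dr)%:C by rewrite -be {1}de -rmorphM mulrC.
  by case.
(* The norm of the matrix f of functionals puts the index of f first, the norm on the bidual puts it
   second. *)
have := hb (fun i => v (i.2, i.1)); rewrite be.
have bij : bijective (fun i : 'I_m * 'I_n => (i.2, i.1)) by exists (fun i => (i.2, i.1)) => -[].
rewrite (reindex (fun i : 'I_m * 'I_n => (i.2, i.1)))/=; last exact: onW_bij.
rewrite [V](reindex (fun i : 'I_m * 'I_n => (i.2, i.1)))/=; last exact: onW_bij.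
move=> h; apply: le_trans h; rewrite le_eqVlt; apply/orP; left; apply/eqP.
apply: eq_bigr => i _; congr (nrm _ ^+ 2).
by rewrite (reindex (fun i : 'I_m * 'I_n => (i.2, i.1)))//=; exact: onW_bij.
Qed.

End WeakExpectation.

Lemma qwep_criterion : QWEP M.
Proof.
split; first exact: commutant_cstar.
have [U [UU GU]] := ultraFilterLemma unit_filter_proper.
exists K, S, J; split; [exact: S_cstar| |exact: J_ideal|exact: S_quotient].
exists K, id, (weak_exp U); split.
- by split=> // X SX; exact: Sb.
- split; [exact: weak_exp_bidual| |exact: weak_exp_cc].
  by move=> a T T' bT bT' f df; exact: weak_exp_linear.
- by move=> X f; exact: weak_exp_id.
Qed.

End Criterion.

(** * Commutation and density *)

Section FormalCombinations.
Context {R : realType} {T : Type}.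
Local Notation C := R[i].
Local Notation formal := (seq (C * seq T)).
Implicit Types (v w : formal) (E : lmodType C).

(** A list of coefficients and words is a noncommutative polynomial. Keeping it formal lets the same
    polynomial be evaluated in the limit space and in every model; [fstar] is the adjoint for
    self-adjoint letters. *)
Definition fsum E (al : seq T -> E) v : E := \sum_(p <- v) p.1 *: al p.2.
Definition flc (a : C) v w : formal := [seq (a * p.1, p.2) | p <- v] ++ w.
Definition fstar v : formal := [seq (p.1^*, rev p.2) | p <- v].
Definition fword (s : seq T) : formal := [:: (1, s)].
Definition fcons (t : T) v : formal := [seq (p.1, t :: p.2) | p <- v].
Definition fall (P : pred T) v : bool := all (fun p => all P p.2) v.

Lemma fsum_lc E (al : seq T -> E) a v w : fsum al (flc a v w) = a *: fsum al v + fsum al w.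
Proof.
rewrite /fsum big_cat big_map scaler_sumr; congr (_ + _).
by apply: eq_bigr => p _; rewrite scalerA.
Qed.

Lemma fsum_nil E (al : seq T -> E) : fsum al [::] = 0.
Proof. exact: big_nil. Qed.

Lemma fsum_word E (al : seq T -> E) s : fsum al (fword s) = al s.
Proof. by rewrite /fsum big_seq1 scale1r. Qed.

Lemma fsum_cons E (al : seq T -> E) t v : fsum al (fcons t v) = fsum (fun s => al (t :: s)) v.
Proof. by rewrite /fsum big_map. Qed.

Lemma fsum_lin E E' (al : seq T -> E) (f : E -> E') v : linear f ->
  f (fsum al v) = fsum (f \o al) v.
Proof.
move=> lf; have f0 : f 0 = 0 by have := lf (-1) 0 0; rewrite scaler0 addr0 scaleN1r addNr.
rewrite /fsum; elim: v => [|p v IH]; first by rewrite !big_nil.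
by rewrite !big_cons lf IH.
Qed.

Lemma eq_fsum E (al be : seq T -> E) v : al =1 be -> fsum al v = fsum be v.
Proof. by move=> h; apply: eq_bigr => p _; rewrite h. Qed.

Lemma fall_lc P a v w : fall P v -> fall P w -> fall P (flc a v w).
Proof. by rewrite /fall all_cat all_map => h1 h2; apply/andP. Qed.

Lemma fall_star P v : fall P v -> fall P (fstar v).
Proof. by rewrite /fall all_map => h; apply: sub_all h => p /=; rewrite all_rev. Qed.

Lemma fsum_star_lc E (al : seq T -> E) a v w :
  fsum al (fstar (flc a v w)) = a^* *: fsum al (fstar v) + fsum al (fstar w).
Proof.
rewrite /fsum /fstar map_cat big_cat !big_map scaler_sumr; congr (_ + _).
by apply: eq_bigr => p _; rewrite /= rmorphM scalerA.
Qed.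

Lemma fsum_starK E (al : seq T -> E) v : fsum al (fstar (fstar v)) = fsum al v.
Proof. by rewrite /fsum !big_map; apply: eq_bigr => p _; rewrite /= conjCK revK. Qed.

End FormalCombinations.

Section Projection.
Context {R : realType} (H : hilbertType R) (W : set H).
Local Notation C := R[i].
Hypotheses (W0 : W 0) (W_lin : forall a x y, W x -> W y -> W (a *: x + y)).

Definition closed_span (z : H) : Prop := forall e, 0 < e -> exists2 w, W w & nrm (z - w) < e.

Lemma closed_span_orth z y : closed_span z -> (forall w, W w -> dot y w = 0) -> dot y z = 0.
Proof.
move=> cz h; apply: nrm_eq0; apply/eqP; rewrite eq_le nrm_ge0 andbT.
apply: le_eps => e e0; rewrite add0r.
have c0 : 0 < nrm y + 1 by rewrite ltr_wpDl ?nrm_ge0.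
have [w Ww hw] := cz _ (divr_gt0 e0 c0).
have -> : dot y z = dot y (z - w) by rewrite dotBr (h _ Ww) subr0.
rewrite (le_trans (CS _ _))//; have : nrm y * nrm (z - w) <= (nrm y + 1) * (e / (nrm y + 1)).
  by apply: ler_pM; rewrite ?nrm_ge0// ?lerDl// ltW.
by rewrite [X in _ <= X]mulrC divfK// gt_eqF.
Qed.

(** A real projection onto a complex subspace, tested on w and i w, is the complex orthogonal
    projection onto its closure. The last clause characterizes it, and serves to prove that P is
    linear and commutes with operators. *)
Lemma projection_ex : exists P : H -> H, [/\ bounded_op P, (forall u, closed_span (P u)),
  (forall u w, W w -> dot (u - P u) w = 0) &
  forall u z, closed_span z -> (forall w, W w -> dot (u - z) w = 0) -> P u = z].
Proof.
have [P hP] : exists P : H -> H, forall u, closed_span (P u) /\ forall w, W w -> dot (u - P u) w = 0.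
  apply: (choice_ex (P := fun u z => closed_span z /\ forall w, W w -> dot (u - z) w = 0)) => u.
  have [|z [h1 h2]] := @real_projection _ _ W u W0.
    by move=> r x y; exact: W_lin.
  exists z; split=> // w Ww; apply: cplx_eq; first exact: h2.
  have := h2 ('i%C *: w); rewrite dotZr ReiM => h3.
  by apply/eqP; rewrite -oppr_eq0 h3// -[_ *: w]addr0; exact: W_lin.
have uni u z : closed_span z -> (forall w, W w -> dot (u - z) w = 0) -> P u = z.
  move=> cz hz; have [h1 h2] := hP u; apply/eqP; rewrite -subr_eq0; apply/eqP/dot_eq0.
  have h3 w : W w -> dot (P u - z) w = 0.
    move=> Ww; have -> : P u - z = (u - z) - (u - P u) by rewrite opprB [RHS]addrC addrA subrK.
    by rewrite dotBl hz// h2// subr0.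
  by rewrite dotBr !closed_span_orth// subr0.
have lP : linear P.
  move=> a x y; have [h1 h2] := hP x; have [h3 h4] := hP y; apply: uni => [e e0|w Ww].
    have c0 : 0 < nrm a + 1 by rewrite ltr_wpDl ?nrm_ge0.
    have e2 : 0 < e / 2 by rewrite divr_gt0.
    have [w Ww hw] := h1 _ (divr_gt0 e2 c0); have [w' Ww' hw'] := h3 _ e2.
    exists (a *: w + w'); first exact: W_lin.
    have -> : a *: P x + P y - (a *: w + w') = a *: (P x - w) + (P y - w').
      by rewrite scalerBr opprD addrACA.
    rewrite (le_lt_trans (nrmD _ _))// nrmZ.
    have : nrm a * nrm (P x - w) <= (nrm a + 1) * (e / 2 / (nrm a + 1)).
      by apply: ler_pM; rewrite ?nrm_ge0// ?lerDl// ltW.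
    by rewrite [X in _ <= X]mulrC divfK ?gt_eqF// => h; lra.
  have -> : a *: x + y - (a *: P x + P y) = a *: (x - P x) + (y - P y).
    by rewrite scalerBr opprD addrACA.
  by rewrite dotDl dotZl h2// h4// mulr0 addr0.
exists P; split=> //.
- apply: (bounded_opI ler01); split=> // x; rewrite mul1r -(@ler_pXn2r _ 2)// ?nnegrE ?nrm_ge0//.
  have [h1 h2] := hP x; have h3 := closed_span_orth h1 h2.
  rewrite -{2}(subrK (P x) x) nrmD_sq h3 /=; have := sqr_ge0 (nrm (x - P x)); lra.
- by move=> u; case: (hP u).
- by move=> u; case: (hP u).
Qed.

End Projection.

Section Approximation.
Context {R : realType}.
Local Notation C := R[i].
Implicit Types H : hilbertType R.

Lemma dot_close H (a b a' b' : H) (d : R) : nrm (a - a') <= d -> nrm (b - b') <= d ->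
  nrm (dot a b - dot a' b') <= d * (nrm b + nrm a + d).
Proof.
move=> h1 h2; have d0 : 0 <= d := le_trans (nrm_ge0 _) h1.
have -> : dot a b - dot a' b' = dot (a - a') b + dot a (b - b') - dot (a - a') (b - b').
  by rewrite !dotBl !dotBr; ring.
rewrite (le_trans (nrmB _ _))// (le_trans (lerD (nrmD _ _) (lexx _)))//.
have h3 := CS (a - a') b; have h4 := CS a (b - b'); have h5 := CS (a - a') (b - b').
have := nrm_ge0 a; have := nrm_ge0 b; have := nrm_ge0 (a - a'); have := nrm_ge0 (b - b').
move=> *; nra.
Qed.

Lemma eq_small (z : C) (k : R) : 0 <= k -> (forall e, 0 < e -> e <= 1 -> nrm z <= e * k) -> z = 0.
Proof.
move=> k0 h; apply: nrm_eq0; apply/eqP; rewrite eq_le nrm_ge0 andbT.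
apply: le_eps => e e0; rewrite add0r; have k1 : 0 < k + 1 by rewrite ltr_wpDl.
have [h1|h1] := leP (e / (k + 1)) 1.
  have := h _ (divr_gt0 e0 k1) h1; have h2 : e / (k + 1) * (k + 1) = e by rewrite divfK// gt_eqF.
  have h3 : 0 < e / (k + 1) by rewrite divr_gt0.
  move: h2 h3; set t := e / _ => h2 h3; nra.
have := h 1 ltr01 (lexx _); move: h1; rewrite ltr_pdivlMr// mul1r; lra.
Qed.

End Approximation.

(** * Commutation and strong density *)

Section Rieffel.
Context {R : realType} (F : hilbertType R) (Om : F) (L : Type) (op : L -> F -> F).
Local Notation C := R[i].
Hypotheses (op_b : forall l, bounded_op (op l)) (op_sa : forall l, adjoint (op l) (op l)).

Definition vword (w : seq L) (z : F) : F := foldr op z w.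
Definition vpoly (v : seq (C * seq L)) (z : F) : F := fsum (vword^~ z) v.
Definition letters (P : pred L) : set (F -> F) := [set T | exists2 l, P l & T = op l].

Lemma letters_star P : star_closed (letters P).
Proof. by move=> T [l Pl ->]; split; [exact: op_b|exists l; rewrite ?(adjE (op_b l) (@op_sa l))]. Qed.

Lemma vword_bounded w : bounded_op (vword w).
Proof. by elim: w => [|l w IH] /=; [exact: bounded_id|exact: bounded_comp (op_b l) IH]. Qed.

Lemma vpoly_bounded v : bounded_op (vpoly v).
Proof.
have -> : vpoly v = \sum_(p <- v) p.1 *: vword p.2.
  by apply/funext => z; rewrite fct_sumE.
by apply: bounded_sum => // p; exact/boundedZ/vword_bounded.
Qed.

Lemma vword_adj w x y : dot (vword w x) y = dot x (vword (rev w) y).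
Proof.
elim: w y => [|l w IH] y //=; rewrite op_sa IH rev_cons /vword -cats1 foldr_cat.
by [].
Qed.

Lemma vpoly_adj v x y : dot (vpoly v x) y = dot x (vpoly (fstar v) y).
Proof.
rewrite /vpoly /fsum dot_suml dot_sumr big_map; apply: eq_bigr => p _ /=.
by rewrite dotZl dotZr vword_adj.
Qed.

Lemma vword_cat s t z : vword (s ++ t) z = vword s (vword t z).
Proof. exact: foldr_cat. Qed.

Lemma comm_vword (P : pred L) T w z : commutant (letters P) T -> all P w -> T (vword w z) = vword w (T z).
Proof.
move=> hT; elim: w => //= l w IH /andP[Pl /IH <-].
by apply: (comm_commute _ hT); exists l.
Qed.

Lemma comm_vpoly (P : pred L) T v z : commutant (letters P) T -> fall P v -> T (vpoly v z) = vpoly v (T z).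
Proof.
move=> hT; have lT := bounded_lin (comm_bounded hT).
rewrite /vpoly (fsum_lin _ _ lT) /fsum; elim: v => [|p v IH] /=; first by rewrite !big_nil.
by move=> /andP[h1 h2]; rewrite !big_cons IH//= (comm_vword _ hT h1).
Qed.

Lemma vacuum_star (S S' : F -> F) w : (forall x y, dot (S x) y = dot x (S' y)) ->
  S (vword w Om) = vword w (S Om) ->
  dot (S Om) (vword (rev w) Om) = (dot (S' Om) (vword w Om))^*.
Proof. by move=> hS hw; rewrite -vword_adj -hw hS [LHS]dot_conj. Qed.

Section Side.
Context (P : pred L).
Hypothesis op_comm : forall l l' z, P l -> ~~ P l' -> op l (op l' z) = op l' (op l z).

Lemma vword_letters w : all P w -> commutant (letters (predC P)) (vword w).
Proof.
elim: w => [|l w IH] /=; first by move=> _; exact: (@comm_id _ F).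
move=> /andP[Pl /IH h]; apply: comm_comp h.
split; first exact: op_b.
by move=> _ [l' Pl' ->]; apply/funext => z /=; rewrite op_comm.
Qed.

Lemma vpoly_letters v : fall P v -> commutant (letters (predC P)) (vpoly v).
Proof.
move=> h; have -> : vpoly v = \sum_(p <- v) p.1 *: vword p.2.
  by apply/funext => z; rewrite fct_sumE.
elim: v h => [|p v IH] /=; first by rewrite big_nil => _; apply: comm0; exact: letters_star.
move=> /andP[h1 /IH h2]; rewrite big_cons; apply: (commD (@letters_star _) _ h2).
by apply: commZ; [exact: letters_star|exact: vword_letters].
Qed.

(* zeta is orthogonal, for the real inner product, to the self-adjoint P-polynomials applied to the
   vacuum and to i times the self-adjoint polynomials in the other letters. *)
Definition separating : Prop := forall zeta : F,
  (forall w, all P w -> dot zeta (vword (rev w) Om) = - (dot zeta (vword w Om))^*) ->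
  (forall w, all (predC P) w -> dot zeta (vword (rev w) Om) = (dot zeta (vword w Om))^*) ->
  zeta = 0.

Hypothesis sep : separating.

(** Let z be the real projection of [T Om] on the self-adjoint P-polynomials at the vacuum. The
    difference is orthogonal to these by construction. Its coefficients on the other words are
    hermitian, since this holds for S [Om] whenever S is self-adjoint and commutes with the other
    letters, and passes to the limit z. Separation makes it vanish. *)
Lemma vacuum_approx_sa T e : commutant (letters (predC P)) T -> adj T = T -> 0 < e ->
  exists v, [/\ fall P v, nrm (T Om - vpoly v Om) < e & nrm (T Om - vpoly (fstar v) Om) < e].
Proof.
move=> hT aT e0; have bT := comm_bounded hT.
pose W := [set x | exists2 v, fall P v & x = vpoly v Om + vpoly (fstar v) Om].
have WD (r : R) x y : W x -> W y -> W (r%:C *: x + y).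
  move=> [v hv ->] [w hw ->]; exists (flc r%:C v w); first exact: fall_lc.
  by rewrite /vpoly fsum_lc fsum_star_lc conjR scalerDr addrACA.
have W0 : W 0 by exists [::]; rewrite // /vpoly /= !fsum_nil addr0.
have [z [hz1 hz2]] := real_projection (T Om) W0 WD.
have yW w : all (predC P) w -> forall x, W x ->
    dot x (vword (rev w) Om) = (dot x (vword w Om))^*.
  move=> hw _ [v hv ->].
  have c1 := comm_vword Om (vpoly_letters hv) hw.
  have c2 := comm_vword Om (vpoly_letters (fall_star hv)) hw.
  rewrite !dotDl (vacuum_star (vpoly_adj v) c1) [X in _ + X](vacuum_star (S' := vpoly v) _ c2).
    by rewrite -rmorphD addrC.
  by move=> x y; rewrite vpoly_adj /vpoly fsum_starK.
have hz : T Om - z = 0.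
  apply: sep => w hw.
    (* Orthogonality to c w plus its adjoint; c = 1 and c = i give the real and imaginary parts. *)
    have h1 c : complex.Re (c * dot (T Om - z) (vword w Om)) =
        - complex.Re (c^* * dot (T Om - z) (vword (rev w) Om)).
      apply/eqP; rewrite -addr_eq0 -ReD -!dotZr -dotDr; apply/eqP/hz2.
      exists (flc c (fword w) [::]); first by rewrite /fall /= hw.
      by rewrite /vpoly fsum_star_lc fsum_lc !fsum_nil !addr0 fsum_word /fsum /= big_seq1 /= conjC1 scale1r.
    apply: cplx_eq.
      by have := h1 1; rewrite conjC1 !mul1r ReN ReJ => ->; rewrite opprK.
    by have := h1 'i%C; rewrite conj_i mulNr ReN opprK !ReiM ImN ImJ opprK => /oppr_inj ->.
  have hT' : dot (T Om) (vword (rev w) Om) = (dot (T Om) (vword w Om))^*.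
    apply: (vacuum_star (S := T)); last exact: comm_vword hT hw.
    by move=> x y; rewrite -{2}aT dot_adjr.
  have hz' : dot z (vword (rev w) Om) = (dot z (vword w Om))^*.
    apply/eqP; rewrite -subr_eq0; apply/eqP.
    apply: (@eq_small _ _ (nrm (vword (rev w) Om) + nrm (vword w Om))); first by rewrite addr_ge0 ?nrm_ge0.
    move=> d d0 _; have [x Wx hx] := hz1 _ d0.
    have -> : dot z (vword (rev w) Om) - (dot z (vword w Om))^* =
        dot (z - x) (vword (rev w) Om) - (dot (z - x) (vword w Om))^*.
      by rewrite !dotBl rmorphB /= (yW _ hw _ Wx); ring.
    rewrite (le_trans (nrmB _ _))// nrmJ mulrDr lerD// (le_trans (CS _ _))// ler_wpM2r ?nrm_ge0// ltW//.
  by rewrite !dotBl hT' hz' rmorphB.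
have [x [v hv ->] hx] := hz1 _ e0.
have {}hx : nrm (T Om - (vpoly v Om + vpoly (fstar v) Om)) < e.
  by move/eqP: hz; rewrite subr_eq0 => /eqP ->.
exists (flc 1 v (fstar v)); split; first exact/fall_lc/fall_star.
  by rewrite /vpoly fsum_lc scale1r.
by rewrite /vpoly fsum_star_lc conjC1 scale1r fsum_starK addrC [fsum _ _ + _]addrC addrC.
Qed.

Lemma vacuum_approx T e : commutant (letters (predC P)) T -> 0 < e ->
  exists v, [/\ fall P v, nrm (T Om - vpoly v Om) < e & nrm (adj T Om - vpoly (fstar v) Om) < e].
Proof.
move=> hT e0; have bT := comm_bounded hT; have sY : star_closed (letters (predC P)) by exact: letters_star.
have hT' : commutant (letters (predC P)) (adj T) by exact: comm_adj.
have bT' := comm_bounded hT'.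
have [|v [v1 v2 v3]] := vacuum_approx_sa (commD sY hT hT') _ e0.
  by rewrite adjD// adjK// addrC.
have [|w [w1 w2 w3]] := vacuum_approx_sa (commZ sY 'i%C (commB sY hT hT')) _ e0.
  rewrite adjZ; last exact: boundedB.
  by rewrite adjB// adjK// conj_i scaleNr -scalerN opprB.
have half (x : F) : (2^-1 : C) *: (x + x) = x.
  by rewrite -mulr2n -[x *+ 2]scaler_nat scalerA mulVf ?scale1r// pnatr_eq0.
have nh : nrm (2^-1 : C) = 2^-1.
  have -> : (2^-1 : C) = (2^-1 : R)%:C by rewrite fmorphV rmorph_nat.
  by rewrite nrmR gtr0_norm// invr_gt0.
have ch : (2^-1 : C)^* = 2^-1 by rewrite fmorphV rmorph_nat.
exists (flc 2^-1 v (flc (- 'i / 2) w [::])); split.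
- by apply: fall_lc => //; apply: fall_lc.
- rewrite /vpoly !fsum_lc fsum_nil addr0.
  have -> : T Om = 2^-1 *: (T Om + adj T Om) + (- 'i / 2) *: ('i%C *: (T Om - adj T Om)).
    rewrite scalerA -[(- 'i / 2) * 'i]mulrA [2^-1 * 'i]mulrC mulrA mulNr mulii opprK mul1r -scalerDr.
    by rewrite addrACA subrr addr0 half.
  rewrite opprD addrACA -!scalerBr (le_lt_trans (nrmD _ _))// !nrmZ nrmM nrmN nrm_i mul1r nh.
  by move: v2 w2; rewrite /vpoly !fctE => *; lra.
- rewrite /vpoly !fsum_star_lc fsum_nil addr0 rmorphM rmorphN /= conj_i opprK ch.
  have -> : adj T Om = 2^-1 *: (T Om + adj T Om) + ('i / 2) *: ('i%C *: (T Om - adj T Om)).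
    rewrite scalerA -[('i / 2) * 'i]mulrA [2^-1 * 'i]mulrC mulrA mulii mulN1r scaleNr -scalerBr.
    by rewrite opprB [X in _ *: X]addrC addrA subrK half.
  rewrite opprD addrACA -!scalerBr (le_lt_trans (nrmD _ _))// !nrmZ nrmM nrm_i mul1r nh.
  by move: v3 w3; rewrite /vpoly !fctE => *; lra.
Qed.

End Side.

(** Multiplication of [zeta] by i exchanges the two conditions. *)
Lemma separating_swap (P : pred L) : separating P -> separating (predC P).
Proof.
move=> sep zeta h1 h2; have iz : 'i%C *: zeta = 0.
  apply: sep => w hw; rewrite !dotZl conj_i.
    rewrite h2; last by apply: sub_all hw => l /=; rewrite negbK.
    by rewrite rmorphM rmorphN /= conj_i opprK mulNr.
  by rewrite h1// rmorphM rmorphN /= conj_i opprK mulrN mulNr opprK.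
have := congr1 ( *:%R 'i%C) iz; rewrite scaler0 scalerA mulii scaleN1r => /eqP.
by rewrite oppr_eq0 => /eqP.
Qed.

Section Commutation.
Context (P : pred L).
Hypothesis op_comm : forall l l' z, P l -> ~~ P l' -> op l (op l' z) = op l' (op l z).
Hypothesis sep : separating P.
Hypothesis cyclic : forall z, (forall w, all P w -> dot (vword w Om) z = 0) -> z = 0.

Lemma predCK : predC (predC P) = P :> pred L.
Proof. by apply/funext => l /=; rewrite negbK. Qed.

(** This is <Om, TZ Om> = <Om, ZT Om>, written so that only the values of T, Z and their adjoints at
    the vacuum occur. [vacuum_approx] replaces these by polynomials in the two commuting sets of
    letters. *)
Lemma rieffel_vacuum T Z : commutant (letters (predC P)) T -> commutant (letters P) Z ->
  dot (adj T Om) (Z Om) = dot (adj Z Om) (T Om).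
Proof.
move=> hT hZ; apply/eqP; rewrite -subr_eq0; apply/eqP.
set ta := adj T Om; set t := T Om; set za := adj Z Om; set z := Z Om.
apply: (@eq_small _ _ (nrm z + nrm ta + 1 + (nrm t + nrm za + 1))).
  by rewrite !addr_ge0 ?nrm_ge0.
move=> e e0 e1; have [v [v1 v2 v3]] := vacuum_approx op_comm sep hT e0.
have op_comm' l l' u : predC P l -> ~~ predC P l' -> op l (op l' u) = op l' (op l u).
  by move=> /= h1; rewrite negbK => h2; exact/esym/op_comm.
have hZ' : commutant (letters (predC (predC P))) Z by rewrite predCK.
have [w [w1 w2 w3]] := vacuum_approx op_comm' (separating_swap sep) hZ' e0.
have h1 := dot_close (ltW v3) (ltW w2); have h2 := dot_close (ltW w3) (ltW v2).
have E : dot (vpoly (fstar v) Om) (vpoly w Om) = dot (vpoly (fstar w) Om) (vpoly v Om).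
  rewrite !vpoly_adj /vpoly !fsum_starK; congr (dot _ _).
  by rewrite -!/(vpoly _ _) (comm_vpoly (P := predC P))//; exact: vpoly_letters.
have -> : dot ta z - dot za t = (dot ta z - dot (vpoly (fstar v) Om) (vpoly w Om)) -
    (dot za t - dot (vpoly (fstar w) Om) (vpoly v Om)) by rewrite E; ring.
rewrite (le_trans (nrmB _ _))// (le_trans (lerD h1 h2))// -/ta -/t -/za -/z mulrDr.
by have := ler_wpM2l (ltW e0) e1; rewrite mulr1 => ee; rewrite !mulrDr !mulr1; lra.
Qed.

(** The vacuum identity for T multiplied on both sides by P-words, which Z commutes with, gives all
    coefficients of TZ and ZT between cyclic vectors. *)
Lemma rieffel T Z : commutant (letters (predC P)) T -> commutant (letters P) Z ->
  forall z, T (Z z) = Z (T z).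
Proof.
move=> hT hZ; have bT := comm_bounded hT; have bZ := comm_bounded hZ.
have D w1 w2 : all P w1 -> all P w2 ->
    dot (vword w1 Om) (T (Z (vword w2 Om))) = dot (vword w1 Om) (Z (T (vword w2 Om))).
  move=> h1 h2; pose T' := vword (rev w1) \o (T \o vword w2).
  have hr : all P (rev w1) by rewrite all_rev.
  have hT' : commutant (letters (predC P)) T'.
    by apply: comm_comp (vword_letters op_comm hr) _; apply: comm_comp hT (vword_letters op_comm h2).
  have bT' := comm_bounded hT'.
  have := rieffel_vacuum hT' hZ; rewrite !dot_adjl// /T' /= -(comm_vword _ hZ h2) (comm_vword _ hZ hr).
  by rewrite -!vword_adj.
have cyc z z' : (forall w, all P w -> dot (vword w Om) z = dot (vword w Om) z') -> z = z'.
  move=> h; apply/eqP; rewrite -subr_eq0; apply/eqP/cyclic => w hw.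
  by rewrite dotBr h// subrr.
move=> z; apply: (cyc _ _) => w1 h1.
rewrite -!(dot_adjl _ _ bT) -!(dot_adjl _ _ bZ) -(dot_adjl _ _ bT).
congr (dot _ z); apply: cyc => w2 h2.
have := D _ _ h1 h2; rewrite -!(dot_adjl _ _ bT) -!(dot_adjl _ _ bZ) -(dot_adjl _ _ bT) => e.
by rewrite [LHS]dot_conj [RHS]dot_conj e.
Qed.

(** The density half of the double commutant theorem: the projection onto the closure of the
    polynomials applied to the family z commutes with the amplified letters, so its entries lie in
    their commutant, and by [rieffel] they commute with T. *)
Lemma strong_approx (J : finType) (z : J -> F) T e : commutant (letters (predC P)) T -> 0 < e ->
  exists2 v, fall P v & forall k, nrm (T (z k) - vpoly v (z k)) < e.
Proof.
move=> hT e0; have bT := comm_bounded hT; have lT := bounded_lin bT.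
pose zz : hsum J (fun=> F) := hfin (K := fun=> F) z.
pose W := [set x | exists2 v, fall P v & x = ampl (vpoly v) zz].
have W0 : W 0 by exists [::] => //; apply: hsum_eq => k; rewrite amplE /vpoly fsum_nil.
have W_lin a x y : W x -> W y -> W (a *: x + y).
  move=> [v hv ->] [w hw ->]; exists (flc a v w); first exact: fall_lc.
  by apply: hsum_eq => k; rewrite !amplE hvalD hvalZ !amplE /vpoly fsum_lc.
have [Pj [bP P1 P2 P3]] := projection_ex W0 W_lin; have lP := bounded_lin bP.
have Wop l x : P l -> W x -> W (ampl (op l) x).
  move=> Pl [v hv ->]; exists (fcons l v).
    by rewrite /fall /fcons all_map; apply: sub_all hv => p /= ->; rewrite Pl.
  apply: hsum_eq => k; rewrite !amplE /vpoly fsum_cons (fsum_lin _ _ (bounded_lin (op_b l))).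
  exact: eq_fsum.
have Pc l u : P l -> Pj (ampl (op l) u) = ampl (op l) (Pj u).
  move=> Pl; apply: P3 => [d d0|w Ww].
    have /bounded_byP[c c0 [lc hc]] := ampl_bounded (I := J) (op_b l).
    have c1 : 0 < c + 1 by rewrite ltr_wpDl.
    have [w Ww hw] := P1 u _ (divr_gt0 d0 c1).
    exists (ampl (op l) w); first exact: Wop.
    rewrite -(linB _ _ lc) (le_lt_trans (hc _))//.
    have : c * nrm (Pj u - w) <= c * (d / (c + 1)) by rewrite ler_wpM2l// ltW.
    have : d / (c + 1) * (c + 1) = d by rewrite divfK// gt_eqF.
    have : 0 < d / (c + 1) by rewrite divr_gt0.
    by move: (d / (c + 1)) => r *; nra.
  rewrite -(linB _ _ (bounded_lin (ampl_bounded (op_b l)))).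
  by rewrite (ampl_adj _ _ (@op_sa l)) P2//; exact: Wop.
have cP : Pj (ampl T zz) = ampl T (Pj zz).
  rewrite -(mxop_entry lP) -[LHS]/((mxop (entry Pj) \o ampl T) zz) -ampl_comm//.
  move=> i j x; apply/esym/rieffel => //; apply: commI => [|_ u [l Pl ->]]; first exact: entry_bounded.
  apply: entry_ampl_comm; first exact: bounded_lin.
  by apply/funext => y /=; rewrite Pc.
have zW : W zz.
  by exists (fword [::]) => //; apply: hsum_eq => k; rewrite amplE /vpoly fsum_word.
have Pz : Pj zz = zz.
  by apply: P3 => [d d0|w _]; [exists zz => //; rewrite subrr nrm0|rewrite subrr dot0l].
have [_ [v hv ->] h] := P1 (ampl T zz) _ e0; exists v => // k.
move: h; rewrite cP Pz => h; apply: le_lt_trans h.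
have := nrm_hval (ampl T zz - ampl (vpoly v) zz) k.
by rewrite hvalD hvalN !amplE.
Qed.

Lemma strong_approx_sa (J : finType) (z : J -> F) T e : commutant (letters (predC P)) T -> adj T = T ->
  0 < e -> exists2 v, fall P v & forall k, nrm (T (z k) - vpoly (flc 1 v (fstar v)) (z k)) < e.
Proof.
move=> hT aT e0; have bT := comm_bounded hT; have lT := bounded_lin bT.
have T_sym x y : dot (T x) y = dot x (T y) by rewrite -{2}aT dot_adjr.
pose zz : hsum J (fun=> F) := hfin (K := fun=> F) z.
pose W := [set x | exists2 v, fall P v & x = ampl (vpoly v) zz + ampl (vpoly (fstar v)) zz].
have W0 : W 0.
  exists [::] => //; apply: hsum_eq => k; rewrite hvalD !amplE /vpoly /= fsum_nil.
  by rewrite addr0.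
have W_lin (r : R) x y : W x -> W y -> W (r%:C *: x + y).
  move=> [v hv ->] [w hw ->]; exists (flc r%:C v w); first exact: fall_lc.
  apply: hsum_eq => k; rewrite !(hvalD, hvalZ, amplE) /vpoly fsum_lc fsum_star_lc conjR.
  by rewrite scalerDr addrACA.
have [y [hy1 hy2]] := real_projection (ampl T zz) W0 W_lin.
set ze := ampl T zz - y in hy2.
have h1 : complex.Re (dot ze (ampl T zz)) = 0.
  suff : 2 * complex.Re (dot ze (ampl T zz)) = 0 by lra.
  suff : ((2 * complex.Re (dot ze (ampl T zz)))%:C : C) = 0 by case.
  pose k := \sum_i (nrm (ze i) + nrm (z i)).
  have k0 : 0 <= k by apply: sumr_ge0 => i _; rewrite addr_ge0 ?nrm_ge0.
  apply: (eq_small k0) => d d0 _.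
  (* Approximation at the vectors z and at the residue ze simultaneously: the coefficient <ze, v* z>
     equals <v ze, z>, so v suffices and v* need not be controlled. *)
  pose z' (i : J + J) := match i with inl i => z i | inr i => ze i end.
  have [v hv hz] := strong_approx z' hT d0.
  have -> : 2 * complex.Re (dot ze (ampl T zz)) =
      \sum_i complex.Re (dot (ze i) (T (z i) - vpoly v (z i)) + dot (T (ze i) - vpoly v (ze i)) (z i)).
    have := hy2 _ (ex_intro2 _ _ v hv erefl); rewrite !dot_fin !(big_morph _ ReD (erefl : complex.Re (0 : C) = 0)) => e1.
    rewrite -[LHS]subr0 -[X in _ - X]e1 mulr_sumr -sumrB; apply: eq_bigr => i _.
    rewrite hvalD !amplE -[zz i]/(z i); move: (ze i) => x.
    by rewrite !(dotDr, dotDl, dotNl, dotNr, ReD, ReN) T_sym !vpoly_adj; lra.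
  rewrite nrmR (le_trans (ler_norm_sum _ _ _))// /k mulr_sumr; apply: ler_sum => i _.
  rewrite (le_trans (Re_le_nrm _))// (le_trans (nrmD _ _))// mulrDr lerD// (le_trans (CS _ _))//.
    by rewrite mulrC ler_wpM2r ?nrm_ge0// ltW// (hz (inl i)).
  by rewrite ler_wpM2r ?nrm_ge0// ltW// (hz (inr i)).
have h2 : complex.Re (dot ze y) = 0.
  suff : ((complex.Re (dot ze y))%:C : C) = 0 by case.
  apply: (eq_small (nrm_ge0 ze)) => d d0 _; have [w Ww hw] := hy1 _ d0.
  have -> : complex.Re (dot ze y) = complex.Re (dot ze (y - w)) by rewrite dotBr ReB (hy2 _ Ww) subr0.
  rewrite nrmR (le_trans (Re_le_nrm _))// (le_trans (CS _ _))// mulrC ler_wpM2r ?nrm_ge0// ltW //.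
have ze0 : ze = 0.
  have h3 : nrm ze ^+ 2 = 0 by rewrite nrm_dot {2}/ze dotBr ReB h1 h2 subr0.
  by apply: nrm_eq0; apply/eqP; rewrite -sqrf_eq0 h3.
have [_ [v hv ->] hw] := hy1 _ e0; exists v => // k; apply: le_lt_trans hw.
have ey : ampl T zz = y by apply/eqP; rewrite -subr_eq0 -/ze ze0.
have := nrm_hval (y - (ampl (vpoly v) zz + ampl (vpoly (fstar v)) zz)) k.
by rewrite -ey hvalD hvalN hvalD !amplE /vpoly fsum_lc scale1r.
Qed.

End Commutation.
End Rieffel.

(** * Ultraproducts *)

Section Blocks.
Context {R : realType} (I : choiceType) (K : I -> hilbertType R).
Context (Y : forall i, set (K i -> K i)) (E : forall i, (K i -> K i) -> (K i -> K i)).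
Local Notation C := R[i].
Local Notation hs := (hsum I K).
Hypothesis Ys : forall i, star_closed (@Y i).
Hypothesis E_A : forall i (T : K i -> K i), bounded_op T -> commutant (@Y i) (E T).
Hypothesis E_lin : forall i a (S T : K i -> K i), bounded_op S -> bounded_op T ->
  E (a *: S + T) = a *: E S + E T.
Hypothesis E_id : forall i (T : K i -> K i), commutant (@Y i) T -> E T = T.
Hypothesis E_cc : forall i n (T : 'I_n -> 'I_n -> K i -> K i) c, 0 <= c ->
  (forall k l, bounded_op (T k l)) -> mx_bound T c -> mx_bound (fun k l => E (T k l)) c.

Definition block i (y : K i -> K i) (v : hs) : hs := hinj (y (v i)).
Definition corner (T : hs -> hs) i (x : K i) : K i := T (hinj x) i.
Arguments corner T i x : clear implicits.
(** The blocks of [id] are the projections onto the summands; commuting with them makes an operator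
    block diagonal, so the commutant is the bounded product of the commutants. *)
Definition block_letters : set (hs -> hs) :=
  [set T | exists i (y : K i -> K i), (Y y \/ y = id) /\ T = block y].
Local Notation A := (commutant block_letters).
Definition block_exp (T : hs -> hs) : hs -> hs := hdiag (fun i => E (corner T i)).

Lemma block_bounded i (y : K i -> K i) : bounded_op y -> bounded_op (block y).
Proof.
move=> /bounded_byP[c c0 [ly hc]]; apply: (bounded_opI c0); split=> [a u v|v].
  by rewrite /block hvalD hvalZ ly hinj_linear.
by rewrite nrm_hinj (le_trans (hc _))// ler_wpM2l// nrm_hval.
Qed.

Lemma letter_bounded i (y : K i -> K i) : (Y y \/ y = id) -> bounded_op y.
Proof. by case=> [/Ys[]//|->]; exact: bounded_id. Qed.

Lemma block_letters_star : star_closed block_letters.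
Proof.
move=> _ [i [y [hy ->]]]; have by_ := letter_bounded hy; split; first exact: block_bounded.
exists i, (adj y); split.
  by case: hy => [/Ys[_ h]|->]; [left|right; exact: adj_id].
apply: adjE; first exact: block_bounded.
move=> u v; rewrite /block dot_hinjl [RHS]dot_conj dot_hinjl -dot_conj.
by rewrite dot_adjr.
Qed.

Lemma comm_corner T v i : A T -> T v i = corner T i (v i).
Proof.
move=> hT; rewrite /corner; have hb : block_letters (block (id : K i -> K i)).
  by exists i, id; split; [right|].
have := comm_commute v hT hb; rewrite /block /= => ->.
by rewrite hinjE.
Qed.

Lemma corner_bounded T i : bounded_op T -> bounded_op (corner T i).
Proof.
move=> /bounded_byP[c c0 [lT hT]]; apply: (bounded_opI c0); split=> [a x y|x].
  by rewrite /corner hinj_linear lT.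
by rewrite (le_trans (nrm_hval _ _))// (le_trans (hT _))// nrm_hinj.
Qed.

Lemma corner_bound T c i x : (forall v, nrm (T v) <= c * nrm v) -> nrm (corner T i x) <= c * nrm x.
Proof. by move=> hT; rewrite (le_trans (nrm_hval _ _))// (le_trans (hT _))// nrm_hinj. Qed.

Lemma corner_comm T i : A T -> commutant (@Y i) (corner T i).
Proof.
move=> hT; apply: commI => [|y x Yy]; first exact: corner_bounded (comm_bounded hT).
have hb : block_letters (block y) by exists i, y; split; [left|].
have := comm_commute (hinj x) hT hb; rewrite /block hinjE /corner => ->.
by rewrite hinjE.
Qed.

Lemma corner_lin a S T i : corner (a *: S + T) i = a *: corner S i + corner T i.
Proof. by []. Qed.

Lemma corner_id i : corner id i = id.
Proof. by apply/funext => x; rewrite /corner hinjE. Qed.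

Lemma corner_comp S T i : A S -> corner (S \o T) i = corner S i \o corner T i.
Proof. by move=> hS; apply/funext => x; rewrite /corner /= (comm_corner _ _ hS). Qed.

Lemma corner_adj T i : bounded_op T -> corner (adj T) i = adj (corner T i).
Proof.
move=> bT; apply/esym/adjE; first exact: corner_bounded.
move=> x y; rewrite /corner -[RHS]dot_hinjl (dot_adjr _ _ bT).
by rewrite [RHS]dot_conj dot_hinjl -dot_conj.
Qed.

Lemma diag_comm (S : forall i, K i -> K i) c : 0 <= c -> (forall i, commutant (@Y i) (S i)) ->
  (forall i x, nrm (S i x) <= c * nrm x) -> A (hdiag S).
Proof.
move=> c0 hS hc; have lS i := bounded_lin (comm_bounded (hS i)).
have bd : bounded_op (hdiag S).
  apply: (bounded_opI c0); split=> [a u v|v].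
    by apply: hsum_eq => i; rewrite hvalD hvalZ !(hdiagE _ _ hc) hvalD hvalZ lS.
  have := @mx_hdiag_bound _ _ K _ (fun _ _ : 'I_1 => hdiag S) (fun _ _ => S) c
    (fun _ _ w i => hdiagE w i hc) _ (fun=> v).
  rewrite !big_ord1 -exprMn ler_pXn2r ?nnegrE ?mulr_ge0 ?nrm_ge0//; apply=> i w.
  by rewrite !big_ord1 -exprMn ler_pXn2r ?nnegrE ?mulr_ge0 ?nrm_ge0.
apply: commI => // _ v [i [y [hy ->]]]; rewrite /block.
have ly := bounded_lin (letter_bounded hy).
apply: hsum_eq => j; rewrite (hdiagE _ _ hc).
have [ij|ij] := pselect (i = j).
  case: j / ij; rewrite !hinjE (hdiagE _ _ hc).
  by case: hy => [Yy|->//]; rewrite (comm_commute _ (hS i) Yy).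
by rewrite !hinj_ne// (lin0 (lS j)).
Qed.

Lemma corner_diag (S : forall i, K i -> K i) c i : (forall i x, nrm (S i x) <= c * nrm x) ->
  corner (hdiag S) i = S i.
Proof. by move=> hc; apply/funext => x; rewrite /corner (hdiagE _ _ hc) hinjE. Qed.

Lemma E_bound i (T : K i -> K i) c : 0 <= c -> bounded_op T -> (forall x, nrm (T x) <= c * nrm x) ->
  forall x, nrm (E T x) <= c * nrm x.
Proof.
move=> c0 bT h x; have := E_cc c0 (fun _ _ : 'I_1 => bT) (mx_bound1 c0 h) (fun=> x).
by rewrite !big_ord1 -exprMn ler_pXn2r ?nnegrE ?mulr_ge0 ?nrm_ge0.
Qed.

Lemma block_expE T i v : bounded_op T -> block_exp T v i = E (corner T i) (v i).
Proof.
move=> bT; have /bounded_byP[c c0 [lT hT]] := bT.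
rewrite (@hdiagE _ _ K _ c)// => k x; apply: E_bound => //; first exact: corner_bounded.
by move=> y; exact: corner_bound.
Qed.

Lemma block_exp_A T : bounded_op T -> A (block_exp T).
Proof.
move=> bT; have /bounded_byP[c c0 [lT hT]] := bT; apply: (diag_comm c0) => i.
  exact/E_A/corner_bounded.
apply: E_bound => //; first exact: corner_bounded.
by move=> y; exact: corner_bound.
Qed.

Lemma block_exp_lin a S T : bounded_op S -> bounded_op T ->
  block_exp (a *: S + T) = a *: block_exp S + block_exp T.
Proof.
move=> bS bT; apply/funext => v; apply: hsum_eq => i.
rewrite block_expE; last exact: bounded_linc.
rewrite corner_lin E_lin; [|exact: corner_bounded|exact: corner_bounded].
rewrite -[RHS]/((a *: block_exp S v + block_exp T v) i) hvalD hvalZ.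
by rewrite !block_expE.
Qed.

Lemma block_exp_id T : A T -> block_exp T = T.
Proof.
move=> hT; apply/funext => v; apply: hsum_eq => i; rewrite block_expE; last exact: comm_bounded hT.
by rewrite E_id ?(comm_corner _ _ hT)//; exact: corner_comm.
Qed.

Lemma corner_mx_bound n (T : 'I_n -> 'I_n -> hs -> hs) c i :
  mx_bound T c -> mx_bound (fun k l => corner (T k l) i) c.
Proof.
move=> hT v; have := hT (fun k => hinj (v k)).
under [in X in _ <= X]eq_bigr => k _ do rewrite nrm_hinj.
apply: le_trans; apply: ler_sum => k _; rewrite ler_pXn2r ?nnegrE ?nrm_ge0//.
have -> : \sum_l corner (T k l) i (v l) = (\sum_l T k l (hinj (v l))) i.
  by elim/big_rec2: _ => [|l x y _ ->] //.
exact: nrm_hval.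
Qed.

Lemma block_exp_cc n (T : 'I_n -> 'I_n -> hs -> hs) c : 0 <= c ->
  (forall k l, bounded_op (T k l)) -> mx_bound T c -> mx_bound (fun k l => block_exp (T k l)) c.
Proof.
move=> c0 bT hT.
apply: (@mx_hdiag_bound _ _ K _ _ (fun k l i => E (corner (T k l) i))) => [k l v i|i v].
  exact: block_expE.
apply: (E_cc c0 _ (corner_mx_bound (i := i) hT)) => k l; exact: corner_bounded.
Qed.

End Blocks.
Arguments corner {R I K} T i x.

Section Density.
Context {R : realType}.
Local Notation C := R[i].
Implicit Types H : hilbertType R.

Lemma le_small (x k : R) : 0 <= k -> (forall e, 0 < e -> e <= 1 -> x <= e * k) -> x <= 0.
Proof.
move=> k0 h; apply: le_eps => e e0; rewrite add0r; have k1 : 0 < k + 1 by rewrite ltr_wpDl.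
have [h1|h1] := leP (e / (k + 1)) 1.
  have := h _ (divr_gt0 e0 k1) h1; have h2 : e / (k + 1) * (k + 1) = e by rewrite divfK// gt_eqF.
  have h3 : 0 < e / (k + 1) by rewrite divr_gt0.
  move: h2 h3; set t := e / _ => h2 h3; nra.
have := h 1 ltr01 (lexx _); move: h1; rewrite ltr_pdivlMr// mul1r; lra.
Qed.

Section Dense.
Context H (D : set H).
Hypothesis dD : forall x e, 0 < e -> exists2 d, D d & nrm (x - d) < e.

Lemma dense_form_bound (T : H -> H) c : bounded_op T -> 0 <= c ->
  (forall x y, D x -> D y -> nrm (dot x (T y)) <= c * nrm x * nrm y) -> forall y, nrm (T y) <= c * nrm y.
Proof.
move=> /bounded_byP[k k0 [lT hT]] c0 h y.
have hD d : D d -> nrm (T d) <= c * nrm d.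
  move=> Dd; apply: (approx_bound (P := D)); first by rewrite mulr_ge0// nrm_ge0.
    exact: dD.
  move=> x Dx; rewrite (le_trans (Re_le _))// dot_conj nrmJ (le_trans (h _ _ Dx Dd))//.
  by rewrite mulrAC.
rewrite -subr_le0; apply: (@le_small _ (k + c)); first exact: addr_ge0.
move=> e e0 _; have [d Dd hd] := dD y e0.
have h1 : nrm (T y) <= nrm (T d) + k * e.
  rewrite -[T y](subrK (T d)) addrC (le_trans (nrmD _ _))// lerD2l -(linB _ _ lT).
  by rewrite (le_trans (hT _))// ler_wpM2l// ltW.
have h2 : nrm d <= nrm y + e by rewrite -[d](subrK y) addrC (le_trans (nrmD _ _))// lerD2l nrmBC ltW.
have h3 := hD _ Dd; have h4 : c * nrm d <= c * (nrm y + e) by rewrite ler_wpM2l.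
lra.
Qed.

Lemma dense_pos (T : H -> H) : bounded_op T -> (forall d, D d -> 0 <= complex.Re (dot d (T d))) ->
  forall z, 0 <= complex.Re (dot z (T z)).
Proof.
move=> /bounded_byP[k k0 [lT hT]] h z; rewrite -oppr_le0.
apply: (@le_small _ ((k + 1) * (nrm (T z) + nrm z + (k + 1)))).
  by rewrite mulr_ge0 ?addr_ge0 ?nrm_ge0.
move=> e e0 e1; have [d Dd hd] := dD z e0.
have k1 : 0 <= k * e by rewrite mulr_ge0// ltW.
have h1 : nrm (z - d) <= (k + 1) * e by rewrite mulrDl mul1r ler_wpDl// ltW.
have h2 : nrm (T z - T d) <= (k + 1) * e.
  rewrite -(linB _ _ lT) (le_trans (hT _))// mulrDl mul1r ler_wpDr ?(ltW e0)// ler_wpM2l// ltW//.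
have h3 := dot_close h1 h2; have := Re_le_nrm (dot z (T z) - dot d (T d)).
rewrite ReB ler_norml => /andP[h4 _]; have h5 := h _ Dd.
have h6 : (k + 1) * e * (nrm (T z) + nrm z + (k + 1) * e) <= e * ((k + 1) * (nrm (T z) + nrm z + (k + 1))).
  rewrite mulrAC mulrC ler_wpM2l ?(ltW e0)// ler_wpM2l ?addr_ge0// lerD2l.
  by rewrite -[leRHS]mulr1 ler_wpM2l ?addr_ge0.
lra.
Qed.

End Dense.

Lemma norm_eventually (J : Type) (U : set_system J) {UF : ProperFilter U} (V : J -> hilbertType R)
    (x_ : forall j, V j) H (x : H) e : 0 < e ->
  tends U (fun j => dot (x_ j) (x_ j)) (dot x x) -> U [set j | nrm (x_ j) <= nrm x + e].
Proof.
move=> e0 /(_ _ (exprn_gt0 2 e0)); apply: filterS => j /= h.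
have := le_lt_trans (Re_le _) h; rewrite ReB -!nrm_dot => {}h.
rewrite -(@ler_pXn2r _ 2)// ?nnegrE ?addr_ge0 ?nrm_ge0 ?(ltW e0)//.
by have := nrm_ge0 x; nra.
Qed.

Lemma le_prod_eps (x c a b : R) : 0 <= c -> 0 <= a -> 0 <= b ->
  (forall e, 0 < e -> x <= c * (a + e) * (b + e)) -> x <= c * a * b.
Proof.
move=> c0 a0 b0 h; rewrite -subr_le0; apply: (@le_small _ (c * (a + b + 1))).
  by rewrite mulr_ge0// !addr_ge0.
move=> e e0 e1; have := h e e0.
have : c * e * e <= c * e by rewrite -[leRHS]mulr1 ler_wpM2l// mulr_ge0// ltW.
lra.
Qed.

(** (h - i)^-1 = (h + i)(1 + h^2)^-1, with the inverse supplied by coercivity. *)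
Lemma resolvent_sa H (h : H -> H) : bounded_op h -> adjoint h h ->
  exists r, [/\ bounded_by r 1, forall z, r (h z - 'i%C *: z) = z & forall z, h (r z) - 'i%C *: r z = z].
Proof.
move=> bh ha; have lh := bounded_lin bh.
have bB : bounded_op (id + (h \o h)) by apply: boundedD; [exact: bounded_id|exact: bounded_comp].
have cB z : nrm z ^+ 2 <= complex.Re (dot z ((id + (h \o h)) z)).
  by rewrite [(id + _) z]/(z + h (h z)) dotDr ReD nrm_dot lerDl -ha -nrm_dot sqr_ge0.
have [[lV hV] BV VB] := op_invP bB cB; set V := op_inv _ in lV hV BV VB.
have BVz z : V z + h (h (V z)) = z by have := congr1 (@^~ z) BV.
have VBz z : V (z + h (h z)) = z by have := congr1 (@^~ z) VB.
have Vh z : V (h z) = h (V z) by rewrite -{1}(BVz z) (linD _ _ lh) VBz.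
exists (fun z => h (V z) + 'i%C *: V z); split.
- split=> [a x y|z].
    by rewrite !lV (lh a) scalerDr [in RHS]scalerDr !scalerA mulrC addrACA.
  rewrite mul1r -(@ler_pXn2r _ 2)// ?nnegrE ?nrm_ge0// nrmD_sq nrmZ nrm_i mul1r dotZr ReiM.
  have -> : complex.Im (dot (h (V z)) (V z)) = 0.
    have e := dot_conj (h (V z)) (V z); rewrite -ha in e.
    by have := congr1 (@complex.Im R) e; rewrite ImJ; lra.
  have h1 : nrm (h (V z)) ^+ 2 + nrm (V z) ^+ 2 = complex.Re (dot (V z) z).
    by rewrite -{4}(BVz z) dotDr ReD -nrm_dot -ha -nrm_dot addrC.
  have h2 := CS_Re (V z) z; have h3 := hV z; rewrite mul1r in h3.
  have := nrm_ge0 z; have := nrm_ge0 (V z); nra.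
- move=> z; rewrite (linB _ _ lV) (linZ _ _ lV) Vh (linB _ _ lh) (linZ _ _ lh) scalerBr scalerA mulii.
  by rewrite scaleN1r opprK addrA subrK addrC.
- move=> z; rewrite (linD _ _ lh) (linZ _ _ lh) scalerDr scalerA mulii scaleN1r opprD opprK.
  by rewrite addrA addrK addrC.
Qed.

End Density.

Lemma vpoly_lc {R : realType} (H : hilbertType R) (L : Type) (f : L -> H -> H) a v w z :
  vpoly f (flc a v w) z = a *: vpoly f v z + vpoly f w z.
Proof. exact: fsum_lc. Qed.

Lemma vpoly_word {R : realType} (H : hilbertType R) (L : Type) (f : L -> H -> H) s z :
  vpoly f (fword s) z = vword f s z.
Proof. exact: fsum_word. Qed.

Section IteratedFilter.
Context {L : Type} {I0 : Type} (G : set_system I0) {GF : ProperFilter G}.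
Local Notation Q := (seq (seq L) * nat)%type.

(** An iterated limit: the index of a polynomial approximant is fixed first, and the model then goes
    to its own limit. Moments converge without uniformity in the polynomial, so the two cannot be
    taken together. *)
Definition iter_filter : set_system (Q * I0) :=
  [set S | exists ws n0, forall ws' n, (forall w, List.In w ws -> List.In w ws') -> (n0 <= n)%N ->
    G [set i | S ((ws', n), i)]].

Lemma iter_filter_proper : ProperFilter iter_filter.
Proof.
split.
  move=> [ws [n0 h]]; have := h ws n0 (fun w => id) (leqnn _).
  exact: filter_not_empty.
split.
- by exists [::], 0%N => ws' n _ _; exact: filterT.
- move=> S1 S2 [w1 [n1 h1]] [w2 [n2 h2]]; exists (w1 ++ w2), (maxn n1 n2) => ws n hw.
  rewrite geq_max => /andP[le1 le2]; apply: filterI.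
    by apply: h1 => // w hw1; apply/hw/List.in_or_app; left.
  by apply: h2 => // w hw1; apply/hw/List.in_or_app; right.
- move=> S1 S2 S12 [w1 [n1 h1]]; exists w1, n1 => ws n hw hn.
  by apply: filterS (h1 _ _ hw hn) => i; exact: S12.
Qed.

Lemma iter_filter_snd S : G S -> iter_filter [set j | S j.2].
Proof. by move=> GS; exists [::], 0%N. Qed.

End IteratedFilter.

(** * Compression of a product of models to the limit space *)

Section Ultraproduct.
Context {R : realType} (F : hilbertType R) (Om : F) (L : choiceType) (op : L -> F -> F).
Local Notation C := R[i].
Hypotheses (op_b : forall l, bounded_op (op l)) (op_sa : forall l, adjoint (op l) (op l)).
Context (P : pred L).
Hypothesis op_comm : forall l l' z, P l -> ~~ P l' -> op l (op l' z) = op l' (op l z).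
Hypothesis sep : separating Om op P.
Hypothesis cyclic : forall z, (forall w, all P w -> dot (vword op w Om) z = 0) -> z = 0.
Context (I0 : choiceType) (G : set_system I0) {GF : ProperFilter G}.
Context (K : I0 -> hilbertType R) (Om_ : forall i, K i) (xi : forall i, L -> K i -> K i).
Arguments xi : clear implicits.
Hypotheses (xi_b : forall i l, bounded_op (xi i l)) (xi_sa : forall i l, adjoint (xi i l) (xi i l)).
Context (Y : forall i, set (K i -> K i)) (E : forall i, (K i -> K i) -> (K i -> K i)).
Hypothesis Ys : forall i, star_closed (@Y i).
Hypothesis E_A : forall i (T : K i -> K i), bounded_op T -> commutant (@Y i) (E T).
Hypothesis E_lin : forall i a (S T : K i -> K i), bounded_op S -> bounded_op T ->
  E (a *: S + T) = a *: E S + E T.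
Hypothesis E_id : forall i (T : K i -> K i), commutant (@Y i) T -> E T = T.
Hypothesis E_cc : forall i n (T : 'I_n -> 'I_n -> K i -> K i) c, 0 <= c ->
  (forall k l, bounded_op (T k l)) -> mx_bound T c -> mx_bound (fun k l => E (T k l)) c.
Hypothesis xi_x : forall i l, P l -> commutant (@Y i) (xi i l).
Hypothesis xi_y : forall i l (T : K i -> K i) x, ~~ P l -> commutant (@Y i) T ->
  T (xi i l x) = xi i l (T x).
Hypothesis mom : forall w,
  tends G (fun i => dot (Om_ i) (vword (xi i) w (Om_ i))) (dot Om (vword op w Om)).

Local Notation J := ((seq (seq L) * nat) * I0)%type.
Context (U : set_system J) {UU : UltraFilter U} (GU : iter_filter G `<=` U).
Local Notation formal := (seq (C * seq L)).
Local Notation KK := (fun j : J => K j.2).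
Local Notation hs := (hsum J KK).
Local Notation YY := (block_letters (fun j : J => @Y j.2)).
Local Notation A := (commutant YY).
Implicit Types (u v w : formal) (a : hs -> hs).

Definition vF v : F := vpoly op v Om.
Definition vK i v : K i := vpoly (xi i) v (Om_ i).

Let U_snd S : G S -> U [set j | S j.2]. Proof. by move=> /(@iter_filter_snd L)/GU. Qed.

Lemma moment_polyG v w : tends G (fun i => dot (vK i v) (vK i w)) (dot (vF v) (vF w)).
Proof.
have -> : (fun i => dot (vK i v) (vK i w)) = (fun i =>
    \sum_(p <- v) \sum_(r <- w) (p.1^* * r.1) * dot (Om_ i) (vword (xi i) (rev p.2 ++ r.2) (Om_ i))).
  apply/funext => i; rewrite /vK /vpoly /fsum dot_suml; apply: eq_bigr => p _.
  rewrite dot_sumr; apply: eq_bigr => r _; rewrite dotZl dotZr mulrA; congr (_ * _).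
  by rewrite (vword_adj (@xi_sa i)) vword_cat.
have -> : dot (vF v) (vF w) =
    \sum_(p <- v) \sum_(r <- w) (p.1^* * r.1) * dot Om (vword op (rev p.2 ++ r.2) Om).
  rewrite /vF /vpoly /fsum dot_suml; apply: eq_bigr => p _.
  rewrite dot_sumr; apply: eq_bigr => r _; rewrite dotZl dotZr mulrA; congr (_ * _).
  by rewrite (vword_adj op_sa) vword_cat.
by apply: tends_sum => p; apply: tends_sum => r; exact: tendsM.
Qed.

Lemma moment_poly v w : tends U (fun j => dot (vK j.2 v) (vK j.2 w)) (dot (vF v) (vF w)).
Proof. by move=> e e0; exact: U_snd (moment_polyG v w e0). Qed.

Lemma vF_dense z e : 0 < e -> exists2 d, range vF d & nrm (z - d) < e.
Proof.
have W0 : range vF 0 by exists [::] => //; rewrite /vF /vpoly fsum_nil.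
have W_lin (c : C) x y : range vF x -> range vF y -> range vF (c *: x + y).
  by move=> [v _ <-] [w _ <-]; exists (flc c v w) => //; rewrite /vF /vpoly fsum_lc.
have [Pj [bP P1 P2 P3]] := projection_ex W0 W_lin => e0.
have zP : z - Pj z = 0.
  apply: cyclic => w hw; rewrite dot_conj P2 ?rmorph0//.
  by exists (fword w) => //; rewrite /vF /vpoly fsum_word.
have [d hd1 hd2] := P1 z _ e0; exists d => //.
by move/eqP: zP; rewrite subr_eq0 => /eqP ->.
Qed.

Lemma vF_ext x y : (forall v, dot (vF v) x = dot (vF v) y) -> x = y.
Proof.
move=> h; apply: (dense_dot_ext (D := range vF)); first exact: vF_dense.
by move=> _ [v _ <-].
Qed.

Lemma vF_op_ext (S T : F -> F) : bounded_op S -> bounded_op T ->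
  (forall v w, dot (vF v) (S (vF w)) = dot (vF v) (T (vF w))) -> S = T.
Proof.
move=> bS bT h; apply/funext => z; apply: vF_ext => v.
rewrite -(dot_adjl _ _ bS) -(dot_adjl _ _ bT); congr (dot _ z).
apply: vF_ext => w; rewrite [LHS]dot_conj [RHS]dot_conj; congr (_^*).
by rewrite !dot_adjl.
Qed.

Section Columns.
Context {n : nat}.
Implicit Types s t : 'I_n -> formal.

Definition colF s : hsum 'I_n (fun=> F) := hfin (K := fun=> F) (fun k => vF (s k)).
Definition colK i s : hsum 'I_n (fun=> K i) := hfin (K := fun=> K i) (fun k => vK i (s k)).

Lemma colK_eventually s e : 0 < e -> U [set j | nrm (colK j.2 s) <= nrm (colF s) + e].
Proof.
move=> e0; apply: norm_eventually => //.
rewrite dot_fin; under eq_fun do rewrite dot_fin.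
by apply: tends_sum => k; exact: moment_poly.
Qed.

Lemma form_bound (T : 'I_n -> 'I_n -> hs -> hs) c s t (l : C) : 0 <= c -> mx_bound T c ->
  tends U (fun j => \sum_k \sum_m dot (vK j.2 (s k)) (corner (T k m) j (vK j.2 (t m)))) l ->
  nrm l <= c * nrm (colF s) * nrm (colF t).
Proof.
move=> c0 hT hl; apply: le_prod_eps; rewrite ?nrm_ge0// => e e0.
apply: (tends_le hl); apply: filterS2 (colK_eventually s e0) (colK_eventually t e0) => j /= h1 h2.
pose y := hfin (K := fun=> K j.2) (fun k => \sum_m corner (T k m) j (vK j.2 (t m))).
have -> : \sum_k \sum_m dot (vK j.2 (s k)) (corner (T k m) j (vK j.2 (t m))) = dot (colK j.2 s) y.
  by rewrite dot_fin; apply: eq_bigr => k _; rewrite dot_sumr.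
rewrite (le_trans (CS _ _))//.
have hy : nrm y <= c * nrm (colK j.2 t).
  rewrite -(@ler_pXn2r _ 2)// ?nnegrE ?mulr_ge0 ?nrm_ge0// exprMn !nrm_fin.
  exact: (corner_mx_bound (i := j) hT).
rewrite mulrAC mulrC; apply: ler_pM => //; rewrite ?nrm_ge0//.
by rewrite (le_trans hy)// ler_wpM2l.
Qed.

End Columns.

(** T is the compression of the class of a to the span of the words on the vacuum. Other vectors of
    the ultraproduct are discarded, and multiplicativity with them. *)
Definition represents a (T : F -> F) : Prop := bounded_op T /\
  forall v w, tends U (fun j => dot (vK j.2 v) (corner a j (vK j.2 w))) (dot (vF v) (T (vF w))).

Lemma vK_eventually v e : 0 < e -> U [set j | nrm (vK j.2 v) <= nrm (vF v) + e].
Proof. by move=> e0; apply: norm_eventually => //; exact: moment_poly. Qed.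

Lemma represents_ex a : A a -> exists T, represents a T.
Proof.
move=> Aa; have ba := comm_bounded Aa; have /bounded_byP[c c0 [la hc]] := ba.
pose B v w := ulim U (fun j => dot (vK j.2 v) (corner a j (vK j.2 w))).
have hB v w : tends U (fun j => dot (vK j.2 v) (corner a j (vK j.2 w))) (B v w).
  apply: (@ulimP _ _ U UU _ ((nrm (vF v) + 1) * (c * (nrm (vF w) + 1)))).
  apply: filterS2 (vK_eventually v ltr01) (vK_eventually w ltr01) => j /= h1 h2.
  rewrite (le_trans (CS _ _))// ler_pM ?nrm_ge0// (le_trans (corner_bound _ hc))//.
  by rewrite ler_wpM2l.
have [|k x y z|k x y z|x y|z e e0|T [lT hT TB]] :=
    @form_op _ F formal flc [::] vF B c c0 _ _ _ _ _.
- by move=> k x y; rewrite /vF /vpoly fsum_lc.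
- apply: (tends_uniq (hB _ _)).
  apply: tends_eq (tendsD (tendsM k (hB x y)) (hB x z)); apply: filterE => j /=.
  rewrite /vK /vpoly fsum_lc -dotZr -dotDr; congr (dot _ _).
  by rewrite (bounded_lin (corner_bounded j ba)).
- apply: (tends_uniq (hB _ _)).
  apply: tends_eq (tendsD (tendsM k^* (hB x z)) (hB y z)); apply: filterE => j /=.
  by rewrite /vK /vpoly fsum_lc dotDl dotZl.
- have h1 := @form_bound 1 (fun _ _ => a) c (fun=> x) (fun=> y) (B x y) c0 (mx_bound1 c0 hc).
  have nc s : nrm (@colF 1 (fun=> s)) = nrm (vF s).
    by apply/eqP; rewrite -(@eqrXn2 _ 2)// ?nrm_ge0// nrm_fin big_ord1.
  rewrite !nc in h1; apply: h1.
  by apply: tends_eq (hB x y); apply: filterE => j /=; rewrite !big_ord1.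
- by have [_ [x _ <-] hx] := vF_dense z e0; exists x.
exists T; split; first exact: bounded_opI c0 (conj lT hT).
by move=> v w; rewrite -TB.
Qed.

Definition ultra a : F -> F := pick_op (represents a).

Lemma ultraP a : A a -> represents a (ultra a).
Proof. by move=> /represents_ex; exact: pick_opP. Qed.

Lemma ultra_uniq a T : A a -> represents a T -> ultra a = T.
Proof.
move=> Aa [bT hT]; have [bS hS] := ultraP Aa.
by apply: vF_op_ext => // v w; exact: tends_uniq (hS v w) (hT v w).
Qed.

Lemma ultra_bounded a : A a -> bounded_op (ultra a). Proof. by case/ultraP. Qed.

Lemma ultra_lin c a b : A a -> A b -> ultra (c *: a + b) = c *: ultra a + ultra b.
Proof.
move=> Aa Ab; have YYs := block_letters_star (fun j : J => @Ys j.2).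
have [bS hS] := ultraP Aa; have [bT hT] := ultraP Ab.
apply: ultra_uniq; first exact: comm_lin.
split=> [|v w]; first exact: bounded_linc.
rewrite -[(_ + _) _]/(c *: ultra a (vF w) + ultra b (vF w)) dotDr dotZr.
apply: tends_eq (tendsD (tendsM c (hS v w)) (hT v w)); apply: filterE => j /=.
by rewrite -dotZr -dotDr.
Qed.

Lemma ultra_adj a : A a -> ultra (adj a) = adj (ultra a).
Proof.
move=> Aa; have YYs := block_letters_star (fun j : J => @Ys j.2).
have [bS hS] := ultraP Aa; have ba := comm_bounded Aa.
apply: ultra_uniq; first exact: comm_adj.
split=> [|v w]; first exact: adj_bounded.
rewrite dot_adjr// dot_conj; apply: tends_eq (tends_conj (hS w v)); apply: filterE => j /=.
rewrite corner_adj// dot_adjr; last exact: corner_bounded.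
by rewrite -dot_conj.
Qed.

Lemma ultra_id : ultra id = id.
Proof.
apply: ultra_uniq; first exact: comm_id.
split=> [|v w]; first exact: bounded_id.
apply: tends_eq (moment_poly v w); apply: filterE => j /=.
by rewrite corner_id.
Qed.

(** A right letter, moved from one side of a coefficient to the other, only turns a word vector into
    another word vector; no uniform bound on the letter is needed. *)
Lemma ultra_comm a : A a -> commutant (letters op (predC P)) (ultra a).
Proof.
move=> Aa; have [bS hS] := ultraP Aa; apply: commI => // _ z [l Pl ->].
suff e : ultra a \o op l = op l \o ultra a by exact: (congr1 (@^~ z) e).
apply: vF_op_ext => [||v w]; [exact: bounded_comp|exact: bounded_comp|].
have vFc s : op l (vF s) = vF (fcons l s).
  by rewrite /vF /vpoly (fsum_lin _ _ (bounded_lin (op_b l))) fsum_cons.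
have vKc i s : xi i l (vK i s) = vK i (fcons l s).
  by rewrite /vK /vpoly (fsum_lin _ _ (bounded_lin (xi_b i l))) fsum_cons.
have h1 := hS v (fcons l w); rewrite -vFc in h1.
have h2 := hS (fcons l v) w; rewrite -vFc op_sa in h2.
apply: (tends_uniq h1); apply: tends_eq h2; apply: filterE => j /=.
rewrite -!vKc (@xi_sa j.2) (xi_y _ Pl)//; exact: (corner_comm j Aa).
Qed.

Lemma ultra_cc n (T : 'I_n -> 'I_n -> hs -> hs) c : 0 <= c ->
  (forall k l, A (T k l)) -> mx_bound T c -> mx_bound (fun k l => ultra (T k l)) c.
Proof.
move=> c0 AT hT; have bT k l := ultra_bounded (AT k l).
apply/(mx_bounded_by c0 (fun k l => bounded_lin (bT k l))).
have bM := mxop_bounded bT; split; first exact: bounded_lin.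
apply: (dense_form_bound (D := range (@colF n))) => //.
- move=> x e e0; have n1 : 0 < n.+1%:R :> R by [].
  have h k : exists s, nrm (x k - vF s) < e / n.+1%:R.
    by have [_ [s _ <-] hs'] := vF_dense (x k) (divr_gt0 e0 n1); exists s.
  have [s hs'] := choice_ex h; exists (colF s); first by exists s.
  rewrite -(@ltr_pXn2r _ 2)// ?nnegrE ?nrm_ge0 ?(ltW e0)// nrm_fin.
  have h2 : \sum_k nrm ((x - colF s) k) ^+ 2 <= \sum_(k < n) (e / n.+1%:R) ^+ 2.
    apply: ler_sum => k _; rewrite ler_pXn2r ?nnegrE ?nrm_ge0 ?divr_ge0 ?(ltW e0)// ltW//.
    by rewrite hvalD hvalN hs'.
  rewrite (le_lt_trans h2)// sumr_const card_ord -[_ *+ n]mulr_natl.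
  have : e / n.+1%:R * n.+1%:R = e by rewrite divfK// gt_eqF.
  have : 0 < e / n.+1%:R by rewrite divr_gt0.
  have : 0 <= n%:R :> R by [].
  rewrite -[n.+1%:R]natr1; move: (n%:R : R) (e / _) => m r m0 r0 <-.
  by have : 0 < r ^+ 2 * (m ^+ 2 + m + 1); [rewrite mulr_gt0 ?exprn_gt0 ?ltr_wpDl ?addr_ge0 ?sqr_ge0|nra].
move=> _ _ [s _ <-] [t _ <-].
have -> : dot (colF s) (mxop (fun k l => ultra (T k l)) (colF t)) =
    \sum_k \sum_m dot (vF (s k)) (ultra (T k m) (vF (t m))).
  by rewrite dot_fin; apply: eq_bigr => k _; rewrite dot_sumr.
apply: (form_bound c0 hT); apply: tends_sum => k; apply: tends_sum => m.
by have [_] := ultraP (AT k m).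
Qed.

Lemma ultra_schwarz a z : A a ->
  nrm (ultra a z) ^+ 2 <= complex.Re (dot z (ultra (adj a \o a) z)).
Proof.
move=> Aa; have YYs := block_letters_star (fun j : J => @Ys j.2).
have [bS hS] := ultraP Aa; have ba := comm_bounded Aa.
have Aaa : A (adj a \o a) by apply: comm_comp => //; exact: comm_adj.
have [bT hT] := ultraP Aaa.
have bSS : bounded_op (adj (ultra a) \o ultra a) by exact: bounded_comp (adj_bounded bS) bS.
have bD : bounded_op (ultra (adj a \o a) - (adj (ultra a) \o ultra a)) by exact: boundedB.
suff h : 0 <= complex.Re (dot z ((ultra (adj a \o a) - (adj (ultra a) \o ultra a)) z)).
  move: h; rewrite -[(_ - _) z]/(ultra (adj a \o a) z - adj (ultra a) (ultra a z)) dotBr ReB dot_adjr//.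
  by rewrite -nrm_dot subr_ge0.
apply: (dense_pos vF_dense bD) => _ [v _ <-].
rewrite -[(_ - _) (vF v)]/(ultra (adj a \o a) (vF v) - adj (ultra a) (ultra a (vF v))) dotBr ReB dot_adjr//.
rewrite -nrm_dot subr_ge0; set y := ultra a (vF v); set s := complex.Re _.
(* In each model 2 Re<u, av> <= |u|^2 + |av|^2, and |av|^2 is a coefficient of a*a; all terms pass
   to the limit. Letting u tend to y gives |y|^2 <= s. *)
have key u : 2 * complex.Re (dot (vF u) y) <= nrm (vF u) ^+ 2 + s.
  have h1 := tendsM 2 (hS u v); have h2 := tendsD (moment_poly u u) (hT v v).
  have := tends_Re_le (h1 _) (h2 _); rewrite natC ReZ ReD -nrm_dot; apply.
  apply: filterE => j /=; rewrite ReZ ReD -nrm_dot (corner_comp _ _ (comm_adj YYs Aa)).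
  rewrite corner_adj// /= dot_adjr; last exact: corner_bounded.
  rewrite -nrm_dot; have := CS_Re (vK j.2 u) (corner a j (vK j.2 v)).
  by have := sqr_ge0 (nrm (vK j.2 u) - nrm (corner a j (vK j.2 v))); nra.
rewrite -subr_le0; apply: (@le_small _ _ (4 * nrm y + 1)); first by rewrite addr_ge0// mulr_ge0// nrm_ge0.
move=> e e0 e1; have [_ [u _ <-] hu] := vF_dense y e0.
have h1 := key u; have h2 : nrm (vF u) <= nrm y + e.
  by rewrite -[vF u](subrK y) addrC (le_trans (nrmD _ _))// lerD2l nrmBC ltW.
have h3 : nrm y ^+ 2 - e * nrm y <= complex.Re (dot (vF u) y).
  have -> : vF u = y - (y - vF u) by rewrite opprB addrC subrK.
  rewrite dotBl ReB -nrm_dot lerD2l lerN2 (le_trans (CS_Re _ _))// ler_wpM2r ?nrm_ge0// ltW//.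
have h4 : nrm (vF u) ^+ 2 <= (nrm y + e) ^+ 2.
  by rewrite ler_pXn2r// nnegrE ?addr_ge0 ?nrm_ge0// ltW.
have := nrm_ge0 y; nra.
Qed.

Section Resolvent.
Context (x : F -> F) (bx : bounded_op x) (pol : seq (seq L) * nat -> formal).
Hypothesis hpol : forall ws n (w : seq L), List.In w ws ->
  nrm (x (vword op w Om) - vpoly op (pol (ws, n)) (vword op w Om)) < n.+1%:R^-1.

Let fmulw v s : formal := [seq (p.1, p.2 ++ s) | p <- v].
Let vpoly_mulw (H : hilbertType R) (f : L -> H -> H) (z : H) v s :
  vpoly f (fmulw v s) z = vpoly f v (vword f s z).
Proof. by rewrite /vpoly /fsum big_map; apply: eq_bigr => p _; rewrite /= vword_cat. Qed.

(* a = (p(xi) - sg)^-1 for polynomials p approximating x. *)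
Lemma ultra_inverse a (sg : C) : A a ->
  (forall j z, corner a j (vpoly (xi j.2) (pol j.1) z - sg *: z) = z) ->
  forall z, ultra a (x z - sg *: z) = z.
Proof.
move=> Aa ha; have [bS hS] := ultraP Aa; have ba := comm_bounded Aa.
have /bounded_byP[c c0 [la hc]] := ba; have /bounded_byP[k k0 [lS hk]] := bS.
have lx := bounded_lin bx.
suff key u s : dot (vF u) (ultra a (x (vF (fword s)) - sg *: vF (fword s))) = dot (vF u) (vF (fword s)).
  have bT : bounded_op (ultra a \o (x - sg *: id)).
    by apply: bounded_comp => //; apply: boundedB => //; apply: boundedZ; exact: bounded_id.
  suff e : ultra a \o (x - sg *: id) = id by move=> z; exact: (congr1 (@^~ z) e).
  apply: vF_op_ext => // [|u v]; first exact: bounded_id.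
  have lT := bounded_lin bT; set T := _ \o _ in lT bT *.
  have hT s : T (vword op s Om) = vword op s Om.
    apply: vF_ext => w; have := key w s; rewrite /vF /vpoly fsum_word //.
  by congr (dot _ _); rewrite {1}/vF /vpoly (fsum_lin _ _ lT); exact: eq_fsum.
set w := vF (fword s); have wE : w = vword op s Om by rewrite /w /vF /vpoly fsum_word.
apply/eqP; rewrite -subr_eq0; apply/eqP.
apply: (@eq_small _ _ (nrm (vF u) * k + (nrm (vF u) + 1) * (c * 3))).
  by rewrite addr_ge0 ?mulr_ge0 ?addr_ge0 ?nrm_ge0.
move=> e e0 e1; have [_ [v _ <-] hv] := vF_dense (x w - sg *: w) e0.
have -> : dot (vF u) (ultra a (x w - sg *: w)) - dot (vF u) w =
    dot (vF u) (ultra a (x w - sg *: w - vF v)) + (dot (vF u) (ultra a (vF v)) - dot (vF u) w).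
  by rewrite (linB _ (vF v) lS) dotBr; ring.
rewrite (le_trans (nrmD _ _))// mulrDr; apply: lerD.
  rewrite (le_trans (CS _ _))// mulrCA ler_wpM2l ?nrm_ge0// (le_trans (hk _))// mulrC.
  by rewrite ler_wpM2r// ltW.
apply: (tends_le (tendsB (hS u v) (moment_poly u (fword s)))).
(* D is the polynomial v - (p - sg) s. The operator a inverts p - sg in every model, so a v - s = a
   D there, and D is small: in F the vector v is within e of x s - sg s, and p s within e of x s. *)
pose D q := flc (-1) (fmulw (pol q) s) (flc sg (fword s) v).
have hD : U [set j | nrm (vK j.2 (D j.1)) <= 3 * e].
  have [n0 hn0] := invS_small e0.
  apply: GU; exists [:: s], n0 => ws n hws hn.
  have hF : nrm (vF (D (ws, n))) <= 2 * e.
    have -> : vF (D (ws, n)) = (x w - vpoly op (pol (ws, n)) w) - (x w - sg *: w - vF v).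
      rewrite {1}/vF !vpoly_lc vpoly_mulw vpoly_word -wE scaleN1r -/(vF v).
      rewrite opprD opprK opprB [x w - _]addrC -[RHS]addrA; congr (_ + _).
      by rewrite addrA [x w + _]addrC subrK.
    rewrite (le_trans (nrmB _ _))// mulr_natl mulr2n lerD ?(ltW hv)//.
    have := hpol n (hws s (or_introl erefl)); rewrite -wE => h; rewrite ltW// (lt_trans h)//.
    exact: hn0.
  apply: filterS (norm_eventually e0 (moment_polyG (D (ws, n)) (D (ws, n)))) => i /= h.
  by rewrite (le_trans h)//; lra.
apply: filterS2 (vK_eventually u ltr01) hD => j /= h1 h2.
rewrite -dotBr (le_trans (CS _ _))// mulrCA; apply: ler_pM; rewrite ?nrm_ge0//.
have lc := bounded_lin (corner_bounded j ba).
have -> : corner a j (vK j.2 v) - vK j.2 (fword s) = corner a j (vK j.2 (D j.1)).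
  rewrite -[X in _ - X](ha j) -(linB _ _ lc); congr (corner a j _).
  rewrite /vK !vpoly_lc vpoly_mulw !vpoly_word.
  by rewrite scaleN1r opprB [LHS]addrC [X in X + _]addrC -addrA.
rewrite (le_trans (corner_bound _ hc))// (_ : e * (c * 3) = c * (3 * e)); last by ring.
by rewrite ler_wpM2l.
Qed.

End Resolvent.

Lemma ultra_resolvent x : commutant (letters op (predC P)) x -> adj x = x -> exists a, [/\ A a,
  ultra (adj a \o a) = adj (ultra a) \o ultra a,
  ultra (a \o adj a) = ultra a \o adj (ultra a),
  (forall z, ultra a (x z - 'i%C *: z) = z) & (forall z, ultra (adj a) (x z + 'i%C *: z) = z)].
Proof.
move=> Mx ax; have bx := comm_bounded Mx; have YYs := block_letters_star (fun j : J => @Ys j.2).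
have [pol hpol] : exists pol : seq (seq L) * nat -> formal, forall q, fall P (pol q) /\
    forall w : seq L, List.In w q.1 -> nrm (x (vword op w Om) -
      vpoly op (flc 1 (pol q) (fstar (pol q))) (vword op w Om)) < q.2.+1%:R^-1.
  apply: (choice_ex (P := fun q p => fall P p /\ forall w : seq L, List.In w q.1 -> nrm (x (vword op w Om) -
      vpoly op (flc 1 p (fstar p)) (vword op w Om)) < q.2.+1%:R^-1)) => -[ws n] /=.
  have e0 : 0 < n.+1%:R^-1 :> R by rewrite invr_gt0.
  have [v hv hz] := strong_approx_sa op_b op_sa op_comm sep cyclic
    (fun k : 'I_(size ws) => vword op (nth [::] ws k) Om) Mx ax e0.
  exists v; split=> // w hw.
  have {}hw : w \in ws by elim: ws hw {hz} => //= s ws IH [->|/IH h]; rewrite inE ?eqxx// h orbT.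
  have hi : (index w ws < size ws)%N by rewrite index_mem.
  by have := hz (Ordinal hi); rewrite /= nth_index.
pose pl q := flc 1 (pol q) (fstar (pol q)).
pose h (j : J) : K j.2 -> K j.2 := vpoly (xi j.2) (pl j.1).
have bh j : bounded_op (h j) by exact: vpoly_bounded.
have sh j : adjoint (h j) (h j).
  move=> y z; rewrite /h vpoly_adj; last exact: xi_sa.
  by rewrite /pl /vpoly fsum_star_lc fsum_lc conjC1 !scale1r fsum_starK addrC.
have Yh j : commutant (@Y j.2) (h j).
  have hp : fall P (pl j.1) by have [hp _] := hpol j.1; apply: fall_lc hp (fall_star hp).
  rewrite /h; have -> : vpoly (xi j.2) (pl j.1) = \sum_(p <- pl j.1) p.1 *: vword (xi j.2) p.2.
    by apply/funext => z; rewrite fct_sumE.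
  elim: (pl j.1) hp => [|p v IH] /=; first by rewrite big_nil => _; exact: comm0.
  move=> /andP[h1 /IH h2]; rewrite big_cons; apply: commD => //; apply: commZ => //.
  elim: p.2 h1 => [|l s IHs] /=; first by move=> _; exact: comm_id.
  by move=> /andP[Pl /IHs hs1]; apply: comm_comp hs1; exact: xi_x.
have [r hr] : exists r : forall j, K j.2 -> K j.2, forall j, [/\ bounded_by (r j) 1,
    forall z, r j (h j z - 'i%C *: z) = z & forall z, h j (r j z) - 'i%C *: r j z = z].
  exists (fun j => projT1 (cid (resolvent_sa (bh j) (@sh j)))) => j.
  exact: projT2 (cid (resolvent_sa (bh j) (@sh j))).
have br j : bounded_op (r j) by have [h1 _ _] := hr j; exact: bounded_opI ler01 h1.
have hr1 j z : nrm (r j z) <= 1 * nrm z by have [[_ h1] _ _] := hr j.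
have Yr j : commutant (@Y j.2) (r j).
  have [_ h1 h2] := hr j; apply: commI => // y z Yy; have [by_ _] := Ys Yy.
  have ly := bounded_lin by_.
  rewrite -{1}(h2 z) (linB _ _ ly) (linZ _ _ ly) -(comm_commute _ (Yh j) Yy).
  by rewrite h1.
(* The resolvents are contractions, so they form an element of the bounded product, whatever the
   norms of the polynomials h j. *)
pose a := hdiag r : hs -> hs.
have Aa : A a by exact: (diag_comm _ ler01 Yr hr1).
have ba := comm_bounded Aa; have Aad : A (adj a) by exact: comm_adj.
have ca j : corner a j = r j by exact: corner_diag hr1.
have r_adj j z : adj (r j) (h j z + 'i%C *: z) = z.
  have [_ _ h2] := hr j; apply: dot_ext => y; rewrite dot_adjr// dotDr dotZr -sh.
  by rewrite -[in RHS](h2 y) dotBl dotZl conj_i mulNr opprK.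
have hpol' ws n (w : seq L) : List.In w ws -> nrm (x (vword op w Om) - vpoly op (pl (ws, n)) (vword op w Om)) < n.+1%:R^-1.
  by have [_ h1] := hpol (ws, n) => /h1.
have e1 z : ultra a (x z - 'i%C *: z) = z.
  apply: (ultra_inverse bx hpol' Aa) => j y; rewrite ca; have [_ h1 _] := hr j; exact: h1.
have e2 z : ultra (adj a) (x z + 'i%C *: z) = z.
  have := @ultra_inverse x bx pl hpol' (adj a) (- 'i%C) Aad _ z; rewrite scaleNr opprK; apply.
  by move=> j y; rewrite corner_adj// ca scaleNr opprK; exact: r_adj.
have bu := ultra_bounded Aa; have bu' := adj_bounded bu.
have e3 z : x (ultra a z) - 'i%C *: ultra a z = z.
  apply: dot_ext => y; rewrite -[in RHS](e2 y) ultra_adj// dot_adjl//.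
  by rewrite dotBr dotDl dotZr dotZl conj_i mulNr -{1}ax dot_adjr.
have e4 z : x (adj (ultra a) z) + 'i%C *: adj (ultra a) z = z.
  apply: dot_ext => y; rewrite -[in RHS](e1 y) -[RHS](dot_adjr _ _ bu).
  by rewrite dotDr dotBl dotZr dotZl conj_i mulNr opprK -{1}ax dot_adjr.
have e2' z : adj (ultra a) (x z + 'i%C *: z) = z by rewrite -ultra_adj.
have li2 : (2 * 'i%C)^-1 * (2 * 'i%C) = 1 :> C.
  by rewrite mulVf// mulf_eq0 negb_or pnatr_eq0 /=; apply/eqP => h1; have := mulii (R := R); rewrite h1 mulr0 => /eqP; rewrite eq_sym oppr_eq0 oner_eq0.
(* resolvent identity: r*r = (r - r* )/2i = rr* *)
have resF (H : hilbertType R) (g s s' : H -> H) : linear s -> linear s' ->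
    (forall z, s (g z - 'i%C *: z) = z) -> (forall z, g (s z) - 'i%C *: s z = z) ->
    (forall z, s' (g z + 'i%C *: z) = z) -> (forall z, g (s' z) + 'i%C *: s' z = z) ->
    s' \o s = (2 * 'i%C)^-1 *: (s - s') /\ s \o s' = (2 * 'i%C)^-1 *: (s - s').
  move=> ls ls' h1 h2 h3 h4.
  have two (b t : H) : b + t - (b - t) = t + t by rewrite opprB addrC addrA subrK.
  have t1 z : s z - s' z = (2 * 'i%C) *: s' (s z).
    have e5 : s' z = s' (g (s z)) - 'i%C *: s' (s z) by rewrite -{1}(h2 z) (linB _ _ ls') (linZ _ _ ls').
    have e6 : s z = s' (g (s z)) + 'i%C *: s' (s z) by rewrite -[LHS]h3 (linD _ _ ls') (linZ _ _ ls').
    by rewrite [X in X - _]e6 e5 two -scalerA scaler_nat mulr2n.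
  have t2 z : s z - s' z = (2 * 'i%C) *: s (s' z).
    have e5 : s' z = s (g (s' z)) - 'i%C *: s (s' z) by rewrite -[LHS]h1 (linB _ _ ls) (linZ _ _ ls).
    have e6 : s z = s (g (s' z)) + 'i%C *: s (s' z) by rewrite -{1}(h4 z) (linD _ _ ls) (linZ _ _ ls).
    by rewrite e6 [X in _ - X]e5 two -scalerA scaler_nat mulr2n.
  split; apply/funext => z; rewrite -[RHS]/(_ *: (s z - s' z)).
    by rewrite t1 scalerA li2 scale1r.
  by rewrite t2 scalerA li2 scale1r.
have rel (b : hs -> hs) : A b -> (forall j, corner b j = (2 * 'i%C)^-1 *: (r j - adj (r j))) ->
    ultra b = (2 * 'i%C)^-1 *: (ultra a - adj (ultra a)).
  move=> Abb hb; have -> : b = (2 * 'i%C)^-1 *: (a - adj a).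
    apply/funext => v; apply: hsum_eq => j; rewrite (comm_corner _ _ Abb) hb.
    rewrite -[RHS]/(((2 * 'i%C)^-1 *: (a v - adj a v)) j) hvalZ hvalD hvalN.
    by rewrite (comm_corner _ _ Aa) (comm_corner _ _ Aad) corner_adj// ca.
  have Aab : A (a - adj a) by exact: commB.
  have := ultra_lin (2 * 'i%C)^-1 Aab (comm0 YYs); rewrite addr0 => ->.
  have u0 : ultra 0 = 0.
    have h1 := ultra_lin (-1) (comm0 YYs) (comm0 YYs).
    by rewrite scaler0 addr0 scaleN1r addNr in h1.
  rewrite u0 addr0; congr (_ *: _).
  have := ultra_lin (-1) Aad Aa; rewrite !scaleN1r addrC => ->.
  by rewrite ultra_adj// addrC.
have sh' j z : h j (adj (r j) z) + 'i%C *: adj (r j) z = z.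
  have [_ h1 _] := hr j; apply: dot_ext => y; rewrite -[in RHS](h1 y) -[RHS](dot_adjr _ _ (br j)).
  by rewrite dotDr dotZr -sh dotBl dotZl conj_i mulNr opprK.
have resK j : adj (r j) \o r j = (2 * 'i%C)^-1 *: (r j - adj (r j)) /\ r j \o adj (r j) = (2 * 'i%C)^-1 *: (r j - adj (r j)).
  have [_ h1 h2] := hr j; apply: (resF _ (h j)) => //; [exact: bounded_lin|exact: bounded_lin (adj_bounded (br j))].
have [f1 f2] := resF F x (ultra a) (adj (ultra a)) (bounded_lin bu) (bounded_lin bu') e1 e3 e2' e4.
exists a; split => //.
- rewrite f1; apply: rel; first exact: comm_comp.
  by move=> j; rewrite (corner_comp _ _ Aad) corner_adj// ca; case: (resK j).
- rewrite f2; apply: rel; first exact: comm_comp.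
  by move=> j; rewrite (corner_comp _ _ Aa) corner_adj// ca; case: (resK j).
Qed.

Lemma ultra_qwep : QWEP (commutant (letters op (predC P))).
Proof.
apply: (@qwep_criterion R hs F YY (letters op (predC P)) (block_exp (fun j : J => @E j.2)) ultra).
- exact: (block_letters_star (fun j : J => @Ys j.2)).
- exact: letters_star.
- by move=> T; exact: (block_exp_A (fun j : J => @Ys j.2) (fun j : J => @E_A j.2) (fun j : J => @E_cc j.2)).
- by move=> c S T; exact: (block_exp_lin (fun j : J => @E_lin j.2) (fun j : J => @E_cc j.2)).
- by move=> T; exact: (block_exp_id (fun j : J => @E_id j.2) (fun j : J => @E_cc j.2)).
- by move=> n T c; exact: (block_exp_cc (fun j : J => @E_cc j.2)).
- exact: ultra_comm.
- exact: ultra_lin.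
- exact: ultra_adj.
- exact: ultra_id.
- exact: ultra_cc.
- exact: ultra_schwarz.
- exact: ultra_resolvent.
Qed.

End Ultraproduct.

Lemma Forall_seqrev (V : Type) (A : V -> Prop) s : List.Forall A s -> List.Forall A (rev s).
Proof.
elim: s => // h s IH hs; rewrite rev_cons -cats1; apply/List.Forall_app.
by inversion hs; split; [exact: IH|exact: List.Forall_cons].
Qed.

(** * The q-Fock space *)

Section FormalAnnihilation.
Context {R : realType} {V : Type} (q : R[i]).
Local Notation C := R[i].
Implicit Types (E : lmodType C) (b c : V -> C) (s t : seq V).

Fixpoint annl b s : seq (C * seq V) :=
  if s is h :: s' then (b h, s') :: [seq (q * p.1, h :: p.2) | p <- annl b s'] else [::].

(* The q-annihilation operator, transposed: al is a functional on words. *)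
Definition annF E b (al : seq V -> E) s : E := fsum al (annl b s).
Definition annR E b (al : seq V -> E) s : E := annF b (al \o rev) (rev s).

Lemma annF_nil E b (al : seq V -> E) : annF b al [::] = 0.
Proof. exact: fsum_nil. Qed.

Lemma annF_cons E b (al : seq V -> E) h s :
  annF b al (h :: s) = b h *: al s + q *: annF b (fun t => al (h :: t)) s.
Proof.
rewrite /annF /fsum /= big_cons big_map scaler_sumr; congr (_ + _).
by apply: eq_bigr => p _; rewrite scalerA.
Qed.

Lemma annF_ext E b (al be : seq V -> E) s : (forall t, size t = (size s).-1 -> al t = be t) ->
  annF b al s = annF b be s.
Proof.
elim: s al be => [|h s IH] al be e; first by rewrite !annF_nil.
rewrite !annF_cons e//; congr (_ + _ *: _); case: s IH e => [|k s] IH e; first by rewrite !annF_nil.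
by apply: IH => t ht; apply: e; rewrite /= ht.
Qed.

Lemma annF_sub E b (al be : seq V -> E) (A : V -> Prop) s : List.Forall A s ->
  (forall t, List.Forall A t -> size t = (size s).-1 -> al t = be t) -> annF b al s = annF b be s.
Proof.
elim: s al be => [|h s IH] al be hA e; first by rewrite !annF_nil.
have [hh hs] := List.Forall_cons_iff A h s; have {hh} [hh {}hs] := hh hA.
rewrite !annF_cons e//; congr (_ + _ *: _); case: s IH e hs {hA} => [|k s] IH e hs; first by rewrite !annF_nil.
by apply: IH => // t hA ht; apply: e; [exact: List.Forall_cons|rewrite /= ht].
Qed.

Lemma annF_lin E b (al be : seq V -> E) a s :
  annF b (fun t => a *: al t + be t) s = a *: annF b al s + annF b be s.
Proof.
rewrite /annF /fsum scaler_sumr -big_split /=; apply: eq_bigr => p _.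
by rewrite scalerDr !scalerA mulrC.
Qed.

Lemma annF_scale E b (al : seq V -> E) a s : annF b (fun t => a *: al t) s = a *: annF b al s.
Proof.
rewrite /annF /fsum scaler_sumr; apply: eq_bigr => p _; by rewrite !scalerA mulrC.
Qed.

Lemma annF_D E b (al be : seq V -> E) s :
  annF b (fun t => al t + be t) s = annF b al s + annF b be s.
Proof. by rewrite /annF /fsum -big_split /=; apply: eq_bigr => p _; rewrite scalerDr. Qed.

Lemma annF_nat E E' b (al : seq V -> E) (f : E -> E') s : linear f ->
  f (annF b al s) = annF b (f \o al) s.
Proof. exact: fsum_lin. Qed.

Lemma annF_rcons E b (al : seq V -> E) s g :
  annF b al (rcons s g) = annF b (fun t => al (rcons t g)) s + (q ^+ size s * b g) *: al s.
Proof.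
elim: s al => [|h s IH] al /=.
  by rewrite annF_cons !annF_nil scaler0 addr0 add0r mul1r.
by rewrite !annF_cons IH scalerDr scalerA mulrA -exprS addrA.
Qed.

Lemma annR_nil E b (al : seq V -> E) : annR b al [::] = 0.
Proof. exact: annF_nil. Qed.

Lemma annR_cons E b (al : seq V -> E) h s :
  annR b al (h :: s) = (q ^+ size s * b h) *: al s + annR b (fun t => al (h :: t)) s.
Proof.
rewrite /annR rev_cons annF_rcons size_rev /= revK addrC; congr (_ + _).
by apply: annF_ext => t _ /=; rewrite rev_rcons.
Qed.

Lemma annR_lin E b (al be : seq V -> E) a s :
  annR b (fun t => a *: al t + be t) s = a *: annR b al s + annR b be s.
Proof. by rewrite /annR -annF_lin. Qed.

Lemma annR_D E b (al be : seq V -> E) s :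
  annR b (fun t => al t + be t) s = annR b al s + annR b be s.
Proof. by rewrite /annR -annF_D. Qed.

Lemma annR_nat E E' b (al : seq V -> E) (f : E -> E') s : linear f ->
  f (annR b al s) = annR b (f \o al) s.
Proof. exact: annF_nat. Qed.

Lemma annR_ext E b (al be : seq V -> E) s : (forall t, size t = (size s).-1 -> al t = be t) ->
  annR b al s = annR b be s.
Proof. by move=> h; apply: annF_ext => t ht; apply: h; rewrite size_rev ht size_rev. Qed.

(** Removing two letters from opposite ends gives the same power of q in either order: if they do
    not cross, neither exponent changes, and if they do, whichever goes first saves the other one
    factor q. *)
Lemma annF_annR E b c (al : seq V -> E) s : annF b (annR c al) s = annR c (annF b al) s.
Proof.
elim: s al => [|h s IH] al; first by rewrite annF_nil annR_nil.
rewrite annF_cons annR_cons.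
have -> : annF b (fun t => annR c al (h :: t)) s =
    (q ^+ (size s).-1 * c h) *: annF b al s + annR c (annF b (fun t => al (h :: t))) s.
  rewrite -IH -annF_lin; apply: annF_ext => t ht; rewrite annR_cons ht //.
have -> : annR c (fun t => annF b al (h :: t)) s =
    b h *: annR c al s + q *: annR c (annF b (fun t => al (h :: t))) s.
  have -> : (fun t => annF b al (h :: t)) = (fun t => b h *: al t + q *: annF b (fun t => al (h :: t)) t).
    by apply/funext => t; rewrite annF_cons.
  rewrite annR_lin; congr (_ + _); exact: (annF_scale c).
rewrite scalerDr addrA addrA; congr (_ + _); rewrite addrC; congr (_ + _).
case: s {IH} => [|k s]; first by rewrite annF_nil !scaler0.
by rewrite scalerA mulrA -exprS.
Qed.

Definition opL E b f (al : seq V -> E) s : E := al (f :: s) + annF b al s.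
Definition opR E c g (al : seq V -> E) s : E := al (rcons s g) + annR c al s.

(** Creations at opposite ends commute, and so do annihilations. What remains are the terms where
    one side annihilates the letter just created by the other, q^|s| b(g) against q^|s| c(f). *)
Lemma opLR E b c f g (al : seq V -> E) : b g = c f ->
  opL b f (opR c g al) = opR c g (opL b f al).
Proof.
move=> bc; apply/funext => s; rewrite /opL /opR annF_D annR_D annF_annR annR_cons annF_rcons bc.
rewrite /= -!addrA; congr (_ + _); rewrite !addrA; congr (_ + _).
by rewrite -addrA addrC -addrA addrC -!addrA addrCA.
Qed.

Definition wordL E (b : V -> V -> C) w (al : seq V -> E) : seq V -> E :=
  foldl (fun al f => opL (b f) f al) al w.
Definition wordR E (c : V -> V -> C) w (al : seq V -> E) : seq V -> E :=
  foldl (fun al f => opR (c f) f al) al w.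

Lemma wordL_opR E (b c : V -> V -> C) g w (al : seq V -> E) : (forall f, b f g = c g f) ->
  opR (c g) g (wordL b w al) = wordL b w (opR (c g) g al).
Proof. by move=> bc; elim: w al => //= f w IH al; rewrite IH -opLR. Qed.

(** On the empty word a left letter and the right letter of the same vector agree; the latter can
    then be moved past the remaining left letters, which reverses the word. *)
Lemma wordL_rev E (b c : V -> V -> C) w (al : seq V -> E) : (forall f g, b f g = c g f) ->
  wordL b (rev w) al [::] = wordR c w al [::].
Proof.
move=> bc; elim: w al => // g w IH al; rewrite rev_cons /wordL -cats1 foldl_cat /=.
rewrite {1}/opL annF_nil addr0 -IH -wordL_opR// /opR annR_nil addr0 //.
Qed.

(* wordR has a triangular shape: its leading term at [::] is al (rev w). *)
Lemma wordR_top E (c : V -> V -> C) (A : V -> Prop) w t (al : seq V -> E) :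
  List.Forall A w -> List.Forall A t ->
  (forall u, List.Forall A u -> (size u < size w + size t)%N -> al u = 0) ->
  wordR c w al t = al (t ++ rev w).
Proof.
elim: w al t => [|f w IH] al t hw ht h; first by rewrite cats0.
have [hh _] := List.Forall_cons_iff A f w; have {hh} [hf {}hw] := hh hw.
have z u : List.Forall A u -> (size u <= size w + size t)%N -> annR (c f) al u = 0.
  move=> hu su; rewrite /annR -[RHS](annF_nil (c f) (al \o rev)).
  transitivity (annF (c f) (fun=> 0 : E) (rev u)); last first.
    by rewrite annF_nil /annF /fsum big1// => p _; rewrite scaler0.
  apply: (@annF_sub E (c f) _ _ A); first exact: Forall_seqrev.
  move=> v hv sv /=; case: u hu su v sv hv => [|k u] hu su v sv hv.
    by case: v sv hv => // _ _; apply: h => //=; rewrite addSn.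
  apply: h; first exact: Forall_seqrev.
  by rewrite size_rev sv size_rev /= addSn ltnS; exact: leq_trans (leqnSn _) su.
rewrite /= IH//.
  rewrite /opR rev_cons -rcons_cat z ?addr0//.
    by apply/List.Forall_app; split=> //; exact: Forall_seqrev.
  by rewrite size_cat size_rev addnC.
move=> u hu su; rewrite /opR z ?addr0//; last exact: ltnW.
apply: h; first by rewrite -cats1; apply/List.Forall_app; split=> //; exact: List.Forall_cons.
by rewrite size_rcons addSn ltnS.
Qed.

End FormalAnnihilation.

Section Inversions.

Lemma inversionsE n (s : 'S_n) :
  inversions s = (\sum_(i < n) \sum_(j < n) ((i < j)%N && (s j < s i)%N))%N.
Proof.
rewrite /inversions cardsE -sum1_card pair_big /= big_mkcond /=.
by apply: eq_bigr => p _; rewrite unfold_in; case: ifP.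
Qed.

Lemma inversions_lift n (j : 'I_n.+1) (s : 'S_n) :
  inversions (lift_perm ord0 j s) = (j + inversions s)%N.
Proof.
rewrite !inversionsE big_ord_recl; congr addn.
  rewrite big_ord_recl /= add0n.
  have -> : (\sum_(i < n) ((0 < bump 0 i)%N && (lift_perm ord0 j s (lift ord0 i) < lift_perm ord0 j s ord0)%N) =
      \sum_(i < n) (s i < j)%N)%N.
    apply: eq_bigr => i _; rewrite lift_perm_lift lift_perm_id /= /bump /=; congr nat_of_bool.
    by case: (leqP j (s i)) => h; rewrite ?add1n ?add0n; lia.
  transitivity (\sum_(k < n) (k < j)%N)%N; first by rewrite [RHS](reindex_inj (@perm_inj _ s)).
  have cnt m : (\sum_(k < m) (k < j) = minn m j)%N.
    by elim: m => [|m IH]; rewrite ?big_ord0 ?min0n// big_ord_recr /= IH; case: leqP; lia.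
  by rewrite cnt; apply/minn_idPr; rewrite -ltnS.
apply: eq_bigr => a _; rewrite big_ord_recl /= add0n; apply: eq_bigr => b _.
rewrite !lift_perm_lift /= /bump !leq0n !add1n ltnS; congr (nat_of_bool (_ && _)).
by case: (leqP j (s b)) => h1; case: (leqP j (s a)) => h2; rewrite /= ?add0n ?add1n ?ltnS; lia.
Qed.

Lemma perm_split (V : zmodType) n (f : 'S_n.+1 -> V) :
  \sum_p f p = \sum_(j < n.+1) \sum_(s : 'S_n) f (lift_perm ord0 j s).
Proof.
rewrite pair_big /=.
have inj : injective (fun js : 'I_n.+1 * 'S_n => lift_perm ord0 js.1 js.2).
  move=> [j s] [k r] /= /permP e; have jk : j = k by have := e ord0; rewrite !lift_perm_id.
  rewrite jk in e *; congr pair; apply/permP => i.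
  by have := e (lift ord0 i); rewrite !lift_perm_lift => /lift_inj.
have bij : bijective (fun js : 'I_n.+1 * 'S_n => lift_perm ord0 js.1 js.2).
  apply: (inj_card_bij inj); rewrite card_prod card_ord !card_Sn factS.
  by [].
by rewrite (reindex _ (onW_bij _ bij)).
Qed.

End Inversions.

Section AnnihilationIndex.
Context {R : realType} {V : nmodType} (q : R[i]).

Lemma annF_index (E : lmodType R[i]) (b : V -> R[i]) (al : seq V -> E) t :
  annF q b al t = \sum_(0 <= j < size t) (q ^+ j * b (nth 0 t j)) *: al (take j t ++ drop j.+1 t).
Proof.
elim: t al => [|h t IH] al; first by rewrite annF_nil big_geq.
rewrite annF_cons IH /= big_nat_recl// mul1r drop0; congr (_ + _).
by rewrite scaler_sumr; apply: eq_bigr => j _; rewrite scalerA mulrA -exprS.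
Qed.

End AnnihilationIndex.

Section FockRecursion.
Context {R : realType} (q : R) (H F : hilbertType R) (tens : seq H -> F).
Hypothesis Ff : q_fock q tens.
Local Notation C := R[i].
Local Notation Q := (q%:C : C).

(** Expansion of the sum over permutations along the image j of the first index, which accounts for
    j inversions. The later arguments use this recursion in place of permutations. *)
Lemma fock_dot_cons h s t :
  dot (tens (h :: s)) (tens t) = annF Q (dot h) (fun t => dot (tens s) (tens t) : C^o) t.
Proof.
rewrite annF_index (fock_dot Ff) /=; case: eqP => [st|st]; last first.
  rewrite big_nat big1// => j /andP[_ jt]; rewrite (fock_dot Ff); case: eqP => [e|_]; last exact: scaler0.
  case: st; rewrite e size_cat size_takel ?size_drop; last exact: ltnW.
  by lia.
rewrite perm_split -st big_mkord; apply: eq_bigr => j _.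
rewrite (fock_dot Ff) size_cat size_takel ?size_drop -?st; last by rewrite ltnW// st -st ltn_ord.
have -> : (j + ((size s).+1 - j.+1) = size s)%N by have := ltn_ord j; lia.
rewrite eqxx scaler_sumr; apply: eq_bigr => p _.
rewrite inversions_lift big_ord_recl lift_perm_id exprD rmorphM /= rmorphXn /=.
rewrite -[RHS]/((_ * _) * (_ * _)) -!mulrA; congr (_ * _); rewrite mulrCA; congr (_ * (_ * _)).
apply: eq_bigr => i _; rewrite lift_perm_lift /= /bump nth_cat size_takel; last by rewrite ltnW// -st ltn_ord.
case: (ltnP (p i) j) => h1.
  by rewrite nth_take// leqNgt h1.
by rewrite nth_drop add0n add1n addSn subnKC.
Qed.

End FockRecursion.

(** * Creation operators, the flip, left and right fields *)

Section Fock.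
Context {R : realType} (q : R) (H F : hilbertType R) (tens : seq H -> F).
Hypothesis q_gt : -1 < q.
Hypothesis q_lt : q < 1.
Hypothesis Ff : q_fock q tens.
Local Notation C := R[i].
Local Notation Q := (q%:C : C).
Local Notation formal := (seq (C * seq H)).
Implicit Types (v w : formal) (s t : seq H).

Definition fT v : F := fsum tens v.

Lemma fT_lc a v w : fT (flc a v w) = a *: fT v + fT w. Proof. exact: fsum_lc. Qed.
Lemma fT_word s : fT (fword s) = tens s. Proof. exact: fsum_word. Qed.

Lemma fT_dense z e : 0 < e -> exists2 d, range fT d & nrm (z - d) < e.
Proof.
move=> e0; have /dense_nrm/(_ z e e0)[_ [n [c [s ->]] hz]] := fock_dense Ff.
exists (\sum_i c i *: tens (s i)) => //; exists [seq (c i, s i) | i <- enum 'I_n] => //.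
by rewrite /fT /fsum big_map big_enum.
Qed.

Lemma fT_lin (E : lmodType C) (f : F -> E) v : linear f -> f (fT v) = fsum (f \o tens) v.
Proof. exact: fsum_lin. Qed.

Lemma tens_ext x y : (forall s, dot (tens s) x = dot (tens s) y) -> x = y.
Proof.
move=> h; apply: (dense_dot_ext (D := range fT)); first exact: fT_dense.
move=> _ [v _ <-]; rewrite /fT /fsum !dot_suml; apply: eq_bigr => p _.
by rewrite !dotZl h.
Qed.

Lemma tens_op_ext (S T : F -> F) : bounded_op S -> bounded_op T ->
  (forall s, S (tens s) = T (tens s)) -> S = T.
Proof.
move=> bS bT h; apply/funext => z; apply: tens_ext => s.
rewrite -(dot_adjl _ _ bS) -(dot_adjl _ _ bT); congr (dot _ z).
by apply: tens_ext => t; rewrite !dot_adjr// h.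
Qed.

Definition fann (b : H -> C) v : formal :=
  flatten [seq [seq (p.1 * r.1, r.2) | r <- annl Q b p.2] | p <- v].

Lemma fsum_fann (E : lmodType C) (al : seq H -> E) b v : fsum al (fann b v) = fsum (annF Q b al) v.
Proof.
rewrite /fsum /fann big_flatten big_map; apply: eq_bigr => p _.
by rewrite big_map /annF /fsum scaler_sumr; apply: eq_bigr => r _; rewrite scalerA.
Qed.

Lemma dot_linear_fun x : linear (dot x : F -> C^o).
Proof. by move=> a y z; rewrite dotDr dotZr. Qed.

Lemma dot_fcons h v w : dot (fT (fcons h v)) (fT w) = dot (fT v) (fT (fann (dot h) w)).
Proof.
rewrite {1 3}/fT fsum_cons /fsum !dot_suml; apply: eq_bigr => p _; rewrite !dotZl; congr (_ * _).
rewrite (fT_lin _ (@dot_linear_fun _)) (fT_lin _ (@dot_linear_fun _)) fsum_fann.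
by apply: eq_fsum => s /=; rewrite (fock_dot_cons Ff).
Qed.

Lemma dot_fcons_sq h v : dot (fT (fcons h v)) (fT (fcons h v)) =
  dot h h * dot (fT v) (fT v) + Q * dot (fT (fann (dot h) v)) (fT (fann (dot h) v)).
Proof.
rewrite dot_fcons.
have -> : fT (fann (dot h) (fcons h v)) = dot h h *: fT v + Q *: fT (fcons h (fann (dot h) v)).
  rewrite {1 3}/fT !fsum_cons !fsum_fann fsum_cons /fT /fsum !scaler_sumr -big_split /=.
  by apply: eq_bigr => p _; rewrite annF_cons scalerDr !scalerA mulrC [Q * _]mulrC.
rewrite dotDr !dotZr; congr (_ + _ * _).
by rewrite dot_conj dot_fcons dot_nrm conjR.
Qed.

Let C2 (h : H) : R := nrm h ^+ 2 / (1 - `|q|).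
Let q1 : 0 < 1 - `|q|. Proof. by rewrite subr_gt0 ltr_norml q_gt. Qed.

Lemma annl_size b s p : List.In p (annl Q b s) -> (size p.2).+1 = size s.
Proof.
elim: s p => //= h s IH p [<-//|/List.in_map_iff[r [<- /IH /= e]]].
by rewrite e.
Qed.

(** Induction on the length of words, before the operator exists. Writing a for the formal
    annihilation, |a* v|^2 = |h|^2 |v|^2 + q |a v|^2, and |a v|^2 <= |a* a v| |v|, where the
    induction bounds a* on the shorter a v; so |a v|^2 <= C2 |v|^2. The constant solves C2 = |h|^2 +
    |q| C2. *)
Lemma creation_formal_bound h v : nrm (fT (fcons h v)) ^+ 2 <= C2 h * nrm (fT v) ^+ 2.
Proof.
have C20 : 0 <= C2 h by rewrite divr_ge0 ?sqr_ge0// ltW.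
have [n] : exists n, forall p, List.In p v -> (size p.2 < n)%N.
  elim: v => [|p v [n hn]]; first by exists 0%N.
  exists (maxn (size p.2).+1 n) => r [<-|/hn h1]; first exact: leq_maxl.
  exact: leq_trans h1 (leq_maxr _ _).
elim: n v => [|n IH] v hv.
  case: v hv => [|p v] hv; last by have := hv p (or_introl erefl).
  by rewrite /fT /fsum !big_nil nrm0 expr0n /= mulr0.
have h1 : nrm (fT (fcons h v)) ^+ 2 = nrm h ^+ 2 * nrm (fT v) ^+ 2 + q * nrm (fT (fann (dot h) v)) ^+ 2.
  by rewrite nrm_dot dot_fcons_sq !dot_nrm -!rmorphM -rmorphD.
have h2 : nrm (fT (fann (dot h) v)) ^+ 2 <= nrm (fT (fcons h (fann (dot h) v))) * nrm (fT v).
  by rewrite nrm_dot -dot_fcons CS_Re.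
have h3 : nrm (fT (fcons h (fann (dot h) v))) ^+ 2 <= C2 h * nrm (fT (fann (dot h) v)) ^+ 2.
  apply: IH => p; rewrite /fann; elim: v hv {h1 h2} => //= r v IHv hv /List.in_app_iff[|].
    move=> /List.in_map_iff[u [<- /annl_size /= e]]; rewrite -ltnS e.
    exact: (hv r (or_introl erefl)).
  by apply: IHv => u hu; apply: hv; right.
set a := nrm (fT (fann _ _)) in h1 h2 h3 *; set b := nrm (fT (fcons _ (fann _ _))) in h2 h3.
set t := nrm (fT v) in h1 h2 *.
have h4 : a ^+ 2 <= C2 h * t ^+ 2.
  have [a0|a0] := leP (a ^+ 2) 0; first by rewrite (le_trans a0)// mulr_ge0// sqr_ge0.
  have h5 : (a ^+ 2) ^+ 2 <= (C2 h * a ^+ 2) * t ^+ 2.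
    rewrite (le_trans (_ : _ <= (b * t) ^+ 2))//.
      by rewrite ler_pXn2r// nnegrE ?sqr_ge0// mulr_ge0 ?nrm_ge0.
    by rewrite exprMn ler_wpM2r// sqr_ge0.
  rewrite -(ler_pM2l a0) -expr2 (_ : _ * (_ * _) = C2 h * a ^+ 2 * t ^+ 2)//; ring.
have h5 : C2 h * (1 - `|q|) = nrm h ^+ 2 by rewrite divfK// gt_eqF.
rewrite h1 -h5; have : q * a ^+ 2 <= `|q| * (C2 h * t ^+ 2).
  by rewrite (le_trans (_ : _ <= `|q| * a ^+ 2))// ?ler_wpM2l// ler_wpM2r ?sqr_ge0// ler_norm.
by move: (`|q|) (C2 h) => x y; lra.
Qed.

Definition cnorm h : R := Num.sqrt (C2 h).

Lemma cnorm_ge0 h : 0 <= cnorm h. Proof. exact: sqrtr_ge0. Qed.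

Lemma creation_formal h v : nrm (fT (fcons h v)) <= cnorm h * nrm (fT v).
Proof.
rewrite -(@ler_pXn2r _ 2)// ?nnegrE ?mulr_ge0 ?nrm_ge0 ?cnorm_ge0// exprMn sqr_sqrtr.
  exact: creation_formal_bound.
by rewrite divr_ge0 ?sqr_ge0// ltW.
Qed.

Lemma cnormE h : cnorm h = nrm h / Num.sqrt (1 - `|q|).
Proof. by rewrite /cnorm sqrtrM ?sqr_ge0// sqrtr_sqr ger0_norm ?nrm_ge0// sqrtrV// ltW. Qed.

(* Bounded operators are determined on words: f is any map of formal combinations. *)
Lemma formal_op (f : formal -> formal) c : 0 <= c ->
  (forall a v w, fT (f (flc a v w)) = a *: fT (f v) + fT (f w)) ->
  (forall v, nrm (fT (f v)) <= c * nrm (fT v)) ->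
  exists T, [/\ bounded_op T, (forall z, nrm (T z) <= c * nrm z) & forall s, T (tens s) = fT (f (fword s))].
Proof.
move=> c0 fl fb.
have [|a x y z|a x y z|x y|z e e0|T [lT hT TB]] := @form_op _ F formal flc [::] fT
    (fun v w => dot (fT v) (fT (f w))) c c0 _ _ _ _ _.
- exact: fT_lc.
- by rewrite fl dotDr dotZr.
- by rewrite fT_lc dotDl dotZl.
- by rewrite (le_trans (CS _ _))// [c * _]mulrC -mulrA ler_wpM2l ?nrm_ge0.
- by have [_ [v _ <-] h] := fT_dense z e0; exists v.
exists T; split=> //; first exact: bounded_opI c0 (conj lT hT).
move=> s; apply: tens_ext => t; have := TB (fword t) (fword s).
by rewrite !fT_word => <-.
Qed.

Lemma creation_ex h : exists c, creation tens h c /\ forall z, nrm (c z) <= cnorm h * nrm z.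
Proof.
have [|T [bT hT Tt]] := @formal_op (fcons h) (cnorm h) (cnorm_ge0 h) _ (creation_formal h).
  by move=> a v w; rewrite /fT !fsum_cons fsum_lc.
exists T; split=> //; split=> // s.
by rewrite Tt /fT fsum_cons fsum_word.
Qed.

Definition cr h : F -> F := pick_op (creation tens h).

Lemma crP h : creation tens h (cr h).
Proof. by apply: pick_opP; have [c [hc _]] := creation_ex h; exists c. Qed.

Lemma creation_uniq h c : creation tens h c -> c = cr h.
Proof.
move=> [bc hc]; have [b h'] := crP h; apply: tens_op_ext => // s.
by rewrite hc h'.
Qed.

Lemma cr_bounded h : bounded_op (cr h). Proof. by case: (crP h). Qed.
Lemma cr_tens h s : cr h (tens s) = tens (h :: s). Proof. by case: (crP h). Qed.

Lemma tens_cons_bound h s : nrm (tens (h :: s)) <= cnorm h * nrm (tens s).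
Proof. by rewrite -!fT_word; have := creation_formal h (fword s). Qed.

Lemma adj_cr_tens h s : adj (cr h) (tens s) = annF Q (dot h) tens s.
Proof.
apply: tens_ext => t; rewrite (dot_adjr _ _ (cr_bounded h)) cr_tens (fock_dot_cons Ff).
by rewrite (annF_nat _ _ _ _ (@dot_linear_fun _)).
Qed.

Definition xop h : F -> F := cr h + adj (cr h).

Lemma xop_bounded h : bounded_op (xop h).
Proof. by apply: boundedD; [exact: cr_bounded|apply/adj_bounded/cr_bounded]. Qed.

Lemma xop_sa h : adjoint (xop h) (xop h).
Proof.
have bc := cr_bounded h; move=> x y; rewrite /xop !fctE dotDl dotDr.
by rewrite dot_adjr// dot_adjl// addrC.
Qed.

Lemma xop_tens h s : xop h (tens s) = opL Q (dot h) h tens s.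
Proof. by rewrite /xop fctE cr_tens adj_cr_tens. Qed.

(* The flip invariance of the inner product follows from the commutation of left and right annihilation. *)
Lemma fock_dot_rcons g s t :
  dot (tens (rcons s g)) (tens t) = annR Q (dot g) (fun t => dot (tens s) (tens t) : C^o) t.
Proof.
elim: s t => [|h s IH] t /=; last first.
  rewrite (fock_dot_cons Ff).
  have -> : (fun u => dot (tens (rcons s g)) (tens u) : C^o) =
      annR Q (dot g) (fun u => dot (tens s) (tens u) : C^o) by apply/funext => u; exact: IH.
  rewrite annF_annR; congr (annR _ _ _ t).
  by apply/funext => u; rewrite (fock_dot_cons Ff).
have z (u : seq H) : (0 < size u)%N -> dot (tens [::]) (tens u) = 0 by rewrite (fock_dot Ff); case: u.
rewrite (fock_dot_cons Ff); case: t => [|h [|k t]].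
- by rewrite annF_nil annR_nil.
- by rewrite annF_cons annR_cons annF_nil annR_nil scaler0 expr0 mul1r.
- transitivity (annF Q (dot g) (fun=> 0 : C^o) (h :: k :: t)).
    by apply: annF_ext => u su; apply: z; rewrite su.
  transitivity (annR Q (dot g) (fun=> 0 : C^o) (h :: k :: t)).
    by rewrite /annR /annF /fsum !big1// => p _; exact: scaler0.
  by apply: annR_ext => u su; rewrite z// su.
Qed.

Lemma dot_rev s t : dot (tens (rev s)) (tens (rev t)) = dot (tens s) (tens t).
Proof.
elim: s t => [|h s IH] t.
  by rewrite !(fock_dot Ff) size_rev; case: t => [|k t]; rewrite // rev_cons size_rcons.
rewrite rev_cons fock_dot_rcons /annR revK (fock_dot_cons Ff); congr (annF _ _ _ t).
by apply/funext => u /=; exact: IH.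
Qed.

Let frev v : formal := [seq (p.1, rev p.2) | p <- v].

Lemma flip_ex : exists T, bounded_op T /\ forall s, T (tens s) = tens (rev s).
Proof.
have fE v : fT (frev v) = fsum (tens \o rev) v by rewrite /fT /fsum big_map.
have [a v w|v|T [bT hT Tt]] := @formal_op frev 1 ler01.
- by rewrite !fE fsum_lc.
- rewrite mul1r le_eqVlt; apply/orP; left; rewrite -(@eqrXn2 _ 2)// ?nrm_ge0// !nrm_dot.
  rewrite fE /fT /fsum !dot_suml; apply/eqP; congr complex.Re; apply: eq_bigr => p _.
  rewrite !dot_sumr; apply: eq_bigr => r _; rewrite !dotZl !dotZr; congr (_ * (_ * _)).
  exact: dot_rev.
exists T; split=> // s; by rewrite Tt fE fsum_word.
Qed.

Definition flip : F -> F := pick_op [set T | bounded_op T /\ forall s, T (tens s) = tens (rev s)].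

Lemma flip_bounded : bounded_op flip. Proof. by case: (pick_opP flip_ex). Qed.
Lemma flip_tens s : flip (tens s) = tens (rev s). Proof. by case: (pick_opP flip_ex). Qed.

Lemma flipK z : flip (flip z) = z.
Proof.
have bf := flip_bounded.
have e : flip \o flip = id.
  by apply: tens_op_ext; [exact: bounded_comp|exact: bounded_id|move=> s /=; rewrite !flip_tens revK].
exact: (congr1 (@^~ z) e).
Qed.

Lemma flip_sa : adjoint flip flip.
Proof.
have bf := flip_bounded.
suff e : adj flip = flip by move=> x y; rewrite -{2}e dot_adjr.
apply: tens_op_ext => [||s]; [exact: adj_bounded|exact: bf|].
apply: tens_ext => t; rewrite dot_adjr// !flip_tens.
by rewrite -{2}(revK t) dot_rev.
Qed.

Definition yop g : F -> F := flip \o (xop g \o flip).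

Lemma yop_bounded g : bounded_op (yop g).
Proof.
have bf := flip_bounded; apply: bounded_comp => //; apply: bounded_comp => //; exact: xop_bounded.
Qed.

Lemma yop_sa g : adjoint (yop g) (yop g).
Proof. by move=> x y; rewrite /yop /= flip_sa xop_sa flip_sa. Qed.

Lemma yop_tens g s : yop g (tens s) = opR Q (dot g) g tens s.
Proof.
have lf := bounded_lin flip_bounded.
rewrite /yop /= flip_tens xop_tens /opL (linD _ _ lf) flip_tens rev_cons revK; congr (_ + _).
rewrite (annF_nat _ _ _ _ lf) /annR; congr (annF _ _ _ _); apply/funext => u /=.
exact: flip_tens.
Qed.

Lemma opL_nat (E E' : lmodType C) b h (al : seq H -> E) (f : E -> E') s : linear f ->
  f (opL Q b h al s) = opL Q b h (f \o al) s.
Proof.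
move=> lf; have fD x y : f (x + y) = f x + f y by have := lf 1 x y; rewrite !scale1r.
by rewrite /opL fD (annF_nat _ _ _ _ lf).
Qed.

Lemma opR_nat (E E' : lmodType C) b h (al : seq H -> E) (f : E -> E') s : linear f ->
  f (opR Q b h al s) = opR Q b h (f \o al) s.
Proof.
move=> lf; have fD x y : f (x + y) = f x + f y by have := lf 1 x y; rewrite !scale1r.
by rewrite /opR fD (annR_nat _ _ _ _ lf).
Qed.

Lemma xy_comm f g z : dot f g = dot g f -> xop f (yop g z) = yop g (xop f z).
Proof.
move=> fg; have bx := xop_bounded f; have by_ := yop_bounded g.
suff e : xop f \o yop g = yop g \o xop f by exact: (congr1 (@^~ z) e).
apply: tens_op_ext => [||s /=]; [exact: bounded_comp|exact: bounded_comp|].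
rewrite yop_tens xop_tens (opR_nat _ _ _ _ (bounded_lin bx)) (opL_nat _ _ _ _ (bounded_lin by_)).
have -> : xop f \o tens = opL Q (dot f) f tens by apply/funext => u; exact: xop_tens.
have -> : yop g \o tens = opR Q (dot g) g tens by apply/funext => u; exact: yop_tens.
by rewrite opLR.
Qed.

Lemma xword_tens (E : lmodType C) (A : F -> E) (w : seq H) : linear A ->
  A (foldr xop (tens [::]) w) = wordL Q (fun h => dot h) w (A \o tens) [::].
Proof.
elim: w A => [|h w IH] A lA //=; have lx := bounded_lin (xop_bounded h).
rewrite -[LHS]/((A \o xop h) _) IH; last by move=> a x y /=; rewrite lx lA.
congr (wordL _ _ w _ [::]); apply/funext => u /=.
by rewrite xop_tens (opL_nat _ _ _ _ lA).
Qed.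

Lemma yword_flip (w : seq H) : foldr yop (tens [::]) w = flip (foldr xop (tens [::]) w).
Proof.
by elim: w => [|h w IH] /=; rewrite ?flip_tens// IH /yop /= flipK.
Qed.

Lemma tens_slot_bound s1 s2 : exists2 c, 0 <= c & forall h, nrm (tens (s1 ++ h :: s2)) <= c * nrm h.
Proof.
elim: s1 => [|k s1 [c c0 hc]].
  exists (nrm (tens s2) / Num.sqrt (1 - `|q|)); first by rewrite divr_ge0 ?nrm_ge0 ?sqrtr_ge0.
  by move=> h; rewrite (le_trans (tens_cons_bound _ _))// cnormE mulrAC [nrm h * _]mulrC mulrAC.
exists (cnorm k * c); first by rewrite mulr_ge0// cnorm_ge0.
by move=> h; rewrite (le_trans (tens_cons_bound _ _))// -mulrA ler_wpM2l// cnorm_ge0.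
Qed.

End Fock.

(* Identities between vectors, tested against an arbitrary vector. *)
Ltac hring := apply: dot_ext => ?; rewrite ?(dotDr, dotZr, dotNr, dot0r); ring.
Ltac hfield := apply: dot_ext => ?; rewrite ?(dotDr, dotZr, dotNr, dot0r); field.

(** * Linear and antilinear parts of a real projection *)

Section RealSubspace.
Context {R : realType} (H : hilbertType R) (E0 : set H).
Local Notation C := R[i].
Hypothesis E0_0 : E0 0.
Hypothesis E0_lin : forall (r : R) x y, E0 x -> E0 y -> E0 (r%:C *: x + y).

Definition rclosure (z : H) : Prop := forall e, 0 < e -> exists2 w, E0 w & nrm (z - w) < e.

Lemma rclosure_orth z y : rclosure z -> (forall w, E0 w -> complex.Re (dot y w) = 0) ->
  complex.Re (dot y z) = 0.
Proof.
move=> cz h; suff : ((complex.Re (dot y z))%:C : C) = 0 by case.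
apply: nrm_eq0; apply/eqP; rewrite eq_le nrm_ge0 andbT; apply: le_eps => e e0; rewrite add0r.
have c0 : 0 < nrm y + 1 by rewrite ltr_wpDl ?nrm_ge0.
have [w Ww hw] := cz _ (divr_gt0 e0 c0).
have -> : complex.Re (dot y z) = complex.Re (dot y (z - w)) by rewrite dotBr ReB (h _ Ww) subr0.
rewrite nrmR (le_trans (Re_le_nrm _))// (le_trans (CS _ _))//.
have : nrm y * nrm (z - w) <= (nrm y + 1) * (e / (nrm y + 1)).
  by apply: ler_pM; rewrite ?nrm_ge0// ?lerDl// ltW.
by rewrite [X in _ <= X]mulrC divfK// gt_eqF.
Qed.

Lemma rprojection_ex : exists P : H -> H, forall z, rclosure (P z) /\
  forall w, E0 w -> complex.Re (dot (z - P z) w) = 0.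
Proof.
apply: (choice_ex (P := fun z y => rclosure y /\ forall w, E0 w -> complex.Re (dot (z - y) w) = 0)) => z.
by have [y [h1 h2]] := real_projection z E0_0 E0_lin; exists y.
Qed.

Context (P : H -> H).
Hypothesis hP : forall z, rclosure (P z) /\ forall w, E0 w -> complex.Re (dot (z - P z) w) = 0.

Let P_orth z y : rclosure y -> complex.Re (dot (z - P z) y) = 0.
Proof. by move=> hy; have [_ h] := hP z; exact: rclosure_orth. Qed.

Lemma rproj_sym x y : complex.Re (dot (P x) y) = complex.Re (dot x (P y)).
Proof.
have h1 := P_orth x (hP y).1; have h2 := P_orth y (hP x).1.
rewrite dotBl ReB in h1; rewrite dot_conj ReJ dotBr ReB in h2; lra.
Qed.

Lemma rproj_ext (x y : H) : (forall z, complex.Re (dot z x) = complex.Re (dot z y)) -> x = y.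
Proof.
move=> h; apply: dot_ext => z; apply: cplx_eq => //.
by have := h ('i%C *: z); rewrite !dotZl conj_i !mulNr !ReN !ReiM !opprK.
Qed.

Lemma rproj_lin (r : R) x y : P (r%:C *: x + y) = r%:C *: P x + P y.
Proof.
apply: rproj_ext => z; rewrite -rproj_sym !dotDr !dotZr !ReD !ReZ.
by rewrite -!rproj_sym.
Qed.

Lemma rproj_idem x : P (P x) = P x.
Proof.
apply: rproj_ext => z; rewrite -rproj_sym -[LHS]rproj_sym.
have h := P_orth x (hP (P z)).1; have h2 := P_orth (P z) (hP x).1.
rewrite dotBl ReB in h2; have := rproj_sym (P z) x; have := rproj_sym z x.
have := P_orth z (hP x).1; rewrite dotBl ReB; lra.
Qed.

Let P0 : P 0 = 0. Proof. by have := rproj_lin (-1) 0 0; rewrite scaler0 addr0 rmorphN1 scaleN1r addNr. Qed.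
Let PN x : P (- x) = - P x.
Proof. by have := rproj_lin (-1) x 0; rewrite !addr0 P0 addr0 rmorphN1 !scaleN1r. Qed.
Lemma rproj_norm x : nrm (P x) ^+ 2 = complex.Re (dot x (P x)).
Proof. by rewrite nrm_dot rproj_sym rproj_idem. Qed.

Let P_le x : nrm (P x) <= nrm x /\ nrm (x - P x) <= nrm x.
Proof.
have h : nrm x ^+ 2 = nrm (P x) ^+ 2 + nrm (x - P x) ^+ 2.
  rewrite nrmB_sq -rproj_norm; lra.
by split; rewrite -(@ler_pXn2r _ 2)// ?nnegrE ?nrm_ge0// h ?lerDl ?lerDr sqr_ge0.
Qed.

(** The real projection onto the closure of i E0. As P (i x) = i [iproj] x, half the sum of the two
    projections commutes with i and half the difference anticommutes with it. *)
Definition iproj (x : H) : H := 'i%C *: P (- ('i%C *: x)).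
Definition rlin (x : H) : H := 2^-1 *: (P x + iproj x).
Definition ralin (x : H) : H := 2^-1 *: (P x - iproj x).

Let ii (x : H) : 'i%C *: ('i%C *: x) = - x. Proof. by rewrite scalerA mulii scaleN1r. Qed.

Lemma iproj_i x : iproj ('i%C *: x) = 'i%C *: P x.
Proof. by rewrite /iproj ii opprK. Qed.

Lemma proj_i x : P ('i%C *: x) = 'i%C *: iproj x.
Proof. by rewrite /iproj ii PN opprK. Qed.

Lemma iproj_lin (r : R) x y : iproj (r%:C *: x + y) = r%:C *: iproj x + iproj y.
Proof.
rewrite /iproj scalerDr scalerA mulrC -scalerA opprD -scalerN rproj_lin scalerDr.
by rewrite !scalerA mulrC.
Qed.

Lemma iproj_sym x y : complex.Re (dot (iproj x) y) = complex.Re (dot x (iproj y)).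
Proof.
rewrite /iproj dotZl dotZr conj_i mulNr ReN !ReiM opprK PN dotNl !PN dotNr ImN.
have := rproj_sym ('i%C *: x) ('i%C *: y).
by rewrite dotZl dotZr conj_i mulNr ReN !ReiM ImN; lra.
Qed.

Lemma rlin_i x : rlin ('i%C *: x) = 'i%C *: rlin x.
Proof. by rewrite /rlin iproj_i proj_i -scalerDr scalerA mulrC -scalerA addrC. Qed.

Lemma ralin_i x : ralin ('i%C *: x) = - ('i%C *: ralin x).
Proof. by rewrite /ralin iproj_i proj_i; hring. Qed.

Lemma projE x : P x = rlin x + ralin x.
Proof. by rewrite /rlin /ralin; hfield. Qed.

Lemma iprojE x : iproj x = rlin x - ralin x.
Proof. by rewrite /rlin /ralin; hfield. Qed.

Let rlin_real (r : R) x y : rlin (r%:C *: x + y) = r%:C *: rlin x + rlin y.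
Proof. by rewrite /rlin rproj_lin iproj_lin; hring. Qed.

Let ralin_real (r : R) x y : ralin (r%:C *: x + y) = r%:C *: ralin x + ralin y.
Proof. by rewrite /ralin rproj_lin iproj_lin; hring. Qed.

Let cplx_scale a (x : H) : a *: x = (complex.Re a)%:C *: x + (complex.Im a)%:C *: ('i%C *: x).
Proof. by rewrite {1}[a]complexE scalerDl scalerA mulrC. Qed.

Lemma rlin_linear : linear rlin.
Proof.
by move=> a x y; rewrite (cplx_scale a x) -addrA !rlin_real rlin_i [in RHS](cplx_scale a) addrA.
Qed.

Lemma rlin_sym x y : dot (rlin x) y = dot x (rlin y).
Proof.
have h u : complex.Re (dot (rlin u) y) = complex.Re (dot u (rlin y)).
  have h2 : (2^-1 : C)^* = 2^-1 by rewrite fmorphV rmorph_nat.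
  have h3 : (2^-1 : C) = (2^-1 : R)%:C by rewrite fmorphV rmorph_nat.
  by rewrite /rlin dotZl dotZr h2 h3 !ReZ dotDl dotDr !ReD rproj_sym iproj_sym.
apply: cplx_eq => //; have := h ('i%C *: x).
by rewrite rlin_i !dotZl conj_i !mulNr !ReN !ReiM !opprK.
Qed.

Lemma ralin_sym x y : dot x (ralin y) = (dot (ralin x) y)^*.
Proof.
have h u : complex.Re (dot (ralin u) y) = complex.Re (dot u (ralin y)).
  have h2 : (2^-1 : C)^* = 2^-1 by rewrite fmorphV rmorph_nat.
  have h3 : (2^-1 : C) = (2^-1 : R)%:C by rewrite fmorphV rmorph_nat.
  by rewrite /ralin dotZl dotZr h2 h3 !ReZ dotBl dotBr !ReB rproj_sym iproj_sym.
apply: cplx_eq; first by rewrite ReJ h.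
have := h ('i%C *: x).
by rewrite ralin_i dotNl ReN !dotZl conj_i !mulNr !ReN !ReiM !opprK ImJ => ->.
Qed.

Lemma iproj_idem x : iproj (iproj x) = iproj x.
Proof. by rewrite {1}/iproj /iproj ii opprK rproj_idem. Qed.

(** P = r + a and [iproj] = r - a are idempotent; adding the two identities cancels the cross terms
    and leaves r^2 + a^2 = r. *)
Lemma ralin_sq x : ralin (ralin x) = rlin (x - rlin x).
Proof.
have lR := rlin_linear; rewrite (linB _ _ lR).
have DD u v : ralin (u + v) = ralin u + ralin v by have := ralin_real 1 u v; rewrite !scale1r.
have DN u : ralin (- u) = - ralin u.
  have D0 : ralin 0 = 0.
    have := ralin_real (-1) 0 0; rewrite scaler0 addr0 rmorphN1 scaleN1r addNr; exact.
  by have := ralin_real (-1) u 0; rewrite !addr0 D0 addr0 rmorphN1 !scaleN1r.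
have e1 := rproj_idem x; rewrite !projE (linD _ _ lR) DD in e1.
have e2 := iproj_idem x; rewrite !iprojE (linB _ _ lR) DD DN in e2.
have {e1 e2} e : (rlin (rlin x) + rlin (ralin x) + (ralin (rlin x) + ralin (ralin x))) +
    (rlin (rlin x) - rlin (ralin x) - (ralin (rlin x) - ralin (ralin x))) =
    (rlin x + ralin x) + (rlin x - ralin x) by rewrite e1 e2.
have e3 : 2%:R *: (rlin (rlin x) + ralin (ralin x)) = 2%:R *: rlin x.
  have g (a b c d : H) : (a + b + (c + d)) + (a - b - (c - d)) = 2%:R *: (a + d).
    by hring.
  have g2 (a b : H) : a + b + (a - b) = 2%:R *: a.
    by hring.
  by move: e; rewrite g g2.
have n2 : (2%:R : C) != 0 by rewrite pnatr_eq0.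
have e4 := scalerI n2 e3; by rewrite -[X in X - _]e4 addrC addKr.
Qed.

Let iP_le x : nrm (iproj x) <= nrm x /\ nrm (x - iproj x) <= nrm x.
Proof.
have [h1 h2] := P_le (- ('i%C *: x)); rewrite nrmN nrmZ nrm_i mul1r in h1 h2.
split; first by rewrite /iproj nrmZ nrm_i mul1r.
have -> : x - iproj x = 'i%C *: (- ('i%C *: x) - P (- ('i%C *: x))).
  by rewrite scalerBr scalerN ii opprK.
by rewrite nrmZ nrm_i mul1r.
Qed.

Let half_norm (x y : H) c : nrm x <= c -> nrm y <= c -> nrm ((2^-1 : C) *: (x + y)) <= c.
Proof.
move=> h1 h2; have -> : (2^-1 : C) = (2^-1 : R)%:C by rewrite fmorphV rmorph_nat.
rewrite nrmZ nrmR gtr0_norm ?invr_gt0//; have := nrmD x y.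
by rewrite ler_pdivrMl//; lra.
Qed.

Lemma rlin_le x : nrm (rlin x) <= nrm x.
Proof. by apply: half_norm; [case: (P_le x)|case: (iP_le x)]. Qed.

Lemma rlin_cle x : nrm (x - rlin x) <= nrm x.
Proof.
have -> : x - rlin x = 2^-1 *: ((x - P x) + (x - iproj x)).
  rewrite addrACA -opprD scalerBr; congr (_ - _).
  by rewrite -mulr2n -[x *+ 2]scaler_nat scalerA mulVf ?scale1r// pnatr_eq0.
by apply: half_norm; [case: (P_le x)|case: (iP_le x)].
Qed.

(** 2 Re<x, r x> = |P x|^2 + |[iproj] x|^2, so x is real-orthogonal to E0 and to i E0. *)
Lemma rlin_inj x : (forall z, (forall w, E0 w -> dot w z = 0) -> z = 0) ->
  rlin x = 0 -> x = 0.
Proof.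
move=> dense hx.
have h : complex.Re (dot x (P x)) + complex.Re (dot x (iproj x)) = 0.
  have : complex.Re (dot x (2%:R *: rlin x)) = 0 by rewrite hx scaler0 dot0r.
  by rewrite /rlin scalerA divff ?pnatr_eq0// scale1r dotDr ReD.
have iN : nrm (iproj x) ^+ 2 = complex.Re (dot x (iproj x)) by rewrite nrm_dot iproj_sym iproj_idem.
rewrite -rproj_norm -iN in h.
have Px0 : P x = 0 by apply: nrm_eq0; apply/eqP; rewrite -sqrf_eq0; apply/eqP; have := sqr_ge0 (nrm (P x)); have := sqr_ge0 (nrm (iproj x)); lra.
have iPx0 : iproj x = 0 by apply: nrm_eq0; apply/eqP; rewrite -sqrf_eq0; apply/eqP; have := sqr_ge0 (nrm (P x)); have := sqr_ge0 (nrm (iproj x)); lra.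
have Pix : P ('i%C *: x) = 0 by rewrite proj_i iPx0 scaler0.
apply: dense => w Ew; rewrite dot_conj; have [_ h1] := hP x; have [_ h2] := hP ('i%C *: x).
have := h1 _ Ew; have := h2 _ Ew; rewrite Px0 Pix !subr0 dotZl conj_i mulNr ReN ReiM opprK => h3 h4.
by rewrite (_ : dot x w = 0) ?rmorph0//; apply: cplx_eq.
Qed.

(** So 1 - [iproj] takes its values among the vectors of the right letters. *)
Lemma coproj_real x f : E0 f -> complex.Im (dot f (x - iproj x)) = 0.
Proof.
move=> Ef; have [_ h] := hP (- ('i%C *: x)); have := h _ Ef.
have -> : - ('i%C *: x) - P (- ('i%C *: x)) = - ('i%C *: (x - iproj x)).
  by rewrite scalerBr /iproj ii opprK opprD.
by rewrite dotNl ReN dotZl conj_i mulNr ReN opprK ReiM [dot _ f]dot_conj ImJ opprK.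
Qed.

End RealSubspace.

Section WordFunctionals.
Context {R : realType} (H : hilbertType R).
Local Notation C := R[i].
Implicit Types (al be : seq H -> C) (s : seq H).

Definition multilin al : Prop := forall s1 s2 (a : C) h h',
  al (s1 ++ (a *: h + h') :: s2) = a * al (s1 ++ h :: s2) + al (s1 ++ h' :: s2).
Definition antimultilin be : Prop := forall s1 s2 (a : C) h h',
  be (s1 ++ (a *: h + h') :: s2) = a^* * be (s1 ++ h :: s2) + be (s1 ++ h' :: s2).

Lemma slotD al s1 s2 h h' : multilin al ->
  al (s1 ++ (h + h') :: s2) = al (s1 ++ h :: s2) + al (s1 ++ h' :: s2).
Proof. by move=> ml; have := ml s1 s2 1 h h'; rewrite scale1r mul1r. Qed.

(* The part of al + be that is complex linear in every vector, when al is
   multilinear, be is antilinear, and Lc + Ac splits a real linear map. *)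
Lemma extraction al be (Lc Ac : H -> H) : multilin al -> antimultilin be ->
  (forall h, Lc ('i%C *: h) = 'i%C *: Lc h) -> (forall h, Ac ('i%C *: h) = - ('i%C *: Ac h)) ->
  (forall s, al (map (fun h => Lc h + Ac h) s) + be (map (fun h => Lc h + Ac h) s) = 0) ->
  forall s, al (map Lc s) + be (map Ac s) = 0.
Proof.
move=> ml ma Li Ai h s; pose T h := Lc h + Ac h.
suff key s1 s2 : al (map Lc s1 ++ map T s2) + be (map Ac s1 ++ map T s2) = 0.
  by have := key s [::]; rewrite /= !cats0.
elim/last_ind: s1 s2 => [|s1 k IH] s2; first exact: h.
rewrite !map_rcons !cat_rcons.
have e1 : al (map Lc s1 ++ (Lc k + Ac k) :: map T s2) + be (map Ac s1 ++ (Lc k + Ac k) :: map T s2) = 0 := IH (k :: s2).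
(* Replacing k by i k flips the sign of the terms a2 and b1 relative to a1 and b2, up to a common
   factor i; adding the two relations isolates a1 + b2. *)
have e2 : al (map Lc s1 ++ (Lc ('i%C *: k) + Ac ('i%C *: k)) :: map T s2)
  + be (map Ac s1 ++ (Lc ('i%C *: k) + Ac ('i%C *: k)) :: map T s2) = 0 := IH ('i%C *: k :: s2).
rewrite Li Ai in e2.
have d1 u v : al (u ++ (Lc k + Ac k) :: v) = al (u ++ Lc k :: v) + al (u ++ Ac k :: v).
  exact: slotD.
have d2 u v : be (u ++ (Lc k + Ac k) :: v) = be (u ++ Lc k :: v) + be (u ++ Ac k :: v).
  by have := ma u v 1 (Lc k) (Ac k); rewrite scale1r conjC1 mul1r.
rewrite d1 d2 in e1.
have d3 u v : al (u ++ ('i%C *: Lc k - 'i%C *: Ac k) :: v) = 'i%C * al (u ++ Lc k :: v) - 'i%C * al (u ++ Ac k :: v).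
  rewrite ml; congr (_ + _); have := ml u v (- 'i%C) (Ac k) 0; rewrite addr0 scaleNr => ->.
  have := ml u v 1 0 0; rewrite scale1r addr0 mul1r => /eqP; rewrite addrC -subr_eq subrr eq_sym => /eqP ->.
  by rewrite addr0 mulNr.
have d4 u v : be (u ++ ('i%C *: Lc k - 'i%C *: Ac k) :: v) = - 'i%C * be (u ++ Lc k :: v) + 'i%C * be (u ++ Ac k :: v).
  have ci : (- 'i%C : C)^* = 'i%C by apply: cplx_eq; rewrite /= ?oppr0 ?opprK.
  rewrite ma conj_i; congr (_ + _); have := ma u v (- 'i%C) (Ac k) 0; rewrite addr0 scaleNr => ->.
  have := ma u v 1 0 0; rewrite scale1r addr0 conjC1 mul1r => /eqP; rewrite addrC -subr_eq subrr eq_sym => /eqP ->.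
  by rewrite addr0 ci.
rewrite d3 d4 in e2; move: e1 e2.
move: (al (_ ++ Lc k :: _)) (al (_ ++ Ac k :: _)) => a1 a2.
move: (be (_ ++ Lc k :: _)) (be (_ ++ Ac k :: _)) => b1 b2 e1 e2.
have e3 : 'i%C * (a1 - a2 - b1 + b2) = 0 by rewrite -[RHS]e2; ring.
have e4 : a1 - a2 - b1 + b2 = 0.
  have := congr1 ( *%R 'i%C) e3; rewrite mulr0 mulrA mulii mulN1r => /eqP.
  by rewrite oppr_eq0 => /eqP.
have e5 : (1 + 1) * (a1 + b2) = 0 by rewrite -[RHS]addr0 -{1}e1 -e4; ring.
by apply/eqP; move/eqP: e5; rewrite mulf_eq0 -[1 + 1]/(2%:R) pnatr_eq0.
Qed.

Definition slot_bounded al : Prop := forall s1 s2, exists2 c, 0 <= c &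
  forall h h', nrm (al (s1 ++ h :: s2) - al (s1 ++ h' :: s2)) <= c * nrm (h - h').

Lemma closure_vanish al (S : set H) : slot_bounded al ->
  (forall s, List.Forall S s -> al s = 0) -> forall s, List.Forall (rclosure S) s -> al s = 0.
Proof.
move=> sb h s hs; suff key s1 s2 : List.Forall (rclosure S) s1 -> List.Forall S s2 -> al (s1 ++ s2) = 0.
  by have := key s [::] hs; rewrite cats0; apply; exact: List.Forall_nil.
elim/last_ind: s1 s2 => [|s1 k IH] s2; first by move=> _; exact: h.
rewrite -cats1 => /List.Forall_app[h1 h2] hs2; have hk : rclosure S k by inversion h2.
rewrite -catA /=; have [c c0 hc] := sb s1 s2.
apply: (@eq_small _ _ c c0) => e e0 _; have [w Sw hw] := hk _ e0.
rewrite -[al _]subr0 -(IH (w :: s2)) ?(le_trans (hc _ _))//; last exact: List.Forall_cons.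
by rewrite mulrC ler_wpM2r// ltW.
Qed.

End WordFunctionals.

(** * Second quantization of symmetric contractions *)

Section SecondQuantization.
Context {R : realType} (q : R) (H F : hilbertType R) (tens : seq H -> F).
Hypothesis q_gt : -1 < q.
Hypothesis q_lt : q < 1.
Hypothesis Ff : q_fock q tens.
Local Notation C := R[i].
Local Notation Q := (q%:C : C).
Local Notation formal := (seq (C * seq H)).
Implicit Types (v w : formal) (s t : seq H).

Lemma annF_map (E : lmodType C) (b : H -> C) (al : seq H -> E) (g : H -> H) s :
  annF Q b al (map g s) = annF Q (b \o g) (al \o map g) s.
Proof.
elim: s al => [|h s IH] al /=; first by rewrite !annF_nil.
by rewrite !annF_cons IH.
Qed.

Lemma dot_map_sym (f g : H -> H) : (forall x y, dot (f x) y = dot x (g y)) ->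
  forall s t, dot (tens (map f s)) (tens t) = dot (tens s) (tens (map g t)).
Proof.
move=> fg; elim=> [|h s IH] t /=.
  by rewrite !(fock_dot Ff) size_map; case: t => //= _; rewrite !big_ord0.
rewrite !(fock_dot_cons Ff) annF_map.
have -> : dot (f h) = dot h \o g :> (H -> C) by apply/funext => y /=; exact: fg.
by congr (annF _ _ _ t); apply/funext => u /=; exact: IH.
Qed.

Definition fmap (g : H -> H) v : formal := [seq (p.1, map g p.2) | p <- v].

Lemma fmapE g v : fT tens (fmap g v) = fsum (tens \o map g) v.
Proof. by rewrite /fT /fsum big_map. Qed.

Section Contraction.
Context (T : H -> H).
Hypothesis T_sym : forall x y, dot (T x) y = dot x (T y).
Hypothesis T_le : forall x, nrm (T x) <= nrm x.

Let pw n v := fT tens (fmap (iter n T) v).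

Let T_iter n x y : dot (iter n T x) y = dot x (iter n T y).
Proof. by elim: n x y => // n IH x y; rewrite iterS T_sym IH -iterSr. Qed.

Let T_iter_le n x : nrm (iter n T x) <= nrm x.
Proof. by elim: n => // n IH; rewrite iterS (le_trans (T_le _)). Qed.

Let pw_sq n v : nrm (pw n v) ^+ 2 <= nrm (pw 0 v) * nrm (pw (n + n) v).
Proof.
have -> : nrm (pw n v) ^+ 2 = complex.Re (dot (pw 0 v) (pw (n + n) v)).
  rewrite nrm_dot /pw !fmapE /fsum !dot_suml; congr complex.Re; apply: eq_bigr => p _.
  rewrite !dot_sumr; apply: eq_bigr => r _; rewrite !dotZl !dotZr /=; congr (_ * (_ * _)).
  rewrite (dot_map_sym (T_iter n)) map_id -map_comp; congr (dot _ (tens _)).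
  by apply: eq_map => x /=; rewrite -iterD.
exact: CS_Re.
Qed.

Let tens_iter s : exists2 c, 0 <= c & forall n, nrm (tens (map (iter n T) s)) <= c.
Proof.
elim: s => [|h s [c c0 hc]]; first by exists (nrm (tens [::])) => //; rewrite nrm_ge0.
exists (cnorm q h * c); first by rewrite mulr_ge0// cnorm_ge0.
move=> n /=; rewrite (le_trans (tens_cons_bound q_gt q_lt Ff _ _))// ler_pM ?cnorm_ge0 ?nrm_ge0//.
by rewrite !cnormE// ler_wpM2r ?invr_ge0 ?sqrtr_ge0.
Qed.

Let pw_bounded v : exists2 c, 0 <= c & forall n, nrm (pw n v) <= c.
Proof.
elim: v => [|p v [c c0 hc]].
  by exists 0 => // n; rewrite /pw fmapE fsum_nil nrm0.
have [d d0 hd] := tens_iter p.2.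
exists (nrm p.1 * d + c); first by rewrite addr_ge0// mulr_ge0// nrm_ge0.
move=> n; have := hc n; rewrite /pw !fmapE /fsum big_cons => h.
by rewrite (le_trans (nrmD _ _))// nrmZ lerD// ler_wpM2l ?nrm_ge0//=.
Qed.

(* |T z|^2^k <= |z|^(2^k - 1) |T^(2^k) z| for symmetric T. *)
Lemma fmap_contraction v : nrm (fT tens (fmap T v)) <= nrm (fT tens v).
Proof.
have [c c0 hc] := pw_bounded v.
have e0 : pw 0 v = fT tens v by rewrite /pw fmapE /fT; apply: eq_fsum => s /=; rewrite map_id.
have e1 : pw 1 v = fT tens (fmap T v) by [].
rewrite -e0 -e1; have := nrm_ge0 (pw 0 v); rewrite le_eqVlt => /orP[/eqP z|z0].
  have := pw_sq 1 v; rewrite -z mul0r => h.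
  have : nrm (pw 1 v) ^+ 2 = 0 by apply/eqP; rewrite eq_le h sqr_ge0.
  by move=> /eqP; rewrite sqrf_eq0 => /eqP ->.
pose r n := nrm (pw n v) / nrm (pw 0 v).
have r0 n : 0 <= r n by rewrite divr_ge0 ?nrm_ge0.
have r_sq n : r n ^+ 2 <= r (n + n)%N.
  rewrite /r expr_div_n ler_pdivrMr ?exprn_gt0// expr2 mulrA divfK ?gt_eqF//.
  by rewrite -expr2 [leRHS]mulrC pw_sq.
have r_pow k : r 1%N ^+ (2 ^ k) <= r (2 ^ k)%N.
  elim: k => [|k IH]; first by rewrite expn0 expr1.
  rewrite expnS mul2n -addnn exprD; apply: le_trans (r_sq _).
  by rewrite expr2 ler_pM// exprn_ge0.
rewrite -[leRHS]mul1r -ler_pdivrMr// -/(r 1%N) leNgt; apply/negP => r1.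
pose d := r 1%N - 1; have d0 : 0 < d by rewrite subr_gt0.
have bern m : 1 + m%:R * d <= r 1%N ^+ m.
  elim: m => [|m IH]; first by rewrite mul0r addr0 expr0.
  rewrite exprS -[m.+1%:R]natr1 {1}(_ : r 1%N = 1 + d); last by rewrite /d addrC subrK.
  have : (1 + d) * (1 + m%:R * d) <= (1 + d) * r 1%N ^+ m by rewrite ler_wpM2l// addr_ge0// ltW.
  apply: le_trans; have : 0 <= m%:R * d * d by rewrite !mulr_ge0// ltW.
  by move: (m%:R : R) => x; nra.
have [m hm] : exists m : nat, c / nrm (pw 0 v) / d < m%:R.
  exists (Num.truncn (c / nrm (pw 0 v) / d)).+1; apply: truncnS_gt.
have h1 : r 1%N ^+ (2 ^ m) <= c / nrm (pw 0 v).
  by rewrite (le_trans (r_pow m))// ler_wpM2r ?invr_ge0 ?nrm_ge0.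
have h2 := bern (2 ^ m)%N; have h3 : (m%:R : R) <= (2 ^ m)%N%:R by rewrite ler_nat ltnW// ltn_expl.
rewrite ltr_pdivrMr// in hm.
have : m%:R * d <= (2 ^ m)%N%:R * d by rewrite ler_wpM2r// ltW.
by lra.
Qed.

Lemma second_quant_ex : exists G, [/\ bounded_op G, adjoint G G & forall s, G (tens s) = tens (map T s)].
Proof.
have [a v w|v|G [bG hG Gt]] := @formal_op _ q H F tens Ff (fmap T) 1 ler01.
- by rewrite !fmapE fsum_lc.
- by rewrite mul1r fmap_contraction.
have Gs s : G (tens s) = tens (map T s) by rewrite Gt fmapE fsum_word.
exists G; split=> //; suff e : adj G = G by move=> x y; rewrite -{2}e dot_adjr.
apply: (tens_op_ext Ff) => // [|s]; first exact: adj_bounded.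
by apply: (tens_ext Ff) => t; rewrite dot_adjr// !Gs (dot_map_sym T_sym).
Qed.

End Contraction.
End SecondQuantization.

Section WordConjugation.
Context {R : realType} {V : Type} (q : R).
Local Notation C := R[i].
Local Notation Q := (q%:C : C).
Implicit Types (al be : seq V -> C^o) (s w : seq V).

Lemma annF_conj (b : V -> C) al s :
  (annF Q b al s)^* = annF Q (fun h => (b h)^*) (fun t => (al t)^* : C^o) s.
Proof.
elim: s al => [|h s IH] al; first by rewrite !annF_nil conjC0.
by rewrite !annF_cons rmorphD /= -IH; congr (_ + _); rewrite ?/GRing.scale /= !rmorphM //= conjR.
Qed.

Definition rconj al : seq V -> C^o := fun s => (al (rev s))^*.

Lemma rconj_opL (b : V -> C) f al : rconj (opL Q b f al) = opR Q (fun h => (b h)^*) f (rconj al).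
Proof.
apply/funext => s; rewrite /rconj /opL /opR rmorphD /= rev_rcons; congr (_ + _).
by rewrite annF_conj /annR; congr (annF _ _ _ _); apply/funext => t /=; rewrite revK.
Qed.

Lemma rconj_wordL (b : V -> V -> C) w al :
  rconj (wordL Q b w al) = wordR Q (fun f h => (b f h)^*) w (rconj al).
Proof. by elim: w al => // f w IH al /=; rewrite IH rconj_opL. Qed.

Lemma wordR_lin (c : V -> V -> C) w a al be :
  wordR Q c w (fun s => a *: al s + be s) = (fun s => a *: wordR Q c w al s + wordR Q c w be s).
Proof.
elim: w al be => // f w IH al be /=.
have -> : opR Q (c f) f (fun s => a *: al s + be s) =
  (fun s => a *: opR Q (c f) f al s + opR Q (c f) f be s).
  by apply/funext => s; rewrite /opR annR_lin scalerDr addrACA.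
exact: IH.
Qed.

(** By the triangular shape of [wordR], words of fields determine the values on tensors, by
    induction on the length. *)
Lemma wordR_vanish (A : V -> Prop) (c : V -> V -> C) al :
  (forall w, List.Forall A w -> wordR Q c w al [::] = 0) -> forall w, List.Forall A w -> al w = 0.
Proof.
move=> h w; have [n] := ubnP (size w); elim: n w => // n IH w; rewrite ltnS => sw hw.
have hr := Forall_seqrev hw; rewrite -(revK w) -[rev (rev w)]/([::] ++ rev (rev w)).
rewrite -(@wordR_top _ _ Q _ c A (rev w) [::] al)//; first exact: h.
move=> u hu; rewrite size_rev addn0 => su; apply: IH => //; exact: leq_trans su sw.
Qed.

End WordConjugation.

(** * The separation property *)

Section Separation.
Context {R : realType} (q : R) (H F : hilbertType R) (tens : seq H -> F).
Hypothesis q_gt : -1 < q.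
Hypothesis q_lt : q < 1.
Hypothesis Ff : q_fock q tens.
Local Notation C := R[i].
Local Notation Q := (q%:C : C).
Local Notation x := (xop tens).
Local Notation xw w := (foldr (xop tens) (tens [::]) w).
Local Notation yw w := (foldr (yop tens) (tens [::]) w).
Implicit Types (s w : seq H) (zeta : F).

Let al zeta : seq H -> C^o := fun s => dot zeta (tens s).

Let xw_al zeta w : dot zeta (xw w) = wordL Q (fun f => dot f) w (al zeta) [::].
Proof. exact: (xword_tens q_gt q_lt Ff w (dot_linear_fun zeta)). Qed.

Let xw_rev zeta w : dot zeta (xw (rev w)) = wordR Q (fun f h => dot h f) w (al zeta) [::].
Proof. by rewrite xw_al; apply: wordL_rev. Qed.

Let xw_conj zeta w :
  (dot zeta (xw w))^* = wordR Q (fun f h => dot h f) w (rconj (al zeta)) [::].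
Proof.
rewrite xw_al -[wordL _ _ _ _ _]/(wordL Q (fun f => dot f) w (al zeta) (rev [::])).
rewrite -/(rconj (wordL Q (fun f => dot f) w (al zeta)) [::]) rconj_wordL.
by congr (wordR _ _ _ _ _); apply/funext => f; apply/funext => h; rewrite -dot_conj.
Qed.

(** The coefficients of reversed words and the conjugates of those of the words are both values at
    the empty word of the same words of right operators, applied to [al] and to [rconj al]. The
    hypothesis thus says that these operators kill one linear combination of the two. *)
Let words_vanish zeta (a : C) (A : H -> Prop) :
  (forall w, List.Forall A w -> dot zeta (xw (rev w)) = - a * (dot zeta (xw w))^*) ->
  forall w, List.Forall A w -> al zeta w + a * rconj (al zeta) w = 0.
Proof.
move=> h w hw; rewrite addrC.
apply: (@wordR_vanish _ _ q A (fun f h => dot h f) (fun s => a *: rconj (al zeta) s + al zeta s)) => // u hu.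
by rewrite wordR_lin -xw_rev -xw_conj h// mulNr addrN.
Qed.

Lemma xwords_cyclic zeta (A : H -> Prop) :
  (forall w, List.Forall A w -> dot (xw w) zeta = 0) ->
  forall w, List.Forall A w -> dot zeta (tens w) = 0.
Proof.
move=> h w hw; have := @words_vanish zeta 0 A _ w hw; rewrite mul0r addr0; apply=> u hu.
by rewrite oppr0 mul0r dot_conj h ?conjC0//; exact: Forall_seqrev.
Qed.

Lemma xwords_sep zeta (A : H -> Prop) :
  (forall w, List.Forall A w -> dot zeta (xw (rev w)) = - (dot zeta (xw w))^*) ->
  forall w, List.Forall A w -> dot zeta (tens w) + (dot zeta (tens (rev w)))^* = 0.
Proof.
move=> h w hw; have := @words_vanish zeta 1 A _ w hw; rewrite mul1r; apply=> u hu.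
by rewrite mulN1r h.
Qed.

Lemma ywords_sep zeta (A : H -> Prop) :
  (forall w, List.Forall A w -> dot zeta (yw (rev w)) = (dot zeta (yw w))^*) ->
  forall w, List.Forall A w -> dot zeta (tens w) - (dot zeta (tens (rev w)))^* = 0.
Proof.
move=> h w hw; have := @words_vanish (flip tens zeta) (-1) A _ (rev w) (Forall_seqrev hw).
rewrite mulN1r /al /rconj revK !(flip_sa Ff) !(flip_tens Ff) revK; apply=> u hu.
by rewrite opprK mul1r !(flip_sa Ff) -!(yword_flip Ff) h.
Qed.

Section Projected.
Context (E0 : set H) (P : H -> H).
Hypothesis hP : forall z, rclosure E0 (P z) /\ forall w : H, E0 w -> complex.Re (dot (z - P z) w) = 0.
Hypothesis E0_total : forall z : H, (forall w : H, E0 w -> dot w z = 0) -> z = 0.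

Let al_sb zeta : slot_bounded (al zeta).
Proof.
move=> s1 s2; have [c c0 hc] := tens_slot_bound q_gt q_lt Ff s1 s2.
exists (nrm zeta * c); first by rewrite mulr_ge0 ?nrm_ge0.
move=> h h'; have -> : al zeta (s1 ++ h :: s2) - al zeta (s1 ++ h' :: s2) = dot zeta (tens (s1 ++ (h - h') :: s2)).
  have -> : h - h' = (-1) *: h' + h by rewrite scaleN1r addrC.
  by rewrite (fock_multilinear Ff) scaleN1r dotDr dotNr addrC.
by rewrite (le_trans (CS _ _))// -mulrA ler_wpM2l ?nrm_ge0.
Qed.

Let be_sb zeta : slot_bounded (rconj (al zeta)).
Proof.
move=> s1 s2; have [c c0 hc] := al_sb zeta (rev s2) (rev s1); exists c => // h h'.
by rewrite /rconj -rmorphB nrmJ !rev_cat !rev_cons -!cats1 -!catA; exact: hc.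
Qed.

Let lin_sb (f g : seq H -> C^o) a : slot_bounded f -> slot_bounded g -> slot_bounded (fun s => f s + a * g s).
Proof.
move=> hf hg s1 s2; have [c c0 hc] := hf s1 s2; have [d d0 hd] := hg s1 s2.
exists (c + nrm a * d); first by rewrite addr_ge0// mulr_ge0// nrm_ge0.
move=> h h'; have := hc h h'; have := hd h h'.
move: (f _) (f _) (g _) (g _) => f2 f1 g2 g1 e1 e2.
have -> : f1 + a * g1 - (f2 + a * g2) = (f1 - f2) + a * (g1 - g2) by ring.
by rewrite (le_trans (nrmD _ _))// mulrDl nrmM -mulrA lerD// ler_wpM2l ?nrm_ge0.
Qed.

Let al_ml zeta : multilin (al zeta).
Proof. by move=> s1 s2 a h h'; rewrite /al (fock_multilinear Ff) dotDr dotZr. Qed.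

Let be_ml zeta c : antimultilin (fun s => c * rconj (al zeta) s).
Proof.
move=> s1 s2 a h h'; rewrite /rconj /al !rev_cat !rev_cons -!cats1 -!catA /=.
by rewrite (fock_multilinear Ff) dotDr dotZr rmorphD rmorphM /=; ring.
Qed.

(** A symmetric injective operator has dense range, and tensors of vectors from a dense subspace are
    total. *)
Lemma rlin_total zeta : (forall s, dot zeta (tens (map (rlin P) s)) = 0) -> zeta = 0.
Proof.
move=> h; apply: (tens_ext Ff) => s; rewrite dot0r dot_conj; apply/eqP; rewrite conjC_eq0; apply/eqP.
apply: (@closure_vanish _ _ (al zeta) (range (rlin P))) => // [t ht|].
  suff [u ->] : exists u, t = map (rlin P) u by exact: h.
  elim: t ht => [|k t IH] ht; first by exists [::].
  have [hh _] := List.Forall_cons_iff (range (rlin P)) k t.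
  by have [[u _ <-] /IH[v ->]] := hh ht; exists (u :: v).
have W0 : range (rlin P) 0 by exists 0 => //; exact/lin0/(rlin_linear hP).
have Wl (a : C) (u v : H) : range (rlin P) u -> range (rlin P) v -> range (rlin P) (a *: u + v).
  by move=> [u' _ <-] [v' _ <-]; exists (a *: u' + v') => //; exact: (rlin_linear hP).
have [T [_ h1 h2 _]] := projection_ex W0 Wl.
apply/List.Forall_forall => u _; suff -> : u = T u by exact: h1.
apply/eqP; rewrite -subr_eq0; apply/eqP; apply: (rlin_inj hP E0_total).
by apply: dot_ext => z; rewrite dot0r -(rlin_sym hP) dot_conj h2 ?conjC0//; exists z.
Qed.

Let rlin_i h : rlin P ('i%C *: h) = 'i%C *: rlin P h.
Proof. exact/linZ/(rlin_linear hP). Qed.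

Lemma cyclic_zero zeta : (forall s, List.Forall E0 s -> dot zeta (tens s) = 0) -> zeta = 0.
Proof.
move=> h; apply: rlin_total => s.
have e t : al zeta (map (fun h => rlin P h + ralin P h) t) + 0 * rconj (al zeta) (map (fun h => rlin P h + ralin P h) t) = 0.
  rewrite mul0r addr0; apply: (closure_vanish (al_sb zeta) h).
  by elim: t => [|k t IH] /=; [exact: List.Forall_nil|apply: List.Forall_cons => //; rewrite -projE; case: (hP k)].
by have := extraction (al_ml zeta) (be_ml zeta 0) rlin_i (ralin_i hP) e s; rewrite mul0r addr0.
Qed.

Let dot_map_conj (f g : H -> H) : (forall u v, dot u (g v) = (dot (f u) v)^*) ->
  forall s t, dot (tens s) (tens (map g t)) = (dot (tens (map f s)) (tens t))^*.
Proof.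
move=> fg; elim=> [|h s IH] t /=.
  rewrite !(fock_dot Ff) size_map; case: t => [|k t] /=; last by rewrite conjC0.
  rewrite rmorph_sum; apply: eq_bigr => p _; rewrite rmorphM /= conjR; congr (_ * _).
  by rewrite !big_ord0 conjC1.
rewrite !(fock_dot_cons Ff) annF_map annF_conj.
have -> : dot h \o g = (fun v => (dot (f h) v)^*) by apply/funext => v; exact: fg.
by congr (annF _ _ _ t); apply/funext => u /=; exact: IH.
Qed.

(** With r and a the linear and antilinear parts of P, and G(T) for second quantization, the two
    hypotheses combine into G(1 - r) zeta = - G(r) zeta. Hence |G(r) zeta|^2 = - <zeta, G(r (1 - r))
    zeta>, while r (1 - r) = a^2 and G(a^2) is positive. So G(r) zeta = 0, and G(r) has dense
    range. *)
Lemma separating_zero zeta :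
  (forall s, List.Forall E0 s -> dot zeta (tens s) + (dot zeta (tens (rev s)))^* = 0) ->
  (forall s, List.Forall (fun g => forall f, E0 f -> complex.Im (dot f g) = 0) s ->
     dot zeta (tens s) - (dot zeta (tens (rev s)))^* = 0) -> zeta = 0.
Proof.
move=> h1 h2; set r := rlin P; set rc := fun h => h - r h.
(* P = r + a takes its values in the closure of E0; [extraction] keeps the part that is linear in
   the arguments. *)
have e1 s : al zeta (map r s) + 1 * rconj (al zeta) (map (ralin P) s) = 0.
  apply: (extraction (al_ml zeta) (be_ml zeta 1) rlin_i (ralin_i hP)) => t.
  apply: (@closure_vanish _ _ (fun t => al zeta t + 1 * rconj (al zeta) t) E0).
  - exact: lin_sb (al_sb _) (be_sb _).
  - by move=> u hu; rewrite mul1r; exact: h1.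
  - by elim: t => [|k t IH] /=; [exact: List.Forall_nil|apply: List.Forall_cons => //; rewrite -projE; case: (hP k)].
have rci h : rc ('i%C *: h) = 'i%C *: rc h by rewrite /rc /r rlin_i scalerBr.
(* Here 1 - [iproj] = (1 - r) + a takes its values among the right vectors: the antilinear part is
   the same as for P, which is why the two relations can be compared. *)
have e2 s : al zeta (map rc s) + (-1) * rconj (al zeta) (map (ralin P) s) = 0.
  apply: (extraction (al_ml zeta) (be_ml zeta (-1)) rci (ralin_i hP)) => t.
  rewrite mulN1r; apply: h2; elim: t => [|k t IH] /=; first exact: List.Forall_nil.
  apply: List.Forall_cons => // f hf; have := coproj_real hP k hf.
  by rewrite iprojE opprB addrA addrAC.
have rsym := rlin_sym hP; have rcsym u v : dot (rc u) v = dot u (rc v).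
  by rewrite /rc dotBl dotBr rsym.
have [G1 [b1 a1 t1]] := second_quant_ex q_gt q_lt Ff rsym (rlin_le hP).
have [G2 [b2 a2 t2]] := second_quant_ex q_gt q_lt Ff rcsym (rlin_cle hP).
have e3 : G2 zeta = - G1 zeta.
  apply/eqP; rewrite -addr_eq0; apply/eqP; apply: (tens_ext Ff) => s.
  rewrite dot0r dotDr -a1 -a2 t1 t2 dot_conj [X in _ + X]dot_conj -rmorphD /=.
  apply/eqP; rewrite conjC_eq0; apply/eqP; have := e1 s; have := e2 s; rewrite /al mulN1r mul1r.
  by move: (rconj _ _) (dot _ _) (dot _ _) => u v w k1 k2; rewrite -[RHS]addr0 -{1}k1 -k2; ring.
have bT := bounded_comp b1 b2.
have Tt s : (G1 \o G2) (tens s) = tens (map (ralin P \o ralin P) s).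
  by rewrite /= t2 t1 -map_comp; congr tens; apply: eq_map => k /=; rewrite (ralin_sq hP).
(* On formal vectors <v, G(a^2) v> is a squared norm: antilinear symmetry moves one factor a to the
   left argument, at the cost of conjugating coefficients. *)
have pos : 0 <= complex.Re (dot zeta ((G1 \o G2) zeta)).
  apply: (dense_pos (fT_dense Ff) bT) => _ [v _ <-].
  rewrite (fT_lin _ _ (bounded_lin bT)) /fT /fsum dot_suml.
  suff -> : \sum_(i <- v) dot (i.1 *: tens i.2) (\sum_(p <- v) p.1 *: ((G1 \o G2) \o tens) p.2) =
     (dot (\sum_(i <- v) i.1^* *: tens (map (ralin P) i.2)) (\sum_(i <- v) i.1^* *: tens (map (ralin P) i.2)))^*.
    by rewrite ReJ -nrm_dot sqr_ge0.
  rewrite dot_suml rmorph_sum; apply: eq_bigr => i _; rewrite !dot_sumr rmorph_sum.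
  apply: eq_bigr => j _; rewrite -[(_ \o tens) _]/((G1 \o G2) (tens j.2)) Tt map_comp !dotZl !dotZr !rmorphM /= conjCK; congr (_ * _).
  by rewrite conjCK; congr (_ * _); exact: (dot_map_conj (ralin_sym hP)).
have nz : nrm (G1 zeta) ^+ 2 = - complex.Re (dot zeta ((G1 \o G2) zeta)).
  by rewrite /= e3 (linN _ (bounded_lin b1)) dotNr ReN opprK nrm_dot a1.
have z0 : G1 zeta = 0.
  by apply: nrm_eq0; apply/eqP; rewrite -sqrf_eq0 eq_le sqr_ge0 andbT nz oppr_le0.
by apply: rlin_total => s; rewrite -/r -t1 -a1 z0 dot0l.
Qed.

End Projected.
End Separation.

Section Letters.
Context {R : realType} (q : R) (H F : hilbertType R) (tens : seq H -> F).
Hypothesis q_gt : -1 < q.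
Hypothesis q_lt : q < 1.
Hypothesis Ff : q_fock q tens.
Context (E0 : set H).
Hypothesis E0_0 : E0 0.
Hypothesis E0_lin : forall (r : R) x y, E0 x -> E0 y -> E0 (r%:C *: x + y).
Hypothesis E0_total : forall z : H, (forall w : H, E0 w -> dot w z = 0) -> z = 0.
Local Notation Om := (tens [::]).

(* (true, f) and (false, g) stand for the left field operator of f and the right
   field operator of g, where g ranges over the real-orthogonal of i E0. *)
Definition is_letter (l : bool * H) : bool :=
  `[< if l.1 then E0 l.2 else forall f, E0 f -> complex.Im (dot f l.2) = 0 >].
Definition letter := {l : bool * H | is_letter l}.
HB.instance Definition _ := Choice.on letter.

Definition pop (l : bool * H) : F -> F := if l.1 then xop tens l.2 else yop tens l.2.
Definition lop (l : letter) : F -> F := pop (val l).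
Definition lside (l : letter) : bool := (val l).1.

Lemma lop_b l : bounded_op (lop l).
Proof. by rewrite /lop /pop; case: ifP => _; [exact: (xop_bounded q_gt q_lt Ff)|exact: (yop_bounded q_gt q_lt Ff)]. Qed.

Lemma lop_sa l : adjoint (lop l) (lop l).
Proof. by rewrite /lop /pop; case: ifP => _; [exact: (xop_sa q_gt q_lt Ff)|exact: (yop_sa q_gt q_lt Ff)]. Qed.

Lemma lop_comm l l' z : lside l -> ~~ lside l' -> lop l (lop l' z) = lop l' (lop l z).
Proof.
case: l l' => [[b f] hf] [[b' g] hg]; rewrite /lside /lop /pop /=.
move/asboolP: hf => hf; move/asboolP: hg => hg; move: hf hg; case: b => //; case: b' => //= hf hg _ _; apply: (xy_comm q_gt q_lt Ff).
by apply: cplx_eq; rewrite [dot f g]dot_conj ?ReJ// ImJ dot_conj ImJ hg// !oppr0.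
Qed.

Lemma letter_word b (s : seq H) : List.Forall (fun h => is_letter (b, h)) s ->
  exists w : seq letter, map val w = map (pair b) s.
Proof.
elim: s => [|h s IH] hs; first by exists [::].
have [hh _] := List.Forall_cons_iff (fun h => is_letter (b, h)) h s.
by have [hl /IH[w hw]] := hh hs; exists (exist _ (b, h) hl :: w); rewrite /= hw.
Qed.

Lemma vword_lop w z : vword lop w z = foldr pop z (map val w).
Proof. by elim: w => //= l w ->. Qed.

Lemma vword_letter b (s : seq H) w : map val w = map (pair b) s ->
  all (fun l => lside l == b) w /\ vword lop w Om = foldr (fun h => pop (b, h)) Om s.
Proof.
move=> h; rewrite vword_lop h; split; last by elim: s {h} => //= k s ->.
by elim: w s h => [|l w IH] [|k s]//= [e /IH ->]; rewrite /lside [\val l]e /= eqxx.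
Qed.

Lemma word_of_letters b (Q : F -> F -> Prop) :
  (forall w, all (fun l => lside l == b) w -> Q (vword lop w Om) (vword lop (rev w) Om)) ->
  forall s, List.Forall (fun h => is_letter (b, h)) s ->
  Q (foldr (fun h => pop (b, h)) Om s) (foldr (fun h => pop (b, h)) Om (rev s)).
Proof.
move=> h s /letter_word[w hw]; have [h1 <-] := vword_letter hw.
have [|_ <-] := @vword_letter b (rev s) (rev w); first by rewrite !map_rev hw.
exact: h.
Qed.

Lemma Forall_impl (A B : H -> Prop) s : (forall h, A h -> B h) -> List.Forall A s -> List.Forall B s.
Proof. by move=> h; apply: List.Forall_impl. Qed.

Let P_ex := rprojection_ex E0_0 E0_lin.

Lemma lop_sep : separating Om lop lside.
Proof.
move=> zeta h1 h2; have [P hP] := P_ex.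
apply: (separating_zero q_gt q_lt Ff hP E0_total) => s hs.
  apply: (@xwords_sep _ _ _ _ _ q_gt q_lt Ff _ E0) => // {hs}s hs.
  apply: (@word_of_letters true (fun u v => dot zeta v = - (dot zeta u)^*)) => [w hw|].
    by apply: h1; apply: sub_all hw => l; rewrite eqb_id.
  by apply: Forall_impl hs => h hh; apply/asboolP.
apply: (@ywords_sep _ _ _ _ _ q_gt q_lt Ff _ _ _ s hs) => {hs}s hs.
apply: (@word_of_letters false (fun u v => dot zeta v = (dot zeta u)^*)) => [w hw|].
  by apply: h2; apply: sub_all hw => l /=; rewrite eqbF_neg.
by apply: Forall_impl hs => h hh; apply/asboolP.
Qed.

Lemma lop_cyclic z : (forall w, all lside w -> dot (vword lop w Om) z = 0) -> z = 0.
Proof.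
move=> h; have [P hP] := P_ex; apply: (cyclic_zero q_gt q_lt Ff hP E0_total) => s hs.
apply: (@xwords_cyclic _ _ _ _ _ q_gt q_lt Ff _ E0) => // {hs}s hs.
apply: (@word_of_letters true (fun u v => dot u z = 0)) => [w hw|].
  by apply: h; apply: sub_all hw => l; rewrite eqb_id.
by apply: Forall_impl hs => k hh; apply/asboolP.
Qed.

Lemma commutant_vN (X : set (F -> F)) : star_closed X -> von_neumann (commutant X).
Proof.
move=> sX; split=> [T T' hT bT' aT|].
  by rewrite -(adjE (comm_bounded hT) aT); exact: comm_adj.
apply/seteqP; split=> T [bT hT]; apply: commI => // x z hx.
  have hc : commutant (commutant X) x.
    have bx : bounded_op x by case: (sX _ hx).
    by apply: commI => // y z' hy; rewrite -(comm_commute z' hy hx).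
  by have := congr1 (@^~ z) (hT _ hc).
by rewrite -(comm_commute z hx (conj bT hT)).
Qed.

(** The commutant of the right letters is a von Neumann algebra that contains the left ones.
    Conversely, by [rieffel] its elements commute with everything that commutes with the left
    letters, in particular with M' for every von Neumann algebra M containing these. *)
Lemma vN_left (X : set (F -> F)) : X = letters lop lside ->
  vN_generated X = commutant (letters lop (predC lside)).
Proof.
move=> ->; apply/seteqP; split=> T hT.
  apply: hT; split; first by apply: commutant_vN; apply: letters_star; [exact: lop_b|exact: lop_sa].
  move=> _ [l hl ->]; apply: commI; first exact: lop_b.
  by move=> _ z [l' hl' ->]; exact: lop_comm.
move=> M [[Ms M2] XM]; rewrite -M2; apply: commI; first exact: comm_bounded hT.
move=> Z z hZ; apply: (rieffel lop_b lop_sa lop_comm lop_sep lop_cyclic hT).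
apply: commI; first exact: comm_bounded hZ.
by move=> y u /XM My; exact: comm_commute hZ My.
Qed.

Lemma gaussians_letters (HR : realHilbertType R) (emb : HR -> H) : E0 = range emb ->
  q_gaussians tens emb = letters lop lside.
Proof.
move=> e; apply/seteqP; split=> [_ [f [c [a [hc ba ca ->]]]]|_ [[[b f] hl] + ->]].
  have fl : is_letter (true, emb f) by apply/asboolP; rewrite /= e; exists f.
  exists (exist _ (true, emb f) fl) => //; rewrite /lop /pop /= /xop.
  by rewrite -(creation_uniq q_gt q_lt Ff hc) (adjE (proj1 hc) ca).
rewrite /lside /lop /pop /= => bt; move: hl; rewrite bt => /asboolP /=; rewrite e => -[g _ gf].
exists g, (cr tens f), (adj (cr tens f)); rewrite gf; split=> //.
- exact: (crP q_gt q_lt Ff).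
- by apply: adj_bounded; exact: (cr_bounded q_gt q_lt Ff).
- by apply: adj_adjoint; exact: (cr_bounded q_gt q_lt Ff).
Qed.

End Letters.

(** * Fermionic models *)

Section RandomSigns.
Context {R : realType} (q : R) (N : nat).
Hypothesis q_gt : -1 < q.
Hypothesis q_lt : q < 1.
Hypothesis N_gt0 : (0 < N)%N.
Local Notation I := 'I_N.

Definition mean (w : I -> R) : R := N%:R^-1 * \sum_j w j.

(** Unfolded: the average over all k-tuples of indices i of the squared distance between the mean
    over j of w j times the k signs eps i j, and q^(p + k). Repeated indices are included in the
    average. *)
Fixpoint sign_defect (eps : I -> I -> R) (k : nat) (w : I -> R) (p : nat) : R :=
  if k is k'.+1 then mean (fun i => sign_defect eps k' (fun j => w j * eps i j) p.+1)
  else (mean w - q ^+ p) ^+ 2.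

Lemma mean_le (v w : I -> R) : (forall i, v i <= w i) -> mean v <= mean w.
Proof. by move=> h; rewrite ler_wpM2l ?invr_ge0// ler_sum. Qed.

Lemma mean_ge0 (v : I -> R) : (forall i, 0 <= v i) -> 0 <= mean v.
Proof. by move=> h; rewrite mulr_ge0 ?invr_ge0 ?sumr_ge0. Qed.

Lemma mean_const c : mean (fun=> c) = c.
Proof. by rewrite /mean sumr_const card_ord -[c *+ N]mulr_natl mulrA mulVf ?mul1r// pnatr_eq0 -lt0n. Qed.

Lemma sign_defect_ge0 eps k w p : 0 <= sign_defect eps k w p.
Proof. by elim: k w p => [|k IH] w p /=; [exact: sqr_ge0|apply: mean_ge0 => i]. Qed.

Definition signs (w : I -> R) : Prop := forall j, w j = 1 \/ w j = -1.

Lemma signs_mul v w : signs v -> signs w -> signs (fun j => v j * w j).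
Proof.
move=> hv hw j; case: (hv j) (hw j) => -> [] ->; rewrite ?mulrNN ?mul1r ?mulr1; by [left|right].
Qed.

Lemma normq_le p : `|q ^+ p| <= 1.
Proof. by rewrite normrX exprn_ile1// ler_norml !ltW. Qed.

Lemma sign_defect_le4 eps k w p : (forall i, signs (eps i)) -> signs w -> sign_defect eps k w p <= 4.
Proof.
move=> he; elim: k w p => [|k IH] w p hw /=; last first.
  by rewrite -(mean_const 4); apply: mean_le => i; apply/IH/signs_mul.
have h1 : `|mean w| <= 1.
  rewrite /mean normrM ger0_norm ?invr_ge0// ler_pdivrMl ?ltr0n// mulr1 (le_trans (ler_norm_sum _ _ _))//.
  rewrite -[leRHS]/(N%:R) -[X in _ <= X%:R](card_ord N) -sumr_const ler_sum// => j _.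
  by case: (hw j) => ->; rewrite ?normrN normr1.
move: h1 (normq_le p); rewrite !ler_norml; nra.
Qed.

Definition edge (i j : I) : I * I := if (i < j)%N then (i, j) else (j, i).

Lemma edge_eq i j i' j' : edge i j = edge i' j' -> (i = i' /\ j = j') \/ (i = j' /\ j = i').
Proof. by rewrite /edge; case: ifP => _; case: ifP => _ [-> ->]; [left|right|right|left]. Qed.

Local Notation sample := {ffun I * I -> bool}.
Definition sgnb (b : bool) : R := if b then 1 else -1.
(** One independent sign for each unordered pair, equal to 1 with probability (1 + q) / 2; the
    diagonal value -1 makes the operators of a single site fermionic. *)
Definition eps_of (om : sample) (i j : I) : R := if i == j then -1 else sgnb (om (edge i j)).

Lemma eps_of_signs om i : signs (eps_of om i).
Proof. by move=> j; rewrite /eps_of /sgnb; case: ifP; [right|case: ifP; [left|right]]. Qed.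

Lemma eps_of_sym om i j : eps_of om i j = eps_of om j i.
Proof.
rewrite /eps_of eq_sym; case: eqP => // h; congr (sgnb (om _)); rewrite /edge.
case: ltngtP => // e; by case: h; apply: val_inj.
Qed.

Definition pr (b : bool) : R := if b then (1 + q) / 2 else (1 - q) / 2.
Definition weight (om : sample) : R := \prod_e pr (om e).
Definition expect (X : sample -> R) : R := \sum_om weight om * X om.

Lemma pr_ge0 b : 0 <= pr b.
Proof. by rewrite /pr; case: b; rewrite divr_ge0//; [rewrite -lerBlDl sub0r ltW|rewrite subr_ge0 ltW]. Qed.

Lemma weight_ge0 om : 0 <= weight om.
Proof. by apply: prodr_ge0 => e _; exact: pr_ge0. Qed.

Lemma expect_edges (l : seq (I * I)) : uniq l ->
  expect (fun om => \prod_(e <- l) sgnb (om e)) = q ^+ size l.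
Proof.
move=> ul; rewrite /expect.
under eq_bigr => om _.
  rewrite big_uniq// [X in _ * X]big_mkcond /weight -big_split /=; over.
rewrite -(bigA_distr_bigA (fun e b => pr b * (if e \in l then sgnb b else 1))).
rewrite (eq_bigr (fun e => if e \in l then q else 1)); last first.
  by move=> e _; rewrite big_bool /pr /sgnb /=; case: ifP => _; field.
by rewrite -big_mkcond -big_uniq// big_const_seq count_predT iter_mulr_1.
Qed.

Lemma expect1 : expect (fun=> 1) = 1.
Proof. by rewrite -[RHS](expr0 q) -(expect_edges (l := [::]))//; apply: eq_bigr => om _; rewrite big_nil. Qed.

Lemma expectD X Y : expect (fun om => X om + Y om) = expect X + expect Y.
Proof. by rewrite /expect -big_split; apply: eq_bigr => om _; rewrite mulrDr. Qed.

Lemma expectZ c X : expect (fun om => c * X om) = c * expect X.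
Proof. by rewrite /expect mulr_sumr; apply: eq_bigr => om _; rewrite mulrCA. Qed.

Lemma expect_le X Y : (forall om, X om <= Y om) -> expect X <= expect Y.
Proof. by move=> h; apply: ler_sum => om _; rewrite ler_wpM2l ?weight_ge0. Qed.

Lemma expect_const c : expect (fun=> c) = c.
Proof. by rewrite -[c]mulr1 expectZ expect1. Qed.

Lemma expect_sum (J : finType) (X : J -> sample -> R) :
  expect (fun om => \sum_j X j om) = \sum_j expect (X j).
Proof. by rewrite /expect exchange_big; apply: eq_bigr => om _; rewrite mulr_sumr. Qed.

Lemma expect_mean (X : I -> sample -> R) :
  expect (fun om => mean (fun i => X i om)) = mean (fun i => expect (X i)).
Proof. by rewrite /mean expectZ expect_sum. Qed.

Lemma expect_ex X c : expect X <= c -> exists om, X om <= c.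
Proof.
move=> h; apply/existsP; apply: contraT => /existsPn h'.
have h2 om : c < X om by rewrite ltNge h'.
have g0 om : 0 < X om - c by rewrite subr_gt0.
have p om : 0 <= weight om * (X om - c) by rewrite mulr_ge0 ?weight_ge0 ?ltW.
have e : expect (fun om => X om - c) = 0.
  apply/eqP; rewrite eq_le; apply/andP; split; last by apply: sumr_ge0.
  by rewrite expectD expect_const subr_le0.
have := expect1; rewrite /expect big1 => [/eqP|om _]; first by rewrite eq_sym oner_eq0.
move/eqP: e; rewrite psumr_eq0 // => /allP/(_ om).
by rewrite mem_index_enum /= mulf_eq0 (gt_eqF (g0 om)) orbF mulr1 => /(_ isT)/eqP.
Qed.

Definition wpath (p : seq I) (om : sample) (j : I) : R := \prod_(i <- p) eps_of om i j.

Lemma wpath_signs p om : signs (wpath p om).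
Proof.
elim: p => [|i p IH] j; first by rewrite /wpath big_nil; left.
rewrite /wpath big_cons -/(wpath p om j).
exact: (signs_mul (v := eps_of om i) (eps_of_signs om i) IH).
Qed.

Lemma wpath_edges p om j : j \notin p -> wpath p om j = \prod_(e <- [seq edge i j | i <- p]) sgnb (om e).
Proof.
move=> hj; rewrite /wpath big_map big_seq [RHS]big_seq; apply: eq_bigr => i hi.
by rewrite /eps_of; case: eqP => // e; rewrite -e hi in hj.
Qed.

Lemma edges_uniq p j : uniq p -> j \notin p -> uniq [seq edge i j | i <- p].
Proof.
move=> up hj; rewrite map_inj_in_uniq// => i i' hi hi' /edge_eq[[]//|[e1 e2]].
by rewrite -e2 in hi'; rewrite hi' in hj.
Qed.

Lemma expect_wpath p j : uniq p -> j \notin p -> expect (fun om => wpath p om j) = q ^+ size p.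
Proof.
move=> up hj; rewrite -[in RHS](size_map (edge^~ j)) -expect_edges ?edges_uniq//.
by apply: eq_bigr => om _; rewrite wpath_edges.
Qed.

Lemma expect_wpath2 p j j' : uniq p -> j \notin p -> j' \notin p -> j != j' ->
  expect (fun om => wpath p om j * wpath p om j') = q ^+ size p * q ^+ size p.
Proof.
move=> up hj hj' njj; set l := [seq edge i j | i <- p] ++ [seq edge i j' | i <- p].
have ul : uniq l.
  rewrite cat_uniq !edges_uniq//= andbT; apply/hasPn => _ /mapP[i hi ->]; apply/mapP => -[i' hi' e].
  case: (edge_eq e) => -[e1 e2]; first by rewrite e2 eqxx in njj.
  by rewrite -e1 hi in hj.
rewrite -exprD; have -> : (size p + size p)%N = size l by rewrite size_cat !size_map.
by rewrite -expect_edges//; apply: eq_bigr => om _; rewrite !wpath_edges// /l big_cat.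
Qed.

(** A variance estimate: for distinct j and j' outside the path p, the products run over disjoint
    edges and are uncorrelated. *)
Lemma expect_defect0 p : uniq p ->
  expect (fun om => (mean (wpath p om) - q ^+ size p) ^+ 2) <= (4 * (2 * size p + 1))%:R / N%:R.
Proof.
move=> up; pose Z om j := wpath p om j - q ^+ size p.
have N0 : (N%:R : R) != 0 by rewrite pnatr_eq0 -lt0n.
have e om : (mean (wpath p om) - q ^+ size p) ^+ 2 =
    N%:R^-1 ^+ 2 * \sum_j \sum_j' Z om j * Z om j'.
  have -> : mean (wpath p om) - q ^+ size p = N%:R^-1 * \sum_j Z om j.
    by rewrite sumrB mulrBr -[q ^+ _ in LHS]mean_const.
  rewrite exprMn; congr (_ * _); rewrite expr2 mulr_suml; apply: eq_bigr => j _.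
  by rewrite mulr_sumr.
(* A correlation that need not vanish is at most 4, as |Z| <= 2; m charges 4 to the diagonal and to
   every pair that meets p, a total of 4 (N + 2 N |p|). *)
pose m j j' : nat := (4 * ((j == j') + ((j \in p) + (j' \in p))))%N.
have b j j' : expect (fun om => Z om j * Z om j') <= (m j j')%:R.
  have triv : (0 < (j == j') + ((j \in p) + (j' \in p)))%N -> expect (fun om => Z om j * Z om j') <= (m j j')%:R.
    move=> hm; apply: (@le_trans _ _ (expect (fun=> 4))); last first.
      by rewrite expect_const /m natrM -[leLHS]mulr1 ler_wpM2l// ler1n.
    apply: expect_le => om; move: (normq_le (size p)); rewrite /Z ler_norml => /andP[h1 h2].
    by case: (wpath_signs p om j) (wpath_signs p om j') => -> [] ->; nra.
  case: (boolP (j == j')) => [h|h]; first by apply: triv; rewrite h.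
  case: (boolP (j \in p)) => [h1|h1]; first by apply: triv; rewrite h1 addnA addnAC addn1.
  case: (boolP (j' \in p)) => [h2|h2]; first by apply: triv; rewrite h2 addnA addn1.
  have -> : expect (fun om => Z om j * Z om j') = 0; last by [].
  rewrite (_ : (fun om => _) = (fun om => wpath p om j * wpath p om j' + (- q ^+ size p * wpath p om j +
    (- q ^+ size p * wpath p om j' + q ^+ size p * q ^+ size p)))); last first.
    by apply/funext => om; rewrite /Z; ring.
  by rewrite !expectD !expectZ expect_wpath2// !expect_wpath// expect_const; ring.
rewrite (_ : (fun om => _) = (fun om => N%:R^-1 ^+ 2 * \sum_j \sum_j' Z om j * Z om j')); last exact/funext.
rewrite expectZ expect_sum.
apply: (@le_trans _ _ (N%:R^-1 ^+ 2 * \sum_j \sum_j' (m j j')%:R)).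
  rewrite ler_wpM2l ?sqr_ge0// ler_sum// => j _; rewrite expect_sum ler_sum// => j' _; exact: b.
have -> : \sum_j \sum_j' ((m j j')%:R : R) = (4 * (N + (N * size p + N * size p)))%:R.
  under eq_bigr do rewrite -natr_sum; rewrite -natr_sum; congr (_%:R).
  rewrite /m; under eq_bigr do rewrite -big_distrr /=; rewrite -big_distrr /=; congr (4 * _)%N.
  under eq_bigr do rewrite !big_split /=.
  have cp : (\sum_(i : I) (i \in p) = size p)%N by rewrite -big_mkcond /= sum1_card; apply/card_uniqP.
  rewrite !big_split /=; congr (_ + (_ + _))%N.
  - transitivity (\sum_(i : I) 1)%N; last by rewrite sum1_card card_ord.
    by apply: eq_bigr => i _; rewrite (bigD1 i)//= eqxx big1// => j; rewrite eq_sym => /negPf ->.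
  - rewrite exchange_big /=; under eq_bigr do rewrite cp.
    by rewrite sum_nat_const card_ord.
  - under eq_bigr do rewrite cp; by rewrite sum_nat_const card_ord.
rewrite !natrM !natrD !natrM expr2 -subr_ge0 le_eqVlt eq_sym; apply/orP; left; apply/eqP; by field.
Qed.

(** Averaging over one more index i either extends the path by a new vertex, or hits one of the m
    vertices already visited; the latter has frequency m / N and the defect is then at most 4. *)
Fixpoint defect_const (k m : nat) : nat :=
  if k is k'.+1 then defect_const k' m.+1 + 4 * m else 4 * (2 * m + 1).

Lemma expect_defect k p : uniq p ->
  expect (fun om => sign_defect (eps_of om) k (wpath p om) (size p)) <= (defect_const k (size p))%:R / N%:R.
Proof.
elim: k p => [|k IH] p up; first exact: expect_defect0.
rewrite /= expect_mean.
apply: (@le_trans _ _ (mean (fun i => (defect_const k (size p).+1)%:R / N%:R + 4 * (i \in p)%:R))).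
  apply: mean_le => i.
  have -> : (fun om => sign_defect (eps_of om) k (fun j => wpath p om j * eps_of om i j) (size p).+1) =
    (fun om => sign_defect (eps_of om) k (wpath (i :: p) om) (size (i :: p))).
    apply/funext => om; congr (sign_defect _ _ _ _); apply/funext => j.
    by rewrite /wpath big_cons mulrC.
  case: (boolP (i \in p)) => hi.
    rewrite mulr1 -[leLHS]add0r lerD ?divr_ge0//.
    rewrite -(expect_const 4); apply: expect_le => om.
    by apply: sign_defect_le4; [exact: eps_of_signs|exact: wpath_signs].
  by rewrite mulr0 addr0; apply: (IH (i :: p)); rewrite /= hi.
rewrite /mean big_split /= sumr_const card_ord -mulr_sumr -natr_sum.
have -> : (\sum_(i : I) (i \in p) = size p)%N by rewrite -big_mkcond /= sum1_card; apply/card_uniqP.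
have N0 : (N%:R : R) != 0 by rewrite pnatr_eq0 -lt0n.
rewrite -[_ *+ N]mulr_natl natrD natrM le_eqVlt; apply/orP; left; apply/eqP; by field.
Qed.

Definition sign_bound (k : nat) : R := 2 ^+ k.+1 * (defect_const k 0)%:R.

(* Averaging over independent signs of mean q, with weights 2^-k-1 on the k-th
   defects to control all of them at once. *)
Lemma signs_exist : exists eps : I -> I -> R, [/\ forall i, signs (eps i),
  forall i j, eps i j = eps j i, forall i, eps i i = -1 &
  forall k, (k < N)%N -> sign_defect eps k (fun=> 1) 0 <= sign_bound k / N%:R].
Proof.
have dc k m : (0 < defect_const k m)%N.
  by elim: k m => [|k IH] m /=; [rewrite muln_gt0 addn1|rewrite ltn_addr].
pose c k : R := (sign_bound k)^-1.
have sb0 k : 0 < sign_bound k by rewrite mulr_gt0 ?exprn_gt0// ltr0n.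
have [om hom] : exists om, \sum_(k < N) c k * sign_defect (eps_of om) k (fun=> 1) 0 <= N%:R^-1.
  apply: expect_ex; rewrite expect_sum.
  apply: (@le_trans _ _ (\sum_(k < N) 2^-1 ^+ k.+1 * N%:R^-1)).
    apply: ler_sum => k _; rewrite expectZ.
    apply: (@le_trans _ _ (c k * ((defect_const k 0)%:R / N%:R))).
      apply: ler_wpM2l; first by rewrite invr_ge0 ltW.
      have := @expect_defect k [::] isT.
      suff -> : (fun om => sign_defect (eps_of om) k (wpath [::] om) 0) =
        (fun om => sign_defect (eps_of om) k (fun=> 1) 0) by [].
      apply/funext => om; by congr (sign_defect _ _ _ _); apply/funext => j; rewrite /wpath big_nil.
    rewrite mulrA ler_wpM2r ?invr_ge0// /c /sign_bound invfM exprVn mulfVK//.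
    by rewrite pnatr_eq0 -lt0n.
  rewrite -mulr_suml ler_piMl ?invr_ge0//.
  elim: N => [|n IH]; first by rewrite big_ord0.
  rewrite big_ord_recl expr1; under eq_bigr do rewrite exprS.
  rewrite -mulr_sumr; move: IH; rewrite /bump /=; lra.
exists (eps_of om); split.
- exact: eps_of_signs.
- exact: eps_of_sym.
- by move=> i; rewrite /eps_of eqxx.
move=> k kN; rewrite -[k]/(val (Ordinal kN)); set k' := Ordinal kN.
rewrite mulrC -ler_pdivrMr// mulrC; apply: le_trans hom.
rewrite (bigD1 k')//= lerDl sumr_ge0// => j _.
by apply: mulr_ge0; [rewrite invr_ge0 ltW|exact: sign_defect_ge0].
Qed.

End RandomSigns.

(** * Normalized sums with mixed commutation signs *)

Section FermionicFock.
Context {R : realType} (q : R) (N : nat) (eps : 'I_N -> 'I_N -> R).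
Hypothesis N_gt0 : (0 < N)%N.
Context (K : hilbertType R) (Om : K) (V : Type) (ip : V -> V -> R[i]) (nV : V -> R).
Context (bs an : 'I_N -> V -> K -> K) (Kle : nat -> set K).
Local Notation C := R[i].
Local Notation Q := (q%:C : C).
Hypotheses (bs_lin : forall i h, linear (bs i h)) (an_lin : forall i h, linear (an i h)).
Hypothesis an_bs : forall i j g h z, an j h (bs i g z) =
  (eps i j)%:C *: bs i g (an j h z) + (if i == j then ip h g else 0) *: z.
Hypotheses (an_Om : forall j h, an j h Om = 0) (nrm_Om : nrm Om = 1).
Hypothesis bs_an : forall i h, adjoint (bs i h) (an i h).
Hypotheses (Kle_Om : Kle 0 Om) (Kle0 : forall n, Kle n 0)
  (Kle_lin : forall n a x y, Kle n x -> Kle n y -> Kle n (a *: x + y))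
  (Kle_bs : forall n i g z, Kle n z -> Kle n.+1 (bs i g z))
  (Kle_an : forall n i g z, Kle n z -> Kle n (an i g z))
  (Kle_mono : forall m n z, (m <= n)%N -> Kle m z -> Kle n z).
Hypotheses (nV_ge0 : forall h, 0 <= nV h) (ip_le : forall h g, nrm (ip h g) <= nV h * nV g).

Let rN : R := Num.sqrt N%:R.
(** The vectors v i may depend on the site i, as the errors do to which the creation operators are
    applied in [avg_defect]. *)
Hypothesis key : forall n h (v : 'I_N -> K), (forall i, Kle n (v i)) ->
  nrm ((rN^-1)%:C *: \sum_i bs i h (v i)) ^+ 2 <= n.+1%:R * nV h ^+ 2 * mean (fun i => nrm (v i) ^+ 2).

Let rN_gt0 : 0 < rN. Proof. by rewrite sqrtr_gt0 ltr0n. Qed.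
Let rNV : rN^-1 * rN = 1. Proof. by rewrite mulVf// gt_eqF. Qed.

Definition bsum h z : K := (rN^-1)%:C *: \sum_i bs i h z.
Definition asum h z : K := (rN^-1)%:C *: \sum_i an i h z.
Definition wick (s : seq V) : K := foldr bsum Om s.

Let KleD n x y : Kle n x -> Kle n y -> Kle n (x + y).
Proof. by rewrite -{2}[x]scale1r; exact: Kle_lin. Qed.
Let KleZ n a x : Kle n x -> Kle n (a *: x).
Proof. by move=> h; rewrite -[_ *: _]addr0; exact: Kle_lin. Qed.
Let KleB n x y : Kle n x -> Kle n y -> Kle n (x - y).
Proof. by move=> hx hy; rewrite -scaleN1r; apply: KleD => //; exact: KleZ. Qed.
Let Kle_sum n (J : Type) (r : seq J) (f : J -> K) : (forall j, Kle n (f j)) -> Kle n (\sum_(j <- r) f j).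
Proof. by move=> h; elim: r => [|j r IH]; rewrite ?big_nil// big_cons; exact: KleD. Qed.

Lemma bsum_lin h : linear (bsum h).
Proof.
move=> a x y; rewrite /bsum; under eq_bigr do rewrite bs_lin.
by rewrite big_split /= -scaler_sumr scalerDr !scalerA mulrC.
Qed.

Lemma bsum_asum h : adjoint (bsum h) (asum h).
Proof.
move=> x y; rewrite /bsum /asum dotZl dotZr conjR dot_suml dot_sumr; congr (_ * _).
by apply: eq_bigr => i _; exact: bs_an.
Qed.

Lemma Kle_bsum n h z : Kle n z -> Kle n.+1 (bsum h z).
Proof. by move=> hz; apply/KleZ/Kle_sum => i; exact: Kle_bs. Qed.

Lemma Kle_asum n h z : Kle n z -> Kle n (asum h z).
Proof. by move=> hz; apply/KleZ/Kle_sum => i; exact: Kle_an. Qed.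

Lemma Kle_wick s : Kle (size s) (wick s).
Proof. by elim: s => //= h s IH; exact: Kle_bsum. Qed.

Let sq_le n (x y c : R) : 0 <= x -> 0 <= y -> 0 <= c -> x ^+ 2 <= n.+1%:R * c ^+ 2 * y ^+ 2 -> x <= n.+1%:R * c * y.
Proof.
move=> x0 y0 c0 h; rewrite -(@ler_pXn2r _ 2)// ?nnegrE ?mulr_ge0//; apply: (le_trans h).
rewrite !exprMn ler_wpM2r ?sqr_ge0// ler_wpM2r ?sqr_ge0// expr2 ler_peMr// ler1n //.
Qed.

Lemma bsum_sq n h z : Kle n z -> nrm (bsum h z) ^+ 2 <= n.+1%:R * nV h ^+ 2 * nrm z ^+ 2.
Proof. by move=> hz; have := @key n h (fun=> z) (fun=> hz); rewrite mean_const. Qed.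

Lemma bsum_le n h z : Kle n z -> nrm (bsum h z) <= n.+1%:R * nV h * nrm z.
Proof. by move=> hz; apply: sq_le; rewrite ?nrm_ge0//; exact: bsum_sq. Qed.

Lemma asum_le n h z : Kle n z -> nrm (asum h z) <= n.+1%:R * nV h * nrm z.
Proof.
move=> hz; have := nrm_ge0 (asum h z); rewrite le_eqVlt => /orP[/eqP <-|a0].
  by rewrite !mulr_ge0 ?nrm_ge0.
rewrite -(ler_pM2r a0) -expr2 nrm_dot -bsum_asum (le_trans (CS_Re _ _))//.
have := ler_wpM2r (nrm_ge0 z) (bsum_le h (Kle_asum h hz)).
by move=> h1; apply: (le_trans h1); rewrite -!mulrA ler_wpM2l// ler_wpM2l// mulrC.
Qed.

Let scaled j h s : K := rN%:C *: an j h (wick s).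

Let scaled_cons j h g s : scaled j h (g :: s) =
  ip h g *: wick s + (rN^-1)%:C *: \sum_i (eps i j)%:C *: bs i g (scaled j h s).
Proof.
rewrite /scaled /= /bsum (linZ _ _ (an_lin _ _)) scalerA -rmorphM /= mulrC rNV scale1r.
rewrite (lin_sum _ _ _ (an_lin j h)) /=.
have -> : \sum_i an j h (bs i g (wick s)) = \sum_i ((eps i j)%:C *: bs i g (an j h (wick s)) +
  (if i == j then ip h g else 0) *: wick s) by apply: eq_bigr => i _; exact: an_bs.
rewrite big_split /= addrC; congr (_ + _).
  by rewrite (bigD1 j)//= eqxx big1 ?addr0// => i /negPf ->; rewrite scale0r.
under [in RHS]eq_bigr do rewrite (linZ _ _ (bs_lin _ _)) scalerA mulrC -scalerA.
by rewrite -scaler_sumr scalerA -rmorphM /= rNV scale1r.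
Qed.

(** Moving an annihilation past a creation at site i multiplies it by eps i j, so the recursion does
    not close on the plain average over j: the weights w record the product of the signs met so
    far. *)
Let avg (w : 'I_N -> R) h s : K := (N%:R^-1)%:C *: \sum_j (w j)%:C *: scaled j h s.

Let avg_cons w h g s : avg w h (g :: s) = ((mean w)%:C * ip h g) *: wick s +
  (rN^-1)%:C *: \sum_i bs i g (avg (fun j => w j * eps i j) h s).
Proof.
rewrite /avg; under eq_bigr do rewrite scaled_cons scalerDr.
rewrite big_split /= scalerDr; congr (_ + _).
  rewrite /mean rmorphM /= -mulrA -[RHS]scalerA rmorph_sum mulr_suml scaler_suml.
  by congr (_ *: _); apply: eq_bigr => j _; rewrite scalerA.
under eq_bigr do rewrite scalerA mulrC -scalerA.
rewrite -scaler_sumr scalerA mulrC -scalerA; congr (_ *: _).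
have -> : \sum_j (w j)%:C *: \sum_i (eps i j)%:C *: bs i g (scaled j h s) =
    \sum_i \sum_j (w j)%:C *: ((eps i j)%:C *: bs i g (scaled j h s)).
  by rewrite exchange_big; apply: eq_bigr => j _; rewrite scaler_sumr.
rewrite scaler_sumr; apply: eq_bigr => i _.
rewrite (linZ _ _ (bs_lin _ _)) (lin_sum _ _ _ (bs_lin _ _)); congr (_ *: _); apply: eq_bigr => j _.
by rewrite [RHS](linZ _ _ (bs_lin i g)) scalerA rmorphM.
Qed.

Let asum_avg h s : asum h (wick s) = avg (fun=> 1) h s.
Proof.
rewrite /asum /avg /scaled; under [in RHS]eq_bigr do rewrite scale1r.
rewrite -scaler_sumr scalerA -rmorphM /=; congr ((_ %:C) *: _).
have e : N%:R = rN * rN by rewrite -expr2 sqr_sqrtr.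
by rewrite e invfM -mulrA rNV mulr1.
Qed.

Let Kle_avg w h s : Kle (size s) (avg w h s).
Proof. by apply/KleZ/Kle_sum => j; do 2 apply: KleZ; apply/Kle_an/Kle_wick. Qed.

Lemma Kle_annF n b (al : seq V -> K) s : (forall t, (size t <= size s)%N -> Kle n (al t)) ->
  Kle n (annF Q b al s).
Proof.
elim: s al => [|g s IH] al h; first by rewrite annF_nil.
rewrite annF_cons; apply: Kle_lin; first exact: h (leqnSn _).
by apply/KleZ/IH => t ht; exact: h.
Qed.

Fixpoint wick_bound (s : seq V) : R :=
  if s is g :: s' then (size s').+1%:R * nV g ^+ 2 * wick_bound s' else 1.

Lemma wick_bound_ge0 s : 0 <= wick_bound s.
Proof. by elim: s => //= g s IH; rewrite !mulr_ge0 ?sqr_ge0. Qed.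

Lemma wick_sq_le s : nrm (wick s) ^+ 2 <= wick_bound s.
Proof.
elim: s => [|g s IH] /=; first by rewrite nrm_Om expr1n.
by rewrite (le_trans (bsum_sq _ (Kle_wick s)))// ler_wpM2l// mulr_ge0// sqr_ge0.
Qed.

Fixpoint defect_bound h (s : seq V) : R :=
  if s is g :: s' then 2 * ((nV h * nV g) ^+ 2 * wick_bound s')
    + 2 * ((size s').+1%:R * nV g ^+ 2 * defect_bound h s') else 0.

Lemma defect_bound_ge0 h s : 0 <= defect_bound h s.
Proof.
by elim: s => //= g s IH; rewrite addr_ge0// mulr_ge0// ?mulr_ge0 ?sqr_ge0 ?wick_bound_ge0.
Qed.

(** Induction on the word. The contraction with the first letter has coefficient mean w instead of
    q^p, which is the defect of order 0; the other term averages over i the errors for the weights w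
    j eps i j and the exponent p + 1, which shifts the order of the defects by one. *)
Let avg_defect w p h s :
  nrm (avg w h s - (Q ^+ p) *: annF Q (ip h) wick s) ^+ 2 <=
  defect_bound h s * \sum_(k < size s) sign_defect q eps k w p.
Proof.
elim: s w p => [|g s IH] w p.
  rewrite annF_nil scaler0 subr0 /= mul0r /avg big1 ?scaler0 ?nrm0 ?expr0n// => j _.
  by rewrite /scaled an_Om !scaler0.
pose d i := avg (fun j => w j * eps i j) h s - (Q ^+ p.+1) *: annF Q (ip h) wick s.
have -> : avg w h (g :: s) - (Q ^+ p) *: annF Q (ip h) wick (g :: s) =
   ((mean w - q ^+ p)%:C * ip h g) *: wick s + (rN^-1)%:C *: \sum_i bs i g (d i).
  rewrite avg_cons annF_cons.
  have e : (Q ^+ p) *: (Q *: annF Q (ip h) (fun t => wick (g :: t)) s) =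
      (rN^-1)%:C *: \sum_i bs i g ((Q ^+ p.+1) *: annF Q (ip h) wick s).
    rewrite scalerA -exprSr -[annF _ _ (fun t => _) _]/(annF Q (ip h) (bsum g \o wick) s).
    by rewrite -(annF_nat _ _ _ _ (bsum_lin g)) -(linZ _ _ (bsum_lin g)).
  have -> : \sum_i bs i g (d i) = \sum_i bs i g (avg (fun j => w j * eps i j) h s) -
      \sum_i bs i g ((Q ^+ p.+1) *: annF Q (ip h) wick s).
    by rewrite -sumrB; apply: eq_bigr => i _; rewrite (linB _ _ (bs_lin _ _)).
  rewrite scalerDr e scalerA rmorphB rmorphXn /= mulrBl scalerBl scalerBr.
  by rewrite opprD addrACA.
have kd : forall i, Kle (size s) (d i).
  by move=> i; apply: KleB => //; apply/KleZ/Kle_annF => t ht; apply: (Kle_mono ht (Kle_wick _)).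
set x := _ *: wick s; set y := _ *: \sum_i _.
have h1 : nrm (x + y) ^+ 2 <= 2 * nrm x ^+ 2 + 2 * nrm y ^+ 2.
  apply: le_trans (sqrD_le _ _); rewrite ler_pXn2r ?nnegrE ?nrm_ge0 ?addr_ge0 ?nrm_ge0//; exact: nrmD.
apply: (le_trans h1); rewrite big_ord_recl [defect_bound _ _]/= [X in _ <= X]mulrDl -[X in _ <= X + _]mulrA -[X in _ <= _ + X]mulrA.
rewrite [sign_defect _ _ ord0 _ _]/=.
set D := \sum_(k < size s) _.
have D0 : 0 <= D by apply: sumr_ge0 => k _; apply: sign_defect_ge0.
have V0 := sqr_ge0 (mean w - q ^+ p).
have wb := wick_bound_ge0 s; have db := defect_bound_ge0 h s.
apply: lerD; rewrite ler_wpM2l//.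
  apply: (@le_trans _ _ ((nV h * nV g) ^+ 2 * wick_bound s * (mean w - q ^+ p) ^+ 2)).
    rewrite /x nrmZ nrmM nrmR !exprMn real_normK ?num_real// mulrC mulrA mulrAC.
    rewrite ler_wpM2r// mulrC ler_pM ?sqr_ge0//; last exact: wick_sq_le.
    by rewrite -exprMn ler_pXn2r ?nnegrE ?mulr_ge0 ?nrm_ge0.
  by rewrite mulrDr lerDl mulr_ge0// mulr_ge0// sqr_ge0.
apply: (le_trans (key g kd)); rewrite -[leRHS]mulrA; apply: ler_wpM2l; first by rewrite mulr_ge0 ?sqr_ge0.
apply: (@le_trans _ _ (mean (fun i => defect_bound h s * \sum_(k < size s) sign_defect q eps k (fun j => w j * eps i j) p.+1))).
  by apply: mean_le => i; exact: IH.
rewrite /mean -mulr_sumr mulrCA; apply: ler_wpM2l => //.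
rewrite exchange_big mulr_sumr /= -[leLHS]add0r lerD//.
Qed.

Lemma asum_wick h s : nrm (asum h (wick s) - annF Q (ip h) wick s) ^+ 2 <=
  defect_bound h s * \sum_(k < size s) sign_defect q eps k (fun=> 1) 0.
Proof. by rewrite asum_avg -[annF _ _ _ _]scale1r -(expr0 Q); exact: avg_defect. Qed.

End FermionicFock.

(** * Jordan-Wigner operators for a matrix of signs *)

Section JordanWigner.
Context {R : realType} (F : hilbertType R) (N m : nat) (eps : 'I_N -> 'I_N -> R).
Local Notation C := R[i].
Local Notation mode := ('I_N * 'I_m)%type.
Local Notation K := (hsum {set mode} (fun=> F)).
Hypothesis eps_sign : forall i, signs (eps i).
Hypothesis eps_sym : forall i j, eps i j = eps j i.
Hypothesis eps_diag : forall i, eps i i = -1.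
Implicit Types (b c : mode) (S : {set mode}) (x y z : K).

Let eps_sq i j : eps i j * eps i j = 1.
Proof. by case: (@eps_sign i j) => ->; rewrite ?mulrNN mulr1. Qed.

Section Order.
Context (lt : rel mode).
Hypothesis lt_irr : forall b, lt b b = false.

(* The Jordan-Wigner sign picked up when the mode b is moved past the occupied
   modes that precede it. *)
Definition jw b S : R := \prod_(c in S | lt c b) eps b.1 c.1.

(** A state assigns to every set of occupied modes a coefficient in a Hilbert space F, which takes
    the place of the scalars; a single unit vector of F will serve for the vacuum. *)
Definition crea b z : K := hfin (K := fun=> F) (fun S => if b \in S then (jw b S)%:C *: z (S :\ b) else 0).
Definition anni b z : K := hfin (K := fun=> F) (fun S => if b \in S then 0 else (jw b S)%:C *: z (b |: S)).

Lemma jw_sq b S : jw b S * jw b S = 1.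
Proof. by rewrite /jw -big_split big1//= => c _; exact: eps_sq. Qed.

Lemma jw_norm b S : `|jw b S| = 1.
Proof.
have := jw_sq b S; move: (jw _ _) => r r1.
have : (r - 1) * (r + 1) = 0 by rewrite -[RHS](subrr 1) -{3}r1; ring.
by move/eqP; rewrite mulf_eq0 subr_eq0 addr_eq0 => /orP[/eqP ->|/eqP ->]; rewrite ?normrN normr1.
Qed.

Definition cross b c : R := if lt c b then eps b.1 c.1 else 1.

Lemma jw_setU1 b c S : c \notin S -> jw b (c |: S) = cross b c * jw b S.
Proof. by move=> h; rewrite /jw !big_mkcondr big_setU1. Qed.

Lemma jw_setD1 b c S : c \in S -> jw b S = cross b c * jw b (S :\ c).
Proof. by move=> h; rewrite -jw_setU1 ?finset.setD1K// finset.inE finset.in_set1 eqxx. Qed.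

Lemma cross_id b : cross b b = 1. Proof. by rewrite /cross lt_irr. Qed.

Lemma cross_sq b c : cross b c * cross b c = 1.
Proof. by rewrite /cross; case: ifP => _; rewrite ?eps_sq ?mulr1. Qed.

Lemma jw_D1 b c S : c \in S -> jw b (S :\ c) = cross b c * jw b S.
Proof. by move=> h; rewrite (jw_setD1 b h) mulrA cross_sq mul1r. Qed.

Lemma crea_linear b : linear (crea b).
Proof.
move=> a x y; apply: hsum_eq => S; rewrite hvalD hvalZ /=; case: ifP => _; last by rewrite scaler0 addr0.
by rewrite scalerDr !scalerA mulrC.
Qed.

Lemma anni_linear b : linear (anni b).
Proof.
move=> a x y; apply: hsum_eq => S; rewrite hvalD hvalZ /=; case: ifP => _; first by rewrite scaler0 addr0.
by rewrite scalerDr !scalerA mulrC.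
Qed.

Lemma sum_setU1 (V : zmodType) b (f : {set mode} -> V) :
  \sum_(S : {set mode} | b \in S) f S = \sum_(S : {set mode} | b \notin S) f (b |: S).
Proof.
rewrite (reindex_onto (fun S => b |: S) (fun S => S :\ b)) /=; last by move=> S h; rewrite finset.setD1K.
apply: eq_bigl => S; rewrite finset.setU11 /=; apply/eqP/idP => [<-|h].
  by rewrite finset.setD11.
by rewrite finset.setU1K.
Qed.

Lemma crea_anni b : adjoint (crea b) (anni b).
Proof.
move=> x y; rewrite !dot_fin /=.
rewrite (bigID (fun S => b \in S)) /= [X in _ + X]big1 ?addr0 => [|S /negPf ->]; last by rewrite dot0l.
rewrite [RHS](bigID (fun S => b \in S)) /= [X in _ = X + _]big1 ?add0r => [|S ->]; last by rewrite dot0r.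
rewrite sum_setU1; apply: eq_bigr => S hS; rewrite finset.setU11 (negPf hS) finset.setU1K// dotZl dotZr conjR.
by rewrite jw_setU1// cross_id mul1r.
Qed.

Lemma crea_val b z S : b \in S -> crea b z S = (jw b S)%:C *: z (S :\ b).
Proof. by rewrite /= => ->. Qed.
Lemma crea_out b z S : b \notin S -> crea b z S = 0.
Proof. by rewrite /= => /negPf ->. Qed.
Lemma anni_val b z S : b \notin S -> anni b z S = (jw b S)%:C *: z (b |: S).
Proof. by rewrite /= => /negPf ->. Qed.
Lemma anni_out b z S : b \in S -> anni b z S = 0.
Proof. by rewrite /= => ->. Qed.

End Order.

Lemma D1C b c S : S :\ b :\ c = S :\ c :\ b.
Proof. by apply/setP => a; rewrite !finset.in_setD1 andbCA. Qed.

Lemma U1D1 b c S : b != c -> (b |: S) :\ c = b |: (S :\ c).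
Proof.
move=> bc; apply/setP => a; rewrite finset.in_setD1 !finset.in_setU1 finset.in_setD1.
by have [->|] := eqVneq a b; rewrite ?bc.
Qed.

(* Two orders: the identities needed are the cases lt = lt' and lt' = the
   reverse of lt. *)
Section TwoOrders.
Context (lt lt' : rel mode) (s : mode -> mode -> R).
Hypothesis s_cross : forall b c, b != c -> cross lt' c b = s b c * cross lt b c.

Lemma crea_crea b c z : crea lt b (crea lt' c z) = (s b c)%:C *: crea lt' c (crea lt b z).
Proof.
apply: hsum_eq => S; rewrite hvalZ; have [->|bc] := eqVneq b c.
  have [h|h] := boolP (c \in S); last by rewrite !crea_out// scaler0.
  by rewrite (crea_val _ _ h) (crea_val _ _ h) !crea_out ?finset.setD11// !scaler0.
have [hb|hb] := boolP (b \in S); last first.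
  rewrite crea_out//; have [hc|hc] := boolP (c \in S); last by rewrite crea_out// scaler0.
  by rewrite crea_val// crea_out ?scaler0// finset.in_setD1 (negPf hb) andbF.
have [hc|hc] := boolP (c \in S); last first.
  rewrite [X in _ = _ *: X]crea_out// scaler0 crea_val// crea_out ?scaler0//.
  by rewrite finset.in_setD1 (negPf hc) andbF.
have hc' : c \in S :\ b by rewrite finset.in_setD1 hc eq_sym bc.
have hb' : b \in S :\ c by rewrite finset.in_setD1 hb bc.
rewrite !crea_val// D1C !scalerA -!rmorphM /=; congr (_%:C *: _).
rewrite (jw_D1 _ _ hb) (jw_D1 _ _ hc) s_cross//.
by rewrite mulrCA [RHS]mulrCA; ring.
Qed.

Lemma anni_crea_ne b c z : b != c -> anni lt b (crea lt' c z) = (s b c)%:C *: crea lt' c (anni lt b z).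
Proof.
move=> bc; apply: hsum_eq => S; rewrite hvalZ.
have [hb|hb] := boolP (b \in S).
  rewrite anni_out//; have [hc|hc] := boolP (c \in S); last by rewrite crea_out// scaler0.
  by rewrite crea_val// anni_out ?scaler0// finset.in_setD1 hb bc.
have [hc|hc] := boolP (c \in S); last first.
  rewrite [X in _ = _ *: X]crea_out// scaler0 anni_val// crea_out ?scaler0//.
  by rewrite finset.in_setU1 (negPf hc) orbF eq_sym.
have hc' : c \in b |: S by rewrite finset.in_setU1 hc orbT.
have hb' : b \notin S :\ c by rewrite finset.in_setD1 (negPf hb) andbF.
rewrite anni_val// crea_val// crea_val// anni_val// U1D1// !scalerA -!rmorphM /=; congr (_%:C *: _).
rewrite (jw_setU1 _ _ hb) (jw_D1 _ _ hc) s_cross//.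
by ring.
Qed.

End TwoOrders.

Section Reversal.
Context (lt : rel mode).
Hypothesis lt_irr : forall b, lt b b = false.
Hypothesis lt_tot : forall b c, b != c -> lt b c = ~~ lt c b.
Definition rlt : rel mode := fun b c => lt c b.

Lemma cross_same b c : b != c -> cross lt c b = eps b.1 c.1 * cross lt b c.
Proof.
move=> bc; rewrite /cross (lt_tot bc); case: (lt c b) => /=; first by rewrite eps_sq.
by rewrite mulr1 eps_sym.
Qed.

(** For opposite orders either both strings meet the other mode or neither does, so the exchange
    produces no sign; for equal orders exactly one does, which gives [cross_same]. *)
Lemma cross_rev b c : b != c -> cross rlt c b = 1 * cross lt b c.
Proof. by move=> bc; rewrite /cross /rlt mul1r; case: ifP => // _; exact: eps_sym. Qed.

Lemma creaC b c z : crea lt b (crea lt c z) = (eps b.1 c.1)%:C *: crea lt c (crea lt b z).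
Proof. exact: (crea_crea cross_same). Qed.

Lemma anni_creaC b c z : anni lt b (crea lt c z) =
  (eps b.1 c.1)%:C *: crea lt c (anni lt b z) + (if b == c then 1 else 0 : C) *: z.
Proof.
have [<-|bc] := eqVneq b c; last by rewrite scale0r addr0; exact: (anni_crea_ne cross_same).
rewrite eps_diag scale1r; apply: hsum_eq => S; rewrite hvalD hvalZ.
have [hb|hb] := boolP (b \in S).
  rewrite anni_out// crea_val// anni_val ?finset.setD11// finset.setD1K// scalerA -rmorphM.
  by rewrite (jw_D1 _ _ hb) cross_id// mul1r jw_sq scale1r rmorphN1 scaleN1r addNr.
rewrite anni_val// (crea_out lt (anni lt b z) hb) scaler0 add0r crea_val ?finset.setU11// finset.setU1K// scalerA -rmorphM.
by rewrite (jw_setU1 _ _ hb) cross_id// mul1r jw_sq scale1r.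
Qed.

Lemma rcrea_creaC b c z : crea rlt b (crea lt c z) = crea lt c (crea rlt b z).
Proof.
have := @crea_crea lt rlt (fun _ _ => 1) cross_rev c b z.
by rewrite scale1r => ->.
Qed.

(* Since eps i i = -1, the sign is the same on the states containing b and on the
   others: it depends only on the site of b. *)
Definition site_sign (i : 'I_N) z : K :=
  hfin (K := fun=> F) (fun S => (\prod_(c in S) eps i c.1)%:C *: z S).

Lemma jw_rev b S : b \notin S -> jw lt b S * jw rlt b S = \prod_(c in S) eps b.1 c.1.
Proof.
move=> hb; rewrite /jw [RHS](bigID (fun c => lt c b)) /=; congr (_ * _).
apply: eq_bigl => c; case: (boolP (c \in S)) => //= hc; rewrite /rlt lt_tot ?negbK//.
by apply: contra hb => /eqP ->.
Qed.

Lemma anni_rcreaC b c z : anni lt b (crea rlt c z) =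
  crea rlt c (anni lt b z) + (if b == c then 1 else 0 : C) *: site_sign b.1 z.
Proof.
have [<-|bc] := eqVneq b c; last first.
  rewrite scale0r addr0; have := @anni_crea_ne lt rlt (fun _ _ => 1) cross_rev b c z bc.
  by rewrite scale1r.
rewrite scale1r; apply: hsum_eq => S; rewrite hvalD /=.
have [hb|hb] := boolP (b \in S); last first.
  rewrite finset.setU11 finset.setU1K// add0r scalerA -rmorphM.
  by rewrite (jw_setU1 _ _ hb) cross_id// mul1r jw_rev.
rewrite finset.setD11 finset.setD1K// scalerA -rmorphM.
rewrite (jw_setD1 rlt b hb) cross_id// mul1r mulrC jw_rev ?finset.setD11//.
by rewrite [in X in _ + X](big_setD1 b)//= eps_diag mulN1r rmorphN scaleNr subrr.
Qed.

End Reversal.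
End JordanWigner.

Lemma sum_sqr_le (R : realType) (T : finType) (S : {set T}) (a : T -> R) :
  (\sum_(i in S) a i) ^+ 2 <= #|S|%:R * \sum_(i in S) a i ^+ 2.
Proof.
have : 0 <= \sum_(i in S) \sum_(j in S) (a i - a j) ^+ 2.
  by apply: sumr_ge0 => i _; apply: sumr_ge0 => j _; exact: sqr_ge0.
have -> : \sum_(i in S) \sum_(j in S) (a i - a j) ^+ 2 =
    \sum_(i in S) (#|S|%:R * a i ^+ 2 + (\sum_(j in S) a j ^+ 2 - 2 * (a i * \sum_(j in S) a j))).
  apply: eq_bigr => i _; rewrite mulr_sumr mulr_sumr mulr_natl -sumr_const -sumrB -big_split /=.
  by apply: eq_bigr => j _; ring.
rewrite !big_split /= -mulr_sumr sumr_const -[X in _ + (X + _)]mulr_natl sumrN -mulr_sumr -mulr_suml expr2.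
lra.
Qed.

(** * Smeared creation and annihilation operators *)

Section Smeared.
Context {R : realType} (F : hilbertType R) (om : F) (N m : nat) (eps : 'I_N -> 'I_N -> R).
Context (V : Type) (kap : V -> 'I_m -> R[i]) (nV : V -> R).
Hypothesis nrm_om : nrm om = 1.
Local Notation C := R[i].
Local Notation mode := ('I_N * 'I_m)%type.
Local Notation K := (hsum {set mode} (fun=> F)).
Hypothesis eps_sign : forall i, signs (eps i).
Hypothesis eps_sym : forall i j, eps i j = eps j i.
Hypothesis eps_diag : forall i, eps i i = -1.
Hypothesis nV_ge0 : forall h, 0 <= nV h.
Hypothesis kap_le : forall h, \sum_k nrm (kap h k) ^+ 2 <= nV h ^+ 2.
Implicit Types (x y z : K).

Let eps_sq1 i j : eps i j * eps i j = 1.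
Proof. by case: (@eps_sign i j) => ->; rewrite ?mulrNN mulr1. Qed.

Definition vac : K := @hinj R {set mode} (fun=> F) finset.set0 om.
Definition kip h g : C := \sum_k (kap h k)^* * kap g k.
Definition level n : set K := [set z | forall S : {set mode}, (n < #|S|)%N -> z S = 0].

Lemma kipC h g : kip h g = (kip g h)^*.
Proof. by rewrite /kip rmorph_sum; apply: eq_bigr => k _; rewrite rmorphM /= conjCK mulrC. Qed.

Lemma kip_le h g : nrm (kip h g) <= nV h * nV g.
Proof.
pose v (h : V) : hsum 'I_m (fun=> F) := hfin (K := fun=> F) (fun k => kap h k *: om).
have -> : kip h g = dot (v h) (v g).
  rewrite dot_fin; apply: eq_bigr => k _; rewrite dotZl dotZr dot_nrm nrm_om expr1n mulr1 //.
have vn f : nrm (v f) <= nV f.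
  rewrite -(@ler_pXn2r _ 2)// ?nnegrE ?nrm_ge0//; apply: le_trans (kap_le f).
  rewrite nrm_fin; under eq_bigr do rewrite nrmZ nrm_om mulr1; exact: lexx.
by apply: (le_trans (CS _ _)); apply: ler_pM; rewrite ?nrm_ge0 ?vn.
Qed.

Lemma level_vac : level 0 vac.
Proof. by move=> S h; apply: hinj_ne => e; rewrite -e finset.cards0 in h. Qed.
Lemma nrm_vac : nrm vac = 1. Proof. by rewrite nrm_hinj. Qed.
Lemma level0 n : level n 0. Proof. by []. Qed.
Lemma level_lin n (a : C) x y : level n x -> level n y -> level n (a *: x + y).
Proof. by move=> hx hy S hS; rewrite hvalD hvalZ hx// hy// scaler0 addr0. Qed.
Lemma level_mono k n z : (k <= n)%N -> level k z -> level n z.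
Proof. by move=> kn h S hS; apply: h; exact: leq_ltn_trans kn hS. Qed.

Lemma level_sum n (J : Type) (r : seq J) (f : J -> K) : (forall j, level n (f j)) -> level n (\sum_(j <- r) f j).
Proof. by move=> h S hS; rewrite hval_sum big1// => j _; exact: h. Qed.
Lemma levelZ n (a : C) x : level n x -> level n (a *: x).
Proof. by move=> h; rewrite -[_ *: _]addr0; exact: level_lin. Qed.

Lemma smear_comm (A B : 'I_m -> K -> K) (D : K -> K) (a b : 'I_m -> C) (e d : C) z :
  (forall k, linear (A k)) -> (forall l, linear (B l)) ->
  (forall k l, A k (B l z) = e *: B l (A k z) + (if k == l then d else 0) *: D z) ->
  \sum_k a k *: A k (\sum_l b l *: B l z) =
  e *: (\sum_l b l *: B l (\sum_k a k *: A k z)) + (d * \sum_k a k * b k) *: D z.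
Proof.
move=> lA lB h.
have e1 k : A k (\sum_l b l *: B l z) = \sum_l (b l * e) *: B l (A k z) + (b k * d) *: D z.
  rewrite (lin_sum _ _ _ (lA k)); transitivity (\sum_l ((b l * e) *: B l (A k z) + (b l * (if k == l then d else 0)) *: D z)).
    by apply: eq_bigr => l _; rewrite (linZ _ _ (lA k)) h scalerDr !scalerA.
  rewrite big_split /=; congr (_ + _); rewrite (bigD1 k)//= eqxx big1 ?addr0// => l.
  by rewrite eq_sym => /negPf ->; rewrite mulr0 scale0r.
under eq_bigr do rewrite e1 scalerDr; rewrite big_split /=; congr (_ + _).
  rewrite scaler_sumr; under eq_bigr do rewrite scaler_sumr; rewrite exchange_big /=; apply: eq_bigr => l _.
  rewrite (lin_sum _ _ _ (lB l)) !scaler_sumr; apply: eq_bigr => k _.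
  by rewrite (linZ _ _ (lB l)) !scalerA; congr (_ *: _); ring.
rewrite mulr_sumr scaler_suml; apply: eq_bigr => k _; rewrite scalerA; congr (_ *: _); ring.
Qed.

Section OneOrder.
Context (lt : rel mode).
Hypothesis lt_irr : forall b, lt b b = false.
Hypothesis lt_tot : forall b c, b != c -> lt b c = ~~ lt c b.

Definition bsm i h z : K := \sum_k kap h k *: crea eps lt (i, k) z.
Definition asm i h z : K := \sum_k (kap h k)^* *: anni eps lt (i, k) z.

Lemma bsm_lin i h : linear (bsm i h).
Proof.
move=> a x y; rewrite /bsm scaler_sumr -big_split; apply: eq_bigr => k _ /=.
by rewrite crea_linear scalerDr !scalerA mulrC.
Qed.

Lemma asm_lin i h : linear (asm i h).
Proof.
move=> a x y; rewrite /asm scaler_sumr -big_split; apply: eq_bigr => k _ /=.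
by rewrite anni_linear scalerDr !scalerA mulrC.
Qed.

Lemma bsm_asm i h : adjoint (bsm i h) (asm i h).
Proof.
move=> x y; rewrite /bsm /asm dot_suml dot_sumr; apply: eq_bigr => k _.
by rewrite dotZl dotZr crea_anni.
Qed.

Lemma level_bsm n i g z : level n z -> level n.+1 (bsm i g z).
Proof.
move=> h; apply: level_sum => k; apply: levelZ => S hS /=; case: ifP => // hk.
by rewrite h ?scaler0//; move: hS; rewrite (cardsD1 (i, k)) hk.
Qed.

Lemma level_asm n i g z : level n z -> level n (asm i g z).
Proof.
move=> h; apply: level_sum => k; apply: levelZ => S hS /=; case: ifP => // hk.
by rewrite h ?scaler0// cardsU1 hk (leq_trans hS)// leq_addl.
Qed.

Lemma asm_vac j h : asm j h vac = 0.
Proof.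
rewrite /asm big1// => k _; have -> : anni eps lt (j, k) vac = 0; last by rewrite scaler0.
apply: hsum_eq => S /=; case: ifP => // _; rewrite hinj_fun_ne ?scaler0// => e.
by have := finset.setU11 (j, k) S; rewrite -e finset.in_set0.
Qed.

Lemma asm_bsm i j g h z : asm j h (bsm i g z) =
  (eps i j)%:C *: bsm i g (asm j h z) + (if i == j then kip h g else 0) *: z.
Proof.
apply: (etrans (@smear_comm (fun k => anni eps lt (j, k)) (fun l => crea eps lt (i, l)) id
  (fun k => (kap h k)^*) (kap g) (eps i j)%:C (if i == j then 1 else 0) z _ _ _)).
- by move=> k; exact: anni_linear.
- by move=> k; exact: crea_linear.
- move=> k l; rewrite anni_creaC// eps_sym xpair_eqE eq_sym; congr (_ + _ *: _).
  by case: (i == j); case: (k == l).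
- by congr (_ + _ *: _); case: eqP => _; rewrite ?mul1r ?mul0r.
Qed.

Lemma bsmC i j g h z : bsm j h (bsm i g z) = (eps i j)%:C *: bsm i g (bsm j h z).
Proof.
apply: (etrans (@smear_comm (fun k => crea eps lt (j, k)) (fun l => crea eps lt (i, l)) id
  (kap h) (kap g) (eps i j)%:C 0 z _ _ _)).
- by move=> k; exact: crea_linear.
- by move=> k; exact: crea_linear.
- by move=> k l; rewrite creaC// eps_sym; case: eqP => _; rewrite scale0r addr0.
- by rewrite mul0r scale0r addr0.
Qed.

Lemma asmC i j g h z : asm j h (asm i g z) = (eps i j)%:C *: asm i g (asm j h z).
Proof.
apply: dot_ext => y; rewrite dotZr -!bsm_asm bsmC dotZl conjR eps_sym.
by [].
Qed.

(** The coefficient at S is a sum over the modes of S, at most n + 1 of them because v i has level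
    n: Cauchy-Schwarz yields the factor n + 1. Each pair of a mode and a set not containing it then
    occurs once, so the total is controlled by the squared coordinates of h. *)
Lemma smear_bound n h (v : 'I_N -> K) : (forall i, level n (v i)) ->
  nrm (((Num.sqrt N%:R)^-1)%:C *: \sum_i bsm i h (v i)) ^+ 2 <=
  n.+1%:R * nV h ^+ 2 * mean (fun i => nrm (v i) ^+ 2).
Proof.
move=> lv; rewrite nrmZ nrmR exprMn ger0_norm ?invr_ge0 ?sqrtr_ge0// exprVn sqr_sqrtr//.
rewrite nrm_fin.
pose t (b : mode) (S : {set mode}) := nrm (kap h b.2) ^+ 2 * nrm (v b.1 S) ^+ 2.
have t0 b S : 0 <= t b S by rewrite mulr_ge0 ?sqr_ge0.
have b1 (S : {set mode}) : nrm ((\sum_i bsm i h (v i)) S) ^+ 2 <= n.+1%:R * \sum_(b in S) t b (S :\ b).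
  have [cS|cS] := ltnP n.+1 #|S|.
    have -> : (\sum_i bsm i h (v i)) S = 0; last by rewrite nrm0 expr0n mulr_ge0// sumr_ge0.
    by apply: (level_sum (n := n.+1)) => // i; exact: level_bsm.
  have e : (\sum_i bsm i h (v i)) S = \sum_(b in S) ((kap h b.2 * (jw eps lt b S)%:C) *: v b.1 (S :\ b)).
    transitivity (\sum_i \sum_k (if (i, k) \in S then (kap h k * (jw eps lt (i, k) S)%:C) *: v i (S :\ (i, k)) else 0)).
      rewrite hval_sum; apply: eq_bigr => i _; rewrite hval_sum; apply: eq_bigr => k _; rewrite hvalZ /=.
      by case: ifP => _; rewrite ?scaler0 ?scalerA.
    by rewrite pair_big [RHS]big_mkcond; apply: eq_bigr => -[i k].
  apply: (@le_trans _ _ ((\sum_(b in S) nrm (kap h b.2) * nrm (v b.1 (S :\ b))) ^+ 2)).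
    rewrite ler_pXn2r ?nnegrE ?nrm_ge0 ?sumr_ge0//; last by move=> b _; rewrite mulr_ge0 ?nrm_ge0.
    rewrite e; elim/big_ind2: _ => [|x1 x2 y1 y2 h1 h2|b _]; first by rewrite nrm0.
      by rewrite (le_trans (nrmD _ _))// lerD.
    by rewrite nrmZ nrmM nrmR jw_norm// mulr1.
  apply: (le_trans (sum_sqr_le _ _)); under eq_bigr do rewrite exprMn.
  by apply: ler_wpM2r; [apply: sumr_ge0 => b _; exact: t0|rewrite ler_nat].
have b2 : \sum_(S : {set mode}) \sum_(b in S) t b (S :\ b) <= \sum_b \sum_(S : {set mode}) t b S.
  rewrite (exchange_big_dep xpredT)//=; apply: ler_sum => b _; rewrite sum_setU1.
  rewrite [leRHS](bigID (fun S : {set mode} => b \notin S)) /= -[leLHS]addr0 lerD ?sumr_ge0//.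
  by apply: ler_sum => S hS; rewrite finset.setU1K.
have b3 : \sum_b \sum_(S : {set mode}) t b S <= nV h ^+ 2 * \sum_i nrm (v i) ^+ 2.
  have -> : \sum_b \sum_(S : {set mode}) t b S = (\sum_k nrm (kap h k) ^+ 2) * \sum_i nrm (v i) ^+ 2.
    transitivity (\sum_i \sum_k \sum_(S : {set mode}) t (i, k) S).
      by rewrite [RHS]pair_big; apply: eq_bigr => -[i k].
    rewrite exchange_big mulr_suml /=.
    apply: eq_bigr => k _; rewrite mulr_sumr; apply: eq_bigr => i _.
    by rewrite /t /= -mulr_sumr -nrm_fin.
  by rewrite ler_wpM2r// sumr_ge0// => i _; exact: sqr_ge0.
rewrite /mean mulrCA ler_wpM2l ?invr_ge0//.
apply: (@le_trans _ _ (\sum_(S : {set mode}) n.+1%:R * \sum_(b in S) t b (S :\ b))); first exact: ler_sum.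
by rewrite -mulr_sumr -mulrA ler_wpM2l// (le_trans b2).
Qed.

End OneOrder.

Section TwoSided.
Context (lt : rel mode).
Hypothesis lt_irr : forall b, lt b b = false.
Hypothesis lt_tot : forall b c, b != c -> lt b c = ~~ lt c b.
Local Notation bs := (bsm lt).
Local Notation an := (asm lt).
Local Notation rb := (bsm (rlt lt)).
Local Notation ra := (asm (rlt lt)).

Lemma rlt_irr b : rlt lt b b = false. Proof. exact: lt_irr. Qed.
Lemma rlt_tot b c : b != c -> rlt lt b c = ~~ rlt lt c b.
Proof. by move=> bc; apply: lt_tot; rewrite eq_sym. Qed.

Lemma rb_bs i j g h z : rb j h (bs i g z) = bs i g (rb j h z).
Proof.
apply: (etrans (@smear_comm (fun k => crea eps (rlt lt) (j, k)) (fun l => crea eps lt (i, l)) id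
  (kap h) (kap g) 1 0 z _ _ _)).
- by move=> k; exact: crea_linear.
- by move=> k; exact: crea_linear.
- by move=> k l; rewrite rcrea_creaC//; case: eqP => _; rewrite scale0r addr0 scale1r.
- by rewrite mul0r scale0r addr0 scale1r.
Qed.

Lemma ra_an i j g h z : ra j h (an i g z) = an i g (ra j h z).
Proof.
by apply: dot_ext => y; rewrite -(bsm_asm rlt_irr) -!(bsm_asm lt_irr) -(bsm_asm rlt_irr) rb_bs.
Qed.

Lemma an_rb i j g h z : an j h (rb i g z) =
  rb i g (an j h z) + (if i == j then kip h g else 0) *: site_sign eps j z.
Proof.
apply: (etrans (@smear_comm (fun k => anni eps lt (j, k)) (fun l => crea eps (rlt lt) (i, l)) (site_sign eps j)
  (fun k => (kap h k)^*) (kap g) 1 (if i == j then 1 else 0) z _ _ _)).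
- by move=> k; exact: anni_linear.
- by move=> k; exact: crea_linear.
- move=> k l; rewrite scale1r anni_rcreaC// xpair_eqE eq_sym; congr (_ + _ *: _).
  by case: (i == j); case: (k == l).
- by rewrite scale1r; congr (_ + _ *: _); case: eqP => _; rewrite ?mul1r ?mul0r.
Qed.

Lemma ra_bs i j g h z : ra j h (bs i g z) =
  bs i g (ra j h z) + (if i == j then kip h g else 0) *: site_sign eps j z.
Proof.
apply: (etrans (@smear_comm (fun k => anni eps (rlt lt) (j, k)) (fun l => crea eps lt (i, l)) (site_sign eps j)
  (fun k => (kap h k)^*) (kap g) 1 (if i == j then 1 else 0) z _ _ _)).
- by move=> k; exact: anni_linear.
- by move=> k; exact: crea_linear.
- move=> k l; have := anni_rcreaC (F := F) eps_sign eps_sym eps_diag rlt_irr rlt_tot (j, k) (i, l) z.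
  rewrite scale1r => ->; rewrite xpair_eqE eq_sym; congr (_ + _ *: _).
  by case: (i == j); case: (k == l).
- by rewrite scale1r; congr (_ + _ *: _); case: eqP => _; rewrite ?mul1r ?mul0r.
Qed.

Lemma rb_vac i h : rb i h vac = bs i h vac.
Proof.
apply: eq_bigr => k _; congr (_ *: _); apply: hsum_eq => S /=; case: ifP => // hS.
have [e|e] := pselect (finset.set0 = S :\ (i, k)); last by rewrite hinj_fun_ne// !scaler0.
have e1 l' : jw eps l' (i, k) S = cross eps l' (i, k) (i, k).
  by rewrite (jw_setD1 _ _ _ hS) -e /jw big_pred0 ?mulr1// => c; rewrite finset.in_set0.
by rewrite !e1 /cross lt_irr rlt_irr.
Qed.

Definition xs i f z : K := bs i f z + an i f z.
Definition ys i g z : K := rb i g z + ra i g z.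

(** The annihilator of either side fails to commute with the creator of the other by the same
    operator [site_sign], with coefficients kip f g and kip g f on the two sides of the identity;
    they agree when kip f g is real. *)
Lemma ys_xs i j f g z : complex.Im (kip f g) = 0 -> ys j g (xs i f z) = xs i f (ys j g z).
Proof.
move=> im; rewrite /ys /xs.
rewrite !(linD _ _ (bsm_lin _ _ _)) !(linD _ _ (asm_lin _ _ _)).
rewrite rb_bs ra_an ra_bs an_rb.
have -> : kip g f = kip f g by rewrite kipC; apply: cplx_eq; rewrite ?ReJ// ImJ im oppr0.
rewrite eq_sym.
have -> : (if j == i then kip f g else 0) *: site_sign eps j z = (if j == i then kip f g else 0) *: site_sign eps i z.
  by case: eqP => [->|_]; rewrite ?scale0r.
move: (bs i f (rb j g z)) (bs i f (ra j g z)) (rb j g (an i f z)) (an i f (ra j g z)) (_ *: _) => x1 x2 x3 x4 x5.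
by rewrite -!addrA [x3 + _]addrCA.
Qed.

(** For vectors orthonormal in the real part of [kip], the right fields at single sites square to 1
    and otherwise commute up to sign, which is what the averaging requires. *)
Lemma ys_ys i j u v z : ys j u (ys i v z) =
  (eps i j)%:C *: ys i v (ys j u z) + (if i == j then kip u v + kip v u else 0) *: z.
Proof.
have rt := rlt_tot; have ri := rlt_irr; rewrite /ys.
rewrite !(linD _ _ (bsm_lin _ _ _)) !(linD _ _ (asm_lin _ _ _)).
rewrite [rb j u (rb i v z)]bsmC// [ra j u (ra i v z)]asmC// [ra j u (rb i v z)]asm_bsm//.
have e : rb j u (ra i v z) = (eps i j)%:C *: ra i v (rb j u z) + (if i == j then kip v u else 0) *: z.
  rewrite asm_bsm// scalerDr scalerA -rmorphM eps_sym eps_sq1 scale1r -addrA.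
  rewrite [X in _ + X](_ : _ = 0) ?addr0// eq_sym; case: eqP => [->|_]; last by hring.
  by rewrite eps_diag rmorphN1; hring.
rewrite e.
move: (rb i v (rb j u z)) (ra i v (rb j u z)) (rb i v (ra j u z)) (ra i v (ra j u z)) => x1 x2 x3 x4.
case: eqP => _; hring.
Qed.

End TwoSided.
End Smeared.

(** * Real and complex orthonormalization *)

Section GramSchmidt.
Context {R : realType} (H : hilbertType R) (f : R[i] -> R[i]).
Local Notation C := R[i].
(* f is the identity for the complex process, the real part for the real one. *)
Hypotheses (fD : forall a b, f (a + b) = f a + f b) (fM : forall a b, f (f a * b) = f a * f b)
  (fJ : forall a, f (a^*) = (f a)^*) (fR : forall r : R, f (r%:C) = r%:C).
Local Notation c u g := (f (dot u g)).

Fixpoint orthons (us : seq H) : Prop :=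
  if us is v :: us' then [/\ c v v = 1, forall u, u \in us' -> c v u = 0 & orthons us'] else True.

Definition expansion (us : seq H) g : H := \sum_(u <- us) c u g *: u.

Let f0 : f 0 = 0. Proof. by rewrite -[0]/(0%:C) fR. Qed.
Let fN a : f (- a) = - f a.
Proof. by apply/eqP; rewrite -addr_eq0 -fD addNr f0. Qed.
Let f_sum (us : seq H) (k : H -> C) : f (\sum_(u <- us) k u) = \sum_(u <- us) f (k u).
Proof. by elim: us => [|u us IH]; rewrite ?big_nil// !big_cons fD IH. Qed.

Lemma dot_expansion v us g : c v (expansion us g) = \sum_(u <- us) c u g * c v u.
Proof. by rewrite /expansion dot_sumr f_sum; apply: eq_bigr => u _; rewrite dotZr fM. Qed.

Lemma orthons_residue us u g : orthons us -> u \in us -> c u (g - expansion us g) = 0.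
Proof.
move=> ho hu; rewrite dotBr fD fN dot_expansion; suff -> : \sum_(v <- us) c v g * c u v = c u g by rewrite subrr.
elim: us ho hu => //= v us IH [h1 h2 h3]; rewrite inE big_cons => /predU1P[->|hu].
  by rewrite h1 mulr1 big_seq big1 ?addr0// => w hw; rewrite h2// mulr0.
by rewrite IH// -[f (dot u v)]conjCK -fJ -dot_conj (h2 _ hu) conjC0 mulr0 add0r.
Qed.

(** The last clause transports from the given vectors to the basis any property stable under
    combinations with coefficients in the image of f. *)
Lemma gram_schmidt (gs : seq H) : exists us, [/\ orthons us, forall g, g \in gs -> expansion us g = g &
  forall D : set H, D 0 -> (forall a x y, D x -> D y -> D (f a *: x + y)) ->
    (forall g, g \in gs -> D g) -> forall u, u \in us -> D u].
Proof.
elim: gs => [|g gs [us [ho he hD]]]; first by exists [::].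
pose r := g - expansion us g; have [r0|r0] := eqVneq r 0.
  exists us; split=> // [k|D D0 Dl Dg u hu].
    rewrite inE => /predU1P[->|]; last exact: he.
    by move/eqP: r0; rewrite subr_eq0 => /eqP.
  by apply: hD hu => // k hk; apply: Dg; rewrite inE hk orbT.
have nr0 : nrm r != 0 by apply: contra r0 => /eqP/nrm_eq0 ->.
pose v := (nrm r)^-1%:C *: r.
have cZ u : c v u = (nrm r)^-1%:C * c r u.
  by rewrite dotZl conjR -{1}fR fM fR.
have vu u : u \in us -> c v u = 0.
  by move=> hu; rewrite cZ dot_conj fJ orthons_residue// conjC0 mulr0.
have ve k : expansion us k = k -> c v k = 0.
  move=> <-; rewrite dot_expansion big_seq big1// => u hu; by rewrite vu// mulr0.
exists (v :: us); split.
- split=> //; rewrite cZ dotZr dot_nrm -rmorphM fR -rmorphM; congr (_%:C).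
  by field.
- move=> k; rewrite inE => /predU1P[->|hk]; last first.
    by rewrite /expansion big_cons -/(expansion us k) ve ?he// scale0r add0r.
  rewrite /expansion big_cons -/(expansion us g).
  have -> : c v g = (nrm r)%:C.
    have e : g = r + expansion us g by rewrite subrK.
    rewrite {1}e dotDr fD (_ : f (dot v (expansion us g)) = 0) ?addr0; last first.
      by rewrite dot_expansion big_seq big1// => u hu; rewrite vu// mulr0.
    by rewrite cZ dot_nrm fR -rmorphM; congr (_%:C); field.
  by rewrite /v scalerA -rmorphM /= mulfV// scale1r subrK.
- move=> D D0 Dl Dg; have hus u : u \in us -> D u.
    by move=> hu; apply: hD hu => // k hk; apply: Dg; rewrite inE hk orbT.
  have DZ (x : C) y : D y -> D (f x *: y) by move=> hy; rewrite -[_ *: _]addr0; exact: Dl.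
  move=> u; rewrite inE => /predU1P[->|]; last exact: hus.
  rewrite /v -fR; apply: DZ; rewrite /r addrC.
  have -> : - expansion us g + g = \sum_(u <- us) f (- dot u g) *: u + g.
    by congr (_ + _); rewrite /expansion -sumrN; apply: eq_bigr => w _; rewrite fN scaleNr.
  have : forall w, w \in us -> D w := hus.
  elim: us {ho he hD r r0 nr0 v cZ vu ve hus u} => [|w us IH] hw.
    by rewrite big_nil add0r; apply: Dg; rewrite inE eqxx.
  rewrite big_cons -addrA; apply: Dl; first by apply: hw; rewrite inE eqxx.
  by apply: IH => k hk; apply: hw; rewrite inE hk orbT.
Qed.

Lemma orthons_uniq us u v : orthons us -> u \in us -> v \in us -> c u v = if u == v then 1 else 0.
Proof.
elim: us => //= w us IH [h1 h2 h3]; rewrite !inE => /predU1P[->|hu] /predU1P[->|hv].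
- by rewrite eqxx.
- rewrite h2//; case: eqP => // e; have := h2 _ hv; rewrite -e h1 => /eqP; by rewrite oner_eq0.
- rewrite dot_conj fJ h2// conjC0; case: eqP => // e; have := h2 _ hu; rewrite e h1 => /eqP; by rewrite oner_eq0.
- exact: IH.
Qed.

End GramSchmidt.

Section ComplexGramSchmidt.
Context {R : realType} (H : hilbertType R).
Local Notation C := R[i].

Lemma bessel (us : seq H) h : orthons id us -> \sum_(u <- us) nrm (dot u h) ^+ 2 <= nrm h ^+ 2.
Proof.
move=> ho; pose p := expansion id us h.
have hp : dot p (h - p) = 0.
  rewrite {1}/p /expansion dot_suml big_seq big1// => u hu; rewrite dotZl.
  by rewrite (@orthons_residue _ _ id _ _ _ _ us u h)// ?mulr0.
have e : h = p + (h - p) by rewrite addrC subrK.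
rewrite {2}e nrmD_sq hp /= mulr0 addr0.
have -> : \sum_(u <- us) nrm (dot u h) ^+ 2 = nrm p ^+ 2.
  have -> : nrm p ^+ 2 = complex.Re (dot p h) by rewrite {1}e dotDr hp addr0 nrm_dot.
  rewrite /p /expansion dot_suml (big_morph (@complex.Re R) (@ReD R) erefl).
  by apply: eq_bigr => u _; rewrite dotZl mulrC mulcJ.
by rewrite lerDl sqr_ge0.
Qed.

Lemma complex_basis (gs : seq H) : exists m (e : 'I_m -> H),
  (forall h, \sum_k nrm (dot (e k) h) ^+ 2 <= nrm h ^+ 2) /\
  forall g, g \in gs -> \sum_k dot (e k) g *: e k = g.
Proof.
have [us [ho he _]] := @gram_schmidt R H id (fun _ _ => erefl) (fun _ _ => erefl) (fun _ => erefl) (fun _ => erefl) gs.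
exists (size us), (fun k => nth 0 us k); split=> [h|g /he hg].
  by have := bessel h ho; rewrite (big_nth 0) big_mkord.
by rewrite -[RHS]hg /expansion (big_nth 0) big_mkord.
Qed.

Lemma real_basis (gs : seq H) : exists us : seq H, [/\
  forall u v, u \in us -> v \in us -> complex.Re (dot u v) = if u == v then 1 else 0,
  forall g, g \in gs -> \sum_(u <- us) (complex.Re (dot u g))%:C *: u = g &
  forall D : set H, D 0 -> (forall (r : R) x y, D x -> D y -> D (r%:C *: x + y)) ->
    (forall g, g \in gs -> D g) -> forall u, u \in us -> D u].
Proof.
pose f (a : C) : C := (complex.Re a)%:C.
have fM a b : f (f a * b) = f a * f b by rewrite /f ReZ rmorphM.
have fD a b : f (a + b) = f a + f b by rewrite /f ReD rmorphD.
have fJ a : f (a^*) = (f a)^* by rewrite /f ReJ conjR.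
have [us [ho he hD]] := @gram_schmidt R H f fD fM fJ (fun _ => erefl) gs.
exists us; split=> [u v hu hv|g /he//|D D0 Dl Dg].
  have /(congr1 (@complex.Re R)) := orthons_uniq fJ ho hu hv; rewrite /f /= => ->; by case: ifP.
by apply: hD => // a x y; exact: Dl.
Qed.

End ComplexGramSchmidt.

(** * Conditional expectations by averaging over symmetries *)

Section Averaging.
Context {R : realType} (K : hilbertType R).
Local Notation C := R[i].

Definition sym_avg (s T : K -> K) : K -> K := 2^-1 *: (T + (s \o (T \o s))).
Definition sym_exp (sy : seq (K -> K)) (T : K -> K) : K -> K := foldr sym_avg T sy.

Definition symmetry (s : K -> K) : Prop := [/\ bounded_op s, adjoint s s & forall z, s (s z) = z].

Lemma sym_avg_b s T : bounded_op s -> bounded_op T -> bounded_op (sym_avg s T).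
Proof. by move=> bs bT; apply/boundedZ/boundedD => //; do 2 apply: bounded_comp => //. Qed.

Lemma sym_isometry s z : symmetry s -> nrm (s z) = nrm z.
Proof.
move=> [_ sa ss]; apply/eqP; rewrite -(@eqrXn2 _ 2)// ?nrm_ge0//; apply/eqP.
by rewrite !nrm_dot sa ss.
Qed.

Lemma sym_avg_comm s T z : symmetry s -> linear T -> sym_avg s T (s z) = s (sym_avg s T z).
Proof.
move=> [[ls _] _ ss] lT; rewrite /sym_avg !fctE /= ss (linZ _ _ ls) (linD _ _ ls) ss.
by rewrite addrC.
Qed.

(** If s t = c t s with c^2 = 1, conjugation by s sends operators commuting with t to such
    operators, as the two signs cancel. Successive averages hence do not destroy the commutation
    already achieved. *)
Lemma sym_avg_keep s t T (c : C) z : symmetry s -> linear t -> linear T -> c * c = 1 ->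
  (forall z, s (t z) = c *: t (s z)) -> (forall z, T (t z) = t (T z)) ->
  sym_avg s T (t z) = t (sym_avg s T z).
Proof.
move=> [[ls _] _ ss] lt lT cc st Tt; rewrite /sym_avg !fctE /= (linZ _ _ lt) (linD _ _ lt) Tt.
by rewrite st (linZ _ _ lT) Tt (linZ _ _ ls) st scalerA cc scale1r.
Qed.

Lemma sym_avg_id s T : symmetry s -> (forall z, T (s z) = s (T z)) -> sym_avg s T = T.
Proof.
move=> [[ls _] _ ss] Ts; apply/funext => z; rewrite /sym_avg !fctE /= Ts ss.
by rewrite -[T z + T z]mulr2n -[T z *+ 2]scaler_nat scalerA mulVf ?scale1r// pnatr_eq0.
Qed.

Lemma sym_avg_mx s n (T : 'I_n -> 'I_n -> K -> K) c : symmetry s -> 0 <= c -> (forall k l, bounded_op (T k l)) ->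
  mx_bound T c -> mx_bound (fun k l => sym_avg s (T k l)) c.
Proof.
move=> hs c0 bT hT v; have [[ls cs] sa ss] := hs.
pose a k := \sum_l T k l (v l); pose b k := \sum_l T k l (s (v l)).
have e k : \sum_l sym_avg s (T k l) (v l) = (2^-1)%:C *: (a k + s (b k)).
  rewrite /a /b (lin_sum _ _ _ ls) -big_split scaler_sumr; apply: eq_bigr => l _.
  by rewrite /sym_avg !fctE /= rmorphV ?unitfE ?pnatr_eq0//= rmorph_nat.
have h1 : \sum_k nrm (a k) ^+ 2 <= c ^+ 2 * \sum_l nrm (v l) ^+ 2 := hT v.
have h2 : \sum_k nrm (b k) ^+ 2 <= c ^+ 2 * \sum_l nrm (v l) ^+ 2.
  have e3 : \sum_l nrm (s (v l)) ^+ 2 = \sum_l nrm (v l) ^+ 2.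
    by apply: eq_bigr => l _; rewrite (sym_isometry _ hs).
  by rewrite -e3; exact: hT.
apply: (@le_trans _ _ (\sum_k (2^-1 * nrm (a k) ^+ 2 + 2^-1 * nrm (b k) ^+ 2))); last first.
  by rewrite big_split /= -!mulr_sumr; lra.
apply: ler_sum => k _; rewrite e nrmZ nrmR ger0_norm ?invr_ge0// exprMn.
have := nrmD (a k) (s (b k)); rewrite (sym_isometry _ hs) => h3.
have := sqrD_le (nrm (a k)) (nrm (b k)).
have : nrm (a k + s (b k)) ^+ 2 <= (nrm (a k) + nrm (b k)) ^+ 2.
  by rewrite ler_pXn2r ?nnegrE ?nrm_ge0 ?addr_ge0 ?nrm_ge0.
have -> : (2^-1 : R) ^+ 2 = 4^-1 by rewrite expr2 -invfM -natrM.
move: (nrm (a k) ^+ 2) (nrm (b k) ^+ 2) (nrm (a k + s (b k)) ^+ 2) ((_ + _) ^+ 2) => x y w v' g1 g2.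
lra.
Qed.

Context (sy : seq (K -> K)).
Hypothesis sy_sym : forall s, List.In s sy -> symmetry s.
Hypothesis sy_comm : forall s t, List.In s sy -> List.In t sy ->
  exists2 c : C, c * c = 1 & forall z, s (t z) = c *: t (s z).
Definition in_syms : set (K -> K) := [set s | List.In s sy].

Let sub_ind (Q : seq (K -> K) -> Prop) : Q [::] ->
  (forall s l, symmetry s -> (forall t, List.In t l -> linear t /\
     exists2 c : C, c * c = 1 & forall z, s (t z) = c *: t (s z)) -> Q l -> Q (s :: l)) -> Q sy.
Proof.
move=> h0 h1; have : forall s, List.In s sy -> List.In s sy by [].
suff : forall l, (forall s, List.In s l -> List.In s sy) -> Q l by move=> h; exact: h.
elim=> [//|s l IH] hl; apply: h1; first by apply: sy_sym; apply: hl; left.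
  move=> t ht; have ht' : List.In t sy by apply: hl; right.
  split; first by case: (sy_sym ht') => -[].
  by apply: sy_comm => //; apply: hl; left.
by apply: IH => t ht; apply: hl; right.
Qed.

Lemma in_syms_star : star_closed in_syms.
Proof. by move=> s hs; have [bs sa _] := sy_sym hs; split=> //; rewrite (adjE bs sa). Qed.

Lemma sym_exp_b T : bounded_op T -> bounded_op (sym_exp sy T).
Proof.
move=> bT; apply: (sub_ind (Q := fun l => bounded_op (sym_exp l T))) => // s l [bs _ _] _ IH.
exact: sym_avg_b.
Qed.

Lemma sym_exp_A T : bounded_op T -> commutant in_syms (sym_exp sy T).
Proof.
move=> bT; apply: commI; first exact: sym_exp_b.
suff [_ h] : bounded_op (sym_exp sy T) /\ forall t, List.In t sy -> forall z, sym_exp sy T (t z) = t (sym_exp sy T z).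
  by move=> t z ht; exact: h.
apply: (sub_ind (Q := fun l => bounded_op (sym_exp l T) /\ forall t, List.In t l -> forall z, sym_exp l T (t z) = t (sym_exp l T z))) => //.
move=> s l hs hl [bl IH]; have [bs _ _] := hs; split; first exact: sym_avg_b.
move=> t [<- z|ht z] /=; first exact: sym_avg_comm hs (bounded_lin bl).
have [lt [c cc st]] := hl t ht.
exact: (sym_avg_keep z hs lt (bounded_lin bl) cc st (IH t ht)).
Qed.

Lemma sym_exp_lin a S T : sym_exp sy (a *: S + T) = a *: sym_exp sy S + sym_exp sy T.
Proof.
apply: (sub_ind (Q := fun l => sym_exp l (a *: S + T) = a *: sym_exp l S + sym_exp l T)) => // s l [[ls _] _ _] _ /= ->.
apply/funext => z; rewrite /sym_avg !fctE /= (linD _ _ ls) (linZ _ _ ls).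
by rewrite !scalerDr !scalerA [a * _]mulrC addrACA.
Qed.

Lemma sym_exp_id T : commutant in_syms T -> sym_exp sy T = T.
Proof.
move=> hT; have : forall s, List.In s sy -> forall z, T (s z) = s (T z).
  by move=> s hs z; exact: comm_commute hT hs.
suff : forall l, (forall s, List.In s l -> List.In s sy) -> (forall s, List.In s l -> forall z, T (s z) = s (T z)) -> sym_exp l T = T.
  by move=> h; exact: h.
elim=> //= s l IH hl hc; rewrite IH.
- by apply: sym_avg_id; [apply: sy_sym; apply: hl; left|apply: hc; left].
- by move=> t ht; apply: hl; right.
- by move=> t ht; apply: hc; right.
Qed.

Lemma sym_exp_mx n (T : 'I_n -> 'I_n -> K -> K) c : 0 <= c -> (forall k l, bounded_op (T k l)) ->
  mx_bound T c -> mx_bound (fun k l => sym_exp sy (T k l)) c.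
Proof.
move=> c0 bT hT; suff [] : (forall k l, bounded_op (sym_exp sy (T k l))) /\ mx_bound (fun k l => sym_exp sy (T k l)) c by [].
apply: (sub_ind (Q := fun u => (forall k l, bounded_op (sym_exp u (T k l))) /\ mx_bound (fun k l => sym_exp u (T k l)) c)) => //.
move=> s u hs _ [h1 h2]; have [bs _ _] := hs; split=> [k l|]; first exact: (sym_avg_b bs (h1 k l)).
exact: (sym_avg_mx hs c0 h1 h2).
Qed.

End Averaging.

(** * Convergence of moments *)

Section WordOperators.
Context {R : realType} (q : R) (H : hilbertType R) (L : Type) (side : L -> bool) (vec : L -> H).
Local Notation C := R[i].
Local Notation Q := (q%:C : C).
Implicit Types (l : L) (w : seq L) (s t : seq H).

Definition lopT (E : lmodType C) l (al : seq H -> E) : seq H -> E :=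
  if side l then opL Q (dot (vec l)) (vec l) al else opR Q (dot (vec l)) (vec l) al.
Definition wordT (E : lmodType C) w (al : seq H -> E) : seq H -> E := foldl (fun al l => lopT l al) al w.

Lemma lopT_nat (E E' : lmodType C) l (al : seq H -> E) (f : E -> E') : linear f ->
  f \o lopT l al = lopT l (f \o al).
Proof.
move=> lf; apply/funext => s; rewrite /lopT; case: ifP => _ /=.
  exact: (opL_nat q (dot (vec l)) (vec l) al s lf).
exact: (opR_nat q (dot (vec l)) (vec l) al s lf).
Qed.

Lemma wordT_nat (E E' : lmodType C) w (al : seq H -> E) (f : E -> E') : linear f ->
  f \o wordT w al = wordT w (f \o al).
Proof. by move=> lf; elim: w al => //= l w IH al; rewrite IH lopT_nat. Qed.

Lemma annF_ind (E : lmodType C) (D : set E) (b : H -> C) (al : seq H -> E) n s :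
  D 0 -> (forall (a : C) x y, D x -> D y -> D (a *: x + y)) ->
  (size s <= n)%N -> (forall t, (size t <= n)%N -> D (al t)) -> D (annF Q b al s).
Proof.
move=> D0 Dl; elim: s al n => [|h s IH] al n sn h1; first by rewrite annF_nil.
rewrite annF_cons; apply: (Dl _); first by apply: h1; exact: ltnW.
rewrite -[_ *: _]addr0; apply: (Dl _) => //; apply: (IH _ n.-1); first by case: n sn {h1}.
by move=> t ht; apply: (h1 _); case: n sn ht {h1}.
Qed.

Lemma lopT_ind (E : lmodType C) (D : set E) l (al : seq H -> E) n s :
  D 0 -> (forall (a : C) x y, D x -> D y -> D (a *: x + y)) ->
  (size s < n)%N -> (forall t, (size t <= n)%N -> D (al t)) -> D (lopT l al s).
Proof.
move=> D0 Dl sn h; have DD x y : D x -> D y -> D (x + y) by move=> hx; rewrite -[x]scale1r; exact: Dl.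
rewrite /lopT; case: ifP => _; apply: DD.
- by apply: h.
- by apply: (@annF_ind E D _ _ n) => //; exact: ltnW.
- by apply: h; rewrite size_rcons.
- apply: (@annF_ind E D _ _ n) => //; first by rewrite size_rev ltnW.
  by move=> t ht; apply: (h _); rewrite size_rev.
Qed.

Lemma wordT_ind (E : lmodType C) (D : set E) w (al : seq H -> E) n s :
  D 0 -> (forall (a : C) x y, D x -> D y -> D (a *: x + y)) ->
  (size s + size w <= n)%N -> (forall t, (size t <= n)%N -> D (al t)) -> D (wordT w al s).
Proof.
move=> D0 Dl; elim: w al n s => [|l w IH] al n s sn h /=; first by apply: h; rewrite addn0 in sn.
apply: (IH _ n.-1); first by rewrite /= addnS in sn; case: n sn {h}.
move=> t ht; apply: (@lopT_ind E D _ _ n) => //; move: sn ht; rewrite /= addnS.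
by case: n {h}.
Qed.

Lemma lopTB (E : lmodType C) l (al be : seq H -> E) :
  lopT l (fun s => al s - be s) = (fun s => lopT l al s - lopT l be s).
Proof.
apply/funext => s; have e : (fun s => al s - be s) = (fun s => (-1 : C) *: be s + al s).
  by apply/funext => t; rewrite scaleN1r addrC.
by rewrite e /lopT; case: ifP => _; rewrite /opL /opR ?annF_lin ?annR_lin /= !scaleN1r addrACA addrC opprD.
Qed.

Lemma wordTB (E : lmodType C) w (al be : seq H -> E) :
  wordT w (fun s => al s - be s) = (fun s => wordT w al s - wordT w be s).
Proof. by elim: w al be => //= l w IH al be; rewrite lopTB IH. Qed.

Context (I0 : Type) (G : set_system I0) {GF : ProperFilter G} (K : I0 -> hilbertType R).

Lemma tends_zero (f : I0 -> C) : (forall i, f i = 0) -> tends G f 0.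
Proof. by move=> h e e0; apply: filterE => i /=; rewrite h subr0 nrm0. Qed.

Lemma annF_tends (b : H -> C) (al : forall i, seq H -> K i) s :
  (forall t, tends G (fun i => (nrm (al i t))%:C : C) 0) ->
  tends G (fun i => (nrm (annF Q b (al i) s))%:C : C) 0.
Proof.
elim: s al => [|h s IH] al hal.
  by apply: tends_zero => i; rewrite annF_nil nrm0.
have h1 := tendsD (tendsM ((nrm (b h))%:C : C) (hal s)) (tendsM ((nrm Q)%:C : C) (IH (fun i t => al i (h :: t)) (fun t => hal (h :: t)))).
have {}h1 := h1 GF GF GF; rewrite !mulr0 addr0 in h1; apply: tends0_le h1; apply: filterE => i /=.
have h2 : nrm (annF Q b (al i) (h :: s)) <=
    nrm (b h) * nrm (al i s) + nrm Q * nrm (annF Q b (fun t => al i (h :: t)) s).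
  by rewrite annF_cons -!nrmZ nrmD.
rewrite -!rmorphM -rmorphD [leLHS]nrmR [leRHS]nrmR ger0_norm ?nrm_ge0//.
exact: le_trans h2 (ler_norm _).
Qed.

Lemma lopT_tends l (al : forall i, seq H -> K i) s :
  (forall t, tends G (fun i => (nrm (al i t))%:C : C) 0) ->
  tends G (fun i => (nrm (lopT l (al i) s))%:C : C) 0.
Proof.
move=> hal; suff [t [t' [be [b [hb hl]]]]] : exists t t' (be : forall i, seq H -> K i) b,
    (forall u, tends G (fun i => (nrm (be i u))%:C : C) 0) /\
    forall i, lopT l (al i) s = al i t + annF Q b (be i) t'.
  have h1 := tendsD (hal t) (annF_tends b t' hb); have {}h1 := h1 GF; rewrite addr0 in h1.
  apply: tends0_le h1; apply: filterE => i /=.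
  by rewrite -rmorphD !nrmR hl !ger0_norm ?nrm_ge0 ?addr_ge0 ?nrm_ge0// nrmD.
rewrite /lopT; case: (side l).
  by exists (vec l :: s), s, al, (dot (vec l)).
exists (rcons s (vec l)), (rev s), (fun i => al i \o rev), (dot (vec l)).
by split=> // u; exact: hal.
Qed.

Lemma wordT_tends w (al : forall i, seq H -> K i) s :
  (forall t, tends G (fun i => (nrm (al i t))%:C : C) 0) ->
  tends G (fun i => (nrm (wordT w (al i) s))%:C : C) 0.
Proof.
elim: w al => //= l w IH al hal; apply: (IH (fun i => lopT l (al i))) => t.
exact: lopT_tends.
Qed.

(* wick i s is the model of the vector tens s: the letters act on it as on tens s
   up to an error that vanishes in the limit. *)
Context (F : hilbertType R) (tens : seq H -> F) (op : L -> F -> F).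
Hypothesis op_lin : forall l, linear (op l).
Hypothesis op_tens : forall l s, op l (tens s) = lopT l tens s.
Context (xi : forall i, L -> K i -> K i) (wick : forall i, seq H -> K i) (lev : forall i, nat -> set (K i)).
Arguments xi : clear implicits.
Arguments wick : clear implicits.
Arguments lev : clear implicits.
Hypothesis xi_lin : forall i l, linear (xi i l).
Hypotheses (lev0 : forall i n, lev i n 0)
  (lev_lin : forall i n (a : C) x y, lev i n x -> lev i n y -> lev i n (a *: x + y))
  (lev_mono : forall i m n z, (m <= n)%N -> lev i m z -> lev i n z)
  (lev_wick : forall i s, lev i (size s) (wick i s))
  (lev_xi : forall i n l z, lev i n z -> lev i n.+1 (xi i l z)).
Hypothesis xi_bound : forall l n, exists2 c, 0 <= c & forall i z, lev i n z -> nrm (xi i l z) <= c * nrm z.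
Hypothesis wick_approx : forall l s,
  tends G (fun i => (nrm (xi i l (wick i s) - lopT l (wick i) s))%:C : C) 0.

Lemma word_lop w : vword op w (tens [::]) = wordT w tens [::].
Proof.
elim: w => //= l w ->; rewrite -[op l _]/((op l \o wordT w tens) [::]) wordT_nat//.
by congr (wordT _ _ _); apply/funext => s; exact: op_tens.
Qed.

(** Induction on the word: the previous error has bounded level, where the next letter is uniformly
    bounded, and the new error is a fixed finite combination of errors on single [wick] vectors. *)
Lemma word_model w : tends G (fun i => (nrm (vword (xi i) w (wick i [::]) - wordT w (wick i) [::]))%:C : C) 0.
Proof.
elim: w => [|l w IH].
  by apply: tends_zero => i; rewrite subrr nrm0.
have lv i n : lev i (size w) (vword (xi i) w (wick i [::]) - wordT w (wick i) [::]) /\ (n = n :> nat).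
  split=> //; rewrite addrC -scaleN1r; apply: lev_lin.
    apply: (@wordT_ind _ (lev i (size w)) _ _ (size w)) => //; first exact: lev_lin.
    by move=> t ht; exact: lev_mono ht (lev_wick _ _).
  have : lev i (size (@nil H) + size w)%N (vword (xi i) w (wick i [::])); last by [].
  elim: w {IH} => [|k w IH] /=; first exact: (lev_wick i [::]).
  exact: lev_xi.
have [c c0 hc] := xi_bound l (size w).
have h1 := tendsD (tendsM (c%:C : C) IH) (wordT_tends w [::] (al := fun i s => xi i l (wick i s) - lopT l (wick i) s) (wick_approx l)).
have {}h1 := h1 GF GF; rewrite mulr0 addr0 in h1; apply: tends0_le h1; apply: filterE => i /=.
rewrite -rmorphM -rmorphD !nrmR !ger0_norm ?nrm_ge0 ?addr_ge0 ?mulr_ge0 ?nrm_ge0//.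
rewrite wordTB -[wordT w (fun s => xi i l (wick i s)) [::]]/(wordT w (xi i l \o wick i) [::]).
rewrite -(wordT_nat _ _ (@xi_lin i l)).
apply: le_trans (lerD (hc i _ (lv i 0%N).1) (lexx _)).
by rewrite (linB _ _ (@xi_lin i l)); apply: le_trans (nrmD _ _); rewrite subrKA.
Qed.

Hypothesis wick_dot : forall i s, dot (wick i [::]) (wick i s) = dot (tens [::]) (tens s).
Hypothesis wick_nrm : forall i, nrm (wick i [::]) = 1.

Lemma word_moment w : tends G (fun i => dot (wick i [::]) (vword (xi i) w (wick i [::])))
  (dot (tens [::]) (vword op w (tens [::]))).
Proof.
apply: (tends_sub0 (v := fun=> dot (tens [::]) (vword op w (tens [::])))); last exact: tends_cst.
apply: tends0_le (word_model w); apply: filterE => i /=.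
rewrite nrmR ger0_norm ?nrm_ge0// word_lop.
have -> : dot (tens [::]) (wordT w tens [::]) = dot (wick i [::]) (wordT w (wick i) [::]).
  have l1 := dot_linear_fun (tens [::]); have l2 := dot_linear_fun (wick i [::]).
  transitivity (wordT w ((dot (tens [::]) : F -> C^o) \o tens) [::]); first by rewrite -(wordT_nat _ _ l1).
  transitivity (wordT w ((dot (wick i [::]) : K i -> C^o) \o wick i) [::]); last by rewrite -(wordT_nat _ _ l2).
  by congr (wordT _ _ _); apply/funext => s /=; rewrite wick_dot.
by rewrite -dotBr (le_trans (CS _ _))// wick_nrm mul1r.
Qed.

End WordOperators.

Section FieldOperators.
Context {R : realType} (q : R) (F : hilbertType R) (om : F) (N m : nat) (eps : 'I_N -> 'I_N -> R).
Context (V : Type) (kap : V -> 'I_m -> R[i]) (nV : V -> R).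
Hypothesis N_gt0 : (0 < N)%N.
Hypothesis nrm_om : nrm om = 1.
Local Notation C := R[i].
Local Notation Q := (q%:C : C).
Local Notation mode := ('I_N * 'I_m)%type.
Local Notation K := (hsum {set mode} (fun=> F)).
Hypothesis eps_sign : forall i, signs (eps i).
Hypothesis eps_sym : forall i j, eps i j = eps j i.
Hypothesis eps_diag : forall i, eps i i = -1.
Hypothesis nV_ge0 : forall h, 0 <= nV h.
Hypothesis kap_le : forall h, \sum_k nrm (kap h k) ^+ 2 <= nV h ^+ 2.
Implicit Types (x y z : K).
Local Notation Om := (vac om N m).

Lemma bounded_sumf (J : Type) (r : seq J) (f : J -> K -> K) : (forall j, bounded_op (f j)) ->
  bounded_op (fun z => \sum_(j <- r) f j z).
Proof.
move=> h; suff -> : (fun z => \sum_(j <- r) f j z) = \sum_(j <- r) f j by exact: bounded_sum.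
by apply/funext => z; elim: r => [|j r IH]; rewrite ?big_nil// !big_cons IH.
Qed.

Section OneSide.
Context (lt : rel mode).
Hypothesis lt_irr : forall b, lt b b = false.
Hypothesis lt_tot : forall b c, b != c -> lt b c = ~~ lt c b.

Lemma crea_le b z : nrm (crea eps lt b z) <= 1 * nrm z.
Proof.
rewrite mul1r -(@ler_pXn2r _ 2)// ?nnegrE ?nrm_ge0// !nrm_fin.
rewrite (bigID (fun S : {set mode} => b \in S)) /= [X in _ + X]big1 ?addr0; last first.
  by move=> S /negPf ->; rewrite nrm0 expr0n.
rewrite sum_setU1 [leRHS](bigID (fun S : {set mode} => b \notin S)) /= -[leLHS]addr0.
rewrite lerD ?sumr_ge0// => [|S _]; last exact: sqr_ge0.
by apply: ler_sum => S hS; rewrite finset.setU11 finset.setU1K// nrmZ nrmR jw_norm// mul1r.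
Qed.

Lemma bsm_bounded i h : bounded_op (bsm (F := F) eps kap lt i h).
Proof.
apply: bounded_sumf => k; apply: (boundedZ (S := crea eps lt (i, k))).
apply: (bounded_opI ler01); split; [exact: crea_linear|exact: crea_le].
Qed.

Lemma asm_bounded i h : bounded_op (asm (F := F) eps kap lt i h).
Proof.
apply: bounded_sumf => k; apply: (boundedZ (S := anni eps lt (i, k))).
apply: (bounded_opI ler01); split; first exact: anni_linear.
by apply: (adjoint_bound ler01); [exact: crea_le|exact: crea_anni].
Qed.

Definition field h z : K := bsum (bsm eps kap lt) h z + asum (asm eps kap lt) h z.
Local Notation U := (wick Om (bsm eps kap lt)).

Lemma field_bounded h : bounded_op (field h).
Proof.
apply: (boundedD (S := bsum (bsm eps kap lt) h) (T := asum (asm eps kap lt) h)).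
  apply: (boundedZ (S := fun z => \sum_i bsm eps kap lt i h z)); apply: bounded_sumf => i; exact: bsm_bounded.
apply: (boundedZ (S := fun z => \sum_i asm eps kap lt i h z)); apply: bounded_sumf => i; exact: asm_bounded.
Qed.

Lemma bsum_asm h : adjoint (bsum (bsm eps kap lt) h : K -> K) (asum (asm eps kap lt) h).
Proof. by apply: bsum_asum => i g; exact: bsm_asm. Qed.

Lemma field_sa h : adjoint (field h) (field h).
Proof.
have a := bsum_asm h; by move=> x y; rewrite /field dotDl dotDr a (adjoint_sym a) addrC.
Qed.

Lemma fieldE h z : field h z = ((Num.sqrt N%:R)^-1)%:C *: \sum_i xs eps kap lt i h z.
Proof. by rewrite /field /bsum /asum -scalerDr -big_split. Qed.

Let key n h (v : 'I_N -> K) (lv : forall i, level n (v i)) := smear_bound eps_sign kap_le lt h lv.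

Lemma field_level n h z : level n z -> level n.+1 (field h z).
Proof.
move=> lz; have l0 := @level0 R F N m; have ll := @level_lin R F N m.
rewrite -[field h z](addrC (asum _ h z)) -[asum _ h z]scale1r; apply: (ll _).
  apply: (level_mono (leqnSn n)).
  by apply: (Kle_asum l0 ll) => // k i g y hy; exact: level_asm.
by apply: (Kle_bsum l0 ll) => // k i g y hy; exact: level_bsm.
Qed.

Lemma field_le n h z : level n z -> nrm (field h z) <= 2 * (n.+1%:R * nV h) * nrm z.
Proof.
move=> lz; rewrite (le_trans (nrmD _ _))// -mulrA mulr_natl mulr2n lerD//.
  exact: (bsum_le N_gt0 nV_ge0 key h lz).
apply: (asum_le N_gt0 (fun i h => bsm_asm eps kap lt_irr i h) (@level0 R F N m) (@level_lin R F N m) _ nV_ge0 key h lz).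
by move=> k i g y hy; exact: level_asm.
Qed.

Lemma wick_level s : level (size s) (U s).
Proof.
apply: (Kle_wick (@level_vac R F om N m) (@level0 R F N m) (@level_lin R F N m)).
by move=> k i g y hy; exact: level_bsm.
Qed.

Lemma wick_dot s : dot Om (U s) = if s is [::] then 1 else 0.
Proof.
case: s => [|h s] /=; first by rewrite dot_nrm nrm_vac// expr1n.
rewrite -(adjoint_sym (bsum_asm h)) /asum.
by rewrite big1 ?scaler0 ?dot0l// => i _; rewrite asm_vac.
Qed.

Lemma field_wick h s c : (forall k, (k < size s)%N -> sign_defect q eps k (fun=> 1) 0 <= sign_bound k / c) -> 0 <= c ->
  nrm (field h (U s) - opL Q (kip kap h) h U s) ^+ 2 <=
  defect_bound nV h s * (\sum_(k < size s) sign_bound k) / c.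
Proof.
move=> hd c0; rewrite /field /opL opprD addrACA subrr add0r -mulrA.
apply: (@le_trans _ _ (defect_bound nV h s * \sum_(k < size s) sign_defect q eps k (fun=> 1) 0)); last first.
  apply: ler_wpM2l; first exact: (defect_bound_ge0 nV_ge0).
  by rewrite mulr_suml; apply: ler_sum => k _; exact: hd.
apply: (@asum_wick R q N eps N_gt0 K Om V (kip kap) nV (bsm eps kap lt) (asm eps kap lt) (@level R F N m)).
- by move=> i g; exact: bsm_lin.
- by move=> i g; exact: asm_lin.
- by move=> i j g k z; exact: asm_bsm.
- by move=> j k; exact: asm_vac.
- exact: nrm_vac.
- exact: level_vac.
- exact: level0.
- exact: level_lin.
- by move=> n i g z lz; exact: level_bsm.
- by move=> n i g z lz; exact: level_asm.
- by move=> k n z; exact: level_mono.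
- exact: nV_ge0.
- exact: (kip_le nrm_om nV_ge0 kap_le).
- exact: key.
Qed.

End OneSide.

Section Both.
Context (lt : rel mode).
Hypothesis lt_irr : forall b, lt b b = false.
Hypothesis lt_tot : forall b c, b != c -> lt b c = ~~ lt c b.
Local Notation U := (wick Om (bsm eps kap lt)).
Local Notation Ur := (wick Om (bsm eps kap (rlt lt))).

(** Left and right creation operators commute and coincide on the vacuum. *)
Lemma wick_rev s : U s = Ur (rev s).
Proof.
have comm h g z : bsum (bsm eps kap (rlt lt)) h (bsum (bsm eps kap lt) g z) =
    bsum (bsm eps kap lt) g (bsum (bsm eps kap (rlt lt)) h z).
  rewrite /bsum.
  transitivity (((Num.sqrt N%:R)^-1)%:C *: (((Num.sqrt N%:R)^-1)%:C *: \sum_i \sum_j bsm eps kap (rlt lt) i h (bsm eps kap lt j g z))).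
    congr (_ *: _); rewrite [RHS]scaler_sumr; apply: eq_bigr => i _.
    by rewrite (linZ _ _ (bsm_lin _ _ _ _ _)) (lin_sum _ _ _ (bsm_lin _ _ _ _ _)).
  congr (_ *: _); rewrite exchange_big [LHS]scaler_sumr; apply: eq_bigr => j _.
  rewrite (linZ _ _ (bsm_lin _ _ _ _ _)) (lin_sum _ _ _ (bsm_lin _ _ _ _ _)); congr (_ *: _); apply: eq_bigr => i _.
  exact: rb_bs.
have snoc t g : Ur (rcons t g) = bsum (bsm eps kap lt) g (Ur t).
  elim: t => [|h t IH] /=; last by rewrite IH comm.
  by rewrite /bsum; congr (_ *: _); apply: eq_bigr => i _; exact: rb_vac.
by elim: s => //= g s IH; rewrite rev_cons snoc IH.
Qed.

Lemma rfield_wick h s c : (forall k, (k < size s)%N -> sign_defect q eps k (fun=> 1) 0 <= sign_bound k / c) -> 0 <= c ->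
  nrm (field (rlt lt) h (U s) - opR Q (kip kap h) h U s) ^+ 2 <=
  defect_bound nV h (rev s) * (\sum_(k < size s) sign_bound k) / c.
Proof.
move=> hd c0; have := @field_wick (rlt lt) (rlt_irr lt_irr) (rlt_tot lt_tot) h (rev s) c.
rewrite size_rev -wick_rev => /(_ hd c0); congr (_ <= _); congr (nrm (_ - _) ^+ 2).
rewrite /opL /opR /annR; congr (_ + _); first by rewrite -[U (rcons s h)]/(U (rcons s h)) wick_rev rev_rcons.
by congr (annF _ _ _ _); apply/funext => t /=; rewrite wick_rev revK.
Qed.

End Both.
End FieldOperators.

Lemma In_mem (T : eqType) (x : T) s : List.In x s -> x \in s.
Proof. by elim: s => //= y s IH [->|/IH h]; rewrite inE ?eqxx// h orbT. Qed.

Lemma mem_In (T : eqType) (x : T) s : x \in s -> List.In x s.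
Proof. by elim: s => //= y s IH; rewrite inE => /predU1P[->|/IH h]; [left|right]. Qed.

(** * Models for finitely many letters *)

Section Model.
Context {R : realType} (q : R) (H F : hilbertType R) (tens : seq H -> F).
Hypothesis q_gt : -1 < q.
Hypothesis q_lt : q < 1.
Hypothesis Ff : q_fock q tens.
Context (E0 : set H).
Local Notation C := R[i].
Local Notation letter := (letter E0).

Definition lvec (l : letter) : H := (val l).2.

Definition approx_const (l : letter) (s : seq H) : R :=
  defect_bound nrm (lvec l) (if lside l then s else rev s) * \sum_(k < size s) (sign_bound k : R).

(** The approximation is demanded only for letters in L0 and words of length at most n: finitely
    many vectors need finitely many modes and symmetries, so that the averaging is a finite one. The
    limit is taken over growing L0 and n. *)
Record model (L0 : seq letter) (n : nat) := Model {
  mK : hilbertType R;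
  mwick : seq H -> mK;
  mlev : nat -> set mK;
  mxi : letter -> mK -> mK;
  mY : set (mK -> mK);
  mE : (mK -> mK) -> (mK -> mK);
  mxi_b : forall l, bounded_op (mxi l);
  mxi_sa : forall l, adjoint (mxi l) (mxi l);
  mYs : star_closed mY;
  mE_A : forall T, bounded_op T -> commutant mY (mE T);
  mE_lin : forall (a : C) S T, mE (a *: S + T) = a *: mE S + mE T;
  mE_id : forall T, commutant mY T -> mE T = T;
  mE_mx : forall k (T : 'I_k -> 'I_k -> mK -> mK) c, 0 <= c -> (forall i j, bounded_op (T i j)) ->
    mx_bound T c -> mx_bound (fun i j => mE (T i j)) c;
  mxi_x : forall l, lside l -> commutant mY (mxi l);
  mxi_y : forall l T x, ~~ lside l -> commutant mY T -> T (mxi l x) = mxi l (T x);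
  mlev0 : forall k, mlev k 0;
  mlev_lin : forall k (a : C) x y, mlev k x -> mlev k y -> mlev k (a *: x + y);
  mlev_mono : forall j k z, (j <= k)%N -> mlev j z -> mlev k z;
  mlev_wick : forall s, mlev (size s) (mwick s);
  mlev_xi : forall k l z, mlev k z -> mlev k.+1 (mxi l z);
  mxi_bound : forall l k z, mlev k z -> nrm (mxi l z) <= 2 * (k.+1%:R * nrm (lvec l)) * nrm z;
  mwick_approx : forall l s, l \in L0 -> (size s <= n)%N ->
    nrm (mxi l (mwick s) - lopT q (@lside _ _ E0) lvec l mwick s) ^+ 2 <= approx_const l s / n.+1%:R;
  mwick_dot : forall s, dot (mwick [::]) (mwick s) = if s is [::] then 1 else 0 }.

Arguments mxi {L0 n} _ _ _.
Arguments mE {L0 n} _ _ _.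
Arguments mlev {L0 n} _ _ _.
Arguments mY {L0 n} _ _.

Lemma fock_vac s : dot (tens [::]) (tens s) = if s is [::] then 1 else 0.
Proof.
rewrite (fock_dot Ff); case: s => [|h s] //=.
rewrite (big_pred1 (1%g : 'S_0)) => [|p]; last by apply/esym/eqP/permP => -[].
rewrite big_ord0 mulr1 /inversions (_ : [set _ | _]%SET = finset.set0) ?finset.cards0//.
by apply/setP => -[[]].
Qed.

Lemma opL_kip (K : hilbertType R) (ip : H -> H -> C) h (U : seq H -> K) s :
  (forall g, ip h g = dot h g) -> opL (q%:C : C) (ip h) h U s = opL (q%:C : C) (dot h) h U s.
Proof. by move=> e; congr (opL _ _ _ _ _); apply/funext => g. Qed.

Lemma opR_kip (K : hilbertType R) (ip : H -> H -> C) h (U : seq H -> K) s :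
  (forall g, ip h g = dot h g) -> opR (q%:C : C) (ip h) h U s = opR (q%:C : C) (dot h) h U s.
Proof. by move=> e; congr (opR _ _ _ _ _); apply/funext => g. Qed.

Lemma model_ex (L0 : seq letter) n : exists M : model L0 n, True.
Proof.
pose N := n.+1; have N0 : (0 < N)%N by [].
have [eps [e_sign e_sym e_diag e_def]] := signs_exist q_gt q_lt N0.
have [m [e [e_bes e_exp]]] := complex_basis (map lvec L0).
(* A second basis, orthonormal for the real inner product only: it spans the right vectors over the
   reals, so its members keep real inner products with E0 and their right fields are symmetries. *)
have [us [u_orth u_exp u_ind]] := real_basis [seq lvec l | l <- L0 & ~~ lside l].
pose kap (h : H) (k : 'I_m) : C := dot (e k) h.
pose lt : rel ('I_N * 'I_m) := fun b c => (enum_rank b < enum_rank c)%N.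
have lt_irr b : lt b b = false by exact: ltnn.
have lt_tot b c : b != c -> lt b c = ~~ lt c b.
  move=> bc; rewrite /lt -leqNgt [in RHS]leq_eqVlt; case: eqP => // /val_inj/enum_rank_inj eq_bc.
  by rewrite eq_bc eqxx in bc.
have nom : nrm (tens [::]) = 1.
  apply/eqP; rewrite -(@eqrXn2 _ 2) ?nrm_ge0// expr1n nrm_dot fock_vac /=; exact: eqxx.
(* Cutting down to the coordinates in the basis e preserves an inner product as soon as one of the
   two vectors is in its span; g is arbitrary here. *)
have kapL h g : h \in map lvec L0 -> kip kap h g = dot h g.
  move=> hh; rewrite kipC [RHS]dot_conj; congr (_^*).
  rewrite -[in RHS](e_exp h hh) dot_sumr /kip /kap; apply: eq_bigr => k _.
  by rewrite dotZr -dot_conj mulrC.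
have u_in u : u \in us -> \sum_k dot (e k) u *: e k = u.
  apply: (u_ind [set u | \sum_k dot (e k) u *: e k = u]) => [|r x y /= hx hy|g /mapP[l]] /=.
  - by rewrite big1// => k _; rewrite dot0r scale0r.
  - rewrite -[in RHS]hx -[in RHS]hy scaler_sumr -big_split; apply: eq_bigr => k _ /=.
    by rewrite dotDr dotZr scalerDl scalerA.
  - by rewrite mem_filter => /andP[_ hl] ->; apply: e_exp; apply: map_f.
have kipu h u : u \in us -> kip kap h u = dot h u.
  move=> hu; rewrite -[in RHS](u_in u hu) dot_sumr /kip /kap; apply: eq_bigr => k _.
  by rewrite dotZr -dot_conj mulrC.
have u_real u f : u \in us -> E0 f -> complex.Im (dot f u) = 0.
  move=> hu hf; move: u hu; apply: (u_ind [set u | complex.Im (dot f u) = 0]) => [|r x y /= hx hy|g /mapP[l]] /=.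
  - by rewrite dot0r.
  - by rewrite dotDr dotZr ImD ImZ hx hy mulr0 addr0.
  - rewrite mem_filter => /andP[+ _] ->; case: l => -[b h] /=; rewrite /lside /lvec /=.
    by move=> + bf; rewrite (negPf bf) => /asboolP; apply.
pose K := hsum {set 'I_N * 'I_m} (fun=> F).
pose Om : K := vac (tens [::]) N m.
pose U := wick Om (bsm eps kap lt).
(* Letters outside L0 act as 0, which commutes with everything. *)
pose xi (l : letter) : K -> K := if l \in L0 then
  if lside l then field eps kap lt (lvec l) else field eps kap (rlt lt) (lvec l) else 0.
pose y (p : 'I_N * H) : K -> K := ys eps kap lt p.1 p.2.
(* Right fields at each single site, not just their sums over the sites: these are the symmetries,
   and the sums lie in their span. *)
pose sy : seq (K -> K) := [seq y p | p <- [seq (i, u) | i <- enum 'I_N, u <- us]].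
have ri := rlt_irr lt_irr; have rt := rlt_tot lt_tot.
have sy_in s : List.In s sy -> exists i u, u \in us /\ s = y (i, u).
  move=> /List.in_map_iff[[i u] [<- hp]]; exists i, u; split=> //.
  suff : (i, u) \in [seq (i, u) | i <- enum 'I_N, u <- us] by case/allpairsP => -[j v] /= [_ hv [_ ->]].
  exact: In_mem.
have y_lin p : linear (y p).
  by move=> a v w; rewrite /y /ys bsm_lin asm_lin scalerDr addrACA.
have yy i j u v z : u \in us -> v \in us -> y (j, u) (y (i, v) z) =
    (eps i j)%:C *: y (i, v) (y (j, u) z) + (if i == j then if u == v then 2 else 0 else 0) *: z.
  move=> hu hv; rewrite /y /= ys_ys//; congr (_ + _ *: _); case: ifP => // _.
  rewrite !kipu// [X in _ + X]dot_conj; apply: cplx_eq.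
    by rewrite ReD ReJ u_orth//; case: ifP => _ /=; rewrite ?addr0.
  have im2 : complex.Im (2 : C) = 0 by rewrite -[2]/(1 + 1) ImD /= addr0.
  by rewrite ImD ImJ subrr; case: ifP.
have sy_sym s : List.In s sy -> symmetry s.
  move=> /sy_in[i [u [hu ->]]]; split.
  - apply: (boundedD (S := bsm eps kap (rlt lt) i u) (T := asm eps kap (rlt lt) i u)).
      exact: bsm_bounded.
    exact: asm_bounded.
  - have a := bsm_asm eps kap ri i u (F := F).
    by move=> v w; rewrite /y /ys dotDl dotDr a (adjoint_sym a) addrC.
  - move=> z; have := yy i i u u z hu hu; rewrite !eqxx e_diag rmorphN1 scaleN1r => /eqP.
    rewrite addrC -subr_eq opprK -mulr2n -[_ *+ 2]scaler_nat => /eqP.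
    by apply: scalerI; rewrite pnatr_eq0.
have sy_comm s t : List.In s sy -> List.In t sy ->
    exists2 c : C, c * c = 1 & forall z, s (t z) = c *: t (s z).
  move=> /sy_in[i [u [hu ->]]] /sy_in[j [v [hv ->]]].
  have [e1|ne] := eqVneq (i, u) (j, v); first by exists 1; rewrite ?mulr1// => z; rewrite e1 scale1r.
  exists (eps j i)%:C => [|z].
    by rewrite -rmorphM; case: (e_sign j i) => ->; rewrite ?mulrNN mulr1.
  rewrite yy//; case: eqP => [eji|_]; last by rewrite scale0r addr0.
  by case: eqP => [euv|_]; [rewrite eji euv eqxx in ne|rewrite scale0r addr0].
(* Only real linear in the vector, the annihilation part being antilinear; hence the real basis for
   the right vectors. *)
have ys_real i (r : R) g h z : ys eps kap lt i (r%:C *: g + h) z =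
    r%:C *: ys eps kap lt i g z + ys eps kap lt i h z :> K.
  rewrite /ys /bsm /asm !scalerDr addrACA !scaler_sumr -!big_split /=.
  apply: eq_bigr => k _; rewrite /kap dotDr dotZr rmorphD rmorphM /= conjR.
  by rewrite !scalerDl !scalerA.
have ys0 i z : ys eps kap lt i 0 z = 0 :> K.
  by have := ys_real i 1 0 0 z; rewrite scale1r addr0 scale1r => /eqP; rewrite addrC -subr_eq subrr eq_sym => /eqP.
have ys_us i h z : h \in [seq lvec l | l <- L0 & ~~ lside l] ->
    ys eps kap lt i h z = \sum_(u <- us) (complex.Re (dot u h))%:C *: y (i, u) z.
  move=> /u_exp {1}<-; elim: us {u_orth u_exp u_ind u_in kipu u_real sy sy_in yy sy_sym sy_comm} => [|u vs IH].
    by rewrite !big_nil ys0.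
  by rewrite !big_cons ys_real IH.
have xi_b l : bounded_op (xi l).
  rewrite /xi; case: ifP => _; last exact: bounded0.
  by case: ifP => _; exact: field_bounded.
have xi_sa l : adjoint (xi l) (xi l).
  rewrite /xi; case: ifP => _; last by move=> v w; rewrite dot0l dot0r.
  by case: ifP => _; exact: field_sa.
have xi_x l : lside l -> commutant (in_syms sy) (xi l).
  move=> hl; apply: commI; first exact: xi_b.
  move=> s z /sy_in[j [u [hu ->]]]; rewrite /xi hl; case: ifP => _; last by rewrite (lin0 (y_lin _)).
  rewrite !fieldE (linZ _ _ (y_lin _)) (lin_sum _ _ _ (y_lin _)); congr (_ *: _); apply: eq_bigr => i _.
  rewrite /y /= ys_xs// kipu// u_real//.
  by move: hl; case: l => -[b f] hb; rewrite /lside /lvec /= => bt; move: hb; rewrite bt => /asboolP.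
have xi_y l (T : K -> K) z : ~~ lside l -> commutant (in_syms sy) T -> T (xi l z) = xi l (T z).
  move=> hl hT; have lT := bounded_lin (comm_bounded hT).
  rewrite /xi (negPf hl); case: ifP => hL; last by rewrite (lin0 lT).
  rewrite !fieldE (linZ _ _ lT) (lin_sum _ _ _ lT); congr (_ *: _); apply: eq_bigr => i _.
  rewrite -[xs _ _ (rlt lt) i _ z]/(ys eps kap lt i (lvec l) z) -[RHS]/(ys eps kap lt i (lvec l) (T z)).
  have hv : lvec l \in [seq lvec l | l <- L0 & ~~ lside l] by apply: map_f; rewrite mem_filter hl.
  rewrite !ys_us// (lin_sum _ _ _ lT) big_seq [RHS]big_seq; apply: eq_bigr => u hu.
  rewrite (linZ _ _ lT); congr (_ *: _); apply: (comm_commute z hT).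
  apply: List.in_map; apply/mem_In; apply/allpairsP; exists (i, u); rewrite mem_enum //.
pose nV0 (h : H) := nrm_ge0 h.
unshelve eexists (@Model L0 n K U (@level R F N m) xi (in_syms sy) (sym_exp sy) xi_b xi_sa _ _ _ _ _ xi_x xi_y _ _ _ _ _ _ _ _) => //.
- exact: in_syms_star.
- by move=> T bT; exact: sym_exp_A.
- by move=> a S T; exact: sym_exp_lin.
- by move=> T hT; exact: sym_exp_id.
- by move=> k T c c0 bT hT; exact: sym_exp_mx.
- exact: level_lin.
- by move=> j k z; exact: level_mono.
- by move=> s; exact: wick_level.
- move=> k l z lz; rewrite /xi; case: ifP => _; last exact: level0.
  by case: ifP => _; exact: field_level.
- move=> l k z lz; rewrite /xi; case: ifP => _; last by rewrite nrm0 !mulr_ge0 ?nrm_ge0.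
  case: ifP => _.
    exact: (field_le N0 e_sign nV0 e_bes lt_irr (lvec l) lz).
  exact: (field_le N0 e_sign nV0 e_bes ri (lvec l) lz).
- move=> l s hl hs; have hkip g := kapL (lvec l) g.
  have hd k : (k < size s)%N -> sign_defect q eps k (fun=> 1) 0 <= sign_bound k / N%:R.
    by move=> hk; apply: e_def; exact: leq_trans hk (leq_trans hs (leqnSn n)).
  rewrite /xi hl /lopT /approx_const; case: (lside l).
  + rewrite -(opL_kip U s (fun g => hkip g (map_f _ hl))).
    exact: (field_wick N0 nom e_sign e_sym e_diag nV0 e_bes lt_irr lt_tot (lvec l) hd (ler0n _ _)).
  + rewrite -(opR_kip U s (fun g => hkip g (map_f _ hl))).
    exact: (rfield_wick N0 nom e_sign e_sym e_diag nV0 e_bes lt_irr lt_tot (lvec l) hd (ler0n _ _)).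
- move=> s; exact: (wick_dot eps kap nom lt_irr s).
Qed.

Hypothesis E0_0 : E0 0.
Hypothesis E0_lin : forall (r : R) x y, E0 x -> E0 y -> E0 (r%:C *: x + y).
Hypothesis E0_total : forall z : H, (forall w : H, E0 w -> dot w z = 0) -> z = 0.

Local Notation I0 := (seq letter * nat)%type.

Definition eventually_model : set_system I0 :=
  [set S | exists (L1 : seq letter) n1, forall (L0 : seq letter) n,
    {subset L1 <= L0} -> (n1 <= n)%N -> S (L0, n)].

Lemma eventually_model_filter : ProperFilter eventually_model.
Proof.
split; first by move=> [L1 [n1 h]]; exact: (h L1 n1).
split.
- by exists [::], 0%N.
- move=> S1 S2 [L1 [n1 h1]] [L2 [n2 h2]]; exists (L1 ++ L2), (maxn n1 n2) => L0 n hL.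
  rewrite geq_max => /andP[k1 k2]; split; [apply: h1|apply: h2] => // l hl; apply: hL.
    by rewrite mem_cat hl.
  by rewrite mem_cat hl orbT.
- move=> S1 S2 S12 [L1 [n1 h1]]; exists L1, n1 => L0 n hL hn; exact/S12/h1.
Qed.

Lemma left_qwep : QWEP (commutant (letters (lop tens (E0 := E0)) (predC (@lside _ _ E0)))).
Proof.
pose M (i : I0) : model i.1 i.2 := sval (cid (model_ex i.1 i.2)).
have GF := eventually_model_filter.
have [U [UU GU]] := ultraFilterLemma (iter_filter_proper (L := letter) (G := eventually_model)).
have dotE i s : dot (mwick (M i) [::]) (mwick (M i) s) = dot (tens [::]) (tens s).
  by rewrite mwick_dot fock_vac.
refine (@ultra_qwep R F (tens [::]) letter (lop tens (E0 := E0)) (lop_b q_gt q_lt Ff (E0 := E0)) (lop_sa q_gt q_lt Ff (E0 := E0))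
  (@lside _ _ E0) (lop_comm q_gt q_lt Ff (E0 := E0)) (lop_sep q_gt q_lt Ff E0_0 E0_lin E0_total)
  (lop_cyclic q_gt q_lt Ff E0_0 E0_lin E0_total) I0 eventually_model GF
  (fun i => mK (M i)) (fun i => mwick (M i) [::]) (fun i => mxi (M i))
  _ _ (fun i => mY (M i)) (fun i => mE (M i)) _ _ _ _ _ _ _ _ U UU GU).
- by move=> i l; exact: mxi_b.
- by move=> i l; exact: mxi_sa.
- by move=> i; exact: mYs.
- by move=> i T; exact: mE_A.
- by move=> i a S T _ _; exact: mE_lin.
- by move=> i T; exact: mE_id.
- by move=> i n T c; exact: mE_mx.
- by move=> i l; exact: mxi_x.
- by move=> i l T x; exact: mxi_y.
move=> w.
apply: (@word_moment R q H letter (@lside _ _ E0) lvec I0 eventually_model GF (fun i => mK (M i)) F tens (lop tens (E0 := E0))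
  _ _ (fun i => mxi (M i)) (fun i => mwick (M i)) (fun i => mlev (M i))).
- by move=> l; exact: bounded_lin (lop_b q_gt q_lt Ff l).
- move=> l s; rewrite /lop /pop /lopT /lside /lvec; case: ifP => _.
    exact: (xop_tens q_gt q_lt Ff).
  exact: (yop_tens q_gt q_lt Ff).
- by move=> i l; exact/bounded_lin/mxi_b.
- by move=> i; exact: mlev0.
- by move=> i; exact: mlev_lin.
- by move=> i; exact: mlev_mono.
- by move=> i; exact: mlev_wick.
- by move=> i; exact: mlev_xi.
- move=> l n; exists (2 * (n.+1%:R * nrm (lvec l))); first by rewrite !mulr_ge0 ?nrm_ge0.
  by move=> i z; exact: mxi_bound.
- move=> l s d d0; pose c := approx_const l s; have d2 : 0 < d ^+ 2 by rewrite exprn_gt0.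
  (* n + 1 > c / d^2 makes the squared error c / (n + 1) smaller than d^2. *)
  exists [:: l], (maxn (size s) (Num.truncn (c / d ^+ 2))) => L0 n hL.
  rewrite geq_max => /andP[h1 h2] /=; rewrite subr0 nrmR ger0_norm ?nrm_ge0//.
  rewrite -(@ltr_pXn2r _ 2)// ?nnegrE ?nrm_ge0 ?ltW//.
  apply: (le_lt_trans (@mwick_approx L0 n (M (L0, n)) l s (hL l (mem_head _ _)) h1)).
  rewrite -/c ltr_pdivrMr// mulrC -ltr_pdivrMr//.
  by apply: lt_le_trans (truncnS_gt _) _; rewrite ler_nat.
- exact: dotE.
- move=> i; apply/eqP; rewrite -(@eqrXn2 _ 2) ?nrm_ge0// expr1n nrm_dot mwick_dot; exact: eqxx.
Qed.

End Model.

Theorem theorem6p3 (R : realType)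
  (HR : realHilbertType R) (U : R -> HR -> HR)
  (U_group : orthogonal_group U)
  (* complexification; A positive self-adjoint, injective, with U_t = A^(it) *)
  (HC : hilbertType R) (iota : HR -> HC) (HC_cplx : complexification iota)
  (UC : R -> HC -> HC) (UC_ext : forall t, complex_extension iota (U t) (UC t))
  (A : unbounded_op HC)
  (A_sa : self_adjoint A) (A_pos : positive_op A) (A_inj : injective_op A)
  (A_it : forall t, imaginary_power A t (UC t))
  (* completion of HC for the deformed inner product *)
  (H : hilbertType R) (j : HC -> H) (H_cpl : completion (dot_U A) j)
  (q : R) (q_gt : -1 < q) (q_lt : q < 1)
  (F : hilbertType R) (tens : seq H -> F) (F_fock : q_fock q tens) :
  QWEP (q_araki_woods tens (fun f : HR => j (iota f))).
Proof.
pose emb f := j (iota f); pose E0 : set H := range emb.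
have [lj dj denj] := H_cpl; have [li di deci] := HC_cplx.
have emb_lin (r : R) f g : emb (r *: f + g) = r%:C *: emb f + emb g by rewrite /emb li lj.
have E0_0 : E0 0.
  by exists 0 => //; have := emb_lin (-1) 0 0; rewrite scaler0 addr0 rmorphN1 scaleN1r addNr.
have E0_lin (r : R) x y : E0 x -> E0 y -> E0 (r%:C *: x + y).
  by move=> [f _ <-] [g _ <-]; exists (r *: f + g); rewrite ?emb_lin.
(* H_R + i H_R is all of HC, whose image in H is dense. *)
have E0_total (z : H) : (forall w : H, E0 w -> dot w z = 0) -> z = 0.
  move=> hz; apply: dot_eq0; apply: (@closed_span_orth _ _ (range j)) => [e e0|_ [x _ <-]].
    by have [d Dd hd] := (dense_nrm _).1 denj z e e0; exists d.
  have [f [g ->]] := deci x.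
  rewrite addrC lj dotDr dotZr dot_conj [X in _ + X]dot_conj !hz ?conjC0 ?mulr0 ?addr0//.
    by exists f.
  by exists g.
rewrite /q_araki_woods (vN_left q_gt q_lt F_fock E0_0 E0_lin E0_total (gaussians_letters q_gt q_lt F_fock erefl)).
exact: (left_qwep q_gt q_lt F_fock E0_0 E0_lin E0_total).
Qed.
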